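(* Let $\beta>1$ and let $\{X_n\}_{n\in\mathbb N}$ ($\mathbb N=\{0,1,2,\dots\}$) be random variables bounded from below, with $X_n\in L_G^\beta(\Omega_n)$ for every $n$ and $\hat{\mathbb E}[\sup_{n\in\mathbb N}|X_n|^\beta]<\infty$. For each $N\in\mathbb N$ define $\tilde V^N_N=X_N$ and $$\tilde V^N_n=\max\{X_n,\hat{\mathbb E}_n[\tilde V^N_{n+1}]\},\qquad n\le N-1,$$ and let $\tilde V_n^\infty=\lim_{N\ge n,\,N\to\infty}\tilde V_n^N$ (the limit exists because $\tilde V^N_n\le\tilde V^M_n$ for $n\le N\le M$). Then $\{\tilde V_n^\infty\}_{n\in\mathbb N}$ is the smallest $G$-supermartingale dominating $\{X_n\}_{n\in\mathbb N}$.
   Context: Framework. Fix $0\le\underline\sigma\le\bar\sigma<\infty$ and $G(a)=\frac12(\bar\sigma^2a^+-\underline\sigma^2a^-)$. $\Omega=C_0([0,\infty);\mathbb R)$ is the space of continuous paths starting at $0$ (locally uniform topology, Borel $\sigma$-field $\mathcal B(\Omega)$), $B$ the canonical process, $\Omega_t=\{\omega_{\cdot\wedge t}:\omega\in\Omega\}$. $L_{ip}(\Omega_t)=\{\varphi(B_{t_1},\dots,B_{t_m}): m\ge1,\ t_i\in[0,t],\ \varphi \text{ bounded Lipschitz}\}$, $L_{ip}(\Omega)=\bigcup_tL_{ip}(\Omega_t)$. $\hat{\mathbb E}$ is the $G$-expectation, with conditional $G$-expectations $\hat{\mathbb E}_t$: for $X=\varphi(B_{t_1},B_{t_2}-B_{t_1},\dots,B_{t_m}-B_{t_{m-1}})$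 one sets $\hat{\mathbb E}_{t_j}[X]=\varphi_j(B_{t_1},\dots,B_{t_j}-B_{t_{j-1}})$, where $\varphi_m=\varphi$ and $\varphi_{i-1}(x_1,\dots,x_{i-1})=u(t_i-t_{i-1},0)$ with $u$ the viscosity solution of $\partial_tu=G(\partial^2_{yy}u)$, $u(0,y)=\varphi_i(x_1,\dots,x_{i-1},y)$; $\hat{\mathbb E}=\hat{\mathbb E}_0$. $L_G^p(\Omega_t)$ is the completion of $L_{ip}(\Omega_t)$ under $\hat{\mathbb E}[|\cdot|^p]^{1/p}$. $\mathcal P$ is the weakly compact set of all probability measures $P$ on $\Omega$ with $E^P[X]\le\hat{\mathbb E}[X]$ for all $X\in L_{ip}(\Omega)$; it represents $\hat{\mathbb E}$, and for Borel $X$ such that $E^P[X]$ exists for all $P\in\mathcal P$ one sets $\hat{\mathbb E}[X]=\sup_{P\in\mathcal P}E^P[X]$. $c(A)=\sup_{P\in\mathcal P}P(A)$; ''q.s.'' means outside a set of capacity $c$ zero. Relations between random variables are q.s. Spaces. $\mathbb L^1(\Omega)$: Borel $X:\Omega\to[-\infty,\infty]$ with $\hat{\mathbb E}[|X|]<\infty$; $L_G^{1^*}(\Omega)$: $X\in\mathbb L^1(\Omega)$ with $X_n\downarrow X$ q.s. for some $\{X_n\}\subset L_G^1(\Omega)$; $L_G^{1^*_*}(\Omega)$: $X\in\mathbb L^1(\Omega)$ with $X_n\uparrow X$ q.s. for some $\{X_n\}\subset L_G^{1^*}(\Omega)$; $\bar L_G^{1^*_*}(\Omega)$: $X\in\mathbb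 L^1(\Omega)$ with $\hat{\mathbb E}[|X_n-X|]\to0$ for some $\{X_n\}\subset L_G^{1^*_*}(\Omega)$. The same definitions with $\Omega_t$ give the spaces over $\Omega_t$. Conditional expectation on $\bar L_G^{1^*_*}(\Omega)$. $\hat{\mathbb E}_t$ is extended from $L_{ip}(\Omega)$ to $L^1_G(\Omega)$ and $\bar L_G^{1^*_*}(\Omega)$ by norm limits and monotone limits; it is characterized by $\hat{\mathbb E}_t[X]=\operatorname{ess\,sup}^P_{Q\in\mathcal P(t,P)}E^Q[X|\mathcal F_t]$ $P$-a.s. for every $P\in\mathcal P$, where $\mathcal F_t=\mathcal B(\Omega_t)$ and $\mathcal P(t,P)=\{Q\in\mathcal P:E^Q[X]=E^P[X]\ \forall X\in L_{ip}(\Omega_t)\}$. $\{M_n\}$ is a $G$-supermartingale if $M_n\in\bar L_G^{1^*_*}(\Omega_n)$ for each $n$ and $\hat{\mathbb E}_m[M_n]\le M_m$ for all $m\le n$. $V$ dominates $X$ if $V_n\ge X_n$ for all $n$; smallest means that every $G$-supermartingale $U$ dominating $X$ satisfies $U_n\ge V_n$ for all $n$. *)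

(* Defs.v *)
From HB Require Import structures.
From mathcomp Require Import all_boot all_order all_algebra.
From mathcomp Require Import all_classical all_reals all_analysis.
From mathcomp Require Import measurable_realfun.

Set Implicit Arguments.
Unset Strict Implicit.
Unset Printing Implicit Defensive.
Import Order.TTheory GRing.Theory Num.Theory.
Import numFieldNormedType.Exports.

Local Open Scope classical_set_scope.
Local Open Scope ring_scope.

(** * Path space

    A continuous path on [0, +oo[ starting at 0 is represented by its extension
    by 0 to the negative half-line, so that every path has exactly one
    representative; compact convergence on R of these extensions is locally
    uniform convergence on [0, +oo[. *)

Definition path_set (R : realType) : set {family compact, R -> R} :=
  [set w | continuous (w : R -> R) /\ forall t : R, t <= 0 -> w t = 0].

Definition paths (R : realType) : Type := set_type (@path_set R).

HB.instance Definition _ (R : realType) := Topological.on (paths R).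

Lemma path_set0 (R : realType) :
  (cst 0 : {family compact, R -> R}) \in @path_set R.
Proof. by apply/mem_set; split => // x; exact: cst_continuous. Qed.

HB.instance Definition _ (R : realType) :=
  isPointed.Build (paths R)
    (exist (fun w => w \in @path_set R) _ (@path_set0 R)).

Definition Omega (R : realType) : Type :=
  g_sigma_algebraType (@open (paths R)).

HB.instance Definition _ (R : realType) := Measurable.on (Omega R).

Definition B (R : realType) (t : R) (w : Omega R) : R := (\val w : R -> R) t.

(** [stop T w] is the path w(. /\ T). Time horizons T are extended reals, and
    T = +oo gives back w itself: thus +oo plays the role of the horizon of the
    whole of Omega. *)

Lemma stop_subproof (R : realType) (T : \bar R) (w : Omega R) :
  ((fun s : R => B (fine (mine s%:E T)) w) : {family compact, R -> R})
    \in @path_set R.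
Proof.
have [cw w0] := set_mem (valP w).
apply/mem_set; split => [|t t0]; last first.
  apply: w0; case: T => [r| |]; last by rewrite mineNy.
  - by rewrite -EFin_min /= ge_min t0.
  - by rewrite miney.
case: T => [r| |].
- have -> : (fun s : R => B (fine (mine s%:E r%:E)) w)
          = (\val w : R -> R) \o (fun s : R => Num.min s r).
    by apply/funext => s; rewrite -EFin_min.
  move=> s; apply: continuous_comp; last exact: cw.
  by apply: (@continuous_min _ _ id (cst r)); [exact: cvg_id|exact: cvg_cst].
- have -> : (fun s : R => B (fine (mine s%:E +oo%E)) w) = (\val w : R -> R).
    by apply/funext => s; rewrite miney.
  exact: cw.
- have -> : (fun s : R => B (fine (mine s%:E -oo%E)) w) = cst (B 0 w).
    by apply/funext => s; rewrite mineNy.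
  exact: cst_continuous.
Qed.

Definition stop (R : realType) (T : \bar R) (w : Omega R) : Omega R :=
  exist (fun w => w \in @path_set R) _ (stop_subproof T w).

(** Measurability with respect to B(Omega_T), viewed as a sigma-algebra on Omega
    through w |-> w(. /\ T). *)
Definition adapted (R : realType) (T : \bar R) (X : Omega R -> \bar R) :=
  measurable_fun [set: g_sigma_algebra_preimageType (@stop R T)] X.

(** * Cylinder random variables *)

Definition bounded_lipschitz (R : realType) (m : nat)
    (phi : 'rV[R]_m.+1 -> R) :=
  bounded_fun phi /\ [lipschitz phi x | x in [set: 'rV[R]_m.+1]].

Definition Lip (R : realType) (T : \bar R) (X : Omega R -> R) :=
  exists m (ts : 'I_m.+1 -> R) (phi : 'rV[R]_m.+1 -> R),
    [/\ forall i, 0 <= ts i /\ ((ts i)%:E <= T)%E,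
        bounded_lipschitz phi &
        X = fun w => phi (\row_i B (ts i) w)].

Definition row_of_seq (R : realType) (m : nat) (s : seq R) : 'rV[R]_m :=
  \row_(i < m) s`_i.

(** [:: t_1; t_2 - t_1; ...; t_m - t_(m-1)] *)
Definition steps (R : realType) (ts : seq R) : seq R :=
  pairmap (fun s t => t - s) 0 ts.

(** [:: B_(t_1); B_(t_2) - B_(t_1); ...; B_(t_m) - B_(t_(m-1))] *)
Definition increments (R : realType) (ts : seq R) (w : Omega R) : seq R :=
  pairmap (fun s t => B t w - B s w) 0 ts.

(** * The G-heat equation d_t u = G(d_xx u) *)

Definition Gfun (R : realType) (slo shi a : R) : R :=
  2^-1 * (shi ^+ 2 * Num.max a 0 - slo ^+ 2 * Num.max (- a) 0).

Definition dt (R : realType) (psi : R -> R -> R) (t x : R) : R :=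
  derive1 (psi ^~ x) t.
Definition dx (R : realType) (psi : R -> R -> R) (t x : R) : R :=
  derive1 (psi t) x.

(** C^{1,2} functions on ]0, +oo[ x R *)
Definition C12 (R : realType) (psi : R -> R -> R) :=
  (forall t x : R, 0 < t ->
     [/\ derivable (psi ^~ x) t 1, derivable (psi t) x 1 &
         derivable (dx psi t) x 1]) /\
  (forall p : R * R, 0 < p.1 ->
     [/\ {for p, continuous (fun q => psi q.1 q.2)},
         {for p, continuous (fun q => dt psi q.1 q.2)},
         {for p, continuous (fun q => dx psi q.1 q.2)} &
         {for p, continuous (fun q => dx (dx psi) q.1 q.2)}]).

Definition viscosity_subsolution (R : realType) (slo shi : R)
    (u : R -> R -> R) :=
  forall psi : R -> R -> R, C12 psi -> forall t x : R, 0 < t ->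
    (\forall p \near (t, x), u p.1 p.2 - psi p.1 p.2 <= u t x - psi t x) ->
    dt psi t x <= Gfun slo shi (dx (dx psi) t x).

Definition viscosity_supersolution (R : realType) (slo shi : R)
    (u : R -> R -> R) :=
  forall psi : R -> R -> R, C12 psi -> forall t x : R, 0 < t ->
    (\forall p \near (t, x), u t x - psi t x <= u p.1 p.2 - psi p.1 p.2) ->
    Gfun slo shi (dx (dx psi) t x) <= dt psi t x.

(** The initial data to which this is applied are bounded (and Lipschitz), and
    the solution is sought among bounded functions; some growth condition is
    needed for uniqueness. The values u t x with t < 0 are irrelevant. *)
Definition Gheat_solution (R : realType) (slo shi : R) (f : R -> R)
    (u : R -> R -> R) :=
  [/\ forall x, u 0 x = f x,
      {within [set p : R * R | 0 <= p.1], continuous (fun p => u p.1 p.2)},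
      exists C : R, forall t x : R, 0 <= t -> `|u t x| <= C,
      viscosity_subsolution slo shi u &
      viscosity_supersolution slo shi u].

Definition Gheat (R : realType) (slo shi : R) (f : R -> R) : R -> R -> R :=
  xget (fun=> cst 0) [set u | Gheat_solution slo shi f u].

(** With dts = [:: t_(j+1) - t_j; ...; t_m - t_(m-1)] and xs of size j, this is
    phi_j(xs) of the backward recursion started at phi_m = f. *)
Fixpoint backward (R : realType) (slo shi : R) (f : seq R -> R)
    (dts : seq R) (xs : seq R) : R :=
  if dts is d :: dts' then
    Gheat slo shi (fun y => backward slo shi f dts' (rcons xs y)) d 0
  else f xs.

(** * The representing set, capacity and upper expectation *)

Definition calP (R : realType) (slo shi : R) : set (probability (Omega R) R) :=
  [set P | forall m (ts : m.+1.-tuple R) (phi : 'rV[R]_m.+1 -> R),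
     path <%R 0 ts -> bounded_lipschitz phi ->
     (\int[P]_w (phi (row_of_seq m.+1 (increments ts w)))%:E <=
      (backward slo shi (phi \o row_of_seq m.+1) (steps ts) [::])%:E)%E].

Definition capacity (R : realType) (slo shi : R) (A : set (Omega R)) : \bar R :=
  ereal_sup [set P A | P in calP slo shi].

Definition qs (R : realType) (slo shi : R) (A : set (Omega R)) :=
  exists N : set (Omega R),
    [/\ measurable N, capacity slo shi N = 0%E & ~` A `<=` N].

Definition Ehat (R : realType) (slo shi : R) (X : Omega R -> \bar R) : \bar R :=
  ereal_sup [set (\int[P]_w X w)%E | P in calP slo shi].

Definition cvg_Ehat (R : realType) (slo shi : R)
    (Xn : nat -> Omega R -> \bar R) (X : Omega R -> \bar R) :=
  (fun n => Ehat slo shi (fun w => `|Xn n w - X w|%E)) @ \oo --> 0%E.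

Definition decreases_qs (R : realType) (slo shi : R)
    (Xn : nat -> Omega R -> \bar R) (X : Omega R -> \bar R) :=
  qs slo shi [set w | (forall n, (Xn n.+1 w <= Xn n w)%E) /\
                      Xn ^~ w @ \oo --> X w].

Definition increases_qs (R : realType) (slo shi : R)
    (Xn : nat -> Omega R -> \bar R) (X : Omega R -> \bar R) :=
  qs slo shi [set w | (forall n, (Xn n w <= Xn n.+1 w)%E) /\
                      Xn ^~ w @ \oo --> X w].

(** * Spaces of random variables over Omega_T (over Omega for T = +oo)

    Elements of the completion of L_ip(Omega_T) are represented by
    B(Omega_T)-measurable functions, two of them being identified when equal
    q.s. *)

Definition L1 (R : realType) (slo shi : R) (T : \bar R)
    (X : Omega R -> \bar R) :=
  adapted T X /\ (Ehat slo shi (fun w => `|X w|%E) < +oo)%E.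

Definition LG (R : realType) (slo shi : R) (p : R) (T : \bar R)
    (X : Omega R -> \bar R) :=
  adapted T X /\
  exists Xn : nat -> Omega R -> R, (forall n, Lip T (Xn n)) /\
    (fun n => Ehat slo shi (fun w => (`|(Xn n w)%:E - X w| `^ p)%E))
      @ \oo --> 0%E.

Definition LG1star (R : realType) (slo shi : R) (T : \bar R)
    (X : Omega R -> \bar R) :=
  L1 slo shi T X /\
  exists Xn, (forall n, LG slo shi 1 T (Xn n)) /\ decreases_qs slo shi Xn X.

Definition LG1starstar (R : realType) (slo shi : R) (T : \bar R)
    (X : Omega R -> \bar R) :=
  L1 slo shi T X /\
  exists Xn, (forall n, LG1star slo shi T (Xn n)) /\ increases_qs slo shi Xn X.

Definition LG1bar (R : realType) (slo shi : R) (T : \bar R)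
    (X : Omega R -> \bar R) :=
  L1 slo shi T X /\
  exists Xn, (forall n, LG1starstar slo shi T (Xn n)) /\ cvg_Ehat slo shi Xn X.

(** * Conditional expectation

    The relations [cond_... t X Y], stating that Y is a version of the
    conditional expectation of X at time t, follow the extension of the latter
    from L_ip(Omega) to L^1_G by norm limits, to L^{1*}_G and L^{1*_*}_G by
    monotone limits, and to the closure of L^{1*_*}_G by norm limits. *)

(** Here t has to be 0 or a point of the grid ts; the grid of a cylinder
    variable can always be refined to that effect. *)
Definition cond_lip (R : realType) (slo shi : R) (t : R)
    (X Y : Omega R -> R) :=
  exists m (ts : m.+1.-tuple R) (phi : 'rV[R]_m.+1 -> R) (j : nat),
    [/\ path <%R 0 ts, bounded_lipschitz phi,
        (j <= m.+1)%N /\ t = nth 0 (0 :: ts) j,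
        X = (fun w => phi (row_of_seq m.+1 (increments ts w))) &
        Y = (fun w => backward slo shi (phi \o row_of_seq m.+1)
                        (drop j (steps ts)) (take j (increments ts w)))].

Definition cond_LG1 (R : realType) (slo shi : R) (t : R)
    (X Y : Omega R -> \bar R) :=
  [/\ LG slo shi 1 +oo%E X, adapted t%:E Y &
      exists Xn Yn : nat -> Omega R -> R,
        [/\ forall n, cond_lip slo shi t (Xn n) (Yn n),
            cvg_Ehat slo shi (fun n => EFin \o Xn n) X &
            cvg_Ehat slo shi (fun n => EFin \o Yn n) Y]].

Definition cond_LG1star (R : realType) (slo shi : R) (t : R)
    (X Y : Omega R -> \bar R) :=
  [/\ LG1star slo shi +oo%E X, adapted t%:E Y &
      exists Xn Yn,
        [/\ forall n, cond_LG1 slo shi t (Xn n) (Yn n),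
            decreases_qs slo shi Xn X & decreases_qs slo shi Yn Y]].

Definition cond_LG1starstar (R : realType) (slo shi : R) (t : R)
    (X Y : Omega R -> \bar R) :=
  [/\ LG1starstar slo shi +oo%E X, adapted t%:E Y &
      exists Xn Yn,
        [/\ forall n, cond_LG1star slo shi t (Xn n) (Yn n),
            increases_qs slo shi Xn X & increases_qs slo shi Yn Y]].

Definition cond_LG1bar (R : realType) (slo shi : R) (t : R)
    (X Y : Omega R -> \bar R) :=
  [/\ LG1bar slo shi +oo%E X, adapted t%:E Y &
      exists Xn Yn,
        [/\ forall n, cond_LG1starstar slo shi t (Xn n) (Yn n),
            cvg_Ehat slo shi Xn X & cvg_Ehat slo shi Yn Y]].

Definition condE (R : realType) (slo shi : R) (t : R)
    (X : Omega R -> \bar R) : Omega R -> \bar R :=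
  xget (cst 0%E) [set Y | cond_LG1bar slo shi t X Y].

(** * G-supermartingales and the truncated Snell envelope *)

Definition Gsupermartingale (R : realType) (slo shi : R)
    (M : nat -> Omega R -> \bar R) :=
  (forall n, LG1bar slo shi n%:R%:E (M n)) /\
  (forall m n, (m <= n)%N ->
     qs slo shi [set w | (condE slo shi m%:R (M n) w <= M m w)%E]).

Definition dominates (R : realType) (slo shi : R)
    (V X : nat -> Omega R -> \bar R) :=
  forall n, qs slo shi [set w | (X n w <= V n w)%E].

(** [snell_rec X k n] is the value at time n for the horizon n + k. *)
Fixpoint snell_rec (R : realType) (slo shi : R) (X : nat -> Omega R -> \bar R)
    (k n : nat) : Omega R -> \bar R :=
  if k is k'.+1 then
    fun w => maxe (X n w) (condE slo shi n%:R (snell_rec slo shi X k' n.+1) w)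
  else X n.

(** Meaningful for n <= N only. *)
Definition snellN (R : realType) (slo shi : R) (X : nat -> Omega R -> \bar R)
    (N n : nat) : Omega R -> \bar R :=
  snell_rec slo shi X (N - n) n.

Definition snell (R : realType) (slo shi : R) (X : nat -> Omega R -> \bar R)
    (n : nat) : Omega R -> \bar R :=
  fun w => limn (fun N => snellN slo shi X N n w).

(* Main.v *)
Require Import Defs.
From HB Require Import structures.
From mathcomp Require Import all_boot all_order all_algebra.
From mathcomp Require Import all_classical all_reals all_analysis.
From mathcomp Require Import measurable_realfun.
From mathcomp Require Import ring lra.
Set Implicit Arguments.
Unset Strict Implicit.
Unset Printing Implicit Defensive.
Import Order.TTheory GRing.Theory Num.Theory.
Import numFieldNormedType.Exports.
Local Open Scope classical_set_scope.
Local Open Scope ring_scope.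

(* Semigroup. Iterating one-step operators f |-> max of (f(x + s sqrt h) +
   f(x - s sqrt h)) / 2 over s in {slo, shi} and passing to an ultralimit
   h -> 0 gives a sublinear semigroup S_t on bounded Lipschitz functions.
   It solves the G-heat equation; comparing an arbitrary bounded viscosity
   solution with mollifications of S_t f (supersolutions) and of the linear
   schemes below it shows that Gheat slo shi f t = S_t f.

   Measures. A linear functional on cylinder functionals which is dominated by
   the G-expectation is the expectation under some P in calP: fourth moments of
   increments give an almost compact set of Hoelder paths, hence Daniell
   continuity, hence an outer measure for which Borel sets are measurable.
   With Hahn-Banach this yields, for P in calP and a cylinder functional F,
   some Q in calP which agrees with P up to time t and satisfies
   E^Q[F] = E^P[E_t F].

   Conditional expectation. Y is characterized as E_t X by: E^Q[1_A X] <=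
   E^Q[1_A Y] for all Q in calP and A in the past, and for each P and epsilon,
   E^P[Y] <= E^Q[X] + epsilon for some Q agreeing with P on the past. This relation
   passes to norm limits and to increasing limits, and, calP being weakly
   compact, to decreasing limits. It implies uniqueness, monotonicity and the
   Lipschitz property, which give existence at each stage of the extension.

   Snell envelope. V^N_n belongs to L^1_G and increases with N. The gluing of
   measures along the past bounds E^P[V^N_n] by the upper expectation of
   sup |X_k|, so that the limit is in the class of increasing limits; the
   supermartingale property passes to the limit by dominated convergence, and
   minimality is a backward induction. *)

(** * Limits along an ultrafilter *)

(** [condE] and [Gheat] are chosen by [xget], so each needs existence and uniqueness before the
    recursion says anything. For the heat equation, G is the larger of two linear generators. This
    makes averages of [Ssg] supersolutions, while lower bounds come from one linear flow at a time.
    One of the two compared functions is thus always smooth, and no doubling of variables takes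
    place. The price is the construction of two linear flows, which commute with averaging. For the
    conditional expectation the approximating sequences of the four layers are arbitrary, so
    versions must be recognized by a relation that mentions no sequence. Its lower half is the
    delicate one: along a decreasing sequence the nearly optimal measures change with the index, and
    a limit measure can be taken only for integrands approximable in mean by cylinder functionals,
    uniformly over [calP]. The terms of a decreasing sequence lie in L^1_G, where this holds. For
    the envelope the issue is integrability of the limit: nearly optimal measures differ from step
    to step and from event to event, and have to be merged into a single measure of [calP]. *)

Definition ultra_nat : set_system nat :=
  projT1 (cid (ultraFilterLemma eventually_filter)).

Lemma ultra_natP : UltraFilter ultra_nat /\ \oo `<=` ultra_nat.
Proof. exact: projT2 (cid (ultraFilterLemma eventually_filter)). Qed.

#[global] Instance ultra_nat_ultra : UltraFilter ultra_nat.
Proof. by have [] := ultra_natP. Qed.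

Section ulim.
Variable R : realType.
Implicit Types a b : nat -> R.

Definition ulim a : R := lim (a @ ultra_nat).

Definition bounded_seq a := exists C, forall n, `|a n| <= C.

(** The image of the ultrafilter is an ultrafilter on a compact segment, hence converges. *)
Lemma ulimP a : bounded_seq a -> a @ ultra_nat --> ulim a.
Proof.
move=> [C aC].
have UF : UltraFilter (a @ ultra_nat).
  split; first exact: fmap_proper_filter.
  move=> G GF sG; apply/seteqP; split => // A GA.
  have [//|nA] := in_ultra_setVsetC (a @^-1` A) ultra_nat_ultra.
  have : G (~` A) by exact: sG.
  by move=> /(filterI GA); rewrite setICr => /filter_not_empty.
have aU : (a @ ultra_nat) `[-C, C]%classic.
  have: ultra_nat [set n | a n \in `[-C, C]].
    by apply: filterE => n /=; rewrite in_itv /= -ler_norml.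
  by [].
have cC := @segment_compact R (- C) C; rewrite compact_ultra in cC.
have [l [_ al]] := cC _ UF aU.
by have -> : ulim a = l by exact: cvg_lim al.
Qed.

Lemma ulim_near a e : bounded_seq a -> 0 < e ->
  ultra_nat [set n | `|a n - ulim a| < e].
Proof. by move=> /ulimP/cvgr_distC_lt h e0; exact: h. Qed.

Lemma ulim_unique a l : a @ ultra_nat --> l -> ulim a = l.
Proof. by move=> h; exact: cvg_lim h. Qed.

Lemma ulim_cvg a l : a @ \oo --> l -> ulim a = l.
Proof.
move=> al; apply: ulim_unique; apply: cvg_trans al.
by apply: cvg_app; have [] := ultra_natP.
Qed.

Lemma ulim_cst (c : R) : ulim (fun=> c) = c.
Proof. by apply: ulim_unique; exact: cvg_cst. Qed.

Lemma ulimD a b : bounded_seq a -> bounded_seq b ->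
  ulim (fun n => a n + b n) = ulim a + ulim b.
Proof. by move=> /ulimP ha /ulimP hb; apply: ulim_unique; exact: cvgD. Qed.

Lemma ulimZ c a : bounded_seq a -> ulim (fun n => c * a n) = c * ulim a.
Proof. by move=> /ulimP ha; apply: ulim_unique; exact: cvgMr. Qed.

Lemma ulimN a : bounded_seq a -> ulim (fun n => - a n) = - ulim a.
Proof. by move=> /ulimP ha; apply: ulim_unique; exact: cvgN. Qed.

Lemma ulim_le_near a b : bounded_seq a -> bounded_seq b ->
  ultra_nat [set n | a n <= b n] -> ulim a <= ulim b.
Proof.
move=> /ulimP ha /ulimP hb ab; rewrite /ulim.
by apply: ler_lim => //; apply/cvg_ex; eexists; eassumption.
Qed.

Lemma ulim_le a b : bounded_seq a -> bounded_seq b ->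
  (forall n, a n <= b n) -> ulim a <= ulim b.
Proof. by move=> ha hb ab; apply: ulim_le_near => //; apply: filterE. Qed.

Lemma bounded_seqD a b : bounded_seq a -> bounded_seq b ->
  bounded_seq (fun n => a n + b n).
Proof.
move=> [C aC] [D bD]; exists (C + D) => n.
by apply: le_trans (ler_normD _ _) _; exact: lerD.
Qed.

Lemma bounded_seqZ c a : bounded_seq a -> bounded_seq (fun n => c * a n).
Proof. by move=> [C aC]; exists (`|c| * C) => n; rewrite normrM ler_wpM2l. Qed.

Lemma bounded_seq_cst (c : R) : bounded_seq (fun=> c).
Proof. by exists `|c|. Qed.

Lemma ulim_le_cst a c : bounded_seq a ->
  ultra_nat [set n | a n <= c] -> ulim a <= c.
Proof.
move=> ha hc; rewrite -(ulim_cst c); apply: ulim_le_near => //.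
exact: bounded_seq_cst.
Qed.

Lemma ulim_ge_cst a c : bounded_seq a ->
  ultra_nat [set n | c <= a n] -> c <= ulim a.
Proof.
move=> ha hc; rewrite -(ulim_cst c); apply: ulim_le_near => //.
exact: bounded_seq_cst.
Qed.

Lemma cvg_bounded_seq a (l : R) : a @ \oo --> l -> bounded_seq a.
Proof.
move=> al; have ca : cvgn a by apply/cvg_ex; exists l.
have [M [_ hM]] := cvg_seq_bounded ca.
by exists (M + 1) => n; apply: hM => //; rewrite ltrDl.
Qed.

End ulim.

(** * Sublinear one-step operators and the semigroups they generate *)

Lemma eq_ler (R : numDomainType) (x y : R) : x = y -> x <= y.
Proof. by move=> ->. Qed.

Section step.
Variable R : realType.
Implicit Types (f g : R -> R) (C L t s h x y slo shi a b c k e d q K : R).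

Definition BL C L f :=
  (forall x, `|f x| <= C) /\ (forall x y, `|f x - f y| <= L * `|x - y|).

Definition bl f := exists C L, BL C L f.

Lemma BL_bl C L f : BL C L f -> bl f. Proof. by exists C, L. Qed.

Lemma BL_ge0 C L f : BL C L f -> 0 <= C /\ 0 <= L.
Proof.
move=> [hC hL]; split; first exact: le_trans (hC 0).
by have := hL 1 0; rewrite subr0 normr1 mulr1; exact: le_trans.
Qed.

Lemma bl_cst k : bl (fun=> k).
Proof. by exists `|k|, 0; split=> // x y; rewrite subrr normr0 mul0r. Qed.

Lemma BL_add C L C' L' f g : BL C L f -> BL C' L' g ->
  BL (C + C') (L + L') (fun x => f x + g x).
Proof.
move=> [hC hL] [hC' hL']; split=> [x|x y].
  by apply: le_trans (ler_normD _ _) _; exact: lerD.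
rewrite opprD addrACA mulrDl; apply: le_trans (ler_normD _ _) _; exact: lerD.
Qed.

Lemma bl_add f g : bl f -> bl g -> bl (fun x => f x + g x).
Proof. by move=> [C [L h]] [C' [L' h']]; exact: BL_bl (BL_add h h'). Qed.

Lemma BL_opp C L f : BL C L f -> BL C L (fun x => - f x).
Proof.
by move=> [hC hL]; split=> [x|x y]; rewrite ?normrN -?opprD ?normrN.
Qed.

Lemma bl_opp f : bl f -> bl (fun x => - f x).
Proof. by move=> [C [L h]]; exact: BL_bl (BL_opp h). Qed.

Lemma bl_sub f g : bl f -> bl g -> bl (fun x => f x - g x).
Proof. by move=> hf /bl_opp; exact: bl_add. Qed.

Lemma BL_shift a C L f : BL C L f -> BL C L (fun x => f (x + a)).
Proof.
move=> [hC hL]; split=> // x y; apply: le_trans (hL _ _) _.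
by rewrite (_ : x + a - (y + a) = x - y) //; ring.
Qed.

Lemma bl_shift a f : bl f -> bl (fun x => f (x + a)).
Proof. by move=> [C [L h]]; exact: BL_bl (BL_shift a h). Qed.

Lemma bl_abs f : bl f -> bl (fun x => `|f x|).
Proof.
move=> [C [L [hC hL]]]; exists C, L; split=> [x|x y]; first by rewrite normr_id.
by apply: le_trans (hL x y); exact: ler_dist_dist.
Qed.

(** Degree four lets a test polynomial dominate a bounded function away from a point at the cost of
    a time error of second order. In [step_poly] the factors 6 and 3 are those of E(y + Z)^4 = y^4 +
    6 v y^2 + 3 v^2 for a centered Gaussian Z of variance v = shi^2 t. *)
Definition quart c0 q c K y : R := c0 + q * y + c * y ^+ 2 + K * y ^+ 4.

Record step (slo shi t : R) (T : (R -> R) -> R -> R) : Prop := Step {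
  step_mono : forall f g, bl f -> bl g -> (forall x, f x <= g x) ->
    forall x, T f x <= T g x ;
  step_sub : forall f g, bl f -> bl g ->
    forall x, T (fun y => f y + g y) x <= T f x + T g x ;
  step_scale : forall k f, 0 <= k -> bl f ->
    forall x, T (fun y => k * f y) x = k * T f x ;
  step_cst : forall k f, bl f -> forall x, T (fun y => f y + k) x = T f x + k ;
  step_shift : forall a f, bl f ->
    forall x, T (fun y => f (y + a)) x = T f (x + a) ;
  (* the right-hand side dominates the solution at time t of the G-heat
     equation started at the polynomial *)
  step_poly : forall c0 q c K f, 0 <= K -> bl f ->
    (forall y, f y <= quart c0 q c K y) ->
    forall y, T f y <= quart
      (c0 + t * Gfun slo shi (2 * c) + 3 * shi ^+ 4 * K * t ^+ 2) q
      (c + 6 * shi ^+ 2 * K * t) K y }.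

Lemma GfunE slo shi a : 0 <= slo -> slo <= shi ->
  Gfun slo shi a = Num.max (slo ^+ 2 * a) (shi ^+ 2 * a) / 2.
Proof.
move=> h0 h1; rewrite /Gfun mulrC; congr (_ / _).
have h : slo ^+ 2 <= shi ^+ 2 by rewrite ler_sqr// nnegrE; lra.
have [a0|a0] := leP 0 a.
  have -> : Num.max (- a) 0 = 0 by apply: max_r; rewrite oppr_le0.
  by rewrite mulr0 subr0 max_r// ler_wpM2r.
have -> : Num.max (- a) 0 = - a by apply: max_l; rewrite oppr_ge0 ltW.
by rewrite mulr0 sub0r mulrN opprK max_l// ler_wnM2r// ltW.
Qed.

Lemma Gfun_diag s a : 0 <= s -> Gfun s s a = s ^+ 2 * a / 2.
Proof. by move=> s0; rewrite GfunE// maxxx. Qed.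

Lemma Gfun_lo slo shi a : 0 <= slo -> slo <= shi ->
  Gfun slo slo a <= Gfun slo shi a.
Proof.
move=> h0 h1; rewrite Gfun_diag// GfunE// ler_wpM2r//.
by rewrite le_max lexx.
Qed.

Lemma Gfun_hi slo shi a : 0 <= slo -> slo <= shi ->
  Gfun shi shi a <= Gfun slo shi a.
Proof.
move=> h0 h1; rewrite Gfun_diag ?(le_trans h0)// GfunE// ler_wpM2r//.
by rewrite le_max lexx orbT.
Qed.

Lemma Gfun_incr slo shi a b : 0 <= slo -> slo <= shi -> 0 <= b ->
  Gfun slo shi (a + b) <= Gfun slo shi a + shi ^+ 2 * b / 2.
Proof.
move=> h0 h1 b0; rewrite !GfunE// -mulrDl ler_wpM2r//.
have h : slo ^+ 2 <= shi ^+ 2 by rewrite ler_sqr// nnegrE; lra.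
rewrite addr_maxl ge_max !mulrDr !le_max lexx orbT andbT.
by apply/orP; left; rewrite lerD2l ler_wpM2r.
Qed.

Section step_theory.
Variables (slo shi t : R) (T : (R -> R) -> R -> R).
Hypotheses (slo0 : 0 <= slo) (slohi : slo <= shi) (hT : step slo shi t T).

Lemma step_const k x : T (fun=> k) x = k.
Proof.
have b0 := bl_cst 0.
have -> : (fun=> k) = (fun y : R => 0 * 0 + k).
  by apply/funext => y; rewrite mul0r add0r.
rewrite (step_cst hT); first by have /= -> := step_scale hT (lexx 0) b0 x; rewrite mul0r add0r.
exact: bl_cst.
Qed.

Lemma step_le_cst f k x : bl f -> (forall y, f y <= k) -> T f x <= k.
Proof.
move=> bf h; rewrite -[leRHS](step_const k x); apply: (step_mono hT) => //.
exact: bl_cst.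
Qed.

Lemma step_ge_cst f k x : bl f -> (forall y, k <= f y) -> k <= T f x.
Proof.
move=> bf h; rewrite -[leLHS](step_const k x); apply: (step_mono hT) => //.
exact: bl_cst.
Qed.

Lemma step_oppr f x : bl f -> - T f x <= T (fun y => - f y) x.
Proof.
move=> bf; rewrite lerNl -subr_ge0 opprK.
apply: le_trans (step_sub hT bf (bl_opp bf) x).
by rewrite (_ : (fun y => _) = fun=> 0) ?step_const//; apply/funext => y; rewrite subrr.
Qed.

Lemma step_diff f g x : bl f -> bl g -> T f x - T g x <= T (fun y => f y - g y) x.
Proof.
move=> bf bg; rewrite lerBlDr; apply: le_trans (step_sub hT (bl_sub bf bg) bg x).
by apply: eq_ler; congr (T _ x); apply/funext => y; rewrite subrK.
Qed.

Lemma step_contr f g e x : bl f -> bl g -> (forall y, `|f y - g y| <= e) ->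
  `|T f x - T g x| <= e.
Proof.
move=> bf bg h; rewrite ler_norml lerNl opprB; apply/andP; split.
  apply: le_trans (step_diff _ bg bf) _; apply: step_le_cst; first exact: bl_sub.
  by move=> y; apply: le_trans (ler_norm _) _; rewrite distrC.
apply: le_trans (step_diff _ bf bg) _; apply: step_le_cst; first exact: bl_sub.
by move=> y; apply: le_trans (ler_norm _) _.
Qed.

Lemma step_dist f g x : bl f -> bl g ->
  `|T f x - T g x| <= T (fun y => `|f y - g y|) x.
Proof.
move=> bf bg.
rewrite ler_norml lerNl opprB; apply/andP; split.
  apply: le_trans (step_diff _ bg bf) _; apply: (step_mono hT).
  - exact: bl_sub.
  - exact/bl_abs/bl_sub.
  - by move=> y; rewrite distrC ler_norm.
apply: le_trans (step_diff _ bf bg) _; apply: (step_mono hT).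
- exact: bl_sub.
- exact/bl_abs/bl_sub.
- by move=> y; rewrite ler_norm.
Qed.

Lemma step_BL C L f : BL C L f -> BL C L (T f).
Proof.
move=> [hC hL]; have bf : bl f by exists C, L.
split=> [x|x y].
  rewrite ler_norml; apply/andP; split.
    by apply: step_ge_cst => // y; have := hC y; rewrite ler_norml => /andP[].
  by apply: step_le_cst => // y; have := hC y; rewrite ler_norml => /andP[].
have -> : T f x = T (fun z => f (z + (x - y))) y.
  by rewrite (step_shift hT)//; congr (T f _); ring.
apply: step_contr => //; first exact: bl_shift.
move=> z; apply: le_trans (hL _ _) _.
by rewrite (_ : z + (x - y) - z = x - y) //; ring.
Qed.

Lemma step_bl f : bl f -> bl (T f).
Proof. by move=> [C [L h]]; exact: BL_bl (step_BL h). Qed.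

Lemma step_poly_at x0 c0 q c K f : 0 <= K -> bl f ->
  (forall y, f (x0 + y) <= quart c0 q c K y) ->
  T f x0 <= c0 + t * Gfun slo shi (2 * c) + 3 * shi ^+ 4 * K * t ^+ 2.
Proof.
move=> K0 bf h.
have := step_poly hT K0 (bl_shift x0 bf) (c0 := c0) (q := q) (c := c).
move=> /(_ _ 0); rewrite (step_shift hT)// add0r /quart !expr0n/= !mulr0 !addr0.
by apply => y; rewrite addrC.
Qed.

(** By Young's inequality [L * |y|] lies below [L * (d + y ^+ 2 / d)], a polynomial to which
    [step_poly] applies. The lower bound is the upper one for [- f]. With [d] of order [Num.sqrt t]
    this is Hoelder continuity of exponent 1/2 in time. *)
Lemma step_near C L f d x : 0 <= t -> BL C L f -> 0 < d ->
  `|T f x - f x| <= L * (d + shi ^+ 2 * t / d).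
Proof.
move=> t0.
have up g : BL C L g -> 0 < d -> T g x - g x <= L * (d + shi ^+ 2 * t / d).
  move=> bg d0; have [_ L0] := BL_ge0 bg; have [_ hL] := bg.
  rewrite lerBlDl.
  have := @step_poly_at x (g x + L * d) 0 (L / d) 0 g (lexx _) (BL_bl bg).
  rewrite GfunE// max_r; last first.
    apply: ler_wpM2r; last by rewrite !expr2 ler_pM.
    by rewrite mulr_ge0// divr_ge0// ltW.
  rewrite mulr0 mul0r addr0 => h.
  apply: le_trans (h _) _; last first.
    by apply: eq_ler; field; exact: lt0r_neq0.
  move=> y; rewrite /quart !mul0r !addr0.
  have := le_trans (ler_norm _) (hL (x + y) x).
  rewrite [x + y]addrC addrK lerBlDl => /le_trans; apply.
  rewrite -addrA lerD2l (_ : L * d + _ = L * (d + y ^+ 2 / d)); last first.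
    by field; exact: lt0r_neq0.
  rewrite ler_wpM2l// -(real_normK (num_real y)) -subr_ge0.
  set u := `|y|; have u0 : 0 <= u := normr_ge0 y.
  rewrite (_ : _ - _ = (d ^+ 2 + u ^+ 2 - u * d) / d); last first.
    by field; exact: lt0r_neq0.
  apply: divr_ge0; last exact: ltW.
  by have := sqr_ge0 (d - u); have := mulr_ge0 u0 (ltW d0); nra.
move=> bf d0; rewrite ler_norml; apply/andP; split; last exact: up.
rewrite lerNl opprB.
apply: le_trans (up _ (BL_opp bf) d0); rewrite opprK addrC lerD2r.
exact: step_oppr (BL_bl bf).
Qed.

End step_theory.
End step.

Section ulim_more.
Variable R : realType.
Implicit Types (a b : nat -> R) (e : R).

Lemma ulim_dist a b e : bounded_seq a -> bounded_seq b ->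
  ultra_nat [set n | `|a n - b n| <= e] -> `|ulim a - ulim b| <= e.
Proof.
move=> ha hb h; have hmb := bounded_seqZ (-1) hb.
have -> : ulim a - ulim b = ulim (fun n => a n + -1 * b n).
  by rewrite ulimD// ulimZ// mulN1r.
have hab := bounded_seqD ha hmb.
rewrite ler_norml; apply/andP; split.
  apply: ulim_ge_cst => //; apply: filterS h => n /=.
  by rewrite mulN1r ler_norml => /andP[].
apply: ulim_le_cst => //; apply: filterS h => n /=.
by rewrite mulN1r ler_norml => /andP[].
Qed.

Lemma ultra_forall_lt (A : nat -> set nat) (M : nat) :
  (forall i, ultra_nat (A i)) ->
  ultra_nat [set n | forall i, (i < M)%N -> A i n].
Proof.
move=> hA; elim: M => [|M IH]; first exact: filterE.
apply: filterS (filterI IH (hA M)) => n /= [h1 h2] i.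
by rewrite ltnS leq_eqVlt => /predU1P[->//|]; exact: h1.
Qed.

End ulim_more.

(** * Closure properties of one-step operators *)

Section step_closure.
Variables (R : realType) (slo shi : R).
Hypotheses (slo0 : 0 <= slo) (slohi : slo <= shi).
Implicit Types (f g : R -> R) (t s x y e : R).

Lemma Gfun_pos (a : R) : 0 <= a -> Gfun slo shi a = shi ^+ 2 * a / 2.
Proof.
move=> a0; rewrite GfunE// max_r// ler_wpM2r// !expr2.
by rewrite ler_pM.
Qed.

Lemma step_id : step slo shi 0 id.
Proof.
split=> //= c0 q c K f K0 bf h y; rewrite mul0r expr0n/= !mulr0 !addr0.
exact: h.
Qed.

(** The error term of [step_poly] is exactly stable under composition: the growth
    [6 * shi ^+ 2 * K * t] of the quadratic coefficient, fed through [Gfun_incr], yields the cross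
    term of [3 * shi ^+ 4 * K * (t + s) ^+ 2]. *)
Lemma step_comp t s T S : 0 <= t -> 0 <= s ->
  step slo shi t T -> step slo shi s S -> step slo shi (t + s) (fun f => S (T f)).
Proof.
move=> t0 s0 hT hS.
have TB f : bl f -> bl (T f) by exact: (step_bl hT).
split.
- move=> f g bf bg fg; apply: (step_mono hS); [exact: TB|exact: TB|].
  exact: (step_mono hT).
- move=> f g bf bg x; apply: le_trans (step_sub hS (TB _ bf) (TB _ bg) x).
  apply: (step_mono hS); [exact/TB/bl_add|by apply: bl_add; exact: TB|].
  exact: (step_sub hT).
- move=> k f k0 bf x.
  have -> : T (fun y => k * f y) = (fun y => k * T f y).
    by apply/funext => y; exact: (step_scale hT).
  by rewrite (step_scale hS)//; exact: TB.
- move=> k f bf x.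
  have -> : T (fun y => f y + k) = (fun y => T f y + k).
    by apply/funext => y; exact: (step_cst hT).
  by rewrite (step_cst hS)//; exact: TB.
- move=> a f bf x.
  have -> : T (fun y => f (y + a)) = (fun y => T f (y + a)).
    by apply/funext => y; exact: (step_shift hT).
  by rewrite (step_shift hS)//; exact: TB.
- move=> c0 q c K f K0 bf h y.
  have := step_poly hS K0 (TB _ bf) (step_poly hT K0 bf h) y.
  move=> /le_trans; apply; rewrite /quart mulrDr.
  have shi0 := le_trans slo0 slohi; have b0 : 0 <= 2 * (6 * shi ^+ 2 * K * t) by rewrite !mulr_ge0.
  have := ler_wpM2l s0 (Gfun_incr (2 * c) slo0 slohi b0).
  set G := Gfun _ _ _; set G' := Gfun _ _ _; lra.
Qed.

Lemma step_iter t T k : 0 <= t -> step slo shi t T ->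
  step slo shi (k%:R * t) (iter k T).
Proof.
move=> t0 hT; elim: k => [|k IH]; first by rewrite mul0r; exact: step_id.
rewrite -natr1 mulrDl mul1r.
by have := step_comp (mulr_ge0 (ler0n _ k) t0) t0 IH hT.
Qed.

Lemma step_ulim (T : nat -> (R -> R) -> R -> R) (tn : nat -> R) t :
  (forall n, step slo shi (tn n) (T n)) -> tn @ \oo --> t ->
  step slo shi t (fun f x => ulim (fun n => T n f x)).
Proof.
move=> hT tnt.
have bs f x : bl f -> bounded_seq (fun n => T n f x).
  by move=> [C [L h]]; exists C => n; have [] := step_BL (hT n) h.
split.
- move=> f g bf bg fg x; apply: ulim_le; [exact: bs|exact: bs|].
  by move=> n; exact: (step_mono (hT n)).
- move=> f g bf bg x; rewrite -ulimD; [|exact: bs|exact: bs].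
  apply: ulim_le; first exact/bs/bl_add.
    by apply: bounded_seqD; exact: bs.
  by move=> n; exact: (step_sub (hT n)).
- move=> k f k0 bf x; rewrite -ulimZ; last exact: bs.
  by congr ulim; apply/funext => n; exact: (step_scale (hT n)).
- move=> k f bf x; rewrite -[in RHS](ulim_cst k) -ulimD.
  + by congr ulim; apply/funext => n; exact: (step_cst (hT n)).
  + exact: bs.
  + exact: bounded_seq_cst.
- move=> a f bf x.
  by congr ulim; apply/funext => n; exact: (step_shift (hT n)).
- move=> c0 q c K f K0 bf h y.
  have E t' : quart (c0 + t' * Gfun slo shi (2 * c) + 3 * shi ^+ 4 * K * t' ^+ 2)
      q (c + 6 * shi ^+ 2 * K * t') K y =
      quart c0 q c K y + (Gfun slo shi (2 * c) + 6 * shi ^+ 2 * K * y ^+ 2) * t'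
      + (3 * shi ^+ 4 * K) * (t' * t') by rewrite /quart; ring.
  have cv : (fun n => quart c0 q c K y +
      (Gfun slo shi (2 * c) + 6 * shi ^+ 2 * K * y ^+ 2) * tn n
      + (3 * shi ^+ 4 * K) * (tn n * tn n)) @ \oo --> quart c0 q c K y +
      (Gfun slo shi (2 * c) + 6 * shi ^+ 2 * K * y ^+ 2) * t
      + (3 * shi ^+ 4 * K) * (t * t).
    apply: cvgD; first by apply: cvgD; [exact: cvg_cst|exact: cvgMr].
    by apply: cvgMr; exact: cvgM.
  rewrite E -(ulim_cvg cv); apply: ulim_le; [exact: bs|exact: cvg_bounded_seq cv|].
  by move=> n; rewrite -E; exact: (step_poly (hT n)).
Qed.

(** G is the maximum of the two linear generators, so the polynomial bound of each operator lies
    below the one for G. *)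
Lemma step_max t (T1 T2 : (R -> R) -> R -> R) : 0 <= t ->
  step slo slo t T1 -> step shi shi t T2 ->
  step slo shi t (fun f x => Num.max (T1 f x) (T2 f x)).
Proof.
move=> t0 h1 h2; have shi0 := le_trans slo0 slohi.
have sq : slo ^+ 2 <= shi ^+ 2 by rewrite !expr2 ler_pM.
have sq4 : slo ^+ 4 <= shi ^+ 4.
  by rewrite -[4%N]/(2 * 2)%N !exprM ler_pXn2r// nnegrE sqr_ge0.
split.
- move=> f g bf bg fg x; rewrite ge_max !le_max (step_mono h1)//.
  by rewrite (step_mono h2)// orbT.
- move=> f g bf bg x; rewrite ge_max; apply/andP; split.
    apply: le_trans (step_sub h1 bf bg x) _.
    by apply: lerD; rewrite le_max lexx.
  apply: le_trans (step_sub h2 bf bg x) _.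
  by apply: lerD; rewrite le_max lexx orbT.
- move=> k f k0 bf x; rewrite (step_scale h1)// (step_scale h2)//.
  by rewrite maxr_pMr.
- by move=> k f bf x; rewrite (step_cst h1)// (step_cst h2)// addr_maxl.
- by move=> a f bf x; rewrite (step_shift h1)// (step_shift h2).
- move=> c0 q c K f K0 bf h y; rewrite ge_max; apply/andP; split.
    apply: le_trans (step_poly h1 K0 bf h y) _.
    rewrite /quart; do 2!(apply: lerD => //).
      rewrite lerD2r; apply: lerD; first by rewrite lerD2l ler_wpM2l// Gfun_lo.
      by have := ler_wpM2r (mulr_ge0 K0 (sqr_ge0 t)) sq4; lra.
    apply: ler_wpM2r; first exact: sqr_ge0.
    by have := ler_wpM2r (mulr_ge0 K0 t0) sq; lra.
  apply: le_trans (step_poly h2 K0 bf h y) _.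
  rewrite /quart; do 2!(apply: lerD => //).
  rewrite lerD2r; apply: lerD => //.
  by rewrite lerD2l ler_wpM2l// Gfun_hi.
Qed.

End step_closure.

(** * The semigroup as an ultralimit of iterates *)

Section semigroup.
Variables (R : realType) (slo shi : R).
Hypotheses (slo0 : 0 <= slo) (slohi : slo <= shi).
Variable T : nat -> (R -> R) -> R -> R.
Hypothesis hT : forall n, step slo shi n.+1%:R^-1 (T n).
Implicit Types (f g : R -> R) (t s x y e : R).

Definition sgk t (n : nat) := Num.truncn (t * n.+1%:R).

Definition sg t f x := ulim (fun n => iter (sgk t n) (T n) f x).

Lemma sgk_le t n : 0 <= t -> (sgk t n)%:R * n.+1%:R^-1 <= t.
Proof.
move=> t0; rewrite ler_pdivrMr ?ltr0n//.
by rewrite /sgk truncn_le mulr_ge0.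
Qed.

Lemma sgk_gt t n : t < (sgk t n)%:R * n.+1%:R^-1 + n.+1%:R^-1.
Proof.
rewrite -[X in _ + X]mul1r -mulrDl ltr_pdivlMr ?ltr0n// natr1.
exact: truncnS_gt.
Qed.

Lemma sgk_cvg t : 0 <= t ->
  (fun n => (sgk t n)%:R * n.+1%:R^-1) @ \oo --> t.
Proof.
move=> t0.
apply: (@squeeze_cvgr _ _ _ _ (fun n => t - harmonic n) (fun=> t)).
  apply: nearW => n; rewrite sgk_le// andbT lerBlDr.
  exact/ltW/sgk_gt.
  rewrite -[X in _ --> X]subr0; apply: cvgB; first exact: cvg_cst.
  exact: cvg_harmonic.
exact: cvg_cst.
Qed.

Lemma iter_step n k : step slo shi (k%:R * n.+1%:R^-1) (iter k (T n)).
Proof. by apply: step_iter => //; rewrite invr_ge0. Qed.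

Lemma sg_step t : 0 <= t -> step slo shi t (sg t).
Proof.
move=> t0; apply: step_ulim; last exact: sgk_cvg.
by move=> n; exact: iter_step.
Qed.

(** No step fits into a negative time, so the family is the identity there. It is thus defined for
    all real times, and moduli of continuity in time hold without a boundary at 0. *)
Lemma sg_le0 t f x : t <= 0 -> sg t f x = f x.
Proof.
move=> t0; rewrite /sg -[RHS]ulim_cst; congr ulim; apply/funext => n.
suff -> : sgk t n = 0%N by [].
apply/truncn0Pn; rewrite -ltNge (@le_lt_trans _ _ 0)//.
by rewrite mulr_le0_ge0.
Qed.

Lemma sg_bounded_seq t f x : bl f ->
  bounded_seq (fun n => iter (sgk t n) (T n) f x).
Proof. by move=> [C [L h]]; exists C => n; have [] := step_BL (iter_step n (sgk t n)) h. Qed.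

(** Closeness along the ultrafilter at the finitely many points of a mesh spreads to the whole
    interval because the functions share a Lipschitz constant; the mesh [h] makes [L * h] at most
    [d / 4]. *)
Lemma loc_unif C L (g : nat -> R -> R) (r d : R) x :
  (forall n, BL C L (g n)) -> 0 < d ->
  ultra_nat [set n | forall y, `|y| <= r ->
     `|g n (x + y) - ulim (fun n => g n (x + y))| <= d].
Proof.
move=> gB d0; have [C0 L0] := BL_ge0 (gB 0%N).
have bs z : bounded_seq (fun n => g n z) by exists C => n; have [] := gB n.
pose h := d / (4 * (L + 1)).
have h0 : 0 < h by rewrite divr_gt0// mulr_gt0// ltr_wpDl.
pose p (i : nat) := x - r + i%:R * h.
pose M := (Num.truncn (2 * r / h)).+1.
have := @ultra_forall_lt (fun i => [set n | `|g n (p i) - ulim (g ^~ (p i))| < d / 2]) M.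
move=> /(_ (fun i => ulim_near (bs (p i)) (divr_gt0 d0 (ltr0n _ 2)))).
apply: filterS => n /= hn y yr.
pose i := Num.truncn ((y + r) / h).
have yr0 : 0 <= y + r by move: yr; rewrite ler_norml => /andP[]; lra.
have iM : (i < M)%N.
  rewrite /M ltnS; apply: le_truncn; rewrite ler_pM2r ?invr_gt0//.
  by move: yr; rewrite ler_norml => /andP[]; lra.
have /andP[i1 i2] := truncn_itv (divr_ge0 yr0 (ltW h0)).
rewrite -/i in i1 i2; rewrite ler_pdivlMr// in i1; rewrite ltr_pdivrMr// in i2.
have xp : `|x + y - p i| <= h.
  by rewrite ler_norml /p; rewrite -natr1 in i2; apply/andP; split; lra.
have e1 : L * h <= d / 4.
  have L1 : 0 < L + 1 by rewrite ltr_wpDl.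
  rewrite /h (_ : L * _ = L / (L + 1) * (d / 4)); last by field; exact: lt0r_neq0.
  rewrite ler_piMl//; first by rewrite divr_ge0// ltW.
  by rewrite ler_pdivrMr// mul1r lerDl.
have hg m : `|g m (x + y) - g m (p i)| <= d / 4.
  by have [_ hL] := gB m; apply: le_trans (hL _ _) _; apply: le_trans e1; exact: ler_wpM2l.
have hu : `|ulim (g ^~ (x + y)) - ulim (g ^~ (p i))| <= d / 4.
  by apply: ulim_dist => //; apply: filterE => m; exact: hg.
rewrite (_ : g n (x + y) - _ = (g n (x + y) - g n (p i)) +
  (g n (p i) - ulim (g ^~ (p i))) - (ulim (g ^~ (x + y)) - ulim (g ^~ (p i)))); last by ring.
apply: le_trans (ler_normB _ _) _; apply: le_trans (lerD (ler_normD _ _) (lexx _)) _.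
have := ltW (hn _ iM); have := hg n; rewrite /=; lra.
Qed.

(** On the right the inner ultralimit is already taken, while the outer iterate still varies with
    [n]. The two are exchanged by locally uniform convergence of the inner iterates, the tails being
    paid for by a small quadratic. *)
Lemma sgD t s f x : 0 <= t -> 0 <= s -> bl f -> sg (t + s) f x = sg t (sg s f) x.
Proof.
move=> t0 s0 [C [L Bf]]; have bf := BL_bl Bf; have [C0 L0] := BL_ge0 Bf.
have bg : BL C L (sg s f) by exact: (step_BL (sg_step s0) Bf).
apply/eqP; rewrite -subr_eq0 -normr_le0; apply/ler_addgt0Pl => e e0; rewrite addr0.
have shi0 : 0 <= shi := le_trans slo0 slohi.
have sh2 := sqr_ge0 shi.
have L1 : 0 < L + 1 by rewrite ltr_wpDl.
have s1 : 0 < shi ^+ 2 + 1 by rewrite ltr_wpDl.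
have t1 : 0 < t + 1 by rewrite ltr_wpDl.
pose c := e / (4 * (shi ^+ 2 + 1) * (t + 1)).
have c0 : 0 < c by rewrite divr_gt0// !mulr_gt0.
pose r := 2 * C / c + 1.
pose d := e / (4 * (L + 1)).
have d0 : 0 < d by rewrite divr_gt0// mulr_gt0.
apply: ulim_dist; [exact: sg_bounded_seq|exact/sg_bounded_seq/(BL_bl bg)|].
have hB n : BL C L (iter (sgk s n) (T n) f) := step_BL (iter_step n _) Bf.
have A1 := @loc_unif C L (fun n => iter (sgk s n) (T n) f) r (e / 4) x hB (divr_gt0 e0 (ltr0n _ 4)).
have A2 : ultra_nat [set n : nat | shi ^+ 2 * n.+1%:R^-1 / d < d].
  have [_ sU] := ultra_natP; apply: sU.
  have q0 : 0 < d * d / (shi ^+ 2 + 1) by rewrite divr_gt0// mulr_gt0.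
  have /cvgrPdist_lt /(_ _ q0) := @cvg_harmonic R; apply: filterS => n /=.
  rewrite sub0r normrN ger0_norm// ltr_pdivlMr// => h.
  rewrite ltr_pdivrMr//; apply: le_lt_trans h; rewrite mulrC ler_wpM2l//.
  by rewrite lerDl.
apply: filterS (filterI A1 A2) => n /= [h1 h2].
set N := n.+1%:R^-1 in h2 *; have N0 : 0 < N by rewrite invr_gt0.
pose b := iter (sgk t n) (T n) (iter (sgk s n) (T n) f) x.
(* Truncating [t] and [s] separately loses at most one step, whose effect [step_near] bounds. *)
have E1 : `|iter (sgk (t + s) n) (T n) f x - b| <= e / 2.
  have l1 : (sgk t n + sgk s n <= sgk (t + s) n)%N.
    rewrite /sgk truncn_ge_nat; last by rewrite mulr_ge0// addr_ge0.
    by rewrite natrD mulrDl lerD// truncn_le mulr_ge0.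
  have l2 : (sgk (t + s) n <= (sgk t n + sgk s n).+1)%N.
    rewrite /sgk truncn_le_nat mulrDl -addSn -addnS.
    by rewrite natrD ltrD// truncnS_gt.
  have [<-|ne] := eqVneq (sgk t n + sgk s n)%N (sgk (t + s) n).
    by rewrite iterD subrr normr0 divr_ge0// ltW.
  have -> : sgk (t + s) n = (sgk t n + (sgk s n).+1)%N.
    by apply/eqP; rewrite addnS eqn_leq l2 ltn_neqAle ne l1.
  rewrite iterD /b; apply: (step_contr (iter_step n (sgk t n))).
  - by apply: BL_bl; exact: (step_BL (iter_step n _) Bf).
  - exact: BL_bl (hB n).
  move=> y; rewrite iterS.
  have := step_near slo0 slohi (hT n) y (ltW N0) (hB n) d0.
  move=> /le_trans; apply.
  apply: (@le_trans _ _ (L * (d + d))).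
    by rewrite ler_wpM2l// lerD2l ltW.
  rewrite (_ : L * (d + d) = L / (L + 1) * (e / 2)); last first.
    by rewrite /d; field; exact: lt0r_neq0.
  rewrite ler_piMl//; first by rewrite divr_ge0// ltW.
  by rewrite ler_pdivrMr// mul1r lerDl.
(* The difference of the inner functions is at most [e / 4] for [|y| <= r] and at most [2 * C]
   beyond, hence below [e / 4 + c * y ^+ 2]. The operator sends this polynomial at its center to at
   most [e / 4 + t * shi ^+ 2 * c], and [c] is chosen to make that at most [e / 2]. *)
have E2 : `|b - iter (sgk t n) (T n) (sg s f) x| <= e / 2.
  rewrite /b; apply: le_trans (step_dist (iter_step n _) _ (BL_bl (hB n)) (BL_bl bg)) _.
  have := @step_poly_at _ _ _ _ _ (iter_step n (sgk t n)) x (e / 4) 0 c 0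
    (fun y => `|iter (sgk s n) (T n) f y - sg s f y|) (lexx _).
  have c20 : 0 <= 2 * c by rewrite mulr_ge0// ltW.
  rewrite mulr0 mul0r addr0 Gfun_pos// => hs; apply: le_trans (hs _ _) _.
  - by apply: bl_abs; apply: bl_sub; [exact: BL_bl (hB n)|exact: BL_bl bg].
  - move=> y; rewrite /quart !mul0r !addr0.
    have [yr|yr] := leP `|y| r.
      by apply: le_trans (h1 y yr) _; rewrite lerDl mulr_ge0 ?sqr_ge0 ?ltW.
    apply: (@le_trans _ _ (C + C)).
      apply: le_trans (ler_normB _ _) _; apply: lerD; first by have [] := hB n.
      by have [] := bg.
    apply: (@le_trans _ _ (c * y ^+ 2)); last by rewrite lerDr divr_ge0// ltW.
    rewrite -(real_normK (num_real y)).
    have C2 : 0 <= 2 * C by rewrite mulr_ge0.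
    have r1 : 1 <= r by rewrite lerDr; apply: divr_ge0 => //; exact: ltW.
    have cr : C + C <= c * r.
      by rewrite /r mulrDr mulr1 [c * _]mulrC divfK ?gt_eqF//; lra.
    apply: le_trans cr _; apply: ler_wpM2l; [exact: ltW|nra].
  - have tn := sgk_le n t0; set tt := _ * N in tn *.
    have : tt * (shi ^+ 2 * c) <= e / 4.
      have tt0 : 0 <= tt by rewrite mulr_ge0// ltW.
      rewrite (_ : tt * _ = (tt / (t + 1)) * (shi ^+ 2 / (shi ^+ 2 + 1)) * (e / 4)).
        rewrite ler_piMl//; first by rewrite divr_ge0// ltW.
        by rewrite mulr_ile1// ?divr_ge0// ?(ltW s1) ?(ltW t1)// ler_pdivrMr// mul1r; lra.
      by rewrite /c; field; rewrite !lt0r_neq0.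
    have -> : shi ^+ 2 * (2 * c) / 2 = shi ^+ 2 * c by field.
    lra.
rewrite (_ : _ - _ = (iter (sgk (t + s) n) (T n) f x - b) +
   (b - iter (sgk t n) (T n) (sg s f) x)); last by ring.
apply: le_trans (ler_normD _ _) _; lra.
Qed.

Definition linop (S : (R -> R) -> R -> R) :=
  forall f, bl f -> forall x, S (fun y => - f y) x = - S f x.

Lemma sg_linop t : (forall n, linop (T n)) -> linop (sg t).
Proof.
move=> lT f bf x; rewrite /sg -ulimN; last exact: sg_bounded_seq.
congr ulim; apply/funext => n; elim: (sgk t n) x => //= k IH x.
rewrite -lT; first by congr (T n _ x); apply/funext.
exact: (step_bl (iter_step n k) bf).
Qed.

Lemma sg_near C L f t s x d : 0 <= t -> 0 <= s -> BL C L f -> 0 < d ->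
  `|sg (t + s) f x - sg t f x| <= L * (d + shi ^+ 2 * s / d).
Proof.
move=> t0 s0 bf d0; rewrite [t + s]addrC sgD//; last exact: BL_bl bf.
exact: (step_near slo0 slohi (sg_step s0) x s0 (step_BL (sg_step t0) bf) d0).
Qed.

End semigroup.

(** * Linear heat flows and the sublinear semigroup *)

Section instances.
Variable R : realType.
Implicit Types (f g : R -> R) (t h x y e s slo shi C L : R).

(** One step of the symmetric random walk of variance [s ^+ 2] per unit of time, with time step
    [n.+1%:R^-1]. *)
Definition bern s (n : nat) f x :=
  (f (x + s * Num.sqrt n.+1%:R^-1) + f (x - s * Num.sqrt n.+1%:R^-1)) / 2.

Lemma bern_step s n : 0 <= s -> step s s n.+1%:R^-1 (bern s n).
Proof.
move=> s0; rewrite /bern; set h := n.+1%:R^-1; have h0 : 0 <= h by rewrite invr_ge0.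
set r := Num.sqrt h; have r2 : r ^+ 2 = h by rewrite sqr_sqrtr.
split=> [f g bf bg fg x|f g bf bg x|k f k0 bf x|k f bf x|a f bf x|].
- by apply: ler_wpM2r => //; exact: lerD.
- by apply: eq_ler; field.
- by field.
- by field.
- by congr ((f _ + f _) / 2); ring.
(* The walk has the Gaussian moments up to order three, and its fourth moment [(s * r) ^+ 4] is a
   third of the Gaussian one. *)
- move=> c0 q c K f K0 bf hf y.
  have -> : Gfun s s (2 * c) = s ^+ 2 * c.
    by rewrite Gfun_diag//; field.
  have := lerD (hf (y + s * r)) (hf (y - s * r)).
  have i2 : 0 <= 2^-1 :> R by rewrite invr_ge0.
  move=> /(ler_wpM2r i2)/le_trans; apply.
  rewrite /quart -r2.
  have : 0 <= K * (s * r) ^+ 4 by rewrite mulr_ge0// exprn_even_ge0.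
  lra.
Qed.

Definition Lsg s := sg (bern s).

(** The maximum is taken between the two limiting flows, not between two walks: over each step a
    viscosity solution can then be compared with one linear flow at a time. *)
Definition maxL slo shi (n : nat) f x :=
  Num.max (Lsg slo n.+1%:R^-1 f x) (Lsg shi n.+1%:R^-1 f x).

Definition Ssg slo shi := sg (maxL slo shi).

Lemma Lsg_step s t : 0 <= s -> 0 <= t -> step s s t (Lsg s t).
Proof. by move=> s0 t0; apply: sg_step => // n; exact: bern_step. Qed.

Lemma Lsg_linop s t : 0 <= s -> linop (Lsg s t).
Proof.
move=> s0; apply: (@sg_linop _ s s _ _ (bern s)) => // n; first exact: bern_step.
by move=> f bf x; rewrite /bern; field.
Qed.

Lemma maxL_step slo shi n : 0 <= slo -> slo <= shi ->
  step slo shi n.+1%:R^-1 (maxL slo shi n).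
Proof.
move=> h0 h1; have hn : 0 <= n.+1%:R^-1 :> R by rewrite invr_ge0.
by apply: step_max => //; apply: Lsg_step => //; exact: le_trans h1.
Qed.

Lemma Ssg_step slo shi t : 0 <= slo -> slo <= shi -> 0 <= t ->
  step slo shi t (Ssg slo shi t).
Proof. by move=> h0 h1 t0; apply: sg_step => // n; exact: maxL_step. Qed.

(** The parabolic modulus of continuity: Lipschitz in space and Hoelder of exponent 1/2 in time. *)
Definition MC L C (u : R -> R -> R) := forall t s x y,
  `|u t x - u s y| <= L * `|x - y| + C * Num.sqrt `|t - s|.

Lemma sg_MC slo shi T C L f : 0 <= slo -> slo <= shi ->
  (forall n, step slo shi n.+1%:R^-1 (T n)) -> BL C L f ->
  MC L (L * (1 + shi ^+ 2)) (fun t x => sg T t f x).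
Proof.
move=> h0 h1 hT bf; have [C0 L0] := BL_ge0 bf.
have time t s x : 0 <= t -> 0 <= s ->
    `|sg T (t + s) f x - sg T t f x| <= L * (1 + shi ^+ 2) * Num.sqrt s.
  move=> t0; rewrite le_eqVlt => /predU1P[<-|s0].
    by rewrite addr0 subrr normr0 sqrtr0 mulr0.
  (* The choice [d = Num.sqrt s] balances the two terms of [sg_near]. *)
  have d0 : 0 < Num.sqrt s by rewrite sqrtr_gt0.
  apply: le_trans (sg_near h0 h1 hT x t0 (ltW s0) bf d0) _.
  rewrite -[leRHS]mulrA ler_wpM2l// mulrDl mul1r lerD2l -mulrA.
  rewrite (_ : s / Num.sqrt s = Num.sqrt s)//.
  by rewrite -[X in X / _](sqr_sqrtr (ltW s0)) expr2 mulfK//; exact: lt0r_neq0.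
have BLt t : BL C L (sg T t f).
  have [t0|t0] := leP 0 t; first exact: (step_BL (sg_step h0 h1 hT t0) bf).
  by rewrite (_ : sg T t f = f) //; apply/funext => x; apply: sg_le0; exact: ltW.
have time2 t s x : s <= t ->
    `|sg T t f x - sg T s f x| <= L * (1 + shi ^+ 2) * Num.sqrt `|t - s|.
  move=> st; have M0 : 0 <= L * (1 + shi ^+ 2) by rewrite mulr_ge0// addr_ge0// sqr_ge0.
  have [s0|s0] := leP 0 s.
    have ts : 0 <= t - s by rewrite subr_ge0.
    by have := time s (t - s) x s0 ts; rewrite subrKC (ger0_norm ts).
  rewrite (sg_le0 T f x (ltW s0)).
  have [t0|t0] := leP t 0.
    by rewrite sg_le0// subrr normr0 mulr_ge0// sqrtr_ge0.
  have := time 0 t x (lexx 0) (ltW t0); rewrite add0r (sg_le0 T f x (lexx 0)).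
  move=> /le_trans; apply.
  apply: ler_wpM2l => //; rewrite ler_sqrt ger0_norm ?subr_ge0//; lra.
move=> t s x y.
rewrite (_ : _ - _ = (sg T t f x - sg T t f y) + (sg T t f y - sg T s f y)); last by ring.
apply: le_trans (ler_normD _ _) _; apply: lerD; first by have [] := BLt t.
have [st|/ltW st] := leP s t; first exact: time2.
by rewrite distrC (distrC t); exact: time2.
Qed.

Lemma MC_cvg L C u (tn : nat -> R) t x : MC L C u -> tn @ \oo --> t ->
  (fun n => u (tn n) x) @ \oo --> u t x.
Proof.
move=> hu tnt; apply/cvgrPdist_le => e e0.
have C0 : 0 <= C.
  have := hu 1 0 0 0; rewrite !subrr normr0 mulr0 subr0 add0r normr1 sqrtr1 mulr1.
  exact: le_trans.
have d0 : 0 < (e / (C + 1)) ^+ 2 by rewrite exprn_gt0// divr_gt0// ltr_wpDl.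
move/cvgrPdist_lt : tnt => /(_ _ d0); apply: filterS => n hn.
apply: le_trans (hu _ _ _ _) _; rewrite subrr normr0 mulr0 add0r.
have e1 : 0 <= e / (C + 1) by rewrite divr_ge0 ?ltW// ltr_wpDl.
have : Num.sqrt `|t - tn n| <= e / (C + 1).
  have E : e / (C + 1) = Num.sqrt ((e / (C + 1)) ^+ 2) by rewrite sqrtr_sqr ger0_norm.
  by rewrite [leRHS]E ler_sqrt ?ltW// ltW.
move=> /(ler_wpM2l C0)/le_trans; apply.
rewrite mulrCA ler_piMr ?(ltW e0)// ler_pdivrMr ?mul1r ?lerDl//.
by rewrite ltr_wpDl.
Qed.

(** At grid times the linear flow is, by [sgD], a composition of steps each of which lies below
    [maxL]. Continuity in time ([MC_cvg]) takes care of the truncation of [t] to the grid. *)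
Lemma Lsg_le_Ssg slo shi s t f x : 0 <= slo -> slo <= shi -> (s = slo \/ s = shi) ->
  0 <= t -> bl f -> Lsg s t f x <= Ssg slo shi t f x.
Proof.
move=> h0 h1 hs t0 bf.
have s0 : 0 <= s by case: hs => ->; lra.
have hL n : step s s n.+1%:R^-1 (bern s n) by exact: bern_step.
have hM n : step slo shi n.+1%:R^-1 (maxL slo shi n) by exact: maxL_step.
have [C [L Bf]] := bf.
have cv := MC_cvg (x := x) (sg_MC s0 (lexx s) hL Bf) (sgk_cvg t0).
rewrite /Lsg -(ulim_cvg cv); apply: ulim_le; first exact: cvg_bounded_seq cv.
  exact: (sg_bounded_seq h0 h1 hM).
move=> n; set h := n.+1%:R^-1; have hh : 0 <= h by rewrite invr_ge0.
have iB k : bl (iter k (maxL slo shi n) f).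
  exact: (step_bl (iter_step h0 h1 hM n k) bf).
elim: (sgk t n) x {cv} => [|k IH] x; first by rewrite mul0r sg_le0.
rewrite -natr1 mulrDl mul1r addrC (sgD s0 (lexx s) hL)//; last first.
  by rewrite mulr_ge0.
apply: (@le_trans _ _ (Lsg s h (iter k (maxL slo shi n) f) x)).
  apply: (step_mono (Lsg_step s0 hh)) => //.
  by apply: (step_bl (sg_step s0 (lexx s) hL _) bf); rewrite mulr_ge0.
rewrite iterS /maxL le_max.
by case: hs => ->; rewrite lexx ?orbT.
Qed.

End instances.

(** * Viscosity solutions of the G-heat equation *)

Section calculus.
Variable R : realType.
Implicit Types (f df : R -> R) (a b c x y e t h : R).

Lemma mvt f df a b : a < b ->
  (forall x, a <= x <= b -> is_derive x 1 f (df x)) ->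
  exists2 c, a < c < b & f b - f a = df c * (b - a).
Proof.
move=> ab hd.
have [|| c] := @MVT R f df a b ab.
- by move=> x; rewrite in_itv /= => /andP[h1 h2]; apply: hd; rewrite !ltW.
- apply: derivable_within_continuous => x; rewrite in_itv /= => hx.
  by have [] := hd x hx.
- by rewrite in_itv /= => hc E; exists c.
Qed.

Lemma derive1_is_derive f x : derivable f x 1 -> is_derive x 1 f (derive1 f x).
Proof. by move=> /derivableP; rewrite derive1E. Qed.

Lemma is_derive_derive1 f x c : is_derive x 1 f c -> derivable f x 1 /\ derive1 f x = c.
Proof. by move=> h; split; [have [] := h|rewrite derive1E; exact: derive_val]. Qed.

Lemma near_prod (t x : R) (P : R * R -> Prop) :
  (\forall p \near (t, x), P p) ->
  exists2 r : R, 0 < r & forall s y, `|t - s| < r -> `|x - y| < r -> P (s, y).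
Proof.
by move=> /nbhs_ballP [r /= r0 h]; exists r => // s y h1 h2; apply: h; split.
Qed.

(* Second-order expansion from above, for times before t only: for those the
   term of first order in time needs no absolute value. *)
Lemma C12_taylor (psi : R -> R -> R) t x e : C12 psi -> 0 < t -> 0 < e ->
  exists2 r : R, 0 < r & forall h y, 0 <= h < r -> `|y| < r ->
    psi (t - h) (x + y) <= psi t x - (dt psi t x - e) * h + dx psi t x * y
      + (dx (dx psi) t x + e) / 2 * y ^+ 2.
Proof.
move=> [hd hc] t0 e0.
have [_ /cvgrPdist_lt/(_ _ e0)/near_prod[r1 r10 h1] _ /cvgrPdist_lt/(_ _ e0)/near_prod[r2 r20 h2]] :=
  hc (t, x) t0.
rewrite /= in h1 h2.
exists (Num.min t (Num.min r1 r2)); first by rewrite !lt_min t0 r10.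
move=> h y; rewrite !lt_min => /andP[hh0 /and3P[ht hr1 hr2]] /and3P[_ yr1 yr2].
apply: (@le_trans _ _ (psi t (x + y) - (dt psi t x - e) * h)).
  move: hh0; rewrite le_eqVlt => /predU1P[<-|hh0]; first by rewrite mulr0 !subr0.
  have th : t - h < t by lra.
  have [s|s] := @mvt (psi ^~ (x + y)) (fun s => dt psi s (x + y)) _ _ th.
    move=> /andP[s1 s2]; apply: derive1_is_derive.
    have s0 : 0 < s by lra.
    by case: (hd s (x + y) s0) => Hd _ _; exact: Hd.
  have eh : t - (t - h) = h by lra.
  move=> /andP[s1 s2]; rewrite eh => E.
  have := h1 s (x + y); rewrite opprD addrA subrr sub0r normrN => /(_ _ yr1).
  have ts : `|t - s| < r1 by rewrite ger0_norm; lra.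
  move=> /(_ ts); rewrite distrC ltr_norml => /andP[d1 _].
  have : h * (dt psi t x - e) <= h * dt psi s (x + y) by apply: ler_wpM2l; lra.
  lra.
pose q := dx psi t x; pose r := dx (dx psi) t x.
rewrite -/q -/r.
suff : psi t (x + y) <= psi t x + q * y + (r + e) / 2 * y ^+ 2 by lra.
pose g z := psi t z - psi t x - q * (z - x) - (r + e) / 2 * (z - x) ^+ 2.
pose dg z := dx psi t z - q - (r + e) * (z - x).
suff : g (x + y) <= g x by rewrite /g subrr; lra.
have Hg (z : R) : is_derive z 1 g (dg z).
  have [_ /derive1_is_derive D _] := hd t z t0.
  rewrite /g /dg; apply: is_derive_eq.
  by rewrite -[(psi t)^`()%classic z]/(dx psi t z) /GRing.scale /=; field.
have Hdx (z : R) : is_derive z 1 (dx psi t) (dx (dx psi) t z).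
  by have [_ _ /derive1_is_derive D] := hd t z t0.
have near (z : R) : `|x - z| < r2 -> dx (dx psi) t z <= r + e.
  move=> hz; have := h2 t z; rewrite subrr normr0 => /(_ r20 hz).
  by rewrite distrC ltr_norml => /andP[_]; rewrite -/r; lra.
have [y0|y0|->] := ltgtP y 0; last by rewrite addr0.
- have xy : x + y < x by lra.
  have xy0 : 0 <= x - (x + y) by lra.
  have [z /andP[z1 z2] E] := @mvt g dg _ _ xy (fun z _ => Hg z).
  suff dz : 0 <= dg z by have := mulr_ge0 dz xy0; rewrite -E subr_ge0.
  have [w /andP[w1 w2] E'] := @mvt _ _ _ _ z2 (fun z _ => Hdx z).
  have hw : `|x - w| < r2 by move: yr2; rewrite ltr0_norm// gtr0_norm; lra.
  have xz : 0 <= x - z by lra.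
  have := ler_wpM2r xz (near _ hw); rewrite -E' /dg -/q; lra.
- have xy : x < x + y by lra.
  have xy0 : 0 <= x + y - x by lra.
  have [z /andP[z1 z2] E] := @mvt g dg _ _ xy (fun z _ => Hg z).
  suff dz : dg z <= 0 by have := mulr_le0_ge0 dz xy0; rewrite -E subr_le0.
  have [w /andP[w1 w2] E'] := @mvt _ _ _ _ z1 (fun z _ => Hdx z).
  have hw : `|x - w| < r2 by move: yr2; rewrite gtr0_norm// ltr0_norm; lra.
  have zx : 0 <= z - x by lra.
  have := ler_wpM2r zx (near _ hw); rewrite -E' /dg -/q; lra.
Qed.

Lemma quartic_dom (A B D r : R) : 0 <= A -> 0 <= B -> 0 <= D -> 0 < r ->
  exists2 K, 0 <= K & forall y, r <= `|y| -> A + B * `|y| + D * y ^+ 2 <= K * y ^+ 4.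
Proof.
move=> A0 B0 D0 r0; exists (A / r ^+ 4 + B / r ^+ 3 + D / r ^+ 2).
  by rewrite !addr_ge0// divr_ge0// exprn_ge0// ltW.
move=> y; rewrite -(real_normK (num_real y)).
have -> : y ^+ 4 = `|y| ^+ 4 by rewrite -normrX ger0_norm// exprn_even_ge0.
set a := `|y| => ra.
have a0 : 0 < a by exact: lt_le_trans ra.
have e1 : 1 <= a / r by rewrite ler_pdivlMr// mul1r.
have e2 : 1 <= (a / r) ^+ 2 by exact: exprn_ege1.
have e3 : 1 <= (a / r) ^+ 3 by exact: exprn_ege1.
have e4 : 1 <= (a / r) ^+ 4 by exact: exprn_ege1.
have -> : (A / r ^+ 4 + B / r ^+ 3 + D / r ^+ 2) * a ^+ 4 =
   A * (a / r) ^+ 4 + B * a * (a / r) ^+ 3 + D * a ^+ 2 * (a / r) ^+ 2.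
  by field; exact: lt0r_neq0.
have Ba : 0 <= B * a by rewrite mulr_ge0// ltW.
have Da : 0 <= D * a ^+ 2 by rewrite mulr_ge0// sqr_ge0.
by rewrite !lerD// ler_peMr.
Qed.

End calculus.

(** * Subsolutions from the dynamic programming inequality *)

Section dpp.
Variables (R : realType) (slo shi : R).
Hypotheses (slo0 : 0 <= slo) (slohi : slo <= shi).

(* If v(t) <= T_h v(t-h), then v is a subsolution: test against the quartic
   polynomial made of the expansion of the test function and a penalty. *)
Lemma dpp_subsolution (T : R -> (R -> R) -> R -> R) (v : R -> R -> R) (C : R)
    (psi : R -> R -> R) (t x : R) :
  (forall h, 0 <= h -> step slo shi h (T h)) ->
  (forall s y, `|v s y| <= C) -> (forall s, bl (v s)) ->
  0 < t -> (forall h, 0 < h < t -> v t x <= T h (v (t - h)) x) ->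
  C12 psi ->
  (\forall p \near (t, x), v p.1 p.2 - psi p.1 p.2 <= v t x - psi t x) ->
  dt psi t x <= Gfun slo shi (dx (dx psi) t x).
Proof.
move=> hT vC vb t0 dpp hpsi /near_prod[r1 r10 hv]; rewrite /= in hv.
have shi0 : 0 <= shi := le_trans slo0 slohi.
pose p := dt psi t x; pose q := dx psi t x; pose r := dx (dx psi) t x.
rewrite -/p -/r.
have key e : 0 < e -> p - e <= Gfun slo shi (r + e).
  move=> e0; have [r2 r20 tay] := C12_taylor x hpsi t0 e0.
  rewrite -/p -/q -/r in tay.
  pose rho := Num.min r1 r2; have rho0 : 0 < rho by rewrite lt_min r10.
  have C0 : 0 <= C := le_trans (normr_ge0 _) (vC 0 0).
  have A0 : 0 <= 2 * C + `|p - e| by rewrite addr_ge0// mulr_ge0.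
  have D0 : 0 <= `|(r + e) / 2| by [].
  have [K K0 hK] := quartic_dom A0 (normr_ge0 q) D0 rho0.
  have main h : 0 < h -> h < rho -> h < t -> h < 1 ->
      p - e <= Gfun slo shi (r + e) + 3 * shi ^+ 4 * K * h.
    move=> h0 hrho ht h1.
    have hb : v t x <= T h (v (t - h)) x by apply: dpp; rewrite h0.
    (* Within [rho] the touching condition and the Taylor expansion give the bound; beyond [rho] the
       constant [K] of [quartic_dom] absorbs all lower-order terms. Since [K] is fixed before [h],
       its contribution after division by [h] is of order [h]. *)
    have pol y : v (t - h) (x + y) <= quart (v t x - (p - e) * h) q ((r + e) / 2) K y.
      rewrite /quart; have [yr|yr] := ltP `|y| rho.
        have /andP[yr1 yr2] : (`|y| < r1) && (`|y| < r2) by rewrite -lt_min.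
        have /andP[hr1 hr2] : (h < r1) && (h < r2) by rewrite -lt_min.
        have := hv (t - h) (x + y); rewrite (_ : t - (t - h) = h); last by lra.
        rewrite gtr0_norm// (_ : x - (x + y) = - y); last by lra.
        rewrite normrN => /(_ hr1 yr1).
        have := tay h y; rewrite (ltW h0) hr2 => /(_ isT yr2).
        have : 0 <= K * y ^+ 4 by rewrite mulr_ge0// exprn_even_ge0.
        lra.
      have := hK _ yr.
      have b1 := le_trans (ler_norm _) (vC (t - h) (x + y)).
      have := vC t x; rewrite ler_norml => /andP[b2 _].
      have : - (`|q| * `|y|) <= q * y by rewrite -normrM lerNl -normrN ler_norm.
      have : - (`|(r + e) / 2| * y ^+ 2) <= (r + e) / 2 * y ^+ 2.
        by rewrite -mulNr ler_wpM2r ?sqr_ge0// lerNl -normrN ler_norm.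
      have : (p - e) * h <= `|p - e|.
        apply: le_trans (ler_norm _) _; rewrite normrM ler_piMr//.
        by rewrite gtr0_norm// ltW.
      lra.
    have := step_poly_at (hT _ (ltW h0)) K0 (vb _) pol.
    rewrite (_ : 2 * ((r + e) / 2) = r + e); last by field.
    move=> hh; have {}hh := le_trans hb hh.
    rewrite -(ler_pM2r h0); lra.
  apply/ler_addgt0Pl => d d0.
  have s4 : 0 <= 3 * shi ^+ 4 * K by rewrite !mulr_ge0// exprn_even_ge0.
  pose M := 3 * shi ^+ 4 * K + 1; have M0 : 0 < M by rewrite ltr_wpDl.
  pose h := Num.min (d / M) (Num.min rho (Num.min t 1)) / 2.
  have m0 : 0 < Num.min (d / M) (Num.min rho (Num.min t 1)).
    by rewrite lt_min divr_gt0// lt_min rho0 lt_min t0 ltr01.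
  have h0 : 0 < h by rewrite divr_gt0.
  have : h < Num.min (d / M) (Num.min rho (Num.min t 1)) by rewrite /h; lra.
  rewrite lt_min => /andP[hd]; rewrite lt_min => /andP[h1]; rewrite lt_min => /andP[h2 h3].
  apply: le_trans (main h h0 h1 h2 h3) _; rewrite addrC lerD2r.
  move: hd; rewrite ltr_pdivlMr// /M; nra.
apply/ler_addgt0Pl => d d0.
pose M := 1 + shi ^+ 2 / 2.
have M0 : 0 < M by rewrite ltr_pwDl// divr_ge0// sqr_ge0.
have e0 : 0 < d / M by rewrite divr_gt0.
have := key _ e0; have := Gfun_incr r slo0 slohi (ltW e0).
have : d / M * M = d by rewrite divfK// lt0r_neq0.
rewrite {2}/M; lra.
Qed.

End dpp.

(** * Averages over short intervals *)

Section average.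
Variable R : realType.
Implicit Types (f g : R -> R) (a c e h k s t x y : R).

Lemma derive0_cst f x y : (forall z : R, is_derive z 1 f (0 : R)) -> f x = f y.
Proof.
have H x' y' : (forall z : R, is_derive z 1 f (0 : R)) -> x' < y' -> f x' = f y'.
  move=> hd xy; have [c _ /eqP] := mvt xy (fun z _ => hd z).
  by rewrite mul0r subr_eq0 => /eqP.
move=> hd; have [xy|xy|->//] := ltgtP x y; first exact: H.
exact/esym/H.
Qed.

(** The integrals from [- n] are primitives to the right of [- n]. Subtracting their value at 0
    makes them agree on overlaps, and they glue to a primitive on the whole line. *)
Lemma antiderivative f : continuous f -> exists F, forall x : R, is_derive x 1 F (f x).
Proof.
move=> cf.
pose P (n : nat) (x : R) := (\int[lebesgue_measure]_(t in `[(- n%:R)%R, x]) f t)%R.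
have dP n x : - n%:R < x -> is_derive x 1 (P n) (f x).
  move=> nx; have xu : x < x + 1 by rewrite ltrDl.
  have [|||d1 d2] := @continuous_FTC1_closed R f (- n%:R) x (x + 1) xu.
  - apply: continuous_compact_integrable; first exact: segment_compact.
    exact: continuous_subspaceT.
  - exact: nx.
  - exact: cf.
  - by rewrite -d2; exact: derive1_is_derive.
pose N (x : R) := (Num.truncn `|x|).+2.
have Nx x : - (N x)%:R + 1 < x.
  have e1 : (N x)%:R = (Num.truncn `|x|).+1%:R + 1 :> R by rewrite natr1.
  have h := truncnS_gt `|x|; rewrite e1.
  by have := ler_norm (- x); rewrite normrN; lra.
have E n m x : (n <= m)%N -> - n%:R < x -> (0 < n)%N -> P m x - P m 0 = P n x - P n 0.
  move=> nm nx n0; have n0' : - n%:R < 0 :> R by rewrite oppr_lt0 ltr0n.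
  pose D z := P m z - P n z.
  have dD (z : R) : - n%:R < z -> is_derive z 1 D (0 : R).
    move=> nz; have mz : - m%:R < z by apply: le_lt_trans nz; rewrite lerN2 ler_nat.
    have := dP n z nz; have := dP m z mz => d1 d2.
    by apply: is_derive_eq; rewrite subrr.
  suff : D x = D 0 by rewrite /D; lra.
  have [x0|x0|->//] := ltgtP x 0.
    have [|c _ /eqP] := @mvt R D (fun=> 0) _ _ x0.
      by move=> z /andP[xz _]; apply: dD; exact: lt_le_trans xz.
    by rewrite mul0r subr_eq0 => /eqP.
  have [|c _ /eqP] := @mvt R D (fun=> 0) _ _ x0.
    by move=> z /andP[xz _]; apply: dD; exact: lt_le_trans xz.
  by rewrite mul0r subr_eq0 => /eqP.
exists (fun x => P (N x) x - P (N x) 0) => x.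
pose M := (N x).+1.
have Mx : - M%:R < x by have := Nx x; rewrite /M -natr1; lra.
have dM : is_derive x 1 (fun z => P M z - P M 0) (f x).
  by have := dP M x Mx => d1; apply: is_derive_eq; rewrite subr0.
apply: near_eq_is_derive dM => /=.
apply/nbhs_ballP; exists 1 => //= z; rewrite /ball/= => xz.
apply: E => //.
  rewrite /M /N ltnS ltnS; rewrite -ltnS truncn_lt_nat//.
  have := truncnS_gt `|x|; have <- : (Num.truncn `|x|).+1%:R + 1 = (Num.truncn `|x|).+2%:R :> R.
    by rewrite natr1.
  have : `|z| <= `|x| + `|x - z|.
    by rewrite -[z in leLHS](subKr x) -[in leRHS](normrN (x - z)) ler_normD.
  lra.
by have := Nx z; lra.
Qed.

Definition prim f : R -> R :=
  xget (cst 0) [set F | forall x, is_derive x (1:R) F (f x)].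

Lemma primP f x : continuous f -> is_derive x 1 (prim f) (f x).
Proof.
move=> /antiderivative [F hF]; rewrite /prim.
by case: xgetP => [G _ hG|/(_ F)]; [exact: hG|case].
Qed.

(** The mean of [f] over [[x, x + e]], written with a primitive so that the mean value theorem
    replaces estimates of integrals. The window lies to the right of [x]: an average in time
    involves later times only, so inequalities valid from some time on survive it. *)
Definition avg e f x := (prim f (x + e) - prim f x) / e.

(** The mean value theorem for the difference of the two primitives gives one shift [c] for both
    functions. Bounds and moduli of continuity therefore pass to averages with the same
    constants. *)
Lemma avg_diff e f g x y : 0 < e -> continuous f -> continuous g ->
  exists2 c, 0 < c < e & avg e f x - avg e g y = f (x + c) - g (y + c).
Proof.
move=> e0 cf cg.
have dsh f' x' (z : R) : continuous f' -> is_derive z 1 (fun z => prim f' (x' + z)) (f' (x' + z)).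
  move=> cf'; have d1 := primP (x' + z) cf'.
  have d2 : is_derive z 1 (fun z => x' + z) (1 : R).
    by apply: is_derive_eq; rewrite add0r ?mulr1.
  by have := is_derive1_comp d1 d2; rewrite mulr1.
have [|c c0 E] := @mvt R (fun z => prim f (x + z) - prim g (y + z))
    (fun z => f (x + z) - g (y + z)) 0 e e0.
  move=> z _; have := dsh f x z cf; have := dsh g y z cg => d1 d2.
  exact: is_deriveB.
exists c => //; move: E; rewrite subr0 !addr0 => E.
by rewrite /avg -mulrBl -[RHS](mulfK (lt0r_neq0 e0)) -E; congr (_ / _); ring.
Qed.

Lemma avg_cst e k x : 0 < e -> avg e (fun=> k) x = k.
Proof.
move=> e0; have [||c _ E] := @mvt R (prim (fun=> k)) (fun=> k) x (x + e).
- by rewrite ltrDl.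
- by move=> z _; apply: primP; exact: cst_continuous.
- by rewrite /avg E [x + e]addrC addrK mulfK// lt0r_neq0.
Qed.

Lemma avg_val e f x : 0 < e -> continuous f ->
  exists2 c, 0 < c < e & avg e f x = f (x + c).
Proof.
move=> e0 cf; have [|c ce] := avg_diff x x e0 cf (g := fun=> 0).
  exact: cst_continuous.
by rewrite avg_cst// !subr0; exists c.
Qed.

Lemma avg_lin e f g k x : 0 < e -> continuous f -> continuous g ->
  avg e (fun y => f y + k * g y) x = avg e f x + k * avg e g x.
Proof.
move=> e0 cf cg.
have cfg : continuous (fun y => f y + k * g y).
  by move=> y; apply: cvgD; [exact: cf|apply: cvgMr; exact: cg].
pose D z := prim (fun y => f y + k * g y) z - (prim f z + k * prim g z).
have dD (z : R) : is_derive z 1 D (0 : R).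
  have := primP z cf; have := primP z cg; have := primP z cfg => d1 d2 d3.
  by apply: is_derive_eq; rewrite /GRing.scale /=; ring.
have := derive0_cst (x + e) x dD; rewrite /D /avg => h.
rewrite mulrA -mulrDl; congr (_ / _); lra.
Qed.

Lemma avg_derive e f x : continuous f ->
  is_derive x 1 (avg e f) ((f (x + e) - f x) / e).
Proof.
move=> cf; have d1 := primP x cf; have d2 := primP (x + e) cf.
have d3 : is_derive x 1 (fun z => z + e) (1 : R).
  by apply: is_derive_eq; rewrite addr0 ?mulr1.
have := @is_derive1_comp R (prim f) (fun z => z + e) x _ _ d2 d3; rewrite mulr1 => d4.
rewrite /avg; have -> : (fun z => (prim f (z + e) - prim f z) / e) =
   e^-1 *: ((prim f \o (fun z => z + e)) - prim f).
  by apply/funext => z; rewrite /GRing.scale /= mulrC.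
by apply: is_derive_eq; rewrite /GRing.scale /= mulrC.
Qed.

Lemma avg_half e f x : avg e f x = (avg (e / 2) f x + avg (e / 2) f (x + e / 2)) / 2.
Proof.
rewrite /avg -addrA -splitr.
have [->|e0] := eqVneq e 0; first by rewrite mul0r invr0 !mulr0 addr0 mul0r.
by field.
Qed.

Lemma BL_continuous C L f : BL C L f -> continuous f.
Proof.
move=> bf x; have [_ L0] := BL_ge0 bf; have [_ hL] := bf.
apply/cvgrPdist_le => e e0; apply/nbhs_ballP.
have L1 : 0 < L + 1 by rewrite ltr_wpDl.
exists (e / (L + 1)); first by rewrite /= divr_gt0.
move=> y; rewrite /ball/= => xy; apply: le_trans (hL _ _) _.
move: xy; rewrite ltr_pdivlMr// => xy; have : 0 <= `|x - y| by []; nra.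
Qed.

Lemma BL_avg e C L f : 0 < e -> BL C L f -> BL C L (avg e f).
Proof.
move=> e0 bf; have cf := BL_continuous bf; have [hC hL] := bf; split=> [x|x y].
  by have [c _ ->] := avg_val x e0 cf.
have [c _ ->] := avg_diff x y e0 cf cf.
by apply: le_trans (hL _ _) _; rewrite opprD addrACA subrr addr0.
Qed.

Lemma avg_near e C L f x : 0 < e -> BL C L f -> `|avg e f x - f x| <= L * e.
Proof.
move=> e0 bf; have cf := BL_continuous bf; have [_ L0] := BL_ge0 bf.
have [c /andP[c0 ce] ->] := avg_val x e0 cf.
have [_ hL] := bf; apply: le_trans (hL _ _) _.
by rewrite [x + c]addrC addrK gtr0_norm// ler_wpM2l// ltW.
Qed.

(* Both sides halve the averaging window at no cost, and for a small window
   both are close to [T f]. *)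
Lemma linop_avg slo shi h T e f x : 0 <= slo -> slo <= shi -> step slo shi h T ->
  linop T -> 0 < e -> bl f -> T (avg e f) x = avg e (T f) x.
Proof.
move=> h0 h1 hT lT e0 [C [L bf]]; have [C0 L0] := BL_ge0 bf.
have TB := step_BL hT bf.
have lin f1 f2 z : bl f1 -> bl f2 -> T (fun y => f1 y + f2 y) z = T f1 z + T f2 z.
  move=> b1 b2; apply/eqP; rewrite eq_le (step_sub hT)//=.
  have := step_sub hT (bl_opp b1) (bl_opp b2) z.
  rewrite (lT _ b1) (lT _ b2).
  have -> : (fun y => - f1 y + - f2 y) = (fun y => - (f1 y + f2 y)).
    by apply/funext => y; rewrite opprD.
  by rewrite lT; [lra|exact: bl_add].
have main (m : nat) d y : 0 < d ->
    `|T (avg d f) y - avg d (T f) y| <= 2 * L * d / 2 ^+ m.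
  elim: m d y => [|m IH] d y d0.
    rewrite expr0 divr1.
    rewrite (_ : _ - _ = (T (avg d f) y - T f y) - (avg d (T f) y - T f y)); last by ring.
    apply: le_trans (ler_normB _ _) _.
    have := avg_near y d0 TB.
    have := step_contr hT y (BL_bl (BL_avg d0 bf)) (BL_bl bf)
      (fun z => avg_near z d0 bf).
    lra.
  have d2 : 0 < d / 2 by rewrite divr_gt0.
  have b2 : bl (avg (d / 2) f) := BL_bl (BL_avg d2 bf).
  have -> : T (avg d f) y =
      2^-1 * (T (avg (d / 2) f) y + T (avg (d / 2) f) (y + d / 2)).
    have -> : avg d f = (fun z => 2^-1 * (avg (d / 2) f z + avg (d / 2) f (z + d / 2))).
      by apply/funext => z; rewrite avg_half mulrC.
    rewrite (step_scale hT) ?invr_ge0//; last by apply: bl_add => //; exact: bl_shift.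
    by rewrite lin//; [rewrite (step_shift hT)|exact: bl_shift].
  rewrite avg_half exprS invfM.
  have := IH (d / 2) y d2; have := IH (d / 2) (y + d / 2) d2.
  rewrite !ler_norml => /andP[a1 a2] /andP[a3 a4].
  have e1 : 2 * L * (d / 2) / 2 ^+ m = 2 * L * d * (2^-1 / 2 ^+ m) by ring.
  rewrite e1 in a1 a2 a3 a4; apply/andP; split; lra.
apply/eqP; rewrite -subr_eq0 -normr_le0; apply/ler_addgt0Pl => d d0; rewrite addr0.
pose k := Num.truncn (2 * L * e / d).
apply: le_trans (main k e x e0) _.
rewrite ler_pdivrMr ?exprn_gt0// -ler_pdivrMl// [_^-1 * _]mulrC.
apply: le_trans (ltW (truncnS_gt _)) _; rewrite -/k.
have <- : (2 ^ k)%:R = 2 ^+ k :> R by rewrite natrX.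
by rewrite ler_nat ltn_expl.
Qed.

Lemma avg_le e f g x : 0 < e -> continuous f -> continuous g ->
  (forall y, f y <= g y) -> avg e f x <= avg e g x.
Proof.
move=> e0 cf cg fg; rewrite -subr_le0.
by have [c _ ->] := avg_diff x x e0 cf cg; rewrite subr_le0.
Qed.

End average.

(** * Mollification in time and space *)

Section mollify.
Variable R : realType.
Implicit Types (u w : R -> R -> R) (a c e h k s t x y : R).

Lemma MC_ge0 L C u : MC L C u -> 0 <= L /\ 0 <= C.
Proof.
move=> hu; split.
  have := hu 0 0 1 0; rewrite !subrr normr0 sqrtr0 mulr0 subr0 addr0 normr1 mulr1.
  exact: le_trans.
have := hu 1 0 0 0; rewrite !subrr normr0 mulr0 subr0 add0r normr1 sqrtr1 mulr1.
exact: le_trans.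
Qed.

Lemma MC_BL L C K u t : MC L C u -> (forall t x, `|u t x| <= K) -> BL K L (u t).
Proof.
move=> hu uK; split=> // x y.
by have := hu t t x y; rewrite subrr normr0 sqrtr0 mulr0 addr0.
Qed.

Lemma continuous2 (f : R * R -> R) :
  (forall t x e, 0 < e -> exists2 r : R, 0 < r & forall s y,
     `|t - s| < r -> `|x - y| < r -> `|f (t, x) - f (s, y)| <= e) -> continuous f.
Proof.
move=> H [t x]; apply/cvgrPdist_le => e e0; have [r r0 h] := H t x e e0.
have : nbhs_ball (t, x) [set p : R * R | `|f (t, x) - f p| <= e].
  by exists r => // -[s y] [hs hy]; exact: h.
by move=> /nbhs_ballP.
Qed.

Lemma MC_continuous L C u : MC L C u -> continuous (fun p : R * R => u p.1 p.2).
Proof.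
move=> hu; have [L0 C0] := MC_ge0 hu; apply: continuous2 => t x e e0 /=.
pose M := L + C + 1; have M0 : 0 < M by rewrite ltr_wpDl// addr_ge0.
pose r := Num.min 1 (e / M); have r0 : 0 < r by rewrite lt_min ltr01 divr_gt0.
have r1 : r <= 1 by rewrite ge_min lexx.
exists (r ^+ 2); first by rewrite exprn_gt0.
move=> s y hs hy.
apply: le_trans (hu _ _ _ _) _.
have h1 : `|x - y| <= r by apply: le_trans (ltW hy) _; rewrite expr2 ler_piMr// ltW.
have h2 : Num.sqrt `|t - s| <= r.
  have E : r = Num.sqrt (r ^+ 2) by rewrite sqrtr_sqr ger0_norm// ltW.
  by rewrite [leRHS]E; apply: ler_wsqrtr; exact: ltW.
have : M * r <= e by rewrite mulrC -ler_pdivlMr// ge_min lexx orbT.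
have := ler_wpM2l L0 h1; have := ler_wpM2l C0 h2; rewrite /M; nra.
Qed.

Lemma MC_cont_t L C u x : MC L C u -> continuous (fun t => u t x).
Proof.
move=> hu t; apply/cvgrPdist_le => e e0.
have /(_ (t, x))/cvgrPdist_le/(_ _ e0)/near_prod[r r0 h] := MC_continuous hu.
apply/nbhs_ballP; exists r => // s hs; apply: (h s x) => //.
by rewrite subrr normr0.
Qed.

Lemma MC_cont_x L C u t : MC L C u -> continuous (u t).
Proof.
move=> hu x; apply/cvgrPdist_le => e e0.
have /(_ (t, x))/cvgrPdist_le/(_ _ e0)/near_prod[r r0 h] := MC_continuous hu.
apply/nbhs_ballP; exists r => // y hy; apply: (h t y) => //.
by rewrite subrr normr0.
Qed.

Lemma MC_avgx L C e u : 0 < e -> MC L C u -> MC L C (fun t x => avg e (u t) x).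
Proof.
move=> e0 hu t s x y.
have [c _ ->] := avg_diff x y e0 (MC_cont_x (t := t) hu) (MC_cont_x (t := s) hu).
by apply: le_trans (hu _ _ _ _) _; rewrite opprD addrACA subrr addr0.
Qed.

Lemma MC_avgt L C e u : 0 < e -> MC L C u -> MC L C (fun t x => avg e (fun s => u s x) t).
Proof.
move=> e0 hu t s x y.
have [c _ ->] := avg_diff t s e0 (MC_cont_t (x := x) hu) (MC_cont_t (x := y) hu).
by apply: le_trans (hu _ _ _ _) _; rewrite opprD addrACA subrr addr0.
Qed.

Lemma MC_dx L C e u : 0 < e -> MC L C u ->
  MC (2 * L / e) (2 * C / e) (fun t x => (u t (x + e) - u t x) / e).
Proof.
move=> e0 hu t s x y.
rewrite -mulrBl normrM (gtr0_norm (_ : 0 < e^-1)) ?invr_gt0//.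
rewrite (_ : 2 * L / e * _ + _ = (2 * L * `|x - y| + 2 * C * Num.sqrt `|t - s|) / e); last first.
  by field; exact: lt0r_neq0.
apply: ler_wpM2r; first by rewrite invr_ge0 ltW.
rewrite (_ : _ - _ = (u t (x + e) - u s (y + e)) - (u t x - u s y)); last by ring.
apply: le_trans (ler_normB _ _) _.
have := hu t s (x + e) (y + e); rewrite opprD addrACA subrr addr0.
by have := hu t s x y; lra.
Qed.

Lemma MC_dt L C e u : 0 < e -> MC L C u ->
  MC (2 * L / e) (2 * C / e) (fun t x => (u (t + e) x - u t x) / e).
Proof.
move=> e0 hu t s x y.
rewrite -mulrBl normrM (gtr0_norm (_ : 0 < e^-1)) ?invr_gt0//.
rewrite (_ : 2 * L / e * _ + _ = (2 * L * `|x - y| + 2 * C * Num.sqrt `|t - s|) / e); last first.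
  by field; exact: lt0r_neq0.
apply: ler_wpM2r; first by rewrite invr_ge0 ltW.
rewrite (_ : _ - _ = (u (t + e) x - u (s + e) y) - (u t x - u s y)); last by ring.
apply: le_trans (ler_normB _ _) _.
have := hu (t + e) (s + e) x y; rewrite opprD addrACA subrr addr0.
by have := hu t s x y; lra.
Qed.

Lemma is_derive_quad (f : R -> R) x c M :
  (forall y, `|f (x + y) - f x - y * c| <= M * y ^+ 2) -> is_derive x 1 f c.
Proof.
move=> H.
suff hc : (fun h => h^-1 *: ((f \o shift x) (h *: 1) - f x)) @ 0^' --> c.
  by apply: DeriveDef; [apply/cvg_ex; exists c|exact: cvg_lim hc].
have M0 : 0 <= M by have := le_trans (normr_ge0 _) (H 1); rewrite expr1n mulr1.
have M1 : 0 < M + 1 by rewrite ltr_wpDl.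
apply/cvgrPdist_le => e e0.
apply/nbhs_ballP; exists (e / (M + 1)); first by rewrite /= divr_gt0.
move=> h; rewrite /ball /= sub0r normrN => hh h0.
rewrite /GRing.scale /= mulr1 [h + x]addrC.
have -> : c - h^-1 * (f (x + h) - f x) = - (h^-1 * (f (x + h) - f x - h * c)).
  by field.
rewrite normrN normrM normfV mulrC ler_pdivrMr ?normr_gt0//.
apply: le_trans (H h) _; rewrite -(real_normK (num_real h)) expr2 mulrA ler_wpM2r//.
by move: hh; rewrite ltr_pdivlMr// => hh; have : 0 <= `|h| by []; nra.
Qed.

(** Each average gains one derivative: two in space and one in time give continuous [wt] and [wxx],
    which are difference quotients of averages of [u]. *)
Definition moll e u t x := avg e (fun s => avg e (avg e (u s)) x) t.

Record smooth w wt wx wxx : Prop := Smooth {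
  smooth_t : forall t x, is_derive t (1:R) (fun t => w t x) (wt t x) ;
  smooth_x : forall t x, is_derive x (1:R) (w t) (wx t x) ;
  smooth_xx : forall t x, is_derive x (1:R) (wx t) (wxx t x) ;
  smooth_c : continuous (fun p : R * R => w p.1 p.2) ;
  smooth_ct : continuous (fun p : R * R => wt p.1 p.2) ;
  smooth_cx : continuous (fun p : R * R => wx p.1 p.2) ;
  smooth_cxx : continuous (fun p : R * R => wxx p.1 p.2) }.

Lemma smooth_C12 w wt wx wxx : smooth w wt wx wxx ->
  [/\ C12 w, dt w = wt & dx (dx w) = wxx].
Proof.
move=> hw.
have Et : dt w = wt.
  apply/funext => t; apply/funext => x.
  by have [] := is_derive_derive1 (smooth_t hw t x).
have Ex : dx w = wx.
  apply/funext => t; apply/funext => x.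
  by have [] := is_derive_derive1 (smooth_x hw t x).
have Exx : dx (dx w) = wxx.
  rewrite Ex; apply/funext => t; apply/funext => x.
  by have [] := is_derive_derive1 (smooth_xx hw t x).
split=> //; split=> [t x _|p _].
  by split; rewrite ?Ex; [have [] := smooth_t hw t x|have [] := smooth_x hw t x
    |have [] := smooth_xx hw t x].
rewrite Et Exx Ex; split; [exact: (smooth_c hw)|exact: (smooth_ct hw)
  |exact: (smooth_cx hw)|exact: (smooth_cxx hw)].
Qed.

Definition moll_t e u t x : R :=
  (avg e (avg e (u (t + e))) x - avg e (avg e (u t)) x) / e.
Definition moll_x e u t x :=
  avg e (fun s => (avg e (u s) (x + e) - avg e (u s) x) / e) t.
Definition diff2 e u t x : R :=
  ((u t (x + e + e) - u t (x + e)) / e - (u t (x + e) - u t x) / e) / e.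
Definition moll_xx e u t x := avg e (fun s => diff2 e u s x) t.

Lemma MC_diff2 L C e u : 0 < e -> MC L C u ->
  MC (2 * (2 * L / e) / e) (2 * (2 * C / e) / e) (diff2 e u).
Proof. by move=> e0 hu; exact: MC_dx e0 (MC_dx e0 hu). Qed.

Lemma avg_der_x e u t x : 0 < e -> continuous (u t) ->
  is_derive x (1:R) (fun z => (avg e (u t) (z + e) - avg e (u t) z) / e) (diff2 e u t x).
Proof.
move=> e0 cu; have d1 := avg_derive e x cu; have d2 := avg_derive e (x + e) cu.
have d3 : is_derive x 1 (fun z => z + e) (1 : R).
  by apply: is_derive_eq; rewrite addr0 ?mulr1.
have := @is_derive1_comp R (avg e (u t)) (fun z => z + e) x _ _ d2 d3.
rewrite mulr1 => d4.
have -> : (fun z => (avg e (u t) (z + e) - avg e (u t) z) / e) =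
   e^-1 *: ((avg e (u t) \o (fun z => z + e)) - avg e (u t)).
  by apply/funext => z; rewrite /GRing.scale /= mulrC.
by apply: is_derive_eq; rewrite /GRing.scale /= mulrC.
Qed.

(* Differentiation under the average over t. *)
Lemma avg_quad e (G G' : R -> R -> R) M t x : 0 < e ->
  (forall x, continuous (fun s => G s x)) -> (forall x, continuous (fun s => G' s x)) ->
  (forall s y, `|G s (x + y) - G s x - y * G' s x| <= M * y ^+ 2) ->
  is_derive x (1:R) (fun z => avg e (fun s => G s z) t) (avg e (fun s => G' s x) t).
Proof.
move=> e0 cG cG' H; apply: (@is_derive_quad _ _ _ M) => y.
have E : avg e (fun s => G s (x + y)) t - avg e (fun s => G s x) t
    - y * avg e (fun s => G' s x) t =
    avg e (fun s => G s (x + y) + -1 * G s x + - y * G' s x) t.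
  rewrite !avg_lin//; first by ring.
  by move=> s; apply: cvgD; [exact: cG|apply: cvgMr; exact: cG].
have cH : continuous (fun s => G s (x + y) + -1 * G s x + - y * G' s x).
  by move=> s; apply: cvgD; [apply: cvgD; [exact: cG|apply: cvgMr; exact: cG]
    |apply: cvgMr; exact: cG'].
rewrite E; have [c _ ->] := avg_val t e0 cH.
by rewrite mulN1r mulNr; exact: H.
Qed.

Lemma quad_bound (f f' : R -> R) M x y : (forall z, is_derive z (1:R) f (f' z)) ->
  (forall a b, `|f' a - f' b| <= M * `|a - b|) ->
  `|f (x + y) - f x - y * f' x| <= M * y ^+ 2.
Proof.
move=> hd hM; have M0 : 0 <= M.
  by have := hM 1 0; rewrite subr0 normr1 mulr1; exact: le_trans.
have key a b : a < b -> forall z, a <= z <= b ->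
    `|f b - f a - (b - a) * f' z| <= M * (b - a) ^+ 2.
  move=> ab z /andP[az zb]; have [c /andP[ac cb] ->] := mvt ab (fun z _ => hd z).
  rewrite [f' c * _]mulrC -mulrBr normrM expr2 mulrCA.
  rewrite gtr0_norm ?subr_gt0//; apply: ler_wpM2l; first by rewrite subr_ge0 ltW.
  apply: le_trans (hM _ _) _; apply: ler_wpM2l => //.
  by rewrite ler_norml; apply/andP; split; lra.
have [y0|y0|->] := ltgtP y 0; last by rewrite addr0 subrr mul0r subrr normr0 expr0n mulr0.
- have xy : x + y < x by lra.
  have := key _ _ xy x; rewrite lexx (ltW xy) => /(_ isT).
  have -> : x - (x + y) = - y by ring.
  rewrite sqrrN -normrN; congr (`|_| <= _); ring.
- have xy : x < x + y by lra.
  have := key _ _ xy x; rewrite lexx (ltW xy) => /(_ isT).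
  by have -> : x + y - x = y by ring.
Qed.

Lemma moll_smooth e L C K u : 0 < e -> MC L C u -> (forall t x, `|u t x| <= K) ->
  smooth (moll e u) (moll_t e u) (moll_x e u) (moll_xx e u).
Proof.
move=> e0 hu uK.
have h1 := MC_avgx e0 hu; have h2 := MC_avgx e0 h1.
have h3 := MC_dx e0 h1; have h4 := MC_diff2 e0 hu.
split.
- by move=> t x; exact: (avg_derive e t (MC_cont_t (x := x) h2)).
- move=> t x; apply: (@avg_quad e (fun s => avg e (avg e (u s)))
    (fun s x => (avg e (u s) (x + e) - avg e (u s) x) / e) (2 * L / e)) => //.
  + by move=> z; exact: (MC_cont_t (x := z) h2).
  + by move=> z; exact: (MC_cont_t (x := z) h3).
  + move=> s y; apply: (@quad_bound (avg e (avg e (u s)))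
        (fun z => (avg e (u s) (z + e) - avg e (u s) z) / e)).
      by move=> z; apply: avg_derive; exact: (MC_cont_x (t := s) h1).
    move=> a b; have := h3 s s a b.
    by rewrite subrr normr0 sqrtr0 mulr0 addr0.
- move=> t x; apply: (@avg_quad e (fun s x => (avg e (u s) (x + e) - avg e (u s) x) / e)
    (diff2 e u) (2 * (2 * L / e) / e)) => //.
  + by move=> z; exact: (MC_cont_t (x := z) h3).
  + by move=> z; exact: (MC_cont_t (x := z) h4).
  + move=> s y; apply: (@quad_bound (fun z => (avg e (u s) (z + e) - avg e (u s) z) / e)
        (diff2 e u s)).
      by move=> z; apply: avg_der_x => //; exact: (MC_cont_x (t := s) hu).
    move=> a b; have := h4 s s a b.
    by rewrite subrr normr0 sqrtr0 mulr0 addr0.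
- exact: (MC_continuous (MC_avgt e0 h2)).
- exact: (MC_continuous (MC_dt e0 h2)).
- exact: (MC_continuous (MC_avgt e0 h3)).
- exact: (MC_continuous (MC_avgt e0 h4)).
Qed.

Lemma moll_val e L C u t x : 0 < e -> MC L C u -> exists a b, 
  [/\ 0 < a < e, 0 < b < 2 * e & moll e u t x = u (t + a) (x + b)].
Proof.
move=> e0 hu; have h1 := MC_avgx e0 hu; have h2 := MC_avgx e0 h1.
have [a ha E1] := avg_val t e0 (MC_cont_t (x := x) h2).
have [b hb E2] := avg_val x e0 (MC_cont_x (t := (t + a)) h1).
have [c hc E3] := avg_val (x + b) e0 (MC_cont_x (t := (t + a)) hu).
exists a, (b + c); rewrite /moll E1 E2 E3 addrA; split=> //.
by move: hb hc => /andP[? ?] /andP[? ?]; apply/andP; split; lra.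
Qed.

Lemma moll_near e L C u t x : 0 < e -> MC L C u ->
  `|moll e u t x - u t x| <= L * (2 * e) + C * Num.sqrt e.
Proof.
move=> e0 hu; have [L0 C0] := MC_ge0 hu.
have [a [b [/andP[a0 ae] /andP[b0 be] ->]]] := moll_val t x e0 hu.
apply: le_trans (hu _ _ _ _) _.
rewrite [t + a]addrC [x + b]addrC !addrK !gtr0_norm//.
by rewrite lerD// ler_wpM2l ?(ltW be)// ler_wsqrtr// ltW.
Qed.

End mollify.

(** * Smooth supersolutions and comparison *)

Section comparison.
Variable R : realType.
Implicit Types (u w v : R -> R -> R) (a c e h k s t x y : R).

(* If u grows at least like the heat flow of variance s^2, so does its
   mollification, which is smooth: hence the differential inequality. *)
Lemma moll_super sig e L C K u t0 : 0 <= sig -> 0 < e -> MC L C u ->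
  (forall t x, `|u t x| <= K) ->
  (forall t h x, t0 <= t -> 0 <= h -> Lsg sig h (u t) x <= u (t + h) x) ->
  forall t x, t0 <= t -> sig ^+ 2 / 2 * moll_xx e u t x <= moll_t e u t x.
Proof.
move=> s0 e0 hu uK hsup t x tt0.
have h1 := MC_avgx e0 hu; have h2 := MC_avgx e0 h1; have h4 := MC_diff2 e0 hu.
have K0 : 0 <= K := le_trans (normr_ge0 _) (uK 0 0).
pose F s y := avg e (avg e (u s)) y.
pose D := diff2 e u.
pose L2 := 2 * (2 * L / e) / e; pose C2 := 2 * (2 * C / e) / e.
have [L20 C20] := MC_ge0 h4; rewrite -/L2 in L20; rewrite -/C2 in C20.
have uB s : BL K L (u s) := MC_BL s hu uK.
(* The error is of order [h * Num.sqrt h]: the cubic Taylor remainder of [F s] is split by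
   [|z| ^+ 3 <= d * z ^+ 2 + z ^+ 4 / d] with [d = Num.sqrt h], which turns it into a quartic
   polynomial. *)
have step1 s h y : t0 <= s -> 0 < h ->
   h * (sig ^+ 2 / 2 * D s y - (sig ^+ 2 + 3 * sig ^+ 4) * L2 * Num.sqrt h)
     <= F (s + h) y - F s y.
  move=> ts h0; have hh := ltW h0.
  have hL := Lsg_step s0 hh; have lL := Lsg_linop h s0.
  have B1 := BL_avg e0 (uB s); have B2 := BL_avg e0 B1.
  have E1 : Lsg sig h (F s) y <= F (s + h) y.
    rewrite /F (linop_avg _ s0 (lexx sig) hL lL e0 (BL_bl B1)).
    have Lu := step_BL hL (uB s); have Lu1 := step_BL hL B1.
    apply: avg_le => //.
    - exact: (BL_continuous Lu1).
    - exact: (BL_continuous (BL_avg e0 (uB (s + h)))).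
    - move=> z; rewrite (linop_avg _ s0 (lexx sig) hL lL e0 (BL_bl (uB s))).
      apply: avg_le => //; [exact: (BL_continuous Lu)|exact: (BL_continuous (uB (s + h)))|].
      by move=> z'; exact: hsup.
  suff : - Lsg sig h (F s) y <= - F s y - h * (sig ^+ 2 / 2 * D s y
     - (sig ^+ 2 + 3 * sig ^+ 4) * L2 * Num.sqrt h) by lra.
  rewrite -lL; last exact: (BL_bl B2).
  pose d := Num.sqrt h; have d0 : 0 < d by rewrite sqrtr_gt0.
  have dd : d ^+ 2 = h by rewrite sqr_sqrtr.
  pose Fx z := (avg e (u s) (z + e) - avg e (u s) z) / e.
  have dF z : is_derive z (1:R) (F s) (Fx z).
    by apply: avg_derive; exact: (MC_cont_x (t := s) h1).
  have dFx z : is_derive z (1:R) Fx (D s z).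
    by apply: avg_der_x => //; exact: (MC_cont_x (t := s) hu).
  have D_lip p q : `|D s p - D s q| <= L2 * `|p - q|.
    by have := h4 s s p q; rewrite subrr normr0 sqrtr0 mulr0 addr0.
  have tay z : - F s (y + z) <= quart (- F s y) (- Fx y) (- D s y / 2 + L2 * d) (L2 / d) z.
    have T1 : `|F s (y + z) - F s y - z * Fx y - D s y / 2 * z ^+ 2| <= L2 * `|z| ^+ 3.
      pose g p := F s (y + p) - F s y - p * Fx y - D s y / 2 * p ^+ 2.
      pose dg p := Fx (y + p) - Fx y - p * D s y.
      have dg' (p : R) : is_derive p 1 g (dg p).
        have dd3 : is_derive p 1 (fun p => y + p) (1 : R).
          by apply: is_derive_eq; rewrite add0r ?mulr1.
        have := @is_derive1_comp R (F s) (fun p => y + p) p _ _ (dF (y + p)) dd3.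
        rewrite mulr1 => dd4.
        have -> : g = (F s \o (fun p => y + p)) - cst (F s y) - (Fx y *: id)
            - ((D s y / 2) *: (fun p : R => p ^+ 2)).
          apply/funext => p'; transitivity (F s (y + p') - F s y - Fx y * p' - D s y / 2 * p' ^+ 2) => //.
          by rewrite /g; ring.
        by apply: is_derive_eq; rewrite /dg /GRing.scale /= ; field.
      have bdg p : `|dg p| <= L2 * p ^+ 2 by exact: quad_bound dFx D_lip.
      have g0 : g 0 = 0 by rewrite /g addr0 subrr mul0r expr0n/= mulr0 !subr0.
      rewrite -/(g z).
      have [z0|z0|->] := ltgtP z 0; last by rewrite g0 normr0 expr0n mulr0.
      - have [p /andP[p1 p2]] := @mvt R g dg _ _ z0 (fun p _ => dg' p).
        rewrite g0 !sub0r => /eqP; rewrite eqr_oppLR => /eqP ->.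
        rewrite normrN normrM normrN exprSr mulrA ler_wpM2r//.
        apply: le_trans (bdg p) _; apply: ler_wpM2l => //.
        by rewrite -(real_normK (num_real p)) ler_sqr ?nnegrE// !ltr0_norm; lra.
      - have [p /andP[p1 p2]] := @mvt R g dg _ _ z0 (fun p _ => dg' p).
        rewrite g0 !subr0 => ->; rewrite normrM exprSr mulrA ler_wpM2r//.
        apply: le_trans (bdg p) _; apply: ler_wpM2l => //.
        by rewrite -(real_normK (num_real p)) ler_sqr ?nnegrE// !gtr0_norm; lra.
    have T2 : `|z| ^+ 3 <= d * z ^+ 2 + z ^+ 4 / d.
      have -> : z ^+ 4 = `|z| ^+ 4 by rewrite -normrX ger0_norm// exprn_even_ge0.
      rewrite -(real_normK (num_real z)); set m := `|z|.
      have m0 : 0 <= m := normr_ge0 z.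
      rewrite -subr_ge0 (_ : _ - _ = m ^+ 2 * (d ^+ 2 + m ^+ 2 - m * d) / d); last first.
        by field; exact: lt0r_neq0.
      apply: divr_ge0; last exact: ltW.
      apply: mulr_ge0; first exact: sqr_ge0.
      by have := sqr_ge0 (d - m); have := mulr_ge0 m0 (ltW d0); nra.
    move: T1; rewrite ler_norml => /andP[T1 _].
    have := ler_wpM2l L20 T2; rewrite /quart.
    have -> : L2 / d * z ^+ 4 = L2 * (z ^+ 4 / d) by ring.
    lra.
  have Ld : 0 <= L2 / d by rewrite divr_ge0// ltW.
  have := step_poly_at hL Ld (bl_opp (BL_bl B2)) tay.
  rewrite Gfun_diag// => /le_trans; apply.
  rewrite -/d -dd; apply: eq_ler; field; exact: lt0r_neq0.
have cD : continuous (fun s => D s x) := MC_cont_t (x := x) h4.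
pose P := prim (fun s => D s x).
pose A := sig ^+ 2 / 2.
have A0 : 0 <= A by rewrite divr_ge0// sqr_ge0.
pose B := (sig ^+ 2 + 3 * sig ^+ 4) * L2 + A * C2.
have S0 : 0 <= sig ^+ 2 + 3 * sig ^+ 4.
  by apply: addr_ge0; [exact: sqr_ge0|apply: mulr_ge0 => //; exact: exprn_even_ge0].
have B0 : 0 <= B by apply: addr_ge0; exact: mulr_ge0.
(* Each increment of [m] over a time [h] is at least [- B * h * Num.sqrt h]. Summing [e / h] of them
   and letting [h] tend to 0 gives [m t <= m (t + e)]. Divided by [e], this is the claim, because
   [moll_t] is a difference quotient of [F] and [moll_xx] an average of [D]. *)
pose m s := F s x - A * P s.
have step2 s h : t0 <= s -> 0 < h -> - (h * (B * Num.sqrt h)) <= m (s + h) - m s.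
  move=> ts h0; have := step1 s h x ts h0.
  have [||p /andP[p1 p2] E] := @mvt R P (fun s => D s x) s (s + h).
  - by rewrite ltrDl.
  - by move=> z _; exact: primP.
  have {}E : P (s + h) - P s = D p x * h by rewrite E; congr (_ * _); ring.
  have := h4 p s x x; rewrite subrr normr0 mulr0 add0r -/C2 -/D.
  have : Num.sqrt `|p - s| <= Num.sqrt h.
    by apply: ler_wsqrtr; rewrite gtr0_norm; lra.
  move=> /(ler_wpM2l C20) q1 /le_trans/(_ q1); rewrite ler_norml => /andP[_ q2].
  have := ler_wpM2l (mulr_ge0 A0 (ltW h0)) q2.
  rewrite /m /B -/A; have := E; set sq := Num.sqrt h; set pp := P _; set ps := P s.
  move=> {}E; have -> : pp = ps + D p x * h by rewrite -E; ring.
  lra.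
have step3 n h s : t0 <= s -> 0 < h -> - (n%:R * (h * (B * Num.sqrt h))) <= m (s + n%:R * h) - m s.
  move=> ts h0; elim: n => [|n IH]; first by rewrite !mul0r addr0 subrr oppr0.
  have ts' : t0 <= s + n%:R * h by rewrite (le_trans ts)// lerDl mulr_ge0// ltW.
  have := step2 _ h ts' h0.
  rewrite -natr1 (_ : s + (n%:R + 1) * h = s + n%:R * h + h); [lra|ring].
have : m t <= m (t + e).
  rewrite -subr_ge0; apply/ler_addgt0Pl => d d0.
  pose Q := e * B; have Q0 : 0 <= Q by rewrite mulr_ge0// ltW.
  have Q1 : 0 < Q + 1 by rewrite ltr_wpDl.
  pose n := (Num.truncn (e / (d / (Q + 1)) ^+ 2)).+1.
  have r0 : 0 < d / (Q + 1) by rewrite divr_gt0.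
  have n0 : 0 < n%:R :> R by rewrite ltr0n.
  have hn : e / n%:R <= (d / (Q + 1)) ^+ 2.
    rewrite ler_pdivrMr// mulrC -ler_pdivrMr ?exprn_gt0//.
    exact/ltW/truncnS_gt.
  have en : 0 < e / n%:R by rewrite divr_gt0.
  have sq : Num.sqrt (e / n%:R) <= d / (Q + 1).
    have E : d / (Q + 1) = Num.sqrt ((d / (Q + 1)) ^+ 2) by rewrite sqrtr_sqr gtr0_norm.
    by rewrite [leRHS]E; apply: ler_wsqrtr.
  have := step3 n _ t tt0 en.
  rewrite (_ : n%:R * (e / n%:R) = e); last by field; exact: lt0r_neq0.
  rewrite mulrA (_ : n%:R * (e / n%:R) = e); last by field; exact: lt0r_neq0.
  rewrite mulrA -/Q.
  have := ler_wpM2l Q0 sq; rewrite mulrA => q1 q2.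
  have : Q * d / (Q + 1) <= d by rewrite ler_pdivrMr//; nra.
  lra.
rewrite /m => hm; rewrite /moll_t /moll_xx -/D -/(F (t + e) x) -/(F t x) /avg -/P -/A mulrA.
apply: ler_wpM2r; first by rewrite invr_ge0 ltW.
lra.
Qed.

Definition visc_sub (H : R -> R) v :=
  forall psi, C12 psi -> forall t x, 0 < t ->
    (\forall p \near (t, x), v p.1 p.2 - psi p.1 p.2 <= v t x - psi t x) ->
    dt psi t x <= H (dx (dx psi) t x).

Lemma is_derive_add_affine (f : R -> R) (df a c s t : R) : is_derive t 1 f df ->
  is_derive t 1 (fun t => f t + a * (t - s) + c) (df + a).
Proof.
move=> d1.
have d2 : is_derive t 1 (fun t : R => a * (t - s)) (a * (1 - 0)).
  exact: (is_deriveZ a (is_deriveB (is_derive_id t 1) (is_derive_cst s t 1))).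
have := is_deriveD (is_deriveD d1 d2) (is_derive_cst c t 1).
by rewrite subr0 mulr1 addr0.
Qed.
Lemma is_derive_add_sqr (f : R -> R) (df a c x : R) : is_derive x 1 f df ->
  is_derive x 1 (fun x => f x + a + c * x ^+ 2) (df + 2 * c * x).
Proof.
move=> d1.
have d2 : is_derive x 1 (fun x : R => c * x ^+ 2) (c * (x * 1 + x * 1)).
  exact: (is_deriveZ c (is_deriveM (is_derive_id x 1) (is_derive_id x 1))).
have := is_deriveD (is_deriveD d1 (is_derive_cst a x 1)) d2.
by rewrite addr0 mulr1 (_ : c * (x + x) = 2 * c * x)//; ring.
Qed.
Lemma is_derive_add_linear (f : R -> R) (df c x : R) : is_derive x 1 f df ->
  is_derive x 1 (fun x => f x + c * x) (df + c).
Proof.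
move=> d1.
have := is_deriveD d1 (is_deriveZ c (is_derive_id x 1)).
by rewrite [c *: 1]mulr1.
Qed.

Lemma smooth_add w wt wx wxx a c s : smooth w wt wx wxx ->
  smooth (fun t x => w t x + a * (t - s) + c * x ^+ 2) (fun t x => wt t x + a)
    (fun t x => wx t x + 2 * c * x) (fun t x => wxx t x + 2 * c).
Proof.
move=> hw; split=> [t x|t x|t x||||].
- exact: is_derive_add_affine (smooth_t hw t x).
- exact: is_derive_add_sqr (smooth_x hw t x).
- exact: is_derive_add_linear (smooth_xx hw t x).
- move=> p; apply: cvgD; first apply: cvgD; first exact: (smooth_c hw).
    by apply: cvgMr; apply: cvgB; [exact: cvg_fst|exact: cvg_cst].
  by apply: cvgMr; rewrite expr2; apply: cvgM; exact: cvg_snd.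
- by move=> p; apply: cvgD; [exact: (smooth_ct hw)|exact: cvg_cst].
- move=> p; apply: cvgD; first exact: (smooth_cx hw).
  by apply: cvgMr; exact: cvg_snd.
- by move=> p; apply: cvgD; [exact: (smooth_cxx hw)|exact: cvg_cst].
Qed.

(** Because [w] is smooth, a perturbation of it serves as test function. The penalty
    [z * (t - s) + et * x ^+ 2] confines the maximum of the difference to a compact set and makes
    the supersolution inequality strict, which is a contradiction at a maximum after time [s]. *)
Lemma comparison (H : R -> R) k v w wt wx wxx C s kap : 0 <= k -> 0 <= s ->
  (forall a b, 0 <= b -> H (a + b) <= H a + k * b) ->
  visc_sub H v -> {within [set p : R * R | 0 <= p.1], continuous (fun p => v p.1 p.2)} ->
  (forall t x, 0 <= t -> `|v t x| <= C) -> (forall t x, `|w t x| <= C) ->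
  smooth w wt wx wxx -> (forall t x, s < t -> H (wxx t x) <= wt t x) ->
  (forall x, v s x <= w s x + kap) -> forall t x, s <= t -> v t x <= w t x + kap.
Proof.
move=> k0 s0 HH hv cv vC wC hw hsup hs t1 x1; rewrite le_eqVlt => /predU1P[<-//|st1].
rewrite leNgt; apply/negP => gap.
have C0 : 0 <= C := le_trans (normr_ge0 _) (wC 0 0).
pose g := v t1 x1 - w t1 x1 - kap; have g0 : 0 < g by rewrite /g; lra.
(* At [(t1, x1)] the two penalties together cost at most a quarter of the gap [g]. Then [et] is so
   small that the second-order cost [2 * k * et] stays below the gain [z] in time. *)
pose z := g / (4 * ((t1 - s) + x1 ^+ 2 + 1)).
have q0 : 0 < (t1 - s) + x1 ^+ 2 + 1 by have := sqr_ge0 x1; lra.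
have z0 : 0 < z by rewrite divr_gt0// mulr_gt0.
pose et := z / (2 * k + 1).
have k1 : 0 < 2 * k + 1 by lra.
have et0 : 0 < et by rewrite divr_gt0.
have etz : et <= z by rewrite ler_pdivrMr//; have := mulr_ge0 (ltW z0) k0; lra.
have ketz : 2 * k * et < z.
  have : et * (2 * k + 1) = z by rewrite divfK// lt0r_neq0.
  lra.
pose psi t x := w t x + z * (t - s) + et * x ^+ 2.
have hpsi := smooth_add z et s hw.
pose Phi (p : R * R) := v p.1 p.2 - psi p.1 p.2.
have Phi1 : kap < Phi (t1, x1).
  have : z * ((t1 - s) + x1 ^+ 2 + 1) = g / 4.
    by rewrite /z; field; exact: lt0r_neq0.
  have : et * x1 ^+ 2 <= z * x1 ^+ 2 by rewrite ler_wpM2r// sqr_ge0.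
  rewrite /Phi /psi /=; rewrite /g in g0 *; lra.
have far t x : s <= t -> kap <= Phi (t, x) ->
    z * (t - s) + et * x ^+ 2 <= 2 * C + `|kap|.
  move=> st; rewrite /Phi /psi /= => h.
  have := vC t x (le_trans s0 st); have := wC t x; rewrite !ler_norml.
  have := ler_norm (- kap); rewrite normrN => a1 /andP[a2 a3] /andP[a4 a5].
  lra.
pose M := 2 * C + `|kap|; have M0 : 0 <= M by rewrite addr_ge0// mulr_ge0.
pose T := M / z; pose X := M / et + 1.
have T0 : 0 <= T by rewrite divr_ge0// ltW.
have X0 : 1 <= X by rewrite lerDr divr_ge0// ltW.
have farT t x : s <= t -> kap <= Phi (t, x) -> t <= s + T /\ `|x| <= X.
  move=> st hk; have := far t x st hk; rewrite -/M => h.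
  have zt : 0 <= z * (t - s) by rewrite mulr_ge0 ?subr_ge0// ltW.
  have ex : 0 <= et * x ^+ 2 by rewrite mulr_ge0 ?sqr_ge0// ltW.
  split.
    by rewrite -lerBlDl /T ler_pdivlMr// mulrC; lra.
  have : x ^+ 2 <= M / et by rewrite ler_pdivlMr// mulrC; lra.
  rewrite -(real_normK (num_real x)) => xx; rewrite leNgt; apply/negP => hX.
  have : X ^+ 2 <= `|x| ^+ 2 by rewrite ler_sqr ?nnegrE// ?ltW//; lra.
  rewrite /X in X0 *; nra.
pose A := `[s, s + T]%classic `*` `[- X, X]%classic : set (R * R).
have A0 : (s, 0) \in A.
  rewrite inE; split; rewrite /= in_itv /= ?lexx ?lerDl//.
  by apply/andP; split; lra.
have A1 : (t1, x1) \in A.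
  have [tT xX] := farT t1 x1 (ltW st1) (ltW Phi1).
  by rewrite inE; split; rewrite /= in_itv /= ?(ltW st1)// -ler_norml.
have cA : compact A by apply: compact_setX; exact: segment_compact.
have cPhi : {within A, continuous Phi}.
  apply: (@continuous_subspaceW _ _ A [set p : R * R | 0 <= p.1]).
    by move=> [t x] [/=]; rewrite in_itv /= => /andP[st _] _; exact: le_trans st.
  move=> p; apply: cvgB; first exact: cv.
  exact: (continuous_subspaceT (smooth_c hpsi)).
have A0' : A !=set0 by exists (s, 0); exact: set_mem A0.
have [[t x] hA hmax] := compact_EVT_max A0' cA cPhi.
move: (hA); rewrite inE => -[/=]; rewrite !in_itv /= => /andP[st tT] _.
have Pk : kap < Phi (t, x) by apply: lt_le_trans Phi1 _; exact: hmax.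
have glob t' x' : s <= t' -> Phi (t', x') <= Phi (t, x).
  move=> st'; have [|hk] := leP (Phi (t', x')) kap; first by move/le_trans; apply; exact: ltW.
  have [tT' xX'] := farT t' x' st' (ltW hk).
  apply: hmax; rewrite inE; split; rewrite /= in_itv /= ?st' ?tT'//.
  by rewrite -ler_norml.
have {}st : s < t.
  rewrite lt_neqAle st andbT; apply/eqP => E; move: Pk; rewrite -E /Phi /psi /=.
  have := hs x; have : 0 <= et * x ^+ 2 by rewrite mulr_ge0 ?sqr_ge0// ltW.
  by rewrite subrr mulr0 addr0; lra.
have t0 : 0 < t by exact: le_lt_trans st.
have [C12psi Et Exx] := smooth_C12 hpsi.
have := hv psi C12psi t x t0.
have nr : \forall p \near (t, x), v p.1 p.2 - psi p.1 p.2 <= v t x - psi t x.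
  have : nbhs_ball (t, x) [set p : R * R | v p.1 p.2 - psi p.1 p.2 <= v t x - psi t x].
    exists (t - s); first by rewrite /= subr_gt0.
    move=> [t' x'] [/= ht' _]; apply: (glob t' x').
    by move: ht'; rewrite /ball/= => /(le_lt_trans (ler_norm _)); lra.
  by move=> /nbhs_ballP.
move=> /(_ nr); rewrite Et Exx.
have e20 : 0 <= 2 * et by rewrite mulr_ge0// ltW.
have := HH (wxx t x) (2 * et) e20; have := hsup t x st; lra.
Qed.

End comparison.

(** * Existence and uniqueness of bounded viscosity solutions *)

Section Gheat.
Variables (R : realType) (slo shi : R).
Hypotheses (slo0 : 0 <= slo) (slohi : slo <= shi).
Implicit Types (u v psi : R -> R -> R) (t x h C L : R) (f g : R -> R).

Lemma C12_opp psi : C12 psi -> C12 (fun t x => - psi t x) /\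
  forall t x, 0 < t -> dt (fun t x => - psi t x) t x = - dt psi t x /\
    dx (dx (fun t x => - psi t x)) t x = - dx (dx psi) t x.
Proof.
move=> [hd hc]; set psi' := (fun t x => - psi t x).
have Dt t x : 0 < t -> is_derive t (1:R) (psi' ^~ x) (- dt psi t x).
  by move=> t0; have [/derive1_is_derive d1 _ _] := hd t x t0; exact: is_deriveN.
have Dx t x : 0 < t -> is_derive x (1:R) (psi' t) (- dx psi t x).
  by move=> t0; have [_ /derive1_is_derive d1 _] := hd t x t0; exact: is_deriveN.
have Ex t : 0 < t -> dx psi' t = (fun x => - dx psi t x).
  by move=> t0; apply/funext => x; have [] := is_derive_derive1 (Dx t x t0).
have Dxx t x : 0 < t -> is_derive x (1:R) (dx psi' t) (- dx (dx psi) t x).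
  move=> t0; rewrite Ex//.
  by have [_ _ /derive1_is_derive d1] := hd t x t0; exact: is_deriveN.
have Et t x : 0 < t -> dt psi' t x = - dt psi t x.
  by move=> t0; have [] := is_derive_derive1 (Dt t x t0).
have Exx t x : 0 < t -> dx (dx psi') t x = - dx (dx psi) t x.
  by move=> t0; have [] := is_derive_derive1 (Dxx t x t0).
have nr (p : R * R) (F G : R * R -> R) : 0 < p.1 ->
    (forall q, 0 < q.1 -> F q = - G q) -> {for p, continuous G} -> {for p, continuous F}.
  move=> p0 FG cG; rewrite /prop_for /continuous_at FG//.
  have cNG : (fun q => - G q) @ p --> - G p by exact: cvgN.
  apply: cvg_trans cNG; apply: near_eq_cvg.
  have : nbhs_ball p [set q : R * R | - G q = F q].
    exists p.1 => // -[t x] [/= ht _]; rewrite FG//=.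
    by move: ht; rewrite /ball/= => /(le_lt_trans (ler_norm _)); lra.
  by move=> /nbhs_ballP.
split; last by move=> t x t0; rewrite Et// Exx.
split=> [t x t0|p p0].
  by split; [have [] := Dt t x t0|have [] := Dx t x t0|have [] := Dxx t x t0].
have [c1 c2 c3 c4] := hc p p0; split.
- exact: (nr _ _ _ p0 _ c1).
- by apply: nr c2 => // q q0; exact: Et.
- by apply: nr c3 => // q q0; rewrite Ex.
- by apply: nr c4 => // q q0; exact: Exx.
Qed.

Lemma maxL_steps n : step slo shi n.+1%:R^-1 (maxL slo shi n).
Proof. exact: maxL_step. Qed.

Lemma Ssg_BL t C L f : BL C L f -> BL C L (Ssg slo shi t f).
Proof.
move=> bf; have [t0|t0] := leP 0 t; first exact: (step_BL (Ssg_step slo0 slohi t0)).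
by rewrite (_ : Ssg slo shi t f = f) //; apply/funext => x; apply: sg_le0; exact: ltW.
Qed.

Lemma SsgD t s f x : 0 <= t -> 0 <= s -> bl f ->
  Ssg slo shi (t + s) f x = Ssg slo shi t (Ssg slo shi s f) x.
Proof. by move=> t0 s0 bf; exact: (sgD slo0 slohi maxL_steps). Qed.

Lemma Ssg_MC C L f : BL C L f ->
  MC L (L * (1 + shi ^+ 2)) (fun t x => Ssg slo shi t f x).
Proof. exact: (sg_MC slo0 slohi maxL_steps). Qed.

Lemma Lsg_MC sig C L f : 0 <= sig -> BL C L f ->
  MC L (L * (1 + sig ^+ 2)) (fun t x => Lsg sig t f x).
Proof. by move=> s0; apply: (sg_MC s0 (lexx sig)) => n; exact: bern_step. Qed.

Lemma Lsg_BL sig t C L f : 0 <= sig -> BL C L f -> BL C L (Lsg sig t f).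
Proof.
move=> s0 bf; have [t0|t0] := leP 0 t; first exact: (step_BL (Lsg_step s0 t0)).
by rewrite (_ : Lsg sig t f = f) //; apply/funext => x; apply: sg_le0; exact: ltW.
Qed.

(** The supersolution half is the subsolution statement for [- Ssg] under each linear flow: [Ssg]
    dominates both flows, and G is the larger of their generators. *)
Lemma Ssg_solution f : bl f ->
  Gheat_solution slo shi f (fun t x => Ssg slo shi t f x).
Proof.
move=> [C [L bf]]; have shi0 : 0 <= shi := le_trans slo0 slohi.
have uB t : BL C L (Ssg slo shi t f) := Ssg_BL t bf.
split.
- by move=> x; exact: sg_le0.
- exact: (continuous_subspaceT (MC_continuous (Ssg_MC bf))).
- by exists C => t x _; have [] := uB t.
- move=> psi hpsi t x t0 nr.
  apply: (dpp_subsolution slo0 slohi (T := Ssg slo shi) (v := fun t x => Ssg slo shi t f x) (C := C) _ _ _ t0 _ hpsi nr) => //.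
  + by move=> h h0; exact: Ssg_step.
  + by move=> s y; have [] := uB s.
  + by move=> s; exact: (BL_bl (uB s)).
  + move=> h /andP[h0 ht]; rewrite -SsgD ?(ltW h0) ?subr_ge0 ?(ltW ht)//; last exact: (BL_bl bf).
    by rewrite [h + _]addrC subrK.
- move=> psi hpsi t x t0 nr; have [hpsi' /(_ t x t0)[Et Exx]] := C12_opp hpsi.
  have key sig : (sig = slo \/ sig = shi) -> sig ^+ 2 * dx (dx psi) t x / 2 <= dt psi t x.
    move=> hs; have s0 : 0 <= sig by case: hs => ->.
    have := @dpp_subsolution _ _ _ s0 (lexx sig) (Lsg sig) (fun t x => - Ssg slo shi t f x)
      C (fun t x => - psi t x) t x.
    rewrite Et Exx Gfun_diag// mulrN mulNr lerN2; apply => //.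
    + by move=> h h0; exact: Lsg_step.
    + by move=> s y; rewrite normrN; have [] := uB s.
    + by move=> s; apply: bl_opp; exact: (BL_bl (uB s)).
    + move=> h /andP[h0 ht].
      rewrite (Lsg_linop h s0) ?lerN2; last exact: (BL_bl (uB _)).
      rewrite -[in leRHS](subrK h t) [in leRHS]addrC SsgD ?(ltW h0) ?subr_ge0 ?(ltW ht)//.
        by apply: Lsg_le_Ssg => //; [exact: ltW|exact: (BL_bl (uB _))].
      exact: (BL_bl bf).
    + by apply: filterS nr => p; rewrite -!opprD !lerN2.
  by rewrite GfunE// ler_pdivrMr// ge_max -!ler_pdivrMr// !key; [|right|left].
Qed.

Lemma Gheat_unique f v : bl f -> Gheat_solution slo shi f v ->
  forall t x, 0 <= t -> v t x = Ssg slo shi t f x.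
Proof.
move=> [C [L bf]] [v0 cv [C' vC'] vsub vsup].
have shi0 : 0 <= shi := le_trans slo0 slohi.
have uB t : BL C L (Ssg slo shi t f) := Ssg_BL t bf.
pose K := Num.max C C'.
have vK t x : 0 <= t -> `|v t x| <= K.
  by move=> t0; rewrite le_max (vC' _ _ t0) orbT.
have k0 : 0 <= shi ^+ 2 / 2 by rewrite divr_ge0// sqr_ge0.
have C0 : 0 <= C by have [] := BL_ge0 bf.
(* [kap] bounds the distance from a function to its mollification ([moll_near]); it enters twice,
   once at the initial time and once at the end. *)
pose kap L' e sig := L' * (2 * e) + (L' * (1 + sig ^+ 2)) * Num.sqrt e : R.
have kapP L' sig d : 0 <= L' -> 0 < d -> exists2 e, 0 < e & 2 * kap L' e sig <= d.
  move=> L'0 d0; pose M := 2 * (2 * L' + L' * (1 + sig ^+ 2)) + 1.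
  have M0 : 0 < M.
    by rewrite ltr_wpDl// mulr_ge0// addr_ge0// mulr_ge0// addr_ge0// sqr_ge0.
  pose r := Num.min 1 (d / M); have r0 : 0 < r by rewrite lt_min ltr01 divr_gt0.
  have r1 : r <= 1 by rewrite ge_min lexx.
  exists (r ^+ 2); first exact: exprn_gt0.
  rewrite /kap sqrtr_sqr gtr0_norm//.
  have : r * M <= d by rewrite -ler_pdivlMr// ge_min lexx orbT.
  have : r ^+ 2 <= r by rewrite expr2 ler_piMr// ltW.
  have := sqr_ge0 sig; rewrite /M => q1 q2 q3.
  have := ler_wpM2l L'0 q2; nra.
have le1 t x : 0 <= t -> v t x <= Ssg slo shi t f x.
  move=> t0; have [_ L0] := BL_ge0 bf.
  apply/ler_addgt0Pl => d d0; have [e e0 he] := kapP L shi d L0 d0.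
  have MCu := Ssg_MC bf; pose u t x := Ssg slo shi t f x.
  have uK t' x' : `|u t' x'| <= K by rewrite le_max; have [-> _] := uB t'.
  have near t' x' : `|moll e u t' x' - u t' x'| <= kap L e shi by exact: moll_near.
  have mK t' x' : `|moll e u t' x'| <= K.
    by have [a [b [_ _ ->]]] := moll_val t' x' e0 MCu; exact: uK.
  have sup sig : sig = slo \/ sig = shi -> forall t' x', 0 <= t' ->
      sig ^+ 2 / 2 * moll_xx e u t' x' <= moll_t e u t' x'.
    move=> hs; have s0 : 0 <= sig by case: hs => ->.
    apply: (moll_super s0 e0 MCu uK) => t' h x' t'0 h0.
    rewrite /u [t' + h]addrC SsgD//; last exact: (BL_bl bf).
    by apply: Lsg_le_Ssg => //; exact: (BL_bl (uB t')).
  have := @comparison _ (Gfun slo shi) _ v (moll e u) _ _ _ K 0 (kap L e shi) k0 (lexx 0)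
    _ _ cv vK mK (moll_smooth e0 MCu uK).
  move=> /(_ _ _ _ _ t x t0) h.
  have : v t x <= moll e u t x + kap L e shi.
    apply: h => //.
    - by move=> a b b0; rewrite mulrAC; exact: Gfun_incr.
    - move=> t' x' t'0; rewrite GfunE// ler_pdivrMr// ge_max.
      have := sup slo (or_introl erefl) t' x' (ltW t'0).
      have := sup shi (or_intror erefl) t' x' (ltW t'0).
      by move=> q1 q2; apply/andP; split; lra.
    - move=> y; rewrite v0; have := near 0 y.
      have -> : u 0 y = f y by exact: sg_le0.
      by rewrite ler_norml => /andP[]; lra.
  have := near t x; rewrite ler_norml -/(u t x) => /andP[_ q1] q2; lra.
(* Started at any time [s] from any [g] below [v s], this comparison can be iterated over the steps
   of [maxL]. It is applied to [- v], a subsolution for [H a = - Gfun slo shi (- a)], and to the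
   mollified [- Lsg]. *)
have le2 sig : sig = slo \/ sig = shi -> forall s g, 0 <= s -> bl g ->
    (forall y, g y <= v s y) -> forall t x, s <= t -> Lsg sig (t - s) g x <= v t x.
  move=> hs s g s0 [Cg [Lg bg]] gv t x st; have sig0 : 0 <= sig by case: hs => ->.
  have [_ L0] := BL_ge0 bg.
  apply/ler_addgt0Pl => d d0; have [e e0 he] := kapP Lg sig d L0 d0.
  pose u t x := - Lsg sig (t - s) g x.
  have MCu : MC Lg (Lg * (1 + sig ^+ 2)) u.
    move=> t1 t2 x1 x2; rewrite /u -opprD normrN.
    have := Lsg_MC sig0 bg (t1 - s) (t2 - s) x1 x2.
    by rewrite opprB addrA subrK.
  pose K' := Num.max K Cg.
  have vK' t' x' : 0 <= t' -> `|- v t' x'| <= K'.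
    by move=> t0; rewrite normrN le_max vK.
  have uK t' x' : `|u t' x'| <= K'.
    by rewrite normrN !le_max; have [-> _] := Lsg_BL (t' - s) sig0 bg; rewrite orbT.
  have near t' x' : `|moll e u t' x' - u t' x'| <= kap Lg e sig by exact: moll_near.
  have mK t' x' : `|moll e u t' x'| <= K'.
    by have [a [b [_ _ ->]]] := moll_val t' x' e0 MCu; exact: uK.
  have sup : forall t' x', s <= t' -> sig ^+ 2 / 2 * moll_xx e u t' x' <= moll_t e u t' x'.
    apply: (moll_super sig0 e0 MCu uK) => t' h x' t'0 h0.
    have bL : bl (Lsg sig (t' - s) g) := BL_bl (Lsg_BL _ sig0 bg).
    rewrite /u (Lsg_linop h sig0 bL) lerN2.
    rewrite (_ : t' + h - s = h + (t' - s)); last by ring.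
    rewrite {1}/Lsg (sgD sig0 (lexx sig) _ x' h0) ?subr_ge0//; last exact: (BL_bl bg).
    by move=> n; exact: bern_step.
  have cNv : {within [set p : R * R | 0 <= p.1], continuous (fun p => - v p.1 p.2)}.
    by move=> p; apply: cvgN; exact: cv.
  pose H a := - Gfun slo shi (- a).
  have nsub : visc_sub H (fun t x => - v t x).
    move=> psi hpsi t' x' t'0 nr; have [hpsi' /(_ t' x' t'0)[Et Exx]] := C12_opp hpsi.
    rewrite /H -Exx lerNr -Et; apply: vsup => //.
    by apply: filterS nr => p /=; rewrite !opprK -!opprD lerN2.
  have := @comparison _ H _ _ (moll e u) _ _ _ K' s (kap Lg e sig) k0 s0
    _ nsub cNv vK' mK (moll_smooth e0 MCu uK).
  move=> /(_ _ _ _ t x st) h.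
  have : - v t x <= moll e u t x + kap Lg e sig.
    apply: h => //.
    - move=> a b b0; rewrite /H; have := Gfun_incr (- (a + b)) slo0 slohi b0.
      by rewrite opprD subrK; lra.
    - move=> t' x' st'; apply: le_trans (sup _ _ (ltW st')).
      rewrite /H lerNl -mulrN mulrAC GfunE// ler_pM2r ?invr_gt0//.
      by rewrite le_max; case: hs => ->; rewrite lexx ?orbT.
    - move=> y; have := near s y.
      have -> : u s y = - g y by rewrite /u subrr; congr (- _); exact: sg_le0.
      by have := gv y; rewrite ler_norml => q /andP[]; lra.
  have := near t x; rewrite ler_norml /u => /andP[_ q1] q2; lra.
move=> t x t0; apply/eqP; rewrite eq_le le1//=.
pose N n := n.+1%:R^-1 : R; have N0 n : 0 <= N n by rewrite invr_ge0.
have le3 n k y : iter k (maxL slo shi n) f y <= v (k%:R * N n) y.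
  elim: k y => [|k IH] y; first by rewrite mul0r v0.
  have bk : bl (iter k (maxL slo shi n) f).
    exact: (step_bl (iter_step slo0 slohi maxL_steps n k) (BL_bl bf)).
  have kN : 0 <= k%:R * N n by rewrite mulr_ge0.
  have st : k%:R * N n <= k.+1%:R * N n by rewrite ler_wpM2r// ler_nat.
  have E : k.+1%:R * N n - k%:R * N n = n.+1%:R^-1 by rewrite -mulrBl -natr1 /N; ring.
  rewrite iterS /maxL ge_max; apply/andP; split.
    by have := le2 slo (or_introl erefl) _ _ kN bk IH _ y st; rewrite E.
  by have := le2 shi (or_intror erefl) _ _ kN bk IH _ y st; rewrite E.
(* The iterates lie below [v] at grid times only; continuity of [v] up to time 0 carries the bound
   to [t]. *)
have cvg_v : (fun n => v ((sgk t n)%:R * N n) x) @ \oo --> v t x.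
  have /subspace_continuousP/(_ (t, x) t0) := cv.
  move=> /cvgrPdist_lt hc; apply/cvgrPdist_lt => e e0.
  have := hc e e0; rewrite /within => /near_prod[r r0 hr].
  have /cvgrPdist_lt/(_ r r0) := sgk_cvg t0; apply: filterS => n hn.
  by apply: (hr _ x hn); rewrite ?subrr ?normr0//= mulr_ge0.
rewrite -(ulim_cvg cvg_v); apply: ulim_le.
- exact: (sg_bounded_seq slo0 slohi maxL_steps _ _ (BL_bl bf)).
- exact: (cvg_bounded_seq cvg_v).
- by move=> n; exact: le3.
Qed.

Lemma GheatE f t x : bl f -> 0 <= t -> Gheat slo shi f t x = Ssg slo shi t f x.
Proof.
move=> bf t0; rewrite /Gheat; case: xgetP => [u _ hu|/(_ _ (Ssg_solution bf))//].
exact: Gheat_unique.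
Qed.

End Gheat.

(** * Conditional expectations of cylinder functionals *)

Lemma sub_ge0 (R : numDomainType) (a b : R) : a < b -> 0 <= b - a.
Proof. by rewrite subr_ge0; exact: ltW. Qed.

Section cylinder.
Variable R : realType.
Implicit Types (F G : (R -> R) -> R) (x y : R -> R) (ts g : seq R) (s t r z C L : R).

(* Functionals of arbitrary real functions: neither continuity nor a common
   index set is needed to add, multiply or compare them. *)
Definition cyl ts F := exists C L, (forall x, `|F x| <= C) /\
  (forall x y, `|F x - F y| <= L * \sum_(t <- ts) `|x t - y t|).

Lemma cylP ts F : cyl ts F -> exists C L, [/\ 0 <= C, 0 <= L, (forall x, `|F x| <= C) &
  (forall x y, `|F x - F y| <= L * \sum_(t <- ts) `|x t - y t|)].
Proof.
move=> [C [L [hC hL]]]; exists C, `|L|; split=> //.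
  exact: le_trans (hC 0).
move=> x y; apply: le_trans (hL x y) _; apply: ler_wpM2r; last exact: ler_norm.
by apply: sumr_ge0.
Qed.

Lemma cyl_dep ts F x y : cyl ts F -> {in ts, x =1 y} -> F x = F y.
Proof.
move=> [C [L [_ hL]]] xy; apply/eqP; rewrite -subr_eq0 -normr_le0.
apply: le_trans (hL x y) _; rewrite big_seq big1 ?mulr0// => t tts.
by rewrite xy// subrr normr0.
Qed.

Lemma sum_subset (ts ts' : seq R) (f : R -> R) : {subset ts <= ts'} -> (forall t, 0 <= f t) ->
  \sum_(t <- ts) f t <= (size ts)%:R * \sum_(t <- ts') f t.
Proof.
move=> sub f0; elim: ts sub => [|t ts IH] sub; first by rewrite big_nil mul0r.
rewrite big_cons -natr1 mulrDl mul1r addrC; apply: lerD.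
  by apply: IH => r rts; apply: sub; rewrite inE rts orbT.
have tts : t \in ts' by apply: sub; rewrite inE eqxx.
by rewrite (big_rem t tts) /= lerDl sumr_ge0.
Qed.

Lemma cyl_sub ts ts' F : {subset ts <= ts'} -> cyl ts F -> cyl ts' F.
Proof.
move=> sub /cylP[C [L [C0 L0 hC hL]]]; exists C, (L * (size ts)%:R); split=> // x y.
apply: le_trans (hL x y) _; rewrite -mulrA; apply: ler_wpM2l => //.
by apply: sum_subset.
Qed.

Lemma cyl_cst ts k : cyl ts (fun=> k).
Proof. by exists `|k|, 0; split=> // x y; rewrite subrr normr0 mul0r. Qed.

Lemma cyl_add ts F G : cyl ts F -> cyl ts G -> cyl ts (fun x => F x + G x).
Proof.
move=> [C [L [hC hL]]] [C' [L' [hC' hL']]]; exists (C + C'), (L + L'); split=> [x|x y].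
  by apply: le_trans (ler_normD _ _) _; exact: lerD.
rewrite opprD addrACA mulrDl; apply: le_trans (ler_normD _ _) _; exact: lerD.
Qed.

Lemma cyl_mul ts F G : cyl ts F -> cyl ts G -> cyl ts (fun x => F x * G x).
Proof.
move=> /cylP[C [L [C0 L0 hC hL]]] /cylP[C' [L' [C'0 L'0 hC' hL']]].
exists (C * C'), (C * L' + C' * L); split=> [x|x y].
  by rewrite normrM ler_pM.
rewrite (_ : _ - _ = F x * (G x - G y) + G y * (F x - F y)); last by ring.
apply: le_trans (ler_normD _ _) _; rewrite !normrM mulrDl -!mulrA.
by apply: lerD; apply: ler_pM.
Qed.

Lemma cyl_scale ts k F : cyl ts F -> cyl ts (fun x => k * F x).
Proof. by move=> hF; apply: cyl_mul => //; exact: cyl_cst. Qed.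

Lemma cyl_opp ts F : cyl ts F -> cyl ts (fun x => - F x).
Proof.
move=> hF; have := cyl_scale (-1) hF.
by have -> : (fun x => -1 * F x) = (fun x => - F x) by apply/funext => x; rewrite mulN1r.
Qed.

Lemma cyl_subr ts F G : cyl ts F -> cyl ts G -> cyl ts (fun x => F x - G x).
Proof. by move=> hF /cyl_opp; exact: cyl_add. Qed.

Lemma cyl_norm ts F : cyl ts F -> cyl ts (fun x => `|F x|).
Proof.
move=> [C [L [hC hL]]]; exists C, L; split=> [x|x y]; first by rewrite normr_id.
by apply: le_trans (hL x y); exact: ler_dist_dist.
Qed.

Lemma maxr_half (a b : R) : Num.max a b = 2^-1 * (a + b + `|a - b|).
Proof.
by have [ab|ab] := leP a b; [rewrite ler0_norm ?subr_le0//|rewrite gtr0_norm ?subr_gt0//]; field.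
Qed.

Lemma cyl_max ts F G : cyl ts F -> cyl ts G -> cyl ts (fun x => Num.max (F x) (G x)).
Proof.
move=> hF hG; have := cyl_scale 2^-1 (cyl_add (cyl_add hF hG) (cyl_norm (cyl_subr hF hG))).
by congr (cyl _ _); apply/funext => x; rewrite maxr_half.
Qed.

Lemma cyl_min ts F G : cyl ts F -> cyl ts G -> cyl ts (fun x => Num.min (F x) (G x)).
Proof.
move=> hF hG; have := cyl_opp (cyl_max (cyl_opp hF) (cyl_opp hG)).
by congr (cyl _ _); apply/funext => x; rewrite oppr_max !opprK.
Qed.

Lemma cyl_reindex ts F (p : R -> R) : cyl ts F -> cyl (map p ts) (fun x => F (x \o p)).
Proof.
move=> [C [L [hC hL]]]; exists C, L; split=> // x y.
by rewrite big_map; exact: hL.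
Qed.

(** The path is frozen at [z] from [t] on; further splices in [Eb] overwrite later values. *)
Definition splice t z x : R -> R := fun r => if r < t then x r else z.

Lemma splice_ge t z x r : t <= r -> splice t z x r = z.
Proof. by move=> tr; rewrite /splice ltNge tr. Qed.

Lemma splice_lt t z x r : r < t -> splice t z x r = x r.
Proof. by move=> rt; rewrite /splice rt. Qed.

End cylinder.

(** * Backward recursion along time grids *)

Section Eb.
Variables (R : realType) (slo shi : R).
Hypotheses (slo0 : 0 <= slo) (slohi : slo <= shi).
Implicit Types (F G : (R -> R) -> R) (x y : R -> R) (ts g : seq R) (s t r z C L : R).

(** The backward recursion in terms of positions instead of increments: the state at time [s] is
    [x s], and the past of [x] enters as a parameter. *)
Fixpoint Eb s g F x : R :=
  if g is t :: g' then Ssg slo shi (t - s) (fun z => Eb t g' F (splice t z x)) (x s)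
  else F x.

Lemma Eb_cyl ts F s g : path <%R s g -> cyl ts F -> cyl (s :: ts) (Eb s g F).
Proof.
move=> + hF; elim: g s => [|t g IH] s /=.
  by move=> _; apply: (cyl_sub _ hF) => r rts; rewrite inE rts orbT.
move=> /andP[st pg]; have /cylP[C [L [C0 L0 hC hL]]] := IH t pg.
have n0 : 0 <= (size ts).+1%:R :> R by [].
have BLt x : BL C (L * (size ts).+1%:R) (fun z => Eb t g F (splice t z x)).
  split=> // z z'; apply: le_trans (hL _ _) _; rewrite -mulrA; apply: ler_wpM2l => //.
  apply: (@le_trans _ _ (\sum_(r <- t :: ts) `|z - z'|)).
    apply: ler_sum => r _; rewrite /splice; case: ifP => // _.
    by rewrite subrr normr0.
  by rewrite big_const_seq count_predT iter_addr_0 mulr_natl.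
have hS := Ssg_step slo0 slohi (sub_ge0 st).
exists C, (L * (size ts).+1%:R); split=> [x|x y].
  by have [] := step_BL hS (BLt x).
rewrite (_ : _ - _ =
  (Ssg slo shi (t - s) (fun z => Eb t g F (splice t z x)) (x s) -
   Ssg slo shi (t - s) (fun z => Eb t g F (splice t z x)) (y s)) +
  (Ssg slo shi (t - s) (fun z => Eb t g F (splice t z x)) (y s) -
   Ssg slo shi (t - s) (fun z => Eb t g F (splice t z y)) (y s))); last by ring.
apply: le_trans (ler_normD _ _) _; rewrite big_cons mulrDr; apply: lerD.
  by have [_] := step_BL hS (BLt x); exact.
apply: (step_contr hS); [exact: (BL_bl (BLt x))|exact: (BL_bl (BLt y))|].
move=> z; apply: le_trans (hL _ _) _; rewrite -mulrA; apply: ler_wpM2l => //.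
rewrite big_cons !splice_ge// subrr normr0 add0r.
apply: (@le_trans _ _ (\sum_(r <- ts) `|x r - y r|)).
  by apply: ler_sum => r _; rewrite /splice; case: ifP => // _; rewrite subrr normr0.
by rewrite ler_peMl ?ler1n// sumr_ge0.
Qed.

Lemma Eb_bl ts F t g x : path <%R t g -> cyl ts F -> bl (fun z => Eb t g F (splice t z x)).
Proof.
move=> pg hF; have /cylP[C [L [C0 L0 hC hL]]] := Eb_cyl pg hF.
exists C, (L * (size ts).+1%:R); split=> // z z'.
apply: le_trans (hL _ _) _; rewrite -mulrA; apply: ler_wpM2l => //.
apply: (@le_trans _ _ (\sum_(r <- t :: ts) `|z - z'|)).
  apply: ler_sum => r _; rewrite /splice; case: ifP => // _.
  by rewrite subrr normr0.
by rewrite big_const_seq count_predT iter_addr_0 mulr_natl.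
Qed.

Definition covers s ts g := forall r, r \in ts -> r <= s \/ r \in g.

Lemma covers_cons s t ts g : s < t -> covers s ts (t :: g) -> covers t ts g.
Proof.
move=> st h r /h; rewrite inE => -[rs|/predU1P[->|rg]]; [left|by left|by right].
exact: le_trans (ltW st).
Qed.

Lemma path_gt s g r : path <%R s g -> r \in g -> s < r.
Proof.
by move=> pg rg; have /allP := order_path_min lt_trans pg; apply.
Qed.

Lemma covers_lt s t ts g r : path <%R s (t :: g) -> covers s ts (t :: g) ->
  r \in ts -> r < t -> r <= s.
Proof.
move=> /andP[st pg] h rts rt; have [//|] := h r rts.
rewrite inE => /predU1P[E|rg]; first by move: rt; rewrite E ltxx.
by have := lt_trans rt (path_gt pg rg); rewrite ltxx.
Qed.

Lemma Eb_dep ts F s g x y : path <%R s g -> cyl ts F -> covers s ts g ->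
  (forall r, r \in ts -> r <= s -> x r = y r) -> x s = y s -> Eb s g F x = Eb s g F y.
Proof.
move=> + hF; elim: g s x y => [|t g IH] s x y /=.
  by move=> _ cov xy _; apply: (cyl_dep hF _) => r rts; apply: xy => //; case: (cov r rts).
move=> pg cov xy xys; have /andP[st pg'] := pg; rewrite xys; congr (Ssg _ _ _ _ _).
apply/funext => z; apply: IH => //; first exact: (covers_cons st cov).
  move=> r rts; rewrite le_eqVlt => /predU1P[->|rt]; first by rewrite !splice_ge.
  by rewrite !splice_lt//; apply: xy => //; exact: (covers_lt pg cov rts rt).
by rewrite !splice_ge.
Qed.

(** An extra grid time either splits a step in two, which the semigroup property undoes, or comes
    after all the times of [F], where the step acts on a constant. *)
Lemma Eb_refine ts F s g1 g2 x : cyl ts F -> path <%R s g1 -> path <%R s g2 ->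
  {subset g1 <= g2} -> covers s ts g1 -> Eb s g1 F x = Eb s g2 F x.
Proof.
move=> hF; elim: g2 s g1 x => [|r g2 IH] s g1 x /= p1 p2 sub cov.
  by case: g1 {p1 cov} sub => // t g1 /(_ t); rewrite inE eqxx => /(_ isT).
have /andP[sr p2'] := p2.
have hS := Ssg_step slo0 slohi (sub_ge0 sr).
case: g1 p1 sub cov => [_ sub cov|t g1 p1 sub cov].
  have E z : Eb r g2 F (splice r z x) = F x.
    rewrite -(IH r [::])//; last by move=> q /cov[|//] qs; left; exact: le_trans (ltW sr).
    apply: (cyl_dep hF _) => q /cov[|//] qs; rewrite splice_lt//.
    exact: le_lt_trans sr.
  have -> : (fun z => Eb r g2 F (splice r z x)) = fun=> F x by apply/funext.
  by rewrite (step_const hS).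
have /andP[st p1'] := p1.
have : t \in r :: g2 by apply: sub; rewrite inE eqxx.
rewrite inE => /predU1P[tr|tg2].
  rewrite -tr in p2' sr hS *; congr (Ssg _ _ _ _ _); apply/funext => z.
  apply: IH => //; last exact: (covers_cons st cov).
  move=> q qg1; have : q \in r :: g2 by apply: sub; rewrite inE qg1 orbT.
  rewrite -tr inE => /predU1P[E|//].
  by have := path_gt p1' qg1; rewrite E ltxx.
have rt : r < t := path_gt p2' tg2.
pose K z' := Eb t g1 F (splice t z' x).
have bK : bl K by exact: (Eb_bl x p1' hF).
have E z : Eb r g2 F (splice r z x) = Ssg slo shi (t - r) K z.
  rewrite -(IH r (t :: g1))//=.
  - rewrite splice_ge//; congr (Ssg _ _ _ _ _); apply/funext => z'.
    apply: (Eb_dep p1' hF); first exact: (covers_cons st cov).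
      move=> q qts; rewrite le_eqVlt => /predU1P[->|qt]; first by rewrite !splice_ge.
      rewrite !splice_lt//; apply: le_lt_trans sr.
      exact: (covers_lt p1 cov qts qt).
    by rewrite !splice_ge.
  - by rewrite rt.
  - move=> q qg; have : q \in r :: g2 by exact: sub.
    rewrite inE => /predU1P[E|//]; have := qg; rewrite E inE => /predU1P[E'|/(path_gt p1')].
      by move: rt; rewrite E' ltxx.
    by move=> /(lt_trans rt); rewrite ltxx.
  - move=> q /cov[qs|qg]; [left; exact: le_trans (ltW sr)|by right].
have -> : (fun z => Eb r g2 F (splice r z x)) = Ssg slo shi (t - r) K by apply/funext.
rewrite -(SsgD slo0 slohi (x s) (sub_ge0 sr) (sub_ge0 rt) bK).
by congr (Ssg _ _ _ _ _); ring.
Qed.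

Definition grid s ts := sort <=%R (undup [seq t <- ts | s < t]).

Lemma grid_path s ts : path <%R s (grid s ts).
Proof.
have := sort_lt_sorted (undup [seq t <- ts | s < t]); rewrite undup_uniq -/(grid s ts).
have : all (fun t => s < t) (grid s ts).
  by apply/allP => t; rewrite mem_sort mem_undup mem_filter => /andP[].
by case: (grid s ts) => //= t g /andP[-> _] ->.
Qed.

Lemma mem_grid s ts t : (t \in grid s ts) = (s < t) && (t \in ts).
Proof. by rewrite mem_sort mem_undup mem_filter. Qed.

Lemma covers_grid s ts ts' : {subset ts <= ts'} -> covers s ts (grid s ts').
Proof.
move=> sub r /sub rts; have [rs|sr] := leP r s; [by left|right].
by rewrite mem_grid sr.
Qed.

(** The chosen time set is arbitrary; [EEE] shows that the value does not depend on it. This makes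
    [EE s] an operator on functionals alone. *)
Definition EE s F := Eb s (grid s (xget [::] [set ts | cyl ts F])) F.

Lemma EEE ts F s g x : cyl ts F -> path <%R s g -> covers s ts g -> EE s F x = Eb s g F x.
Proof.
move=> hF pg cov; rewrite /EE; case: xgetP => [ts' _ /= hF'|/(_ _ hF)//].
(* The chosen grid and [g] are both refined to the grid of [ts' ++ g]. *)
have h1 := @Eb_refine _ _ s (grid s ts') (grid s (ts' ++ g)) x hF' (grid_path _ _) (grid_path _ _).
rewrite h1; last exact: covers_grid.
  symmetry; apply: (Eb_refine x hF pg (grid_path _ _) _ cov) => r rg.
  by rewrite mem_grid (path_gt pg rg) mem_cat rg orbT.
by move=> r; rewrite !mem_grid mem_cat => /andP[-> ->].
Qed.

Lemma EE_grid ts ts' F s x : cyl ts F -> {subset ts <= ts'} -> EE s F x = Eb s (grid s ts') F x.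
Proof.
by move=> hF sub; apply: (EEE x hF _ _); [exact: grid_path|exact: covers_grid].
Qed.

Lemma Eb_mono ts F G s g x : path <%R s g -> cyl ts F -> cyl ts G ->
  (forall y, F y <= G y) -> Eb s g F x <= Eb s g G x.
Proof.
move=> + hF hG FG; elim: g s x => [|t g IH] s x //= /andP[st pg].
have hS := Ssg_step slo0 slohi (sub_ge0 st).
by apply: (step_mono hS); [exact: (Eb_bl x pg hF)|exact: (Eb_bl x pg hG)|move=> z; exact: IH].
Qed.

Lemma Eb_sub ts F G s g x : path <%R s g -> cyl ts F -> cyl ts G ->
  Eb s g (fun y => F y + G y) x <= Eb s g F x + Eb s g G x.
Proof.
move=> + hF hG; elim: g s x => [|t g IH] s x //= /andP[st pg].
have hS := Ssg_step slo0 slohi (sub_ge0 st).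
have bF := Eb_bl x pg hF; have bG := Eb_bl x pg hG.
apply: le_trans (step_sub hS bF bG _); apply: (step_mono hS).
- exact: (Eb_bl x pg (cyl_add hF hG)).
- exact: bl_add.
- by move=> z; exact: IH.
Qed.

Lemma Eb_known ts F G s g x : path <%R s g -> cyl ts F -> cyl ts G ->
  (forall y y', (forall r, r <= s -> y r = y' r) -> G y = G y') ->
  Eb s g (fun y => F y + G y) x = Eb s g F x + G x.
Proof.
move=> + hF hG; elim: g s x => [|t g IH] s x //= /andP[st pg] dG.
have hS := Ssg_step slo0 slohi (sub_ge0 st).
rewrite -(step_cst hS); last exact: (Eb_bl x pg hF).
congr (Ssg _ _ _ _ _); apply/funext => z; rewrite IH//.
  congr (_ + _); apply: dG => r rs; rewrite splice_lt//; exact: le_lt_trans st.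
by move=> y y' yy; apply: dG => r rs; apply: yy; exact: le_trans (ltW st).
Qed.

Lemma Eb_scale ts F G s g x : path <%R s g -> cyl ts F -> cyl ts G ->
  (forall y, 0 <= G y) ->
  (forall y y', (forall r, r <= s -> y r = y' r) -> G y = G y') ->
  Eb s g (fun y => G y * F y) x = G x * Eb s g F x.
Proof.
move=> + hF hG G0; elim: g s x => [|t g IH] s x //= /andP[st pg] dG.
have hS := Ssg_step slo0 slohi (sub_ge0 st).
rewrite -(step_scale hS)//; last exact: (Eb_bl x pg hF).
congr (Ssg _ _ _ _ _); apply/funext => z; rewrite IH//.
  congr (_ * _); apply: dG => r rs; rewrite splice_lt//; exact: le_lt_trans st.
by move=> y y' yy; apply: dG => r rs; apply: yy; exact: le_trans (ltW st).
Qed.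

Lemma Eb_cst s g k x : path <%R s g -> Eb s g (fun=> k) x = k.
Proof.
elim: g s x => [|t g IH] s x //= /andP[st pg].
have hS := Ssg_step slo0 slohi (sub_ge0 st).
rewrite (_ : (fun z => _) = fun=> k); first exact: (step_const hS).
by apply/funext => z; exact: IH.
Qed.

Lemma Eb_cat s g1 g2 F x : Eb s (g1 ++ g2) F x = Eb s g1 (Eb (last s g1) g2 F) x.
Proof.
elim: g1 s x => [|t g1 IH] s x //=; congr (Ssg _ _ _ _ _).
by apply/funext => z; exact: IH.
Qed.

Definition known s F := forall y y', (forall r, r <= s -> y r = y' r) -> F y = F y'.

Section EE_theory.
Variables (ts : seq R) (F G : (R -> R) -> R) (s : R).
Hypotheses (hF : cyl ts F) (hG : cyl ts G).

Lemma EE_mono x : (forall y, F y <= G y) -> EE s F x <= EE s G x.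
Proof.
move=> FG; rewrite (EE_grid (ts' := ts) _ _ hF)// (EE_grid (ts' := ts) _ _ hG)//.
exact: (Eb_mono x (grid_path _ _) hF hG FG).
Qed.

Lemma EE_sub x : EE s (fun y => F y + G y) x <= EE s F x + EE s G x.
Proof.
rewrite (EE_grid (ts' := ts) _ _ hF)// (EE_grid (ts' := ts) _ _ hG)//.
rewrite (EE_grid (ts' := ts) _ _ (cyl_add hF hG))//.
exact: (Eb_sub x (grid_path _ _) hF hG).
Qed.

Lemma EE_addr x : known s G -> EE s (fun y => F y + G y) x = EE s F x + G x.
Proof.
move=> kG; rewrite (EE_grid (ts' := ts) _ _ hF)//.
rewrite (EE_grid (ts' := ts) _ _ (cyl_add hF hG))//.
exact: (Eb_known x (grid_path _ _) hF hG kG).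
Qed.

Lemma EE_mulr x : known s G -> (forall y, 0 <= G y) ->
  EE s (fun y => G y * F y) x = G x * EE s F x.
Proof.
move=> kG G0; rewrite (EE_grid (ts' := ts) _ _ hF)//.
rewrite (EE_grid (ts' := ts) _ _ (cyl_mul hG hF))//.
exact: (Eb_scale x (grid_path _ _) hF hG G0 kG).
Qed.

End EE_theory.

Lemma EE_cst s k x : EE s (fun=> k) x = k.
Proof.
by rewrite (EE_grid (ts' := [::]) _ _ (cyl_cst [::] k))// Eb_cst//; exact: grid_path.
Qed.

Lemma EE_id ts F s x : cyl ts F -> known s F -> EE s F x = F x.
Proof.
move=> hF kF; have := EE_addr (s := s) (cyl_cst ts 0) hF x kF.
by rewrite EE_cst add0r => <-; congr (EE s _ x); apply/funext => y; rewrite add0r.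
Qed.

Lemma EE_known ts F s : cyl ts F -> known s (EE s F).
Proof.
move=> hF y y' yy; rewrite !(EE_grid (ts' := ts) _ _ hF)//.
apply: (Eb_dep (grid_path _ _) hF); first exact: covers_grid.
  by move=> r _ rs; exact: yy.
exact: yy.
Qed.

Lemma EE_cyl ts F s : cyl ts F ->
  cyl (map (fun r => Num.min r s) (s :: ts)) (EE s F).
Proof.
move=> hF.
have : cyl (s :: ts) (EE s F).
  have -> : EE s F = Eb s (grid s ts) F by apply/funext => x; exact: (EE_grid _ _ hF).
  exact: (Eb_cyl (grid_path _ _) hF).
move=> /(cyl_reindex (fun r => Num.min r s)); congr (cyl _ _); apply/funext => x.
apply: (EE_known hF) => r rs /=; rewrite min_l//.
Qed.

(** On a grid that contains [t] the recursion splits at [t] by [Eb_cat]. *)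
Lemma EE_tower ts F s t x : s <= t -> cyl ts F -> EE s (EE t F) x = EE s F x.
Proof.
move=> st hF.
have hE := EE_cyl t hF.
move: st; rewrite le_eqVlt => /predU1P[->|st].
  by rewrite (EE_id _ hE)//; exact: (EE_known hF).
pose g1 := rcons (grid s [seq r <- ts | r < t]) t; pose g2 := grid t ts.
have l1 : last s g1 = t by rewrite last_rcons.
have p1 : path <%R s g1.
  rewrite rcons_path grid_path /=.
  have : last s (grid s [seq r <- ts | r < t]) \in s :: grid s [seq r <- ts | r < t].
    exact: mem_last.
  by rewrite inE => /predU1P[->//|]; rewrite mem_grid mem_filter => /and3P[].
have mg1 r : (r \in g1) = (r == t) || [&& s < r, r < t & r \in ts].
  by rewrite mem_rcons inE mem_grid mem_filter.
have E1 : EE s F x = Eb s (g1 ++ g2) F x.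
  apply: (EEE _ hF); first by rewrite cat_path p1 l1 grid_path.
  move=> r rts; have [rs|sr] := leP r s; [by left|right].
  rewrite mem_cat mg1 mem_grid rts sr !andbT/=.
  by case: (ltgtP r t); rewrite ?orbT.
rewrite E1 Eb_cat l1.
have -> : Eb t g2 F = EE t F by apply/funext => y; rewrite (EE_grid (ts' := ts) _ _ hF).
apply: (EEE _ hE p1) => r /mapP[q qts ->].
have [qs|sq] := leP q s; first by left; rewrite ge_min qs.
right; rewrite mg1; have [qt|tq] := ltP q t; last by rewrite eqxx.
move: qts; rewrite inE => /predU1P[E|->]; last by rewrite sq qt orbT.
by move: qt; rewrite E ltxx.
Qed.

Lemma EE_incr_le (b : R -> R) (c0 c K s t : R) : 0 <= s -> s < t -> bl b -> 0 <= c -> 0 <= K ->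
  (forall a, b a <= c0 + c * a ^+ 2 + K * a ^+ 4) ->
  EE 0 (fun x => b (x t - x s)) (cst 0) <= c0 + (t - s) * shi ^+ 2 * c + 3 * shi ^+ 4 * K * (t - s) ^+ 2.
Proof.
move=> s0 st bb c00 K0 hb; have [C [L [hC hL]]] := bb.
have [_ L0] := BL_ge0 (conj hC hL).
have hF : cyl [:: s; t] (fun x => b (x t - x s)).
  exists C, L; split=> // x y; apply: le_trans (hL _ _) _; apply: ler_wpM2l => //.
  rewrite !big_cons big_nil addr0.
  rewrite [leRHS]addrC (_ : x t - x s - _ = (x t - y t) - (x s - y s)); last by ring.
  exact: ler_normB.
have ts0 : 0 <= t - s by rewrite subr_ge0 ltW.
have hS := Ssg_step slo0 slohi ts0.
have key z : Ssg slo shi (t - s) (fun z' => b (z' - z)) z <=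
    c0 + (t - s) * shi ^+ 2 * c + 3 * shi ^+ 4 * K * (t - s) ^+ 2.
  have := @step_poly_at _ _ _ _ _ hS z c0 0 c K (fun z' => b (z' - z)) K0 (bl_shift _ bb).
  rewrite (Gfun_pos slo0 slohi) ?mulr_ge0// => h; apply: le_trans (h _) _.
    by move=> y; rewrite [z + y]addrC addrK /quart mul0r addr0; exact: hb.
  by apply: eq_ler; field.
(* Grids increase strictly from 0, so for [s = 0] the grid is [t] alone. *)
move: s0; rewrite le_eqVlt => /predU1P[E|s0].
  rewrite (@EEE [:: s; t] _ 0 [:: t])//=.
  - rewrite -E subr0 in key *; rewrite -[X in Ssg _ _ X]subr0.
    rewrite (_ : (fun z => _) = (fun z' => b (z' - 0))); last first.
      by apply/funext => z; rewrite splice_ge// splice_lt// -[X in _ < X]subr0 -?E ?subr0 ?E.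
    by rewrite subr0; exact: key.
  - by rewrite -E in st; rewrite st.
  - by move=> r; rewrite !inE => /orP[/eqP->|/eqP->]; [left; rewrite -E|right].
rewrite (@EEE [:: s; t] _ 0 [:: s; t])//=.
- have hS0 := Ssg_step slo0 slohi (sub_ge0 s0).
  apply: (step_le_cst hS0).
    have := @Eb_bl [:: s; t] _ s [:: t] (cst 0) _ hF; apply.
    by rewrite /= st.
  move=> z; rewrite splice_ge//; apply: le_trans (key z).
  apply: eq_ler; congr (Ssg _ _ _ _ _); apply/funext => z'.
  by rewrite splice_ge// splice_lt// splice_ge.
- by rewrite s0 st.
- by move=> r; right.
Qed.

End Eb.

(** * The Borel sigma-algebra of the path space *)

Section paths.
Variable R : realType.
Implicit Types (w : Omega R) (s t r c e : R).

Definition pv w : R -> R := \val w.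

Lemma pv_continuous w : continuous (pv w).
Proof. by have [] := set_mem (valP w). Qed.

Lemma pv_le0 w t : t <= 0 -> pv w t = 0.
Proof. by have [_] := set_mem (valP w); exact. Qed.

Lemma pv_at_continuous t : continuous (fun w : paths R => pv w t).
Proof.
have H : continuous (fun f : {family compact, R -> R} => f t).
  move=> f; have h := @pointwise_cvg_compact_family R R (nbhs f) f _ cvg_id.
  exact: (((pointwise_cvgP (f : R -> R) (nbhs_filter f)).1 (h (nbhs_filter f))) t).
move=> w; apply: (@continuous_comp _ _ _ (\val : paths R -> {family compact, R -> R})
  (fun f => f t)); last exact: H.
exact: initial_continuous.
Qed.

Lemma measurable_B t : measurable_fun [set: Omega R] (B t).
Proof.
apply: (measurability _ (RGenOInfty.measurableE R)) => // _ [_ [x ->] <-]; rewrite setTI; apply: sub_sigma_algebra.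
have /continuousP := @pv_at_continuous t; apply.
exact: rray_open.
Qed.

Lemma open_paths (O : set (paths R)) w : open O -> O w ->
  exists n : nat, forall w' : Omega R, (forall t, 0 <= t <= n%:R ->
    `|pv w' t - pv w t| <= n.+1%:R^-1) -> O w'.
Proof.
move=> [V oV <-] Ow.
pose N (n : nat) := [set f : {family compact, R -> R} |
  forall t, `|t| <= n%:R -> `|f t - pv w t| <= n.+1%:R^-1].
have FF : Filter (filter_from [set: nat] N).
  apply: filter_from_filter; first by exists 0%N.
  move=> i j _ _; exists (maxn i j) => // f hf; split=> t ht.
    apply: le_trans (hf t _) _; first by rewrite (le_trans ht)// ler_nat leq_maxl.
    by rewrite lef_pV2 ?posrE// ler_nat ltnS leq_maxl.
  apply: le_trans (hf t _) _; first by rewrite (le_trans ht)// ler_nat leq_maxr.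
  by rewrite lef_pV2 ?posrE// ler_nat ltnS leq_maxr.
have : {family compact, filter_from [set: nat] N --> (\val w : {family compact, R -> R})}.
  apply/fam_cvgP => A cA P /uniform_nbhs[E [entE hE]].
  move: entE; rewrite -entourage_ballE => -[e /= e0 he].
  have [M [_ hM]] := compact_bounded cA.
  pose n := maxn (Num.truncn (M + 1)).+1 (Num.truncn e^-1).+1.
  exists n => // f hf; apply: hE => y Ay; apply: he; rewrite /ball /= distrC.
  have h1 : `|y| <= n%:R.
    apply: le_trans (hM (M + 1) _ y Ay) _; first by rewrite ltrDl.
    by apply: le_trans (ltW (truncnS_gt _)) _; rewrite ler_nat leq_maxl.
  apply: le_lt_trans (hf y h1) _.
  rewrite invf_plt ?posrE//; apply: lt_le_trans (truncnS_gt _) _.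
  by rewrite ler_nat; apply: (@leq_trans n); [exact: leq_maxr|exact: leqnSn].
move=> /(_ V (open_nbhs_nbhs (conj oV Ow))) [n _ hn].
exists n => w' h; apply: hn => t tn.
have [t0|t0] := leP 0 t; first by apply: h; rewrite t0 -(ger0_norm t0).
rewrite [X in X - _](pv_le0 w' (ltW t0)) (pv_le0 w (ltW t0)) subrr normr0.
by rewrite invr_ge0.
Qed.

(** Two sequences violating uniform continuity have the same ultralimit, and continuity at that
    point contradicts the gap. *)
Lemma unif_cont (f : R -> R) (N e : R) : continuous f -> 0 < e ->
  exists m : nat, forall s t, 0 <= s <= N -> 0 <= t <= N ->
    `|s - t| <= m.+1%:R^-1 -> `|f s - f t| <= e.
Proof.
move=> cf e0; apply/not_existsP => H.
have {}H m : exists p : R * R, [/\ 0 <= p.1 <= N, 0 <= p.2 <= N,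
    `|p.1 - p.2| <= m.+1%:R^-1 & e < `|f p.1 - f p.2|].
  apply: contrapT => /forallNP H'; apply: (H m) => s t hs ht hst.
  by rewrite leNgt; apply/negP => he; apply: (H' (s, t)).
have [p hp] := choice H.
have b1 : bounded_seq (fun n => (p n).1).
  by exists N => n; have [/andP[? ?] _ _ _] := hp n; rewrite ger0_norm.
have b2 : bounded_seq (fun n => (p n).2).
  by exists N => n; have [_ /andP[? ?] _ _] := hp n; rewrite ger0_norm.
have E : ulim (fun n => (p n).1) = ulim (fun n => (p n).2).
  apply/eqP; rewrite -subr_eq0 -normr_le0; apply/ler_addgt0Pl => d d0; rewrite addr0.
  apply: ulim_dist => //; have [_ sU] := ultra_natP; apply: sU.
  have /cvgrPdist_le/(_ d d0) := @cvg_harmonic R; apply: filterS => n /=.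
  rewrite sub0r normrN ger0_norm//; apply: le_trans.
  by have [] := hp n.
pose l := ulim (fun n => (p n).1).
have c1 : (fun n => f (p n).1) @ ultra_nat --> f l by exact: (cvg_comp _ _ (ulimP b1) (cf _)).
have c2 : (fun n => f (p n).2) @ ultra_nat --> f l.
  by rewrite /l E; exact: (cvg_comp _ _ (ulimP b2) (cf _)).
have c3 : (fun n => f (p n).1 - f (p n).2) @ ultra_nat --> (0 : R).
  by rewrite -(subrr (f l)); exact: (cvgB c1 c2).
move/cvgrPdist_lt : c3 => /(_ e e0) /filter_ex[n] /=.
rewrite sub0r normrN => h.
by have [_ _ _ /lt_trans/(_ h)] := hp n; rewrite ltxx.
Qed.

(** Every open set is a countable union of tubes, and a tube is a countable intersection of
    generating sets. This serves to prove a property of all Borel sets from its validity for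
    coordinates. *)
Lemma Borel_gen (S : set (set (Omega R))) : sigma_algebra setT S ->
  (forall q c r, 0 <= q -> S [set w | `|B q w - c| <= r]) ->
  forall A, measurable A -> S A.
Proof.
move=> sS hS; apply: smallest_sub => // O oO.
(* A tube collects the paths which, at all rational times of [[0, n]], stay within [1 / (3 (n + 1))]
   of a step function of mesh [1 / (m + 1)] with rational values. There are countably many. *)
pose tube (i : nat * nat * seq rat) := [set w : Omega R | forall p : rat,
  (0 <= (ratr p : R) <= i.1.1%:R) ->
  `|B (ratr p) w - ratr (nth 0 i.2 (Num.truncn (ratr p * i.1.2.+1%:R : R)))|
     <= (3 * i.1.1.+1%:R)^-1].
have mS A : S A <-> measurable (A : set (g_sigma_algebraType S)).
  by rewrite /measurable /= sigma_algebra_id.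
have S_tube i : S (tube i).
  pose D (p : rat) := [set w : Omega R | (0 <= (ratr p : R) <= i.1.1%:R) ->
  `|B (ratr p) w - ratr (nth 0 i.2 (Num.truncn (ratr p * i.1.2.+1%:R : R)))|
     <= (3 * i.1.1.+1%:R)^-1].
  have -> : tube i = ~` \bigcup_p ~` D p.
    rewrite setC_bigcup; apply/seteqP; split => [w h p _|w h p].
      by rewrite setCK => hp; exact: h.
    by have := h p Logic.I; rewrite setCK; exact.
  apply/mS; apply: measurableC; apply: countable_bigcupT_measurable => //.
  move=> p; apply: measurableC; apply/mS; rewrite /D.
  have [hp|hp] := pselect (0 <= (ratr p : R) <= i.1.1%:R).
    rewrite (_ : [set w | _] = [set w | `|B (ratr p) w -
      ratr (nth 0 i.2 (Num.truncn (ratr p * i.1.2.+1%:R : R)))| <= (3 * i.1.1.+1%:R)^-1]).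
      by apply: hS; case/andP: hp.
    by apply/seteqP; split => w /=; [exact|].
  by rewrite (_ : [set w | _] = setT); [apply/mS; exact: measurableT|apply/seteqP; split => // w _ /hp].
have -> : O = \bigcup_i (if pselect (tube i `<=` O) then tube i else set0).
  apply/seteqP; split => [w Ow|w [i _]]; last by case: pselect => // h; exact: h.
  have [n hn] := open_paths oO Ow.
  (* Oscillation and rational approximation each cost [e], which together is the tube radius
     [1 / (3 (n + 1))]. Two paths of one tube then differ by two thirds of [1 / (n + 1)] at rational
     times, and the last third pays for the passage to real times. *)
  pose e : R := (6 * n.+1%:R)^-1; have e0 : 0 < e by rewrite invr_gt0 mulr_gt0.
  have [m hm] := @unif_cont (pv w) n%:R e (@pv_continuous w) e0.
  have Hq (k : nat) : exists q : rat, `|ratr q - pv w (k%:R / m.+1%:R)| < e.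
    have : pv w (k%:R / m.+1%:R) - e < pv w (k%:R / m.+1%:R) + e by lra.
    move=> /rat_in_itvoo[q]; rewrite in_itv /= => /andP[q1 q2]; exists q.
    by rewrite ltr_norml; apply/andP; split; lra.
  have [f hf] := choice Hq.
  pose N := (n * m.+1).+1; pose i := (n, m, mkseq f N).
  have grid_pt t : 0 <= t <= n%:R -> let k := Num.truncn (t * m.+1%:R : R) in
     (k < N)%N /\ `|t - k%:R / m.+1%:R| <= m.+1%:R^-1 /\ 0 <= (k%:R / m.+1%:R : R) <= n%:R.
    move=> /andP[t0 tn] k; have tm : 0 <= t * m.+1%:R by rewrite mulr_ge0.
    have /andP[k1 k2] := truncn_itv tm; rewrite -/k in k1 k2.
    have k3 : k%:R / m.+1%:R <= t by rewrite ler_pdivrMr.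
    split.
      rewrite /N ltnS -(ler_nat R) natrM; apply: le_trans k1 _.
      by rewrite ler_wpM2r.
    split; last by rewrite divr_ge0//= (le_trans k3).
    rewrite ger0_norm ?subr_ge0//.
    have : t <= (k%:R + 1) / m.+1%:R by rewrite ler_pdivlMr// natr1 ltW.
    by rewrite lerBlDl => /le_trans; apply; rewrite mulrDl mul1r.
  have w_tube : tube i w.
    move=> p hp; have [kN [k1 k2]] := grid_pt _ hp; set k := Num.truncn _ in kN k1 k2.
    rewrite /i /= nth_mkseq// -/k.
    have := hf k; have := hm _ _ hp k2 k1; rewrite -[B _ w]/(pv w _) !ler_norml ltr_norml.
    have -> : (3 * n.+1%:R)^-1 = e + e :> R by rewrite /e; field; rewrite nat1r.
    move=> /andP[a1 a2] /andP[a3 a4]; apply/andP; split; lra.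
  exists i => //; case: pselect => // -[] w' hw'.
  have n1 : 0 < n.+1%:R :> R by [].
  have e6 : e = n.+1%:R^-1 / 6 by rewrite /e invfM mulrC.
  have e3 : (3 * n.+1%:R)^-1 = n.+1%:R^-1 / 3 :> R by rewrite invfM mulrC.
  have rat_pt (p : rat) : (0 <= (ratr p : R) <= n%:R) ->
      `|pv w' (ratr p) - pv w (ratr p)| <= n.+1%:R^-1 * (2 / 3).
    move=> hp; have [kN [k1 k2]] := grid_pt _ hp; set k := Num.truncn _ in kN k1 k2.
    have := hw' p hp; rewrite /i /= nth_mkseq// -/k e3.
    have := hf k; have := hm _ _ hp k2 k1; rewrite e6 !ler_norml ltr_norml.
    rewrite -[B _ w']/(pv w' _).
    set z := n.+1%:R^-1; set y := ratr (f k).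
    move=> /andP[a1 a2] /andP[a3 a4] /andP[a5 a6]; apply/andP; split; lra.
  apply: hn => t /andP[t0 tn].
  have [n0|n0] := posnP n.
    have -> : t = 0 by apply/eqP; rewrite eq_le t0 andbT; move: tn; rewrite n0.
    by rewrite !pv_le0// subrr normr0 invr_ge0.
  pose g t := pv w' t - pv w t.
  have cg : continuous g by move=> x; apply: cvgB; exact: pv_continuous.
  have d0 : 0 < n.+1%:R^-1 / 3 :> R by rewrite divr_gt0// invr_gt0.
  have /cvgrPdist_lt/(_ _ d0)/nbhs_ballP[d /= dd0 hd] := cg t.
  have : Num.max 0 (t - d) < Num.min n%:R (t + d).
    rewrite gt_max !lt_min ltr0n n0 /=; apply/and3P; split; lra.
  move=> /rat_in_itvoo[p]; rewrite in_itv /= gt_max lt_min => /andP[/andP[p0 p1] /andP[p2 p3]].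
  have hp : 0 <= (ratr p : R) <= n%:R by rewrite !ltW.
  have := rat_pt p hp.
  have tp : `|t - ratr p| < d by rewrite ltr_norml; apply/andP; split; lra.
  have := hd _ tp; rewrite /g ltr_norml !ler_norml.
  set z := n.+1%:R^-1.
  move=> /andP[a1 a2] /andP[a3 a4]; apply/andP; split; lra.
apply/mS; apply: countable_bigcupT_measurable => //.
move=> i; case: pselect => h; first by apply/mS; exact: S_tube.
exact: measurable0.
Qed.
End paths.

(** * Tightness *)

Section holder.
Variable R : realType.
Implicit Types (x w : R -> R) (s t a c r : R) (i j k l m n : nat).

(** The ratio needs [2 * rho ^+ 4 > 1], so that fourth moments make violations at dyadic scales
    summable, and [rho < 1] for chaining, where the constant 9 is [rho / (1 - rho)]. *)
Definition rho : R := 9 / 10.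

Lemma rho_gt0 : 0 < rho. Proof. by rewrite /rho divr_gt0. Qed.

Lemma rhoX_gt0 n : 0 < rho ^+ n. Proof. exact: exprn_gt0 rho_gt0. Qed.

(** Hoelder continuity expressed on dyadic scales. At scale [2 ^- j] only [[0, j]] is controlled, so
    that a single constant serves all horizons. *)
Definition modulus c : set (R -> R) := [set x | (forall t, t <= 0 -> x t = 0) /\
  forall j s t, 0 <= s <= j%:R -> 0 <= t <= j%:R -> `|t - s| <= 2 ^- j ->
    `|x t - x s| <= c * rho ^+ j].

Definition clamp r : R := Num.min (Num.max r 0) 1.

Lemma sum_clamp n r : \sum_(i < n) clamp (r - i%:R) = Num.min (Num.max r 0) n%:R.
Proof.
elim: n => [|n IH]; first by rewrite big_ord0 min_r// le_max lexx orbT.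
rewrite big_ord_recr /= IH /clamp -natr1.
have n0 : 0 <= n%:R :> R by [].
have [r0|r0] := leP r 0.
  rewrite (min_l (n0 : 0 <= n%:R)) (@max_r _ _ (r - n%:R)) ?min_l ?addr0//; lra.
have [rn|rn] := leP r n%:R.
  rewrite (@max_r _ _ (r - n%:R)) ?min_l ?addr0//; lra.
rewrite (@max_l _ _ (r - n%:R)); last by lra.
by have [r1|r1] := leP (r - n%:R) 1; have [r2|r2] := leP r (n%:R + 1); lra.
Qed.

Lemma clamp_mono r s : r <= s -> clamp r <= clamp s.
Proof. by move=> rs; rewrite /clamp le_min2// ge_max !le_max rs lexx orbT. Qed.

Lemma clamp_le0 r : r <= 0 -> clamp r = 0.
Proof. by move=> r0; rewrite /clamp max_r// min_l. Qed.

Lemma clamp_ge1 r : 1 <= r -> clamp r = 1.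
Proof. by move=> r1; rewrite /clamp max_l ?min_r//; lra. Qed.

(* piecewise linear interpolation of x - x(0) on the grid of mesh 2^-k of [0, k] *)
Definition interp x k t : R :=
  \sum_(i < (k * 2 ^ k)%N) (x (i.+1%:R / 2 ^+ k) - x (i%:R / 2 ^+ k)) * clamp (t * 2 ^+ k - i%:R).

Lemma interp_le0 x k t : t <= 0 -> interp x k t = 0.
Proof.
move=> t0; rewrite /interp big1// => i _; rewrite clamp_le0 ?mulr0//.
by rewrite subr_le0 (@le_trans _ _ 0)// mulr_le0_ge0// exprn_ge0.
Qed.

Lemma interp_grid x k m : (m <= k * 2 ^ k)%N ->
  interp x k (m%:R / 2 ^+ k) = x (m%:R / 2 ^+ k) - x 0.
Proof.
move=> mk; rewrite /interp.
have p0 : 2 ^+ k != 0 :> R by rewrite expf_neq0.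
pose d i := x (i.+1%:R / 2 ^+ k) - x (i%:R / 2 ^+ k).
rewrite -(big_mkord xpredT (fun i => d i * clamp (m%:R / 2 ^+ k * 2 ^+ k - i%:R))).
rewrite (big_cat_nat (n := m))//= [X in _ + X]big_nat_cond [X in _ + X]big1 ?addr0; last first.
  move=> i /andP[/andP[mi _] _]; rewrite divfK// clamp_le0 ?mulr0//.
  by rewrite subr_le0 ler_nat.
rewrite big_nat_cond (eq_bigr d); last first.
  move=> i /andP[/andP[_ im] _]; rewrite divfK// clamp_ge1 ?mulr1//.
  by rewrite -natrB ?ler1n ?subn_gt0// ltnW.
rewrite -big_nat_cond /d (telescope_sumr (fun i => x (i%:R / 2 ^+ k)))//.
by rewrite mul0r.
Qed.

Lemma interp_lip x k c s t : 0 <= c ->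
  (forall i, (i < k * 2 ^ k)%N -> `|x (i.+1%:R / 2 ^+ k) - x (i%:R / 2 ^+ k)| <= c) ->
  `|interp x k t - interp x k s| <= c * 2 ^+ k * `|t - s|.
Proof.
move=> c0 hc; have p0 : 0 <= 2 ^+ k :> R by rewrite exprn_ge0.
wlog st : s t / s <= t.
  move=> H; have [st|/ltW ts] := leP s t; first exact: H.
  by rewrite distrC (distrC t); exact: H.
rewrite /interp -sumrB (ger0_norm (_ : 0 <= t - s)) ?subr_ge0//.
apply: le_trans (ler_norm_sum _ _ _) _.
have up : t * 2 ^+ k >= s * 2 ^+ k by rewrite ler_wpM2r.
apply: (@le_trans _ _ (\sum_(i < (k * 2 ^ k)%N)
   (c * (clamp (t * 2 ^+ k - i%:R) - clamp (s * 2 ^+ k - i%:R))))).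
  apply: ler_sum => i _; rewrite -mulrBr normrM ler_pM//; first exact: hc.
  by rewrite ger0_norm// subr_ge0 clamp_mono// lerD2r.
rewrite -mulr_sumr sumrB !sum_clamp -mulrA; apply: ler_wpM2l => //.
rewrite mulrBr [2 ^+ k * t]mulrC [2 ^+ k * s]mulrC.
set u := t * _ in up *; set v := s * _ in up *; set N : R := (k * 2 ^ k)%:R.
have d0 : 0 <= u - v by rewrite subr_ge0.
rewrite lerBlDl addr_minl; apply: le_min2; last by rewrite lerDl.
rewrite addr_maxl add0r (_ : v + (u - v) = u); last by ring.
by rewrite ge_max !le_max lexx d0 orbT.
Qed.

Definition dy j t : R := (Num.truncn (t * 2 ^+ j))%:R / 2 ^+ j.

Lemma pow2_gt0 j : 0 < 2 ^+ j :> R. Proof. by rewrite exprn_gt0. Qed.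

Lemma dy_le j t : 0 <= t -> dy j t <= t.
Proof.
by move=> t0; rewrite /dy ler_pdivrMr ?pow2_gt0// truncn_le mulr_ge0// ltW ?pow2_gt0.
Qed.

Lemma dy_gt j t : t < dy j t + 2 ^- j.
Proof.
rewrite /dy -[X in _ + X]mul1r -mulrDl ltr_pdivlMr ?pow2_gt0// natr1.
exact: truncnS_gt.
Qed.

Lemma dy_ge0 j t : 0 <= dy j t.
Proof. by rewrite /dy divr_ge0// ltW ?pow2_gt0. Qed.

Section chain.
Variables (w : R -> R) (k : nat) (a : R).
Hypothesis a0 : 0 <= a.
Hypothesis hw : forall j i, (j <= k)%N -> (i < j * 2 ^ j)%N ->
  `|w (i.+1%:R / 2 ^+ j) - w (i%:R / 2 ^+ j)| <= a * rho ^+ j.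

Lemma cell_lt j l i t : (j <= l)%N -> t <= j%:R -> i.+1%:R / 2 ^+ l <= t -> (i < l * 2 ^ l)%N.
Proof.
move=> jl tj; rewrite ler_pdivrMr ?pow2_gt0// => h.
rewrite -(ler_nat R) natrM natrX; apply: le_trans h _.
by rewrite ler_wpM2r ?exprn_ge0// (le_trans tj)// ler_nat.
Qed.

(** From one scale to the next the truncation [dy] moves by at most one cell, and the increments sum
    to a geometric series. *)
Lemma chain_down j l t : (j <= l <= k)%N -> 0 <= t <= j%:R ->
  `|w (dy l t) - w (dy j t)| <= a * (9 * rho ^+ j - 9 * rho ^+ l).
Proof.
move=> /andP[jl lk] /andP[t0 tj]; elim: l jl lk => [|l IH] jl lk.
  by move: jl; rewrite leqn0 => /eqP ->; rewrite !subrr normr0 mulr0.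
move: jl; rewrite leq_eqVlt => /predU1P[->|]; first by rewrite !subrr normr0 mulr0.
rewrite ltnS => jl; have {}IH := IH jl (ltnW lk).
have step1 : `|w (dy l.+1 t) - w (dy l t)| <= a * rho ^+ l.+1.
  have p1 := pow2_gt0 l.
  have tl : 0 <= t * 2 ^+ l by rewrite mulr_ge0// ltW.
  have tl1 : 0 <= t * 2 ^+ l.+1 by rewrite mulr_ge0// exprn_ge0.
  pose m := Num.truncn (t * 2 ^+ l).
  have /andP[m1 m2] := truncn_itv tl; rewrite -/m in m1 m2.
  have E : dy l t = (2 * m)%:R / 2 ^+ l.+1.
    by rewrite /dy -/m natrM exprS; field; exact: lt0r_neq0.
  have [h|h] := leP (2 * m).+1%:R (t * 2 ^+ l.+1).
    have E1 : dy l.+1 t = (2 * m).+1%:R / 2 ^+ l.+1.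
      rewrite /dy; congr (_%:R / _); apply: truncn_def; rewrite h /=.
      have : t * 2 ^+ l.+1 < 2 * m.+1%:R by rewrite exprS mulrCA ltr_pM2l.
      by move=> /lt_le_trans; apply; rewrite -natrM ler_nat mulnS.
    rewrite E1 E; apply: hw => //.
    apply: (@cell_lt j _ _ t) => //; first exact: leqW.
    by rewrite ler_pdivrMr ?pow2_gt0.
  have E1 : dy l.+1 t = (2 * m)%:R / 2 ^+ l.+1.
    rewrite /dy; congr (_%:R / _); apply: truncn_def; rewrite h andbT.
    by rewrite natrM exprS mulrCA ler_pM2l.
  by rewrite E1 E subrr normr0 mulr_ge0// ltW ?rhoX_gt0.
rewrite (_ : _ - _ = (w (dy l.+1 t) - w (dy l t)) + (w (dy l t) - w (dy j t))); last by ring.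
apply: le_trans (ler_normD _ _) _.
have E : rho ^+ l.+1 = 9 / 10 * rho ^+ l by rewrite exprS.
rewrite E in step1 *; have := rhoX_gt0 l; set rl := rho ^+ l in IH step1 *.
set rj := rho ^+ j in IH *; nra.
Qed.

Lemma chain_adj j s t : (j <= k)%N -> 0 <= s <= j%:R -> 0 <= t <= j%:R ->
  `|t - s| <= 2 ^- j -> `|w (dy j t) - w (dy j s)| <= a * rho ^+ j.
Proof.
move=> jk; wlog st : s t / s <= t.
  move=> H hs ht; have [st|/ltW ts] := leP s t; first exact: H.
  by rewrite distrC [in X in _ -> X]distrC; exact: H.
move=> /andP[s0 sj] /andP[t0 tj]; rewrite ger0_norm ?subr_ge0// => hst.
have p := pow2_gt0 j.
pose m := Num.truncn (s * 2 ^+ j); pose n := Num.truncn (t * 2 ^+ j).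
have mn : (m <= n)%N by apply: le_truncn; rewrite ler_pM2r.
have nm : (n <= m.+1)%N.
  rewrite /n truncn_le_nat -natr1.
  have := truncnS_gt (s * 2 ^+ j); rewrite -/m => h.
  have : (t - s) * 2 ^+ j <= 1 by rewrite -ler_pdivlMr// mul1r.
  lra.
have [E|ne] := eqVneq m n.
  by rewrite /dy -/m -/n E subrr normr0 mulr_ge0// ltW ?rhoX_gt0.
have E : n = m.+1 by apply/eqP; rewrite eqn_leq nm ltn_neqAle ne mn.
rewrite /dy -/m -/n E; apply: hw => //; apply: (@cell_lt j _ _ t) => //.
have tp : 0 <= t * 2 ^+ j by rewrite mulr_ge0// ltW.
have /andP[h _] := truncn_itv tp.
by rewrite ler_pdivrMr// -E.
Qed.

End chain.

Lemma interp_modulus x k a : 0 <= a ->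
  (forall j i, (j <= k)%N -> (i < j * 2 ^ j)%N ->
    `|x (i.+1%:R / 2 ^+ j) - x (i%:R / 2 ^+ j)| <= a * rho ^+ j) ->
  modulus (21 * a) (interp x k).
Proof.
move=> a0 hx; split; first by move=> t; exact: interp_le0.
set w := interp x k.
have hw j i : (j <= k)%N -> (i < j * 2 ^ j)%N ->
    `|w (i.+1%:R / 2 ^+ j) - w (i%:R / 2 ^+ j)| <= a * rho ^+ j.
  move=> jk ij.
  have E m : (m <= j * 2 ^ j)%N -> w (m%:R / 2 ^+ j) = x (m%:R / 2 ^+ j) - x 0.
    move=> mj; have e : m%:R / 2 ^+ j = (m * 2 ^ (k - j))%:R / 2 ^+ k :> R.
      have -> : 2 ^+ k = 2 ^+ (k - j) * 2 ^+ j :> R by rewrite -exprD subnK.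
      rewrite natrM natrX.
      have p0 : 2 ^+ (k - j) != 0 :> R by rewrite expf_neq0.
      have q0 : 2 ^+ j != 0 :> R by rewrite expf_neq0.
      move: p0 q0; set p := 2 ^+ (k - j); set q := 2 ^+ j => p0 q0.
      by field; rewrite p0 q0.
    rewrite e /w interp_grid//.
    have -> : (2 ^ k = 2 ^ j * 2 ^ (k - j))%N by rewrite -expnD subnKC.
    rewrite mulnA leq_mul2r; apply/orP; right; apply: leq_trans mj _.
    by rewrite leq_mul2r jk orbT.
  rewrite !E//; last exact: ltnW.
  by rewrite opprB addrA subrK; exact: hx.
have lip s t : `|w t - w s| <= a * rho ^+ k * 2 ^+ k * `|t - s|.
  apply: interp_lip => [|i ik]; first by rewrite mulr_ge0// ltW ?rhoX_gt0.
  exact: hx.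
move=> j s t hs ht hst.
(* At scales finer than the mesh the interpolation is Lipschitz with constant [a * (2 * rho) ^+ k],
   which is at most [a * (2 * rho) ^+ j] since [2 * rho >= 1]. *)
have [jk|kj] := leqP j k; last first.
  apply: le_trans (lip s t) _.
  apply: (@le_trans _ _ (a * (rho ^+ k * 2 ^+ k) / 2 ^+ j)).
    have A0 : 0 <= a * (rho ^+ k * 2 ^+ k).
      by apply: mulr_ge0 => //; apply: mulr_ge0; apply: ltW; [exact: rhoX_gt0|exact: pow2_gt0].
    by have := ler_wpM2l A0 hst; rewrite !mulrA.
  rewrite ler_pdivrMr ?pow2_gt0// -mulrA -[leRHS]mulrA.
  have : (rho * 2) ^+ k <= (rho * 2) ^+ j.
    by apply: ler_weXn2l; [rewrite /rho; lra|exact: ltnW].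
  rewrite (exprMn k rho 2) (exprMn j rho 2) => h; have := ler_wpM2l a0 h.
  have : 0 <= a * (rho ^+ j * 2 ^+ j) by rewrite mulr_ge0// mulr_ge0// ltW ?rhoX_gt0 ?pow2_gt0.
  lra.
have nearw u : 0 <= u <= j%:R -> `|w u - w (dy j u)| <= a * (9 * rho ^+ j).
  move=> hu; have /andP[u0 uj] := hu.
  have := chain_down a0 hw (_ : j <= k <= k)%N hu; rewrite jk leqnn => /(_ isT) c1.
  have : `|w u - w (dy k u)| <= a * rho ^+ k.
    apply: le_trans (lip _ _) _; rewrite -[leRHS]mulr1 -mulrA ler_wpM2l//.
      by rewrite mulr_ge0// ltW ?rhoX_gt0.
    rewrite ger0_norm ?subr_ge0 ?dy_le// mulrC -ler_pdivlMr ?pow2_gt0// mul1r.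
    by rewrite lerBlDl ltW// dy_gt.
  rewrite (_ : w u - w (dy j u) = (w u - w (dy k u)) + (w (dy k u) - w (dy j u))); last by ring.
  move=> c2; apply: le_trans (ler_normD _ _) _.
  have : 0 <= a * rho ^+ k by rewrite mulr_ge0// ltW ?rhoX_gt0.
  lra.
(* Reaching the two truncations costs 9 each and joining them costs 1, within the constant 21. *)
have := nearw s hs; have := nearw t ht; have := chain_adj a0 hw jk hs ht hst.
rewrite (_ : w t - w s = (w t - w (dy j t)) + (w (dy j t) - w (dy j s)) - (w s - w (dy j s))); last by ring.
move=> c1 c2 c3; apply: le_trans (ler_normB _ _) _; apply: le_trans (lerD (ler_normD _ _) (lexx _)) _.
have : 0 <= a * rho ^+ j by rewrite mulr_ge0// ltW ?rhoX_gt0.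
lra.
Qed.

Lemma modulus_cont c x : 0 <= c -> modulus c x -> continuous x.
Proof.
move=> c0 [x0 hx] t; apply/cvgrPdist_le => e e0.
have c1 : 0 < c + 1 by rewrite ltr_wpDl.
have [j jt hj] : exists2 j : nat, t + 1 <= j%:R & (c + 1) * rho ^+ j <= e.
  have : rho ^+ n @[n --> \oo] --> (0 : R).
    by apply: cvg_expr; rewrite ger0_norm /rho; lra.
  move=> /cvgrPdist_le/(_ (e / (c + 1)))[|N _ hN]; first by rewrite divr_gt0.
  exists (maxn N (Num.truncn (t + 1)).+1).
    by rewrite (le_trans (ltW (truncnS_gt _)))// ler_nat leq_maxr.
  have := hN _ (leq_maxl N (Num.truncn (t + 1)).+1).
  by rewrite /= sub0r normrN gtr0_norm ?rhoX_gt0// ler_pdivlMr// mulrC.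
have E z : x z = x (Num.max z 0).
  by have [z0|z0] := leP z 0; rewrite ?(x0 z z0) ?(x0 0).
apply/nbhs_ballP; exists (2 ^- j); first by rewrite /= invr_gt0 pow2_gt0.
move=> s; rewrite /ball /= => hs.
have h1 : 2 ^- j <= 1 :> R by rewrite invf_le1 ?pow2_gt0// exprn_ege1// ler1n.
have := hs; rewrite ltr_norml => /andP[s1 s2].
rewrite (E t) (E s); apply: (@le_trans _ _ (c * rho ^+ j)).
  apply: hx.
  - by rewrite le_max lexx orbT /= ge_max ler0n andbT; lra.
  - by rewrite le_max lexx orbT /= ge_max ler0n andbT; lra.
  - apply: le_trans (ltW hs); rewrite ler_norml.
    have := ler_norm (t - s); have := ler_norm (- (t - s)); rewrite normrN.
    by have [t0|t0] := leP t 0; have [s0|s0] := leP s 0 => *; apply/andP; split; lra.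
apply: le_trans hj; rewrite ler_wpM2r//; last by lra.
by rewrite ltW// rhoX_gt0.
Qed.

Lemma modulus_bounded c t : 0 <= c -> exists M, forall x, modulus c x -> `|x t| <= M.
Proof.
move=> c0; have [t0|t0] := leP t 0.
  by exists 0 => x [x0 _]; rewrite x0// normr0.
pose j := (Num.truncn t).+1; have tj : t <= j%:R by exact: ltW (truncnS_gt _).
exists (((Num.truncn (t * 2 ^+ j))%:R + 1) * (c * rho ^+ j)) => x [x0 hx].
have p := pow2_gt0 j.
have key m : m%:R / 2 ^+ j <= t -> `|x (m%:R / 2 ^+ j)| <= m%:R * (c * rho ^+ j).
  elim: m => [|m IH] hm; first by rewrite !mul0r x0// normr0.
  have q : m%:R / 2 ^+ j <= m.+1%:R / 2 ^+ j :> R by rewrite ler_pM2r ?invr_gt0// ler_nat.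
  have {}IH := IH (le_trans q hm).
  rewrite -[x _](subrK (x (m%:R / 2 ^+ j))); apply: le_trans (ler_normD _ _) _.
  have -> : m.+1%:R * (c * rho ^+ j) = c * rho ^+ j + m%:R * (c * rho ^+ j).
    by rewrite -natr1 mulrDl mul1r addrC.
  apply: lerD => //; apply: hx.
  - apply/andP; split; first by apply: divr_ge0 => //; exact: ltW.
    by apply: le_trans q _; exact: le_trans hm tj.
  - apply/andP; split; first by apply: divr_ge0 => //; exact: ltW.
    exact: le_trans hm tj.
  - rewrite -mulrBl -natr1 (_ : _ + 1 - _ = 1); last by ring.
    by rewrite mul1r gtr0_norm// invr_gt0.
have d1 : dy j t <= t by rewrite dy_le ?ltW.
have := key _ d1; rewrite -/(dy j t) => h.
rewrite -[x t](subrK (x (dy j t))); apply: le_trans (ler_normD _ _) _.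
rewrite mulrDl mul1r addrC; apply: lerD => //; apply: hx.
- by rewrite dy_ge0 (le_trans d1).
- by rewrite ltW.
- by rewrite ger0_norm ?subr_ge0// lerBlDl ltW// dy_gt.
Qed.

(** This plays the role of the Arzela-Ascoli theorem: a pointwise ultralimit stays in the class and
    is thus again a continuous path. *)
Lemma modulus_ulim c (x : nat -> R -> R) : 0 <= c -> (forall n, modulus c (x n)) ->
  modulus c (fun t => ulim (fun n => x n t)).
Proof.
move=> c0 hx; have bs t : bounded_seq (fun n => x n t).
  by have [M hM] := modulus_bounded t c0; exists M => n; exact: hM.
split=> [t t0|j s t hs ht hst].
  rewrite (_ : (fun n => x n t) = fun=> 0) ?ulim_cst//.
  by apply/funext => n; have [-> //] := hx n.
apply: ulim_dist => //; apply: filterE => n.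
by have [_] := hx n; exact.
Qed.

End holder.

(** * Almost compact sets of paths under dominated functionals *)

Section tight.
Variables (R : realType) (slo shi : R).
Hypotheses (slo0 : 0 <= slo) (slohi : slo <= shi).
Implicit Types (F G : (R -> R) -> R) (x : R -> R) (s t a c d e r y z : R) (ts : seq R).

Definition E0 F := EE slo shi 0 F (cst 0).

Definition cylf F := exists ts : seq R, (forall t, t \in ts -> 0 <= t) /\ cyl ts F.

Lemma cylf2 F G : cylf F -> cylf G ->
  exists ts : seq R, [/\ forall t, t \in ts -> 0 <= t, cyl ts F & cyl ts G].
Proof.
move=> [ts [h hF]] [ts' [h' hG]]; exists (ts ++ ts'); split.
- by move=> t; rewrite mem_cat => /orP[/h|/h'].
- by apply: cyl_sub hF => t ht; rewrite mem_cat ht.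
- by apply: cyl_sub hG => t ht; rewrite mem_cat ht orbT.
Qed.

Lemma cylf_cst k : cylf (fun=> k). Proof. by exists [::]; split=> //; exact: cyl_cst. Qed.

Lemma cylf_add F G : cylf F -> cylf G -> cylf (fun x => F x + G x).
Proof.
by move=> hF hG; have [ts [h h1 h2]] := cylf2 hF hG; exists ts; split=> //; exact: cyl_add.
Qed.

Lemma cylf_subr F G : cylf F -> cylf G -> cylf (fun x => F x - G x).
Proof.
by move=> hF hG; have [ts [h h1 h2]] := cylf2 hF hG; exists ts; split=> //; exact: cyl_subr.
Qed.

Lemma cylf_mul F G : cylf F -> cylf G -> cylf (fun x => F x * G x).
Proof.
by move=> hF hG; have [ts [h h1 h2]] := cylf2 hF hG; exists ts; split=> //; exact: cyl_mul.
Qed.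

Lemma cylf_max F G : cylf F -> cylf G -> cylf (fun x => Num.max (F x) (G x)).
Proof.
by move=> hF hG; have [ts [h h1 h2]] := cylf2 hF hG; exists ts; split=> //; exact: cyl_max.
Qed.

Lemma cylf_min F G : cylf F -> cylf G -> cylf (fun x => Num.min (F x) (G x)).
Proof.
by move=> hF hG; have [ts [h h1 h2]] := cylf2 hF hG; exists ts; split=> //; exact: cyl_min.
Qed.

Lemma cylf_scale k F : cylf F -> cylf (fun x => k * F x).
Proof. by move=> [ts [h hF]]; exists ts; split=> //; exact: cyl_scale. Qed.

Lemma cylf_sum (I : Type) (r : seq I) (F : I -> (R -> R) -> R) :
  (forall i, cylf (F i)) -> cylf (fun x => \sum_(i <- r) F i x).
Proof.
move=> hF; elim: r => [|i r IH].
  have -> : (fun x => \sum_(i <- [::]) F i x) = fun=> 0 by apply/funext => x; rewrite big_nil.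
  exact: cylf_cst.
have -> : (fun x => \sum_(j <- i :: r) F j x) = (fun x => F i x + \sum_(j <- r) F j x).
  by apply/funext => x; rewrite big_cons.
exact: cylf_add.
Qed.

Lemma cylf_incr (f : R -> R) s t : 0 <= s -> 0 <= t -> bl f -> cylf (fun x => f (x t - x s)).
Proof.
move=> s0 t0 [C [L bf]]; have [_ L0] := BL_ge0 bf; have [hC hL] := bf.
exists [:: s; t]; split; first by move=> r; rewrite !inE => /orP[/eqP->|/eqP->].
exists C, L; split=> // x y; apply: le_trans (hL _ _) _; apply: ler_wpM2l => //.
rewrite !big_cons big_nil addr0 [leRHS]addrC.
rewrite (_ : x t - x s - _ = (x t - y t) - (x s - y s)); last by ring.
exact: ler_normB.
Qed.

Lemma cylf_val (f : R -> R) t : 0 <= t -> bl f -> cylf (fun x => f (x t)).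
Proof.
move=> t0 [C [L bf]]; have [hC hL] := bf.
exists [:: t]; split; first by move=> r; rewrite !inE => /eqP->.
by exists C, L; split=> // x y; rewrite big_seq1.
Qed.

Record dominated (Lam : ((R -> R) -> R) -> R) : Prop := Dominated {
  dom_add : forall F G, cylf F -> cylf G -> Lam (fun x => F x + G x) = Lam F + Lam G ;
  dom_scale : forall k F, cylf F -> Lam (fun x => k * F x) = k * Lam F ;
  dom_le : forall F, cylf F -> Lam F <= E0 F }.

Variable Lam : ((R -> R) -> R) -> R.
Hypothesis hL : dominated Lam.

Lemma dom_sub F G : cylf F -> cylf G -> Lam (fun x => F x - G x) = Lam F - Lam G.
Proof.
move=> hF hG; have -> : (fun x => F x - G x) = (fun x => F x + -1 * G x).
  by apply/funext => x; rewrite mulN1r.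
by rewrite (dom_add hL)// ?(dom_scale hL)// ?mulN1r//; exact: cylf_scale.
Qed.

Lemma dom_mono F G : cylf F -> cylf G -> (forall x, F x <= G x) -> Lam F <= Lam G.
Proof.
move=> hF hG FG; rewrite -subr_le0 -dom_sub//; apply: le_trans (dom_le hL _) _.
  exact: cylf_subr.
have [ts [_ hd]] := cylf_subr hF hG; rewrite /E0; apply: le_trans (eq_ler (EE_cst slo0 slohi 0 0 (cst 0))).
apply: (EE_mono slo0 slohi 0 hd (cyl_cst ts 0)) => x.
by rewrite subr_le0.
Qed.

Lemma dom_cst k : Lam (fun=> k) = k.
Proof.
have h1 : Lam (fun=> 1) = 1.
  apply/eqP; rewrite eq_le; apply/andP; split.
    by apply: le_trans (dom_le hL (cylf_cst 1)) _; rewrite /E0 EE_cst.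
  rewrite -lerN2 -[- Lam _]mulN1r -(dom_scale hL _ (cylf_cst 1)).
  by apply: le_trans (dom_le hL (cylf_cst _)) _; rewrite /E0 EE_cst// mulr1.
have -> : (fun _ : R -> R => k) = (fun x => k * (fun=> 1) x) by apply/funext => x; rewrite mulr1.
by rewrite (dom_scale hL _ (cylf_cst 1)) h1 mulr1.
Qed.

Lemma dom_sum (I : Type) (r : seq I) (F : I -> (R -> R) -> R) :
  (forall i, cylf (F i)) -> Lam (fun x => \sum_(i <- r) F i x) = \sum_(i <- r) Lam (F i).
Proof.
move=> hF; elim: r => [|i r IH].
  rewrite big_nil (_ : (fun x => _) = fun=> 0) ?dom_cst//.
  by apply/funext => x; rewrite big_nil.
rewrite big_cons -IH -(dom_add hL)//; last exact: cylf_sum.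
by congr Lam; apply/funext => x; rewrite big_cons.
Qed.

Lemma bl_mul (f g : R -> R) : bl f -> bl g -> bl (fun y => f y * g y).
Proof.
move=> [C [L bf]] [C' [L' bg]].
have [C0 L0] := BL_ge0 bf; have [C'0 L'0] := BL_ge0 bg.
have [hC hLf] := bf; have [hC' hL'] := bg.
exists (C * C'), (C * L' + C' * L); split=> [x|x y].
  by rewrite normrM ler_pM.
rewrite (_ : _ - _ = f x * (g x - g y) + g y * (f x - f y)); last by ring.
apply: le_trans (ler_normD _ _) _; rewrite !normrM mulrDl -!mulrA.
by apply: lerD; apply: ler_pM.
Qed.

Definition cut c z y : R := Num.min c (z * `|y|).

Lemma cut_bl c z : 0 <= c -> 0 <= z -> bl (cut c z).
Proof.
move=> c0 z0; exists c, z; split=> [x|x y].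
  by rewrite ger0_norm ?ge_min ?lexx// le_min c0 mulr_ge0.
have key u v : cut c z u - cut c z v <= z * `|u - v|.
  have : `|u| <= `|v| + `|u - v| by rewrite -[u in leLHS](subrKC v) ler_normD.
  move=> /(ler_wpM2l z0) h; have := mulr_ge0 z0 (normr_ge0 (u - v)).
  rewrite /cut; have [|] := leP c (z * `|v|); have [|] := leP c (z * `|u|); lra.
by rewrite ler_norml (key x y) andbT lerNl opprB distrC (key y x).
Qed.

Lemma cut0 c z : 0 <= c -> cut c z 0 = 0.
Proof. by move=> c0; rewrite /cut normr0 mulr0 min_r. Qed.

(** A bounded Lipschitz function lying between the indicator of [|y| > z] and [(y / z) ^+ 4], for a
    Chebyshev inequality of order four. *)
Definition bump z y := cut 1 z^-1 y ^+ 4.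

Lemma bump_bl z : 0 < z -> bl (bump z).
Proof.
move=> z0; have b : bl (cut 1 z^-1) by apply: cut_bl => //; rewrite invr_ge0 ltW.
by have := bl_mul b (bl_mul b (bl_mul b b)).
Qed.

Lemma bump_ge0 z y : 0 < z -> 0 <= bump z y.
Proof. by move=> z0; rewrite exprn_even_ge0. Qed.

Lemma bump_gt z y : 0 < z -> z < `|y| -> bump z y = 1.
Proof.
move=> z0 zy; rewrite /bump /cut min_l ?expr1n// mulrC ler_pdivlMr// mul1r.
exact: ltW.
Qed.

Lemma bump_le z y : 0 < z -> bump z y <= z ^- 4 * y ^+ 4.
Proof.
move=> z0; have -> : y ^+ 4 = `|y| ^+ 4 by rewrite -normrX ger0_norm// exprn_even_ge0.
rewrite -exprVn -exprMn; apply: lerXn2r; rewrite ?nnegrE.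
- by rewrite le_min ler01 mulr_ge0// invr_ge0 ltW.
- by rewrite mulr_ge0// invr_ge0 ltW.
- by rewrite ge_min lexx orbT.
Qed.

Lemma Lam_bump z s t : 0 < z -> 0 <= s -> s < t ->
  Lam (fun x => bump z (x t - x s)) <= 3 * shi ^+ 4 * (t - s) ^+ 2 / z ^+ 4.
Proof.
move=> z0 s0 st; have bz := bump_bl z0; have t0 : 0 <= t := ltW (le_lt_trans s0 st).
apply: le_trans (dom_le hL (cylf_incr s0 t0 bz)) _.
have zi : 0 <= z ^- 4 by rewrite invr_ge0 exprn_ge0// ltW.
have := @EE_incr_le _ _ _ slo0 slohi (bump z) 0 0 (z ^- 4) s t s0 st bz (lexx _) zi.
rewrite mulr0 !add0r => h; apply: le_trans (h _) _.
  by move=> y; rewrite mul0r !add0r bump_le.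
by apply: eq_ler; ring.
Qed.

Lemma Lam_cut c z s t d : 0 <= c -> 0 <= z -> 0 < d -> 0 <= s -> s <= t ->
  Lam (fun x => cut c z (x t - x s)) <= z * (d + (t - s) * shi ^+ 2 / d).
Proof.
move=> c0 z0 d0 s0 st; have ts0 : 0 <= t - s by rewrite subr_ge0.
move: st; rewrite le_eqVlt => /predU1P[E|st].
  rewrite -E (_ : (fun x => _) = fun=> 0); last first.
    by apply/funext => x; rewrite subrr cut0.
  by rewrite dom_cst subrr !mul0r addr0 mulr_ge0// ltW.
have bc := cut_bl c0 z0; have t0 : 0 <= t := ltW (le_lt_trans s0 st).
apply: le_trans (dom_le hL (cylf_incr s0 t0 bc)) _.
have zd : 0 <= z / d by rewrite divr_ge0// ltW.
have := @EE_incr_le _ _ _ slo0 slohi (cut c z) (z * d) (z / d) 0 s t s0 st bc zd (lexx _).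
rewrite mulr0 mul0r addr0 => h; apply: le_trans (h _) _.
  move=> y; rewrite mul0r addr0; apply: (@le_trans _ _ (z * `|y|)).
    by rewrite ge_min lexx orbT.
  rewrite (_ : z * d + _ = z * (d + y ^+ 2 / d)); last by ring.
  apply: ler_wpM2l => //; rewrite -(real_normK (num_real y)) -subr_ge0.
  set u := `|y|; have u0 : 0 <= u := normr_ge0 y.
  rewrite (_ : _ - _ = (d ^+ 2 + u ^+ 2 - u * d) / d); last first.
    by field; exact: lt0r_neq0.
  apply: divr_ge0; last exact: ltW.
  by have := sqr_ge0 (d - u); have := mulr_ge0 u0 (ltW d0); nra.
by apply: eq_ler; ring.
Qed.

(** The union bound in functional form: a value below 1 forces every increment over a dyadic cell of
    scale [j <= k] inside [[0, j]] to be at most [a * rho ^+ j]. *)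
Definition viol a (k : nat) x : R := \sum_(j <- iota 0 k.+1) \sum_(i <- iota 0 (j * 2 ^ j))
  bump (a * rho R ^+ j) (x (i.+1%:R / 2 ^+ j) - x (i%:R / 2 ^+ j)).

Lemma sum_geo (n : nat) : \sum_(j <- iota 0 n) j%:R * (4 / 5) ^+ j <= 20 :> R.
Proof.
have -> : \sum_(j <- iota 0 n) j%:R * (4 / 5) ^+ j =
    20 - (5 * n%:R + 20) * (4 / 5) ^+ n :> R.
  elim: n => [|n IH]; first by rewrite big_nil expr0; ring.
  rewrite -addn1 iotaD big_cat IH /= big_seq1 add0n addn1 exprS -natr1.
  by field.
by rewrite gerBl !mulr_ge0// ?addr_ge0 ?mulr_ge0// exprn_ge0.
Qed.

Lemma cylf_viol_cell a j i : 0 < a ->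
  cylf (fun x => bump (a * rho R ^+ j) (x (i.+1%:R / 2 ^+ j) - x (i%:R / 2 ^+ j))).
Proof.
move=> a0; apply: cylf_incr; try by rewrite divr_ge0// exprn_ge0.
by apply: bump_bl; rewrite mulr_gt0// rhoX_gt0.
Qed.

(** Scale [j] has [j * 2 ^ j] cells, each contributing at most [3 * shi ^+ 4 * (2 ^- j) ^+ 2 / (a *
    rho ^+ j) ^+ 4]. Since [(2 * rho ^+ 4)^-1 <= 4 / 5] and the sum of [j * (4 / 5) ^+ j] is at most
    20, the constant is 60. *)
Lemma Lam_viol a k : 0 < a -> Lam (viol a k) <= 60 * shi ^+ 4 / a ^+ 4.
Proof.
move=> a0; rewrite /viol dom_sum; last first.
  by move=> j; apply: cylf_sum => i; exact: cylf_viol_cell.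
have s4 : 0 <= shi ^+ 4 by rewrite exprn_even_ge0.
apply: (@le_trans _ _ (\sum_(j <- iota 0 k.+1)
    3 * shi ^+ 4 / a ^+ 4 * (j%:R * (4 / 5) ^+ j))); last first.
  have a4 : 0 <= 3 * shi ^+ 4 / a ^+ 4.
    by apply: divr_ge0; [exact: mulr_ge0|rewrite exprn_ge0// ltW].
  rewrite -mulr_sumr; have := ler_wpM2l a4 (sum_geo k.+1).
  move=> h; apply: le_trans h _.
  by apply: eq_ler; ring.
apply: ler_sum => j _; rewrite dom_sum; last by move=> i; exact: cylf_viol_cell.
have p := pow2_gt0 R j; have rj := rhoX_gt0 R j.
apply: (@le_trans _ _ (\sum_(i <- iota 0 (j * 2 ^ j))
   3 * shi ^+ 4 * (2 ^- j) ^+ 2 / (a * rho R ^+ j) ^+ 4)).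
  apply: ler_sum => i _.
  have := @Lam_bump (a * rho R ^+ j) (i%:R / 2 ^+ j) (i.+1%:R / 2 ^+ j).
  rewrite mulr_gt0// divr_ge0 ?(ltW p)// ltr_pM2r ?invr_gt0// ltr_nat leqnn.
  move=> /(_ isT isT isT); rewrite -mulrBl -natr1 (_ : i%:R + 1 - i%:R = 1); last by ring.
  by rewrite mul1r.
rewrite big_const_seq count_predT size_iota iter_addr_0 -[_ *+ (j * 2 ^ j)]mulr_natl natrM natrX.
have r4 : (2 * rho R ^+ 4)^-1 <= 4 / 5 by rewrite /rho; lra.
have r40 : 0 <= (2 * rho R ^+ 4)^-1 by rewrite invr_ge0 mulr_ge0// exprn_even_ge0.
have : (2 * rho R ^+ 4) ^- j <= (4 / 5) ^+ j.
  by rewrite -exprVn; apply: lerXn2r; rewrite ?nnegrE.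
have c1 : 0 <= 3 * shi ^+ 4 / a ^+ 4 * j%:R.
  by apply: mulr_ge0 => //; apply: divr_ge0; [exact: mulr_ge0|rewrite exprn_ge0// ltW].
move=> /(ler_wpM2l c1); rewrite -[leRHS]mulrA; apply: le_trans; apply: eq_ler.
rewrite (exprMn j 2 (rho R ^+ 4)) -exprM (mulnC 4 j) (exprM _ j 4) (exprMn 4 a).
have rj0 := lt0r_neq0 rj; have p0 := lt0r_neq0 p; have a0' := lt0r_neq0 a0.
move: rj0 p0; set q := rho R ^+ j; set p2 := 2 ^+ j => rj0 p0.
by field; rewrite rj0 p0 a0'.
Qed.

Lemma min_sum c (s : seq R) (f : R -> R) : 0 <= c -> (forall t, 0 <= f t) ->
  Num.min c (\sum_(t <- s) f t) <= \sum_(t <- s) Num.min c (f t).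
Proof.
move=> c0 f0; elim: s => [|t s IH]; first by rewrite !big_nil ge_min lexx orbT.
rewrite !big_cons; have S0 : 0 <= \sum_(t <- s) f t by exact: sumr_ge0.
have := IH; have := f0 t.
have [|] := leP c (f t); have [|] := leP c (\sum_(t <- s) f t);
 have [|] := leP c (f t + \sum_(t <- s) f t); lra.
Qed.

Lemma Lam_cut0 c z : 0 <= c -> 0 <= z -> Lam (fun x => cut c z (x 0)) <= 0.
Proof.
move=> c0 z0; have hc := cylf_val (lexx 0) (cut_bl c0 z0).
apply: le_trans (dom_le hL hc) _; have [ts [_ ch]] := hc.
rewrite /E0 (EE_id slo0 slohi _ ch) ?cut0//.
by move=> y y' yy; rewrite (yy 0).
Qed.

Lemma rho_half k : 2 ^- k / rho R ^+ k <= rho R ^+ k.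
Proof.
rewrite -!exprVn -exprMn; apply: lerXn2r; rewrite ?nnegrE /rho; lra.
Qed.

(** Where [viol a k x < 1], the interpolation of [x] lies in the modulus class. Replacing [x] by it
    costs a sum of [Tk], whose image under [Lam] tends to 0 with the mesh. The resulting bound is
    independent of the times on which [F] depends. *)
Lemma tight F C dl a : cylf F -> 0 <= C -> (forall x, `|F x| <= C) -> 0 < a -> 0 <= dl ->
  (forall x, modulus (21 * a) x -> F x <= dl) ->
  Lam F <= dl + 2 * C * (60 * shi ^+ 4 / a ^+ 4).
Proof.
move=> hF C0 FC a0 dl0 hK; have [ts [ts0 cF]] := hF.
have /cylP[_ [L [_ L0 _ hLip]]] := cF.
have C20 : 0 <= 2 * C by rewrite mulr_ge0.
pose M := (\max_(t <- ts) Num.truncn t).+1.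
have tM t : t \in ts -> t <= M%:R.
  move=> tts; apply: le_trans (ltW (truncnS_gt t)) _; rewrite ler_nat ltnS.
  exact: (@leq_bigmax_seq _ ts xpredT (fun r : R => Num.truncn r) t tts isT).
have cb := cut_bl C20 L0.
(* The three terms bound [|x t - w t|]: the distance to the dyadic truncation of [t], the value
   [x 0] that the interpolation subtracts, and the oscillation of the interpolation within a
   cell. *)
pose Tk k t x := cut (2 * C) L (x t - x (dy k t)) + (cut (2 * C) L (x 0) + L * (a * rho R ^+ k)).
have cTk k t : 0 <= t -> cylf (Tk k t).
  move=> t0; apply: cylf_add; first by apply: cylf_incr => //; exact: dy_ge0.
  by apply: cylf_add; [exact: cylf_val|exact: cylf_cst].
pose Tk' k t := if 0 <= t then Tk k t else fun=> 0.
have cTk' k t : cylf (Tk' k t).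
  by rewrite /Tk'; case: ifP => [/cTk//|_]; exact: cylf_cst.
have cut_ge0 y : 0 <= cut (2 * C) L y by rewrite le_min C20 mulr_ge0.
have bump_ge j y : 0 <= bump (a * rho R ^+ j) y by rewrite bump_ge0// mulr_gt0// rhoX_gt0.
have Tk0 k t x : 0 <= Tk' k t x.
  rewrite /Tk'; case: ifP => // _; rewrite /Tk.
  by rewrite !addr_ge0// !mulr_ge0// ltW// rhoX_gt0.
have viol_ge0 k x : 0 <= viol a k x by apply: sumr_ge0 => j _; exact: sumr_ge0.
have pw k x : (M <= k)%N -> F x <= dl + 2 * C * viol a k x + \sum_(t <- ts) Tk' k t x.
  move=> Mk; have S0 : 0 <= \sum_(t <- ts) Tk' k t x by exact: sumr_ge0.
  have [viol1|viol1] := leP 1 (viol a k x).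
    have := ler_wpM2l C20 viol1; have := FC x; rewrite ler_norml => /andP[_]; lra.
  have cell j i : (j <= k)%N -> (i < j * 2 ^ j)%N ->
      `|x (i.+1%:R / 2 ^+ j) - x (i%:R / 2 ^+ j)| <= a * rho R ^+ j.
    move=> jk ij; rewrite leNgt; apply/negP => hgt; move: viol1; apply/negP; rewrite -leNgt.
    have aj : 0 < a * rho R ^+ j by rewrite mulr_gt0// rhoX_gt0.
    rewrite /viol (big_rem j); last by rewrite mem_iota.
    rewrite /= (big_rem i); last by rewrite mem_iota.
    rewrite bump_gt// -addrA lerDl addr_ge0//; first exact: sumr_ge0.
    by apply: sumr_ge0 => ? _; exact: sumr_ge0.
  have mw := interp_modulus (ltW a0) cell; set w := interp x k in mw.
  have hw := hK _ mw.
  suff h : F x - F w <= \sum_(t <- ts) Tk' k t x.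
    by have := mulr_ge0 C20 (viol_ge0 k x); lra.
  have h1 : F x - F w <= 2 * C.
    by have := FC x; have := FC w; rewrite !ler_norml => /andP[+ _] /andP[_]; lra.
  have h2 := le_trans (ler_norm _) (hLip x w).
  apply: (@le_trans _ _ (Num.min (2 * C) (\sum_(t <- ts) L * `|x t - w t|))).
    by rewrite -mulr_sumr le_min h1 h2.
  apply: le_trans (min_sum _ C20 _) _; first by move=> t; rewrite mulr_ge0.
  rewrite !big_seq; apply: ler_sum => t tts; have t0 := ts0 _ tts.
  rewrite /Tk' t0 /Tk; set d := dy k t.
  have wd : w d = x d - x 0.
    apply: interp_grid; rewrite -(ler_nat R) natrM natrX.
    apply: (@le_trans _ _ (t * 2 ^+ k)).
      by rewrite truncn_le mulr_ge0// ltW ?pow2_gt0.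
    by rewrite ler_wpM2r ?(ltW (pow2_gt0 R k))// (le_trans (tM _ tts))// ler_nat.
  have wl : `|w t - w d| <= a * rho R ^+ k.
    have r0 : 0 <= a * rho R ^+ k by rewrite mulr_ge0 ?ltW// rhoX_gt0.
    apply: le_trans (interp_lip d t r0 (cell k ^~ (leqnn k))) _.
    rewrite -[leRHS]mulr1 -mulrA ler_wpM2l// mulrC -ler_pdivlMr ?pow2_gt0// mul1r.
    by rewrite ger0_norm ?subr_ge0 ?dy_le// lerBlDl ltW// dy_gt.
  have : `|x t - w t| <= `|x t - x d| + `|x 0| + a * rho R ^+ k.
    rewrite (_ : x t - w t = (x t - x d) + x 0 + (w d - w t)); last by rewrite wd; ring.
    apply: le_trans (ler_normD _ _) _; apply: lerD; first exact: ler_normD.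
    by rewrite distrC.
  move=> /(ler_wpM2l L0) h; rewrite /cut.
  have := mulr_ge0 L0 (normr_ge0 (x t - x d)); have := mulr_ge0 L0 (normr_ge0 (x 0)).
  have : 0 <= L * (a * rho R ^+ k) by rewrite !mulr_ge0// ltW// rhoX_gt0.
  move: h; rewrite !mulrDr.
  have [|] := leP (2 * C) (L * `|x t - w t|);
  have [|] := leP (2 * C) (L * `|x t - x d|);
  have [|] := leP (2 * C) (L * `|x 0|); lra.
have LTk k t : 0 <= t -> Lam (Tk k t) <= L * (1 + shi ^+ 2 + a) * rho R ^+ k.
  move=> t0; rewrite (dom_add hL); first last.
  - by apply: cylf_add; [exact: cylf_val|exact: cylf_cst].
  - by apply: cylf_incr => //; exact: dy_ge0.
  rewrite (dom_add hL) ?dom_cst; first last.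
  - exact: cylf_cst.
  - exact: cylf_val.
  have h0 := Lam_cut0 C20 L0.
  have h1 := Lam_cut C20 L0 (rhoX_gt0 R k) (dy_ge0 k t) (dy_le k t0).
  have h2 : (t - dy k t) * shi ^+ 2 / rho R ^+ k <= shi ^+ 2 * rho R ^+ k.
    rewrite mulrAC mulrC; apply: ler_wpM2l; first exact: sqr_ge0.
    apply: le_trans (rho_half k); rewrite ler_pM2r ?invr_gt0 ?rhoX_gt0//.
    by rewrite lerBlDl ltW// dy_gt.
  move: h2 => /(ler_wpM2l L0); move: h1; rewrite mulrDr; lra.
have main k : (M <= k)%N -> Lam F <= dl + 2 * C * (60 * shi ^+ 4 / a ^+ 4) +
    (size ts)%:R * (L * (1 + shi ^+ 2 + a)) * rho R ^+ k.
  move=> Mk; have cv : cylf (viol a k).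
    by apply: cylf_sum => j; apply: cylf_sum => i; exact: cylf_viol_cell.
  have c0 : cylf (fun x => 2 * C * viol a k x) by exact: cylf_scale.
  have c1 := cylf_add (cylf_cst dl) c0.
  have c2 : cylf (fun x => \sum_(t <- ts) Tk' k t x) by exact: cylf_sum.
  apply: le_trans (dom_mono hF (cylf_add c1 c2) (fun x => pw k x Mk)) _.
  rewrite (dom_add hL c1 c2) (dom_add hL (cylf_cst dl) c0) dom_cst (dom_scale hL _ cv) dom_sum//.
  apply: lerD; first by rewrite lerD2l ler_wpM2l// Lam_viol.
  rewrite -[leRHS]mulrA mulr_natl -iter_addr_0 -(count_predT ts) -big_const_seq [leLHS]big_seq [leRHS]big_seq.
  by apply: ler_sum => t tts; rewrite /Tk' (ts0 _ tts) LTk// ts0.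
have cv : dl + 2 * C * (60 * shi ^+ 4 / a ^+ 4) +
    (size ts)%:R * (L * (1 + shi ^+ 2 + a)) * rho R ^+ k @[k --> \oo] -->
    dl + 2 * C * (60 * shi ^+ 4 / a ^+ 4) + (size ts)%:R * (L * (1 + shi ^+ 2 + a)) * 0.
  apply: cvgD; first exact: cvg_cst.
  apply: cvgMr; apply: cvg_expr; rewrite ger0_norm /rho; lra.
rewrite mulr0 addr0 in cv; rewrite -(cvg_lim _ cv)//.
apply: limr_ge; first by apply/cvg_ex; eexists; exact: cv.
by exists M => // k /= ; exact: main.
Qed.

End tight.

(** * Linear functionals dominated by the G-expectation are probability measures *)

Lemma ultra_forall_in (T : eqType) (s : seq T) (A : T -> set nat) :
  (forall t, t \in s -> ultra_nat (A t)) ->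
  ultra_nat [set n | forall t, t \in s -> A t n].
Proof.
elim: s => [|t s IH] hA; first exact: filterE.
have h1 : ultra_nat (A t) by apply: hA; rewrite inE eqxx.
have h2 : ultra_nat [set n | forall r, r \in s -> A r n].
  by apply: IH => r rs; apply: hA; rewrite inE rs orbT.
by apply: filterS (filterI h1 h2) => n /= [a b] r; rewrite inE => /predU1P[->|/b].
Qed.

Lemma path_of (R : realType) (x : R -> R) : continuous x -> (forall t, t <= 0 -> x t = 0) ->
  exists w : Omega R, pv w = x.
Proof.
move=> cx x0; have hx : (x : {family compact, R -> R}) \in @path_set R by apply/mem_set.
by exists (exist (fun w => w \in @path_set R) _ hx).
Qed.

(** * Integrals of bounded measurable functions *)

Section bounded_integral.
Variables (d : measure_display) (T : measurableType d) (R : realType) (P : probability T R).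
Implicit Types f g : T -> R.

Definition bmf f := measurable_fun setT f /\ exists C, forall w, `|f w| <= C.

Lemma bmf_integrable f : bmf f -> P.-integrable setT (EFin \o f).
Proof.
move=> [mf [C hC]]; apply: measurable_bounded_integrable => //.
  by rewrite (le_lt_trans (probability_le1 P measurableT)) ?ltry.
exists C; split; first exact: num_real.
by move=> M CM w _; exact: le_trans (hC w) (ltW CM).
Qed.

Lemma bmf_add f g : bmf f -> bmf g -> bmf (fun w => f w + g w).
Proof.
move=> [mf [C hC]] [mg [D hD]]; split; first exact: measurable_funD.
by exists (C + D) => w; apply: le_trans (ler_normD _ _) _; exact: lerD.
Qed.

Lemma bmf_scale k f : bmf f -> bmf (fun w => k * f w).
Proof.
move=> [mf [C hC]]; split; first exact: measurable_funM.
by exists (`|k| * C) => w; rewrite normrM ler_wpM2l.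
Qed.

Lemma bmf_mul f g : bmf f -> bmf g -> bmf (fun w => f w * g w).
Proof.
move=> [mf [C hC]] [mg [D hD]]; split; first exact: measurable_funM.
by exists (C * D) => w; rewrite normrM ler_pM.
Qed.

Lemma bmf_cst k : bmf (fun=> k).
Proof. by split => //; exists `|k|. Qed.

Lemma bmf_indic (A : set T) : measurable A -> bmf (\1_A).
Proof.
move=> mA; split; first exact: measurable_indic.
by exists 1 => w; rewrite indicE; case: (w \in A); rewrite ?normr1 ?normr0.
Qed.

Lemma bmf_sum (I : Type) (r : seq I) (f : I -> T -> R) :
  (forall i, bmf (f i)) -> bmf (fun w => \sum_(i <- r) f i w).
Proof.
move=> hf; elim: r => [|i r IH].
  by have := bmf_cst 0; congr bmf; apply/funext => w; rewrite big_nil.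
have := bmf_add (hf i) IH; congr bmf; apply/funext => w; rewrite big_cons//.
Qed.

Lemma bmf_EFin f : bmf f -> (\int[P]_w (f w)%:E)%E = (\int[P]_w f w)%R%:E.
Proof. by move=> hf; rewrite fineK//; apply: integrable_fin_num => //; exact: bmf_integrable. Qed.

End bounded_integral.

Lemma cvg_sum0 (R : realType) (I T : Type) (F : set_system T) {FF : Filter F} (r : seq I)
  (f : I -> T -> R) : (forall i, f i @ F --> (0 : R)) ->
  (fun w => \sum_(i <- r) f i w) @ F --> (0 : R).
Proof.
move=> hf; elim: r => [|i r IH].
  rewrite (_ : (fun w => _) = cst 0); last by apply/funext => w; rewrite big_nil.
  exact: cvg_cst.
rewrite (_ : (fun w => _) = (fun w => f i w + \sum_(j <- r) f j w)).
  by have := cvgD (hf i) IH; rewrite addr0; exact.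
by apply/funext => w; rewrite big_cons.
Qed.

Lemma cvg_domination (R : realType) (T : Type) (F : set_system T) {FF : Filter F}
  (f g : T -> R) l L : 0 <= L -> (forall w, `|l - f w| <= L * g w) -> g @ F --> (0 : R) ->
  f @ F --> (l : R).
Proof.
move=> L0 fg hg; have L1 : 0 < L + 1 by rewrite ltr_wpDl.
apply/cvgrPdist_le => e e0; move/cvgrPdist_le: hg => /(_ _ (divr_gt0 e0 L1)).
apply: filterS => w /=; rewrite sub0r normrN ler_pdivlMr// mulrC => h.
apply: le_trans (fg w) (le_trans _ h); apply: le_trans (ler_wpM2l L0 (ler_norm _)) _.
by rewrite ler_wpM2r// lerDl.
Qed.

(** * Cylinder functionals as random variables *)

Section cylf_integral.
Variables (R : realType).
Implicit Types (F : (R -> R) -> R) (P : probability (Omega R) R).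

Lemma cylf_continuous F : cylf F -> continuous (fun w : paths R => F (pv w)).
Proof.
move=> [ts [_ cF]] w; have /cylP[C [L [_ L0 _ hF]]] := cF.
have h1 t : (fun w' : paths R => `|pv w t - pv w' t|) @ w --> (0 : R).
  have hc : (fun w' : paths R => pv w' t) @ w --> pv w t by have := @pv_at_continuous R t w.
  have := cvg_norm (cvgB (cvg_cst (pv w t)) hc).
  by rewrite subrr normr0; exact.
have FF : Filter (nbhs (w : paths R)) by exact: nbhs_filter.
have h := @cvg_sum0 _ _ _ _ FF ts _ h1.
exact: (@cvg_domination _ _ _ FF _ _ _ _ L0 (fun w' => hF (pv w) (pv w')) h).
Qed.

Lemma cylf_measurable F : cylf F -> measurable_fun [set: Omega R] (fun w => F (pv w)).
Proof.
move=> /cylf_continuous cF.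
apply: (measurability _ (RGenOInfty.measurableE R)) => // _ [_ [x ->] <-].
rewrite setTI; apply: sub_sigma_algebra.
by move/continuousP: cF; apply; exact: rray_open.
Qed.

Lemma cylf_bmf F : cylf F -> bmf (fun w : Omega R => F (pv w)).
Proof.
move=> hF; split; first exact: cylf_measurable.
by have [ts [_ [C [L [hC _]]]]] := hF; exists C.
Qed.

End cylf_integral.

(** * Daniell extension to the Borel sets *)

Section representation.
Variables (R : realType) (slo shi : R).
Hypotheses (slo0 : 0 <= slo) (slohi : slo <= shi).
Implicit Types (F G g h : (R -> R) -> R) (x : R -> R) (s t a c e r y z : R) (A : set (Omega R)).
Variable Lam : ((R -> R) -> R) -> R.
Hypothesis hL : dominated slo shi Lam.

Lemma dom_ge0 F : cylf F -> (forall x, 0 <= F x) -> 0 <= Lam F.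
Proof.
by move=> hF F0; rewrite -(dom_cst slo0 slohi hL 0); apply: (dom_mono slo0 slohi hL (cylf_cst 0) hF).
Qed.

Lemma cyl_ulim F (x : nat -> R -> R) (w : R -> R) e : cylf F -> 0 < e ->
  (forall t, bounded_seq (fun n => x n t)) -> (forall t, w t = ulim (fun n => x n t)) ->
  ultra_nat [set n | `|F (x n) - F w| <= e].
Proof.
move=> [ts [_ cF]] e0 bx hw; have /cylP[C [L [_ L0 _ hF]]] := cF.
have e1 : 0 < e / (L * (size ts)%:R + 1).
  by rewrite divr_gt0// ltr_wpDl// mulr_ge0.
have h : forall t, t \in ts -> ultra_nat [set n | `|x n t - w t| <= e / (L * (size ts)%:R + 1)].
  move=> t _; apply: filterS (ulim_near (bx t) e1) => n /=; rewrite -hw; exact: ltW.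
apply: filterS (ultra_forall_in h) => n /= {}h.
apply: le_trans (hF _ _) _.
apply: (@le_trans _ _ (L * ((size ts)%:R * (e / (L * (size ts)%:R + 1))))).
  apply: ler_wpM2l => //; rewrite mulr_natl -iter_addr_0 -(count_predT ts) -big_const_seq.
  by rewrite !big_seq; apply: ler_sum => t /h.
rewrite mulrA mulrA ler_pdivrMr; last by rewrite ltr_wpDl// mulr_ge0.
by rewrite mulrC ler_pM2l// lerDl.
Qed.

(** Dini's argument on an almost compact set. If every [Lam (F n)] exceeded [e], [tight] would give
    in one modulus class points where [F n > e / 2]; by monotonicity every [F m] would then be large
    at their ultralimit, which is a path. *)
Lemma daniell (F : nat -> (R -> R) -> R) C : (forall n, cylf (F n)) -> (forall n x, 0 <= F n x) ->
  (forall n x, F n.+1 x <= F n x) -> (forall x, F 0 x <= C) ->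
  (forall w e, 0 < e -> exists n, F n (pv w) <= e) ->
  forall e, 0 < e -> exists n, Lam (F n) <= e.
Proof.
move=> cF F0 Fd FC Finf e e0.
have C0 : 0 <= C by apply: le_trans (F0 0 (cst 0)) (FC _).
have FnC n x : F n x <= C by elim: n => // n; exact: le_trans.
have Fmono m n x : (m <= n)%N -> F n x <= F m x.
  elim: n => [|n IH]; first by rewrite leqn0 => /eqP->.
  by rewrite leq_eqVlt => /predU1P[->//|/IH]; exact: le_trans.
pose K := 2 * C * (60 * shi ^+ 4).
have K0 : 0 <= K.
  by apply: mulr_ge0; apply: mulr_ge0 => //; rewrite exprn_even_ge0.
(* With [a >= 1], hence [a <= a ^+ 4], this makes the loss [K / a ^+ 4] of [tight] at most
   [e / 2]. *)
pose a := 1 + 2 * K / e.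
have a1 : 1 <= a by rewrite lerDl; apply: divr_ge0; [exact: mulr_ge0|exact: ltW].
have a0 : 0 < a by exact: (lt_le_trans ltr01 a1).
have hK : K / a ^+ 4 <= e / 2.
  rewrite ler_pdivrMr ?exprn_gt0//; apply: (@le_trans _ _ (e / 2 * a)).
    rewrite /a mulrDr mulr1 (_ : e / 2 * (2 * K / e) = K); last by field; exact: lt0r_neq0.
    by rewrite lerDr divr_ge0// ltW.
  by rewrite ler_pM2l ?divr_gt0// ler_eXnr.
apply: contrapT => /forallNP hn.
have bad n : exists x, modulus (21 * a) x /\ e / 2 < F n x.
  apply: contrapT => /forallNP hx; apply: (hn n).
  have {}hx x : modulus (21 * a) x -> F n x <= e / 2.
    by move=> mx; rewrite leNgt; apply/negP => h; apply: (hx x).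
  have FCn x : `|F n x| <= C by rewrite ger0_norm.
  have e2 : 0 <= e / 2 by rewrite divr_ge0// ltW.
  have := tight slo0 slohi hL (cF n) C0 FCn a0 e2 hx.
  by rewrite mulrA -/K; move: hK; lra.
have [x hx] := choice bad.
have a21 : 0 <= 21 * a by rewrite mulr_ge0// ltW.
have mw := modulus_ulim a21 (fun n => (hx n).1).
have bx t : bounded_seq (fun n => x n t).
  by have [M hM] := modulus_bounded t a21; exists M => n; apply: hM; case: (hx n).
have [w hw] := path_of (modulus_cont a21 mw) mw.1.
have e8 : 0 < e / 8 by rewrite divr_gt0.
have [m hm] := Finf w _ e8.
have u1 := cyl_ulim (cF m) e8 bx (fun t => congr1 (fun f => f t) hw).
have u2 : ultra_nat [set n | (m <= n)%N].
  by have [_] := ultra_natP; apply; exists m.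
have [n /= [n1 mn]] := filter_ex (filterI u1 u2).
have := (hx n).2; have := Fmono _ _ (x n) mn; move: n1; rewrite ler_norml => /andP[_].
by move: hm e0; lra.
Qed.

Definition covers_by A r (F : nat -> (R -> R) -> R) :=
  [/\ forall n, cylf (F n), forall n x, 0 <= F n x, forall n x, F n x <= F n.+1 x,
      forall n, Lam (F n) <= r & forall w, A w -> exists n, 1 <= F n (pv w)].

Lemma covers_by_le A r (F : nat -> (R -> R) -> R) m n x : covers_by A r F -> (m <= n)%N -> F m x <= F n x.
Proof.
move=> [_ _ h _ _]; elim: n => [|n IH]; first by rewrite leqn0 => /eqP->.
by rewrite leq_eqVlt => /predU1P[->//|/IH/le_trans]; exact.
Qed.

(** Daniell's outer measure. Covers are increasing sequences rather than single functionals, which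
    gives countable subadditivity. *)
Definition omu A : \bar R := ereal_inf [set r%:E | r in [set r | exists F : nat -> (R -> R) -> R, covers_by A r F]].

Lemma omu_le A r (F : nat -> (R -> R) -> R) : covers_by A r F -> (omu A <= r%:E)%E.
Proof. by move=> h; apply: ereal_inf_lbound; exists r => //; exists F. Qed.

Lemma omu_le_cyl A h : cylf h -> (forall x, 0 <= h x) -> (forall w, A w -> 1 <= h (pv w)) ->
  (omu A <= (Lam h)%:E)%E.
Proof.
by move=> ch h0 hA; apply: (@omu_le _ _ (fun=> h)); split => // w /hA; exists 0%N.
Qed.

(** For a cover [F] of [A], the positive parts of [h - F n] decrease and become arbitrarily small
    along every path because [h] lies below the indicator of [A]; [daniell] then compares [Lam h]
    with the bound of the cover. *)
Lemma omu_ge_cyl A h C : cylf h -> (forall x, h x <= C) -> (forall w, h (pv w) <= (w \in A)%:R) ->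
  ((Lam h)%:E <= omu A)%E.
Proof.
move=> ch hC hA; apply: le_ereal_inf_tmp => _ [r [F hF] <-]; rewrite lee_fin.
have [cF F0 Fi Lr cov] := hF.
have cm n : cylf (fun x => h x - F n x) by exact: cylf_subr.
have cM n : cylf (fun x => Num.max (h x - F n x) 0) by apply: cylf_max => //; exact: cylf_cst.
apply/ler_addgt0Pr => e e0.
have [||||n hn] := @daniell (fun n x => Num.max (h x - F n x) 0) (Num.max C 0) cM _ _ _ _ e e0.
- move=> n x; by rewrite le_max lexx orbT.
- move=> n x; by rewrite ge_max !le_max lexx orbT !andbT; apply/orP; left; have := Fi n x; lra.
- move=> x; by rewrite ge_max !le_max lexx orbT !andbT; apply/orP; left; have := F0 0%N x; have := hC x; lra.
- move=> w d d0; have := hA w; have [wA|wA] := pselect (A w).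
    have [n hn] := cov w wA; rewrite mem_set// mulr1n => h1.
    by exists n; rewrite ge_max (ltW d0) andbT; move: hn d0 h1; lra.
  rewrite memNset// mulr0n => h0; exists 0%N; rewrite ge_max (ltW d0) andbT.
  by have := F0 0%N (pv w); move: h0 d0; lra.
apply: le_trans (lerD (Lr n) hn); rewrite -(dom_add hL)//.
apply: (dom_mono slo0 slohi hL) => // [|x]; first exact: cylf_add.
by rewrite -lerBlDl le_max lexx.
Qed.

Lemma covers_by_ge0 A r (F : nat -> (R -> R) -> R) : covers_by A r F -> 0 <= r.
Proof.
move=> [cF F0 _ Lr _]; apply: le_trans (Lr 0%N); exact: dom_ge0.
Qed.

Lemma omu_ge0 A : (0 <= omu A)%E.
Proof.
by apply: le_ereal_inf_tmp => _ [r [F hF] <-]; rewrite lee_fin (covers_by_ge0 hF).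
Qed.

Lemma omu_le1 A : (omu A <= 1)%E.
Proof.
have := @omu_le_cyl A (fun=> 1) (cylf_cst 1) (fun=> ler01).
by rewrite (dom_cst slo0 slohi hL); apply.
Qed.

Lemma omu_fin A : omu A \is a fin_num.
Proof. by rewrite ge0_fin_numE ?omu_ge0// (le_lt_trans (omu_le1 A)) ?ltry. Qed.

Lemma omu0 : omu set0 = 0%E.
Proof.
apply/eqP; rewrite eq_le omu_ge0 andbT.
have := @omu_le_cyl set0 (fun=> 0) (cylf_cst 0) (fun=> lexx 0).
by rewrite (dom_cst slo0 slohi hL); apply.
Qed.

Lemma omuS A A' : A `<=` A' -> (omu A <= omu A')%E.
Proof.
move=> AA'; apply: ereal_inf_le_tmp => _ [r [F [h1 h2 h3 h4 h5]] <-].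
by exists r => //; exists F; split=> // w /AA'/h5.
Qed.

Lemma omu_adherent A e : 0 < e -> exists r (F : nat -> (R -> R) -> R), covers_by A r F /\ (r%:E < omu A + e%:E)%E.
Proof.
move=> e0; have [_ [r [F hF] <-] hr] := lb_ereal_inf_adherent e0 (omu_fin A).
by exists r, F.
Qed.

Lemma omu_subadd : measure_extension.sigma_subadditive omu.
Proof.
move=> A; apply/lee_addgt0Pr => e e0.
apply: le_trans (epsilon_trick xpredT (fun n => omu_ge0 (A n)) (ltW e0)).
have ek k : 0 < e / (2 ^ k.+1)%:R by rewrite divr_gt0// ltr0n expn_gt0.
have [rF hrF] := choice (fun k => omu_adherent (A k) (ek k)).
have [F hF] := choice hrF.
set S := (X in (_ <= X)%E).
have S0 : (0 <= S)%E by apply: nneseries_ge0 => k _ _; rewrite adde_ge0 ?omu_ge0// lee_fin ltW.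
have sumS n : ((\sum_(k <- iota 0 n) rF k)%:E <= S)%E.
  apply: le_trans (@nneseries_lim_ge _ _ xpredT 0 n _); last first.
    by move=> k _ _; rewrite adde_ge0 ?omu_ge0// lee_fin ltW.
  rewrite -sumEFin /index_iota subn0; apply: lee_sum => k _.
  by apply: ltW; case: (hF k).
case E : S S0 sumS => [r| |] // _ sumS; last by rewrite leey.
(* Diagonal sums: the first [n] covers, each at stage [n], form one increasing sequence. *)
apply: (@omu_le _ _ (fun n x => \sum_(k <- iota 0 n) F k n x)).
have cF k n : cylf (F k n) by have [[]] := hF k.
have F0 k n x : 0 <= F k n x by have [[]] := hF k.
have Fi k n x : F k n x <= F k n.+1 x by have [[]] := hF k.
split=> [n|n x|n x|n|w [k _ Akw]].
- by apply: cylf_sum => k.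
- by apply: sumr_ge0 => k.
- rewrite -addn1 iotaD big_cat/= addn1 big_seq1 add0n.
  by rewrite -[leLHS]addr0; apply: lerD => //; exact: ler_sum.
- rewrite (dom_sum slo0 slohi hL)//; have := sumS n; rewrite lee_fin; apply: le_trans.
  by apply: ler_sum => k _; have [[]] := hF k.
- have [hFk _] := hF k; have [_ _ _ _ cov] := hFk; have [n hn] := cov w Akw.
  exists (maxn n k.+1); rewrite (big_rem k)/=; last by rewrite mem_iota /= add0n leq_maxr.
  apply: (le_trans hn); apply: (le_trans (covers_by_le _ hFk (leq_maxl n k.+1))).
  by rewrite lerDl sumr_ge0.
Qed.

Lemma omu_leU (A A' : set (Omega R)) : (omu (A `|` A') <= omu A + omu A')%E.
Proof.
apply/lee_addgt0Pr => e e0; have e2 : 0 < e / 2 by rewrite divr_gt0.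
have [r [F [[cF F0 Fi Fr cF1] hr]]] := omu_adherent A e2.
have [r' [F' [[cF' F0' Fi' Fr' cF1'] hr']]] := omu_adherent A' e2.
apply: (@le_trans _ _ (r + r')%:E); last first.
  rewrite EFinD; apply: le_trans (leeD (ltW hr) (ltW hr')) _.
  by rewrite addeACA -EFinD -splitr.
apply: (@omu_le _ _ (fun n x => F n x + F' n x)); split=> [n|n x|n x|n|w].
- exact: cylf_add.
- exact: addr_ge0.
- exact: lerD.
- by rewrite (dom_add hL)//; exact: lerD.
- move=> [/cF1[n hn]|/cF1'[n hn]]; exists n; rewrite (le_trans hn)//.
    by rewrite lerDl.
  by rewrite lerDr.
Qed.

(** A cover [F] of [X] is split with [h m], which increases to the indicator of [0 < g]: [F n * h n]
    covers the part of [X] inside, and [F n - F n * h m], with [m] fixed and [n >= m], the part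
    outside. *)
Lemma carath_pos g : cylf g -> (forall x, 0 <= g x) ->
  caratheodory_measurable omu [set w | 0 < g (pv w)].
Proof.
move=> cg g0 X; apply/eqP; rewrite eq_le; apply/andP; split.
  apply: le_trans (omu_leU _ _); apply: omuS => w Xw.
  by have [?|?] := pselect ([set w | 0 < g (pv w)] w); [left|right].
apply/lee_addgt0Pr => e e0; have e2 : 0 < e / 2 by rewrite divr_gt0.
have [r [F [hF hr]]] := omu_adherent X e2; have [cF F0 Fi Fr cov] := hF.
pose h (m : nat) x := Num.min 1 (m%:R * g x).
have ch m : cylf (h m) by apply: cylf_min; [exact: cylf_cst|exact: cylf_scale].
have h0 m x : 0 <= h m x by rewrite le_min ler01 mulr_ge0.
have h1 m x : h m x <= 1 by rewrite ge_min lexx.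
have hi m n x : (m <= n)%N -> h m x <= h n x.
  move=> mn; rewrite /h le_min ge_min lexx /= ge_min; apply/orP; right.
  by apply: ler_wpM2r => //; rewrite ler_nat.
have cFh n m : cylf (fun x => F n x * h m x) by exact: cylf_mul.
have Fhi n x : F n x * h n x <= F n.+1 x * h n.+1 x.
  by apply: ler_pM => //; exact: hi.
have Lle n : Lam (fun x => F n x * h n x) <= r.
  apply: le_trans (Fr n); apply: (dom_mono slo0 slohi hL) => // x.
  by rewrite -[leRHS]mulr1 ler_wpM2l.
(* [a] bounds the cost inside. Freezing [m] when [a] is reached up to [e / 2] leaves at most
   [r - a + e / 2] for the cost outside. *)
pose a := sup (range (fun n => Lam (fun x => F n x * h n x))).
have hs : has_sup (range (fun n => Lam (fun x => F n x * h n x))).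
  by split; [exists (Lam (fun x => F 0%N x * h 0%N x)); exists 0%N|exists r => _ [n _ <-]].
have La n : Lam (fun x => F n x * h n x) <= a by apply: (sup_upper_bound hs); exists n.
have [_ [m _ <-] hm] := sup_adherent e2 hs; rewrite -/a in hm.
have le1 : (omu (X `&` [set w | (0 < g (pv w))%R]) <= a%:E)%E.
  apply: (@omu_le _ _ (fun n x => F n x * h n x)); split=> // [n x|w [Xw gw]].
    by rewrite mulr_ge0.
  have [n hn] := cov w Xw; rewrite /= in gw.
  pose k := maxn n (Num.truncn (g (pv w))^-1).+1.
  exists k; rewrite (_ : h k _ = 1); last first.
    rewrite /h min_l// -ler_pdivrMr// mul1r; apply: ltW; apply: lt_le_trans (truncnS_gt _) _.
    by rewrite ler_nat leq_maxr.
  by rewrite mulr1; exact: (le_trans hn (covers_by_le _ hF (leq_maxl _ _))).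
have le2 : (omu (X `&` ~` [set w | (0 < g (pv w))%R]) <= (r - a + e / 2)%:E)%E.
  have cG n : cylf (fun x => F n x - F n x * h m x) by exact: cylf_subr.
  apply: (@omu_le _ _ (fun n x => F (maxn n m) x - F (maxn n m) x * h m x)).
  split=> [n|n x|n x|n|w [Xw gw]].
  - exact: cG.
  - by rewrite subr_ge0 -[leRHS]mulr1 ler_wpM2l.
  - rewrite -[X in X - _]mulr1 -[X in _ <= X - _]mulr1 -!mulrBr ler_wpM2r ?subr_ge0//.
    by apply: (covers_by_le _ hF); rewrite !geq_max !leq_max leqnn leqnSn !orbT.
  - rewrite (dom_sub hL)//.
    have := Fr (maxn n m).
    have : Lam (fun x => F m x * h m x) <= Lam (fun x => F (maxn n m) x * h m x).
      apply: (dom_mono slo0 slohi hL) => // x; apply: ler_wpM2r => //.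
      by apply: (covers_by_le _ hF); rewrite leq_maxr.
    by move: hm; lra.
  - have [n hn] := cov w Xw; exists n; rewrite (_ : h m (pv w) = 0); last first.
      rewrite /h (_ : g (pv w) = 0) ?mulr0 ?min_r//; apply/eqP; rewrite eq_le g0 andbT.
      by rewrite leNgt; apply/negP.
    by rewrite mulr0 subr0; exact: (le_trans hn (covers_by_le _ hF (leq_maxl _ _))).
apply: le_trans (leeD le1 le2) _; rewrite -EFinD.
have -> : (a + (r - a + e / 2))%R = (r + e / 2)%R by ring.
rewrite EFinD; apply: le_trans (leeD (ltW hr) (lexx _)) _.
by rewrite -addeA -EFinD -splitr.
Qed.

(** A layer-cake argument: [N * g] is the sum of [N] slices; each slice lies below the indicator of
    its support, which in turn lies below the corresponding slice of [N * g + 1]. The error is 1 for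
    [N * g] and vanishes after division by [N]. *)
Lemma slice_le (P : probability (Omega R) R) : (forall A h, measurable A -> cylf h -> (forall x, 0 <= h x <= 1) ->
    (forall w, h (pv w) <= (w \in A)%:R) -> Lam h <= fine (P A)) ->
  forall g, cylf g -> (forall x, 0 <= g x <= 1) ->
  Lam g <= (\int[P]_w g (pv w))%R.
Proof.
move=> hP g cg g01.
have main (N : nat) : N%:R * Lam g <= N%:R * (\int[P]_w g (pv w))%R + 1.
  pose h i x := clamp (N%:R * g x - i%:R).
  have ch i : cylf (h i).
    apply: cylf_min (cylf_cst 1); apply: cylf_max (cylf_cst 0).
    by apply: cylf_subr (cylf_cst _); exact: cylf_scale.
  have h01 i x : 0 <= h i x <= 1.
    by rewrite /h /clamp le_min ler01 le_max lexx !orbT ge_min lexx orbT.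
  pose A i := [set w : Omega R | 0 < h i (pv w)].
  have mA i : measurable (A i).
    have := cylf_measurable (ch i) measurableT (measurable_itv `]0, +oo[).
    rewrite setTI; congr measurable; apply/seteqP; split=> w /=; by rewrite in_itv/= andbT.
  have hA i w : h i (pv w) <= (w \in A i)%:R.
    have [wA|wA] := pselect (A i w); first by rewrite mem_set// mulr1n; case/andP: (h01 i (pv w)).
    by rewrite memNset// mulr0n leNgt; apply/negP.
  have -> : N%:R * Lam g = \sum_(i <- iota 0 N) Lam (h i).
    rewrite -(dom_scale hL)// -(dom_sum slo0 slohi hL)//; congr Lam; apply/funext => x.
    have /andP[gx0 gx1] := g01 x.
    have := sum_clamp N (N%:R * g x); rewrite -(big_mkord xpredT (fun i => clamp (N%:R * g x - i%:R))).
    rewrite /index_iota subn0 => ->; rewrite max_l ?mulr_ge0// min_l//.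
    by rewrite -[leRHS]mulr1 ler_wpM2l.
  have bA i : bmf (\1_(A i) : Omega R -> R) := bmf_indic R (mA i).
  apply: (@le_trans _ _ (\int[P]_w (\sum_(i <- iota 0 N) \1_(A i) w))%R).
    elim: (iota 0 N) => [|i r IH].
      rewrite big_nil; apply: Rintegral_ge0 => w _; by rewrite big_nil.
    rewrite big_cons.
    have -> : (fun w => \sum_(j <- i :: r) \1_(A j) w) =
        (fun w => \1_(A i) w + \sum_(j <- r) \1_(A j) w : R).
      by apply/funext => w; rewrite big_cons.
    rewrite RintegralD//; [|exact/bmf_integrable|exact/bmf_integrable/bmf_sum].
    apply: lerD => //; apply: le_trans (hP _ _ (mA i) (ch i) (h01 i) (hA i)) _.
    by rewrite /Rintegral integral_indic// setIT.
  have bg := bmf_scale N%:R (cylf_bmf cg).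
  rewrite -(RintegralZl _ _ _)//; last exact/bmf_integrable/cylf_bmf.
  have one : (\int[P]_w (cst 1 w))%R = 1 :> R.
    by rewrite Rintegral_cst// mul1r; exact: (congr1 fine (probability_setT P)).
  rewrite -[X in _ + X]one -RintegralD//; [|exact/bmf_integrable|exact/bmf_integrable/bmf_cst].
  apply: le_Rintegral => //.
  - exact/bmf_integrable/bmf_sum.
  - exact/bmf_integrable/bmf_add/bmf_cst.
  move=> w _ /=; have /andP[gx0 gx1] := g01 (pv w).
  apply: (@le_trans _ _ (\sum_(i <- iota 0 N) clamp (N%:R * g (pv w) + 1 - i%:R))); last first.
    have := sum_clamp N (N%:R * g (pv w) + 1).
    rewrite -(big_mkord xpredT (fun i => clamp (N%:R * g (pv w) + 1 - i%:R))).
    rewrite /index_iota subn0 => ->; rewrite max_l ?ge_min ?lexx//.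
    by rewrite addr_ge0// mulr_ge0.
  apply: ler_sum => i _; rewrite indicE.
  have [wA|wA] := pselect (A i w); last first.
    by rewrite memNset// /clamp le_min le_max lexx orbT ler01.
  rewrite mem_set// mulr1n /clamp le_min lexx andbT le_max; apply/orP; left.
  move: wA; rewrite /A /= /h /clamp lt_min lt_max ltxx orbF => /andP[+ _]; lra.
rewrite -subr_ge0 leNgt; apply/negP; set D := _ - _ => D0.
have := main (Num.truncn (- D)^-1).+1; apply/negP; rewrite -ltNge -ltrBrDl -mulrBr.
rewrite -opprB -/D -ltr_pdivrMr ?oppr_gt0// mul1r; exact: truncnS_gt.
Qed.

Lemma rep_eq (P : probability (Omega R) R) : (forall A h, measurable A -> cylf h -> (forall x, 0 <= h x <= 1) ->
    (forall w, h (pv w) <= (w \in A)%:R) -> Lam h <= fine (P A)) ->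
  forall F, cylf F -> (\int[P]_w (F (pv w))%:E = (Lam F)%:E)%E.
Proof.
move=> hP F cF; rewrite bmf_EFin; last exact: cylf_bmf.
have [ts [_ [C0 [_ [hC0 _]]]]] := cF.
pose C := Num.max C0 1; have hC x : `|F x| <= C by rewrite le_max hC0.
have C1 : 0 < C by rewrite lt_max ltr01 orbT.
(* An affine map brings [k * F] into [[0, 1]]; the signs [k = 1] and [k = -1] give the two
   inequalities. *)
have key k : `|k| <= 1 -> k * Lam F <= k * (\int[P]_w F (pv w))%R.
  move=> k1; pose g x := (2 * C)^-1 * (k * F x) + 2^-1.
  have cg : cylf g by apply: cylf_add (cylf_cst _); do 2 apply: cylf_scale.
  have g01 x : 0 <= g x <= 1.
    have : `|k * F x| <= C.
      rewrite normrM -[leRHS]mul1r; exact: ler_pM.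
    rewrite /g invfM ler_norml => /andP[h1 h2].
    have := ler_pM2l (_ : 0 < C^-1) ; rewrite invr_gt0 => /(_ C1) hm.
    move: h1 h2; rewrite -(hm (- C)) -(hm (k * F x)) mulrN mulVf ?lt0r_neq0// -mulrA.
    by move=> *; apply/andP; split; lra.
  have := slice_le hP cg g01; rewrite (dom_add hL); [|by do 2 apply: cylf_scale|exact: cylf_cst].
  rewrite (dom_cst slo0 slohi hL) (dom_scale hL); last exact: cylf_scale.
  rewrite (dom_scale hL)// RintegralD//; first last.
  - exact/bmf_integrable/bmf_cst.
  - exact/bmf_integrable/bmf_scale/bmf_scale/cylf_bmf.
  rewrite RintegralZl//; last exact/bmf_integrable/bmf_scale/cylf_bmf.
  rewrite RintegralZl//; last exact/bmf_integrable/cylf_bmf.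
  rewrite Rintegral_cst// (_ : fine _ = 1) ?(congr1 fine (probability_setT P))//.
  have C2 : 0 < (2 * C)^-1 by rewrite invr_gt0 mulr_gt0.
  by rewrite mulr1 lerD2r (ler_pM2l C2).
congr EFin; apply/eqP; rewrite eq_le; apply/andP; split.
  by have := key (-1); rewrite normrN1 lexx !mulN1r lerN2; exact.
by have := key 1; rewrite normr1 lexx !mul1r; exact.
Qed.

Lemma rep_probability : exists P : probability (Omega R) R,
  forall F, cylf F -> (\int[P]_w (F (pv w))%:E = (Lam F)%:E)%E.
Proof.
pose mo := isOuterMeasure.Build R (Omega R) omu omu0 omu_ge0 omuS omu_subadd.
pose mu : {outer_measure set (Omega R) -> \bar R} := HB.pack omu mo.
have borel A : measurable A -> caratheodory_measurable omu A.
  move=> mA; apply: (Borel_gen (S := caratheodory_measurable mu)) => //.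
    split; first exact: caratheodory_measurable_set0.
    - by move=> D hD; rewrite setTD; exact: caratheodory_measurable_setC.
    - exact: caratheodory_measurable_bigcup.
  move=> q c r q0; pose g x := Num.max 0 (Num.min 1 (`|x q - c| - r)).
  have cg : cylf g.
    apply: (cylf_val q0 (f := fun y => Num.max 0 (Num.min 1 (`|y - c| - r)))).
    exists 1, 1; split=> [y|y z].
      rewrite ger0_norm ?le_max ?lexx// ge_max ler01 ge_min lexx; exact: isT.
    have : `| `|y - c| - `|z - c| | <= `|y - z|.
      by apply: le_trans (ler_dist_dist _ _) _; rewrite opprB addrA subrK.
    rewrite mul1r; set p := `|y - c|; set p' := `|z - c|; rewrite !ler_norml => /andP[h1 h2].
    have := normr_ge0 (y - z).
    have [|] := leP 1 (p - r); have [|] := leP 1 (p' - r);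
      have [|] := leP 0 (p - r); have [|] := leP 0 (p' - r);
      rewrite ?(max_r ler01) => *; apply/andP; split; lra.
  have h : (forall x, 0 <= g x) -> _ := carath_pos cg.
  have -> : [set w | `|B q w - c| <= r] = ~` [set w | 0 < g (pv w)].
    apply/seteqP; split => w /=; rewrite /g lt_max ltxx /= lt_min ltr01 subr_gt0 /= /pv.
      by move=> hr; apply/negP; rewrite -leNgt.
    by move/negP; rewrite -leNgt.
  by apply: caratheodory_measurable_setC; apply: h => x; rewrite /g le_max lexx.
have P0 : omu set0 = 0%E := omu0.
have Psig : semi_sigma_additive omu.
  move=> F mF tF mUF; apply: (@caratheodory_measure_sigma_additive R (Omega R) mu) => //.
  - by move=> i; exact: borel.
  - exact: borel.
have PT : omu setT = 1%E.
  apply/eqP; rewrite eq_le omu_le1/=.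
  have := @omu_ge_cyl setT (fun=> 1) 1 (cylf_cst 1) (fun=> lexx _).
  by rewrite (dom_cst slo0 slohi hL); apply => w; rewrite in_setT.
pose P1 := isMeasure.Build _ _ _ omu P0 omu_ge0 Psig.
have [P2 hP2] : exists P2 : {measure set (Omega R) -> \bar R}, forall A, P2 A = omu A.
  by exists (HB.pack_for {measure set (Omega R) -> \bar R} omu P1).
(* The total mass is 1, so normalization leaves the measure unchanged and turns it into a
   probability. *)
pose P : probability (Omega R) R := mnormalize P2 (dirac point).
have hP A : P A = omu A.
  by rewrite /P /= /mnormalize hP2 PT /= onee_eq0 /= hP2 invr1 mule1.
exists P; apply: rep_eq => A h mA ch h01 hA.
rewrite -lee_fin hP fineK ?omu_fin//; apply: (omu_ge_cyl ch (C := 1)) => // x.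
by case/andP: (h01 x).
Qed.

End representation.

(** * A dominated linear functional touching a sublinear one *)

Section sublinear.
Variable R : realType.
Implicit Types (F G h : (R -> R) -> R) (q p : ((R -> R) -> R) -> R).

Record sublin q : Prop := Sublin {
  sl_add : forall F G, cylf F -> cylf G -> q (fun x => F x + G x) <= q F + q G ;
  sl_scale : forall k F, 0 <= k -> cylf F -> q (fun x => k * F x) = k * q F }.

Lemma sublin_eq0 q F : sublin q -> (forall x, F x = 0) -> q F = 0.
Proof.
move=> sq F0; have -> : F = fun x => 0 * cst 0 x by apply/funext => x; rewrite mul0r F0.
by rewrite (sl_scale sq)// ?mul0r//; exact: cylf_cst.
Qed.

Lemma sublin_opp q F : sublin q -> cylf F -> - q (fun x => -1 * F x) <= q F.
Proof.
move=> sq cF; rewrite -subr_ge0 opprK -(@sublin_eq0 q (fun x => F x + -1 * F x)) //.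
  by apply: (sl_add sq) => //; exact: cylf_scale.
by move=> x; rewrite mulN1r subrr.
Qed.

(** A sublinear functional below [q] whose value at [- h] is at most [- q h]. A linear functional
    below it must therefore take the value [q h] at [h]. *)
Definition tilt q h F : R :=
  inf [set q (fun x => F x + t * h x) - t * q h | t in [set t : R | 0 <= t]].

Section tilt.
Variables (q : ((R -> R) -> R) -> R) (h : (R -> R) -> R).
Hypotheses (sq : sublin q) (ch : cylf h).

Lemma tilt_lb F t : cylf F -> 0 <= t -> - q (fun x => -1 * F x) <= q (fun x => F x + t * h x) - t * q h.
Proof.
move=> cF t0; rewrite lerBrDl lerBlDr -(sl_scale sq)//.
have -> : (fun x => t * h x) = (fun x => (F x + t * h x) + -1 * F x).
  by apply/funext => x; ring.
apply: (sl_add sq); last exact: cylf_scale.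
by apply: cylf_add => //; exact: cylf_scale.
Qed.

Lemma tilt_le F t : cylf F -> 0 <= t -> tilt q h F <= q (fun x => F x + t * h x) - t * q h.
Proof.
move=> cF t0; apply: ge_inf; last by exists t.
by exists (- q (fun x => -1 * F x)) => _ [s s0 <-]; exact: tilt_lb.
Qed.

Lemma tilt_ge F c : (forall t, 0 <= t -> c <= q (fun x => F x + t * h x) - t * q h) ->
  c <= tilt q h F.
Proof.
move=> hc; apply: lb_le_inf; last by move=> _ [t t0 <-]; exact: hc.
by exists (q (fun x => F x + 0 * h x) - 0 * q h), 0 => //=.
Qed.

Lemma tilt_sublin : sublin (tilt q h).
Proof.
split=> [F G cF cG|k F k0 cF].
  rewrite -lerBlDr; apply: tilt_ge => t t0; rewrite lerBlDr addrC -lerBlDr.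
  apply: tilt_ge => s s0; rewrite lerBlDr.
  have ct : cylf (fun x => F x + t * h x) by apply: cylf_add => //; exact: cylf_scale.
  have cs : cylf (fun x => G x + s * h x) by apply: cylf_add => //; exact: cylf_scale.
  have ts0 : 0 <= t + s by exact: addr_ge0.
  apply: le_trans (tilt_le (cylf_add cF cG) ts0) _.
  have := sl_add sq ct cs.
  have -> : (fun x => F x + t * h x + (G x + s * h x)) = (fun x => F x + G x + (t + s) * h x).
    by apply/funext => x; ring.
  lra.
have ckF : cylf (fun x => k * F x) by exact: cylf_scale.
apply/eqP; rewrite eq_le; apply/andP; split.
  move: k0; rewrite [0 <= k]le_eqVlt => /predU1P[k0|k0].
    rewrite -k0 mul0r; apply: le_trans (tilt_le _ (lexx 0)) _.
      exact: cylf_scale.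
    by rewrite mul0r subr0 (sublin_eq0 sq)// => x; rewrite !mul0r addr0.
  rewrite mulrC -ler_pdivrMr//; apply: tilt_ge => t t0; rewrite ler_pdivrMr//.
  have kt : 0 <= k * t by rewrite mulr_ge0// ltW.
  apply: le_trans (tilt_le ckF kt) _.
  have -> : (fun x => k * F x + k * t * h x) = (fun x => k * (F x + t * h x)).
    by apply/funext => x; ring.
  rewrite (sl_scale sq) ?(ltW k0)//; first by apply: eq_ler; ring.
  by apply: cylf_add => //; exact: cylf_scale.
apply: tilt_ge => t t0; move: k0; rewrite [0 <= k]le_eqVlt => /predU1P[<-|k0].
  rewrite mul0r -(sl_scale sq)// (_ : (fun x => 0 * F x + t * h x) = (fun x => t * h x)) ?subrr//.
  by apply/funext => x; rewrite mul0r add0r.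
have tk : 0 <= t / k by rewrite divr_ge0// ltW.
have := ler_wpM2l (ltW k0) (tilt_le cF tk); rewrite mulrBr mulrA mulrCA divff ?lt0r_neq0// mulr1.
have ct : cylf (fun x => F x + t / k * h x) by apply: cylf_add => //; exact: cylf_scale.
rewrite -(sl_scale sq (ltW k0) ct) (_ : (fun x => k * (F x + t / k * h x)) = (fun x => k * F x + t * h x))//.
by apply/funext => x; field; exact: lt0r_neq0.
Qed.

Lemma tilt_le0 F : cylf F -> tilt q h F <= q F.
Proof.
move=> cF; apply: le_trans (tilt_le cF (lexx 0)) _; rewrite mul0r subr0.
by rewrite (_ : (fun x => _) = F)//; apply/funext => x; rewrite mul0r addr0.
Qed.

End tilt.

(** Zorn's lemma gives a minimal sublinear functional below [tilt p F0]. It lies below each of its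
    own tilts, and the term [t = 1] of the tilt makes it additive; being below [tilt p F0] fixes its
    value at [F0]. *)
Lemma hahn_banach p F0 : sublin p -> cylf F0 ->
  exists Lam : ((R -> R) -> R) -> R,
  [/\ forall F G, cylf F -> cylf G -> Lam (fun x => F x + G x) = Lam F + Lam G,
      forall k F, cylf F -> Lam (fun x => k * F x) = k * Lam F,
      forall F, cylf F -> Lam F <= p F & Lam F0 = p F0].
Proof.
move=> sp cF0; have sp0 := tilt_sublin sp cF0; set p0 := tilt p F0 in sp0.
pose T := {q | sublin q /\ forall F, cylf F -> q F <= p0 F}.
pose t0 : T := exist _ p0 (conj sp0 (fun F _ => lexx _)).
pose Rl (a b : T) := `[< forall F, cylf F -> sval b F <= sval a F >].
have [|||[q [sq qp0]] qmin] := @ZL_preorder T t0 Rl.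
- by move=> a; apply/asboolP.
- move=> b a c /asboolP ab /asboolP bc; apply/asboolP => F cF.
  exact: le_trans (bc _ cF) (ab _ cF).
- move=> A tA; have [[a0 Aa0]|nA] := pselect (exists a, A a); last first.
    by exists t0 => s As; exfalso; apply: nA; exists s.
  pose m F := inf [set sval a F | a in A].
  have lb F : cylf F -> has_lbound [set sval a F | a in A].
    move=> cF; exists (- p0 (fun x => -1 * F x)) => _ [a Aa <-].
    have [sa ap] := svalP a; apply: le_trans (sublin_opp sa cF).
    by rewrite lerN2 ap//; exact: cylf_scale.
  have mle F a : cylf F -> A a -> m F <= sval a F.
    by move=> cF Aa; apply: ge_inf; [exact: lb|exists a].
  have mge F c : (forall a, A a -> c <= sval a F) -> c <= m F.
    by move=> hc; apply: lb_le_inf; [exists (sval a0 F), a0|move=> _ [a Aa <-]; exact: hc].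
  have sm : sublin m.
    split=> [F G cF cG|k F k0 cF].
      have cFG := cylf_add cF cG.
      rewrite -lerBlDr; apply: (mge _ _ _) => a Aa; rewrite lerBlDr addrC -lerBlDr.
      apply: (mge _ _ _) => b Ab; rewrite lerBlDr.
      have [sa _] := svalP a; have [sb _] := svalP b.
      have [/asboolP ab|/asboolP ba] := tA _ _ Aa Ab.
        apply: le_trans (mle _ _ cFG Ab) _; apply: le_trans (sl_add sb cF cG) _.
        by rewrite addrC lerD2l ab.
      apply: le_trans (mle _ _ cFG Aa) _; apply: le_trans (sl_add sa cF cG) _.
      by rewrite addrC lerD2r ba.
    have ckF : cylf (fun x => k * F x) by exact: cylf_scale.
    have [sa0 _] := svalP a0.
    apply/eqP; rewrite eq_le; apply/andP; split.
      move: k0; rewrite [0 <= k]le_eqVlt => /predU1P[k0|k0].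
        apply: le_trans (mle _ _ ckF Aa0) _.
        by rewrite -k0 mul0r (sublin_eq0 sa0)// => x; rewrite mul0r.
      rewrite mulrC -ler_pdivrMr//; apply: (mge _ _ _) => a Aa; rewrite ler_pdivrMr// mulrC.
      have [sa _] := svalP a; rewrite -(sl_scale sa) ?(ltW k0)//; exact: mle.
    apply: (mge _ _ _) => a Aa; have [sa _] := svalP a; rewrite (sl_scale sa)//.
    by rewrite ler_wpM2l// mle.
  have mp F : cylf F -> m F <= p0 F.
    by move=> cF; apply: le_trans (mle _ _ cF Aa0) _; have [_] := svalP a0; apply.
  exists (exist _ m (conj sm mp)) => a Aa; apply/asboolP => F cF /=; exact: mle.
have addq F h : cylf F -> cylf h -> q (fun x => F x + h x) = q F + q h.
  move=> cF ch; apply/eqP; rewrite eq_le (sl_add sq)//=.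
  have st := tilt_sublin sq ch.
  have tp G : cylf G -> tilt q h G <= p0 G.
    by move=> cG; apply: le_trans (tilt_le0 sq ch cG) (qp0 _ cG).
  have := qmin (exist _ (tilt q h) (conj st tp)).
  have -> : Rl (exist _ q (conj sq qp0)) (exist _ (tilt q h) (conj st tp)).
    by apply/asboolP => G cG /=; exact: tilt_le0.
  move=> /(_ isT)/asboolP /(_ F cF) /= h1.
  have := le_trans h1 (tilt_le sq ch cF ler01); rewrite mul1r lerBrDr.
  by congr (_ <= q _); apply/funext => x; rewrite mul1r.
have oppq F : cylf F -> q (fun x => -1 * F x) = - q F.
  move=> cF; apply/eqP; rewrite -addr_eq0 -addq//; last exact: cylf_scale.
  by apply/eqP/(sublin_eq0 sq) => x; rewrite mulN1r addNr.
have scq k F : cylf F -> q (fun x => k * F x) = k * q F.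
  move=> cF; have [k0|/ltW k0] := leP 0 k; first exact: (sl_scale sq).
  rewrite -[k]opprK mulNr -(sl_scale sq) ?oppr_ge0// -oppq; last exact: cylf_scale.
  by congr q; apply/funext => x; ring.
exists q; split=> // [F cF|].
  by apply: le_trans (qp0 _ cF) _; exact: (tilt_le0 sp cF0 cF).
apply/eqP; rewrite eq_le; apply/andP; split.
  by apply: le_trans (qp0 _ cF0) _; exact: (tilt_le0 sp cF0 cF0).
have cN : cylf (fun x => -1 * F0 x) by exact: cylf_scale.
have := le_trans (qp0 _ cN) (tilt_le sp cF0 cN ler01).
rewrite oppq// mul1r (sublin_eq0 sp (F := fun x => _)) ?sub0r ?lerN2//.
by move=> x; rewrite mulN1r mul1r addNr.
Qed.

End sublinear.

(** * Cylinder functionals and the backward recursion *)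

Section row_functions.
Variable R : realType.
Implicit Types (m : nat) (t r z a c C L : R) (ts g : seq R) (x y : R -> R).

Lemma row_norm_le m (v : 'rV[R]_m) c : 0 <= c -> (forall i, `|v 0 i| <= c) -> `|v| <= c.
Proof.
move=> c0 hv; rewrite /Num.norm /= mx_normrE; apply: bigmax_le => // -[i j] _ /=.
by rewrite ord1.
Qed.

Lemma row_norm_ge m (v : 'rV[R]_m) i : `|v 0 i| <= `|v|.
Proof.
rewrite [leRHS]/Num.norm /= mx_normrE.
exact: (le_bigmax 0 (fun ij : 'I_1 * 'I_m => `|v ij.1 ij.2|) (0, i)).
Qed.

Lemma bounded_lipschitzP m (phi : 'rV[R]_m.+1 -> R) : bounded_lipschitz phi <->
  exists C L, (forall v, `|phi v| <= C) /\ forall u v, `|phi u - phi v| <= L * `|u - v|.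
Proof.
split=> [[[C [_ hC]] [L [_ hL]]]|[C [L [hC hL]]]].
  exists (C + 1), (L + 1); split=> [v|u v]; first by apply: hC => //; rewrite ltrDl.
  by apply: (hL (L + 1) _ (u, v)) => //; rewrite ltrDl.
split.
  by exists C; split; [exact: num_real|move=> M CM v _; exact: le_trans (hC v) (ltW CM)].
exists L; split; first exact: num_real.
move=> M LM [u v] _ /=; apply: le_trans (hL u v) _; apply: ler_wpM2r => //; exact: ltW.
Qed.

Definition incr a ts x : seq R := pairmap (fun s t => x t - x s) a ts.

Lemma incr_ext a ts x y : {in a :: ts, x =1 y} -> incr a ts x = incr a ts y.
Proof.
rewrite /incr; elim: ts a => [//|t ts IH] a h /=; rewrite IH; last first.
  by move=> r rt; apply: h; rewrite inE rt orbT.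
by rewrite !h// !inE eqxx ?orbT.
Qed.

Definition Fphi m ts (phi : 'rV[R]_m -> R) x := phi (row_of_seq m (incr 0 ts x)).

Lemma term_le_sum (s : seq R) (f : R -> R) t : (forall r, 0 <= f r) -> t \in s ->
  f t <= \sum_(r <- s) f r.
Proof. by move=> f0 ts; rewrite (big_rem t)//= lerDl sumr_ge0. Qed.

Lemma cyl_Fphi m ts (phi : 'rV[R]_m.+1 -> R) : size ts = m.+1 -> bounded_lipschitz phi ->
  cyl (0 :: ts) (Fphi ts phi).
Proof.
move=> sz /bounded_lipschitzP[C [L [hC hL]]]; exists C, (`|L| * 2); split=> [x|x y]; first exact: hC.
apply: le_trans (hL _ _) _.
apply: (@le_trans _ _ (`|L| * `|row_of_seq m.+1 (incr 0 ts x) - row_of_seq m.+1 (incr 0 ts y)|)).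
  by apply: ler_wpM2r => //; exact: ler_norm.
rewrite -mulrA; apply: ler_wpM2l => //; set S := \sum_(_ <- _) _.
have S0 : 0 <= S by exact: sumr_ge0.
apply: row_norm_le; first by rewrite mulr_ge0.
move=> i; rewrite !mxE /incr !(nth_pairmap 0)// ?sz//.
set a := nth 0 (0 :: ts) i; set b := nth 0 ts i.
have i1 : (i < size ts)%N by rewrite sz.
have ha : a \in 0 :: ts by apply: mem_nth; rewrite /= ltnS ltnW.
have hb : b \in 0 :: ts by rewrite inE mem_nth ?orbT.
have f0 r : 0 <= `|x r - y r| by [].
have h1 := term_le_sum f0 ha; have h2 := term_le_sum f0 hb; rewrite -/S in h1 h2.
rewrite (_ : _ - _ = (x b - y b) - (x a - y a)); last by ring.
by apply: le_trans (ler_normB _ _) _; lra.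
Qed.

Lemma path_lt_mem s pre t suf : path <%R s (pre ++ t :: suf) -> forall r, r \in s :: pre -> r < t.
Proof.
elim: pre s => [|p pre IH] s /= /andP[sp hp] r; first by rewrite inE => /eqP->.
rewrite inE => /predU1P[->|]; last exact: IH.
by apply: lt_trans sp _; apply: (IH p hp); rewrite inE eqxx.
Qed.

Lemma path_le_last s pre r : path <%R s pre -> r \in s :: pre -> r <= last s pre.
Proof.
elim: pre s r => [|p pre IH] s r /=; first by rewrite inE => _ /eqP->.
move=> /andP[sp hp]; rewrite inE => /predU1P[->|]; last exact: IH.
by apply: (le_trans (ltW sp)); apply: (IH p p hp); rewrite inE eqxx.
Qed.

Definition recon m g (v : 'rV[R]_m) r : R :=
  \sum_(i < m) (if nth 0 g i <= r then v 0 i else 0).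

Lemma sum_incr a g x r : path <%R a g -> r \in a :: g ->
  \sum_(i < size g) (if nth 0 g i <= r then nth 0 (incr a g x) i else 0) = x r - x a.
Proof.
rewrite /incr; elim: g a => [|b g IH] a /=.
  by rewrite inE => _ /eqP->; rewrite big_ord0 subrr.
move=> /andP[ab pg] rg; rewrite big_ord_recl /=.
have [br|rb] := leP b r.
  have rbg : r \in b :: g.
    by move: rg; rewrite inE => /predU1P[E|//]; move: (lt_le_trans ab br); rewrite E ltxx.
  have := IH b pg rbg => E; rewrite (eq_bigr (fun i : 'I_(size g) =>
    if nth 0 g i <= r then nth 0 (pairmap (fun s t => x t - x s) b g) i else 0)) ?E//.
  by rewrite addrC addrA subrK.
have ra : r = a.
  move: rg; rewrite inE => /predU1P[//|]; rewrite inE => /predU1P[E|rg].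
    by move: rb; rewrite E ltxx.
  by have := path_gt pg rg; rewrite ltNge (ltW rb).
rewrite add0r ra subrr big1// => i _ /=; rewrite leNgt.
have -> // : a < nth 0 g i by apply: lt_trans ab _; apply: (path_gt pg); exact: mem_nth.
Qed.

End row_functions.

(** * From increments to positions *)

Section link.
Variables (R : realType) (slo shi : R).
Hypotheses (slo0 : 0 <= slo) (slohi : slo <= shi).
Implicit Types (F G : (R -> R) -> R) (x y : R -> R) (ts g : seq R) (s t r z C L : R).

(** Increments and positions differ by a translation by [x (last 0 pre)], which commutes with the
    semigroup; [GheatE] replaces the chosen viscosity solution by the semigroup. *)
Lemma backward_Eb (f : seq R -> R) pre suf x :
  path <%R 0 (pre ++ suf) -> cyl (0 :: (pre ++ suf)) (fun y => f (incr 0 (pre ++ suf) y)) ->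
  backward slo shi f (pairmap (fun s t => t - s) (last 0 pre) suf) (incr 0 pre x) =
  Eb slo shi (last 0 pre) suf (fun y => f (incr 0 (pre ++ suf) y)) x.
Proof.
elim: suf pre x => [|t suf IH] pre x pp cF; first by rewrite /= cats0.
have lt_t := path_lt_mem pp.
have lt_last : last 0 pre < t by apply: lt_t; exact: mem_last.
rewrite -cat_rcons in pp cF *; set F := (fun y => _) in cF *.
have pt : path <%R t suf.
  by move: pp; rewrite cat_path last_rcons => /andP[].
have key (y : R) : backward slo shi f (pairmap (fun s t => t - s) t suf) (rcons (incr 0 pre x) y) =
    Eb slo shi t suf F (splice t (y + x (last 0 pre)) x).
  have := IH (rcons pre t) (splice t (y + x (last 0 pre)) x) pp cF.
  rewrite last_rcons => <-; congr backward.
  rewrite /incr -[rcons pre t]cats1 pairmap_cat /= cats1; congr rcons; last first.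
    by rewrite splice_ge// splice_lt// addrK.
  by apply: incr_ext => r rp; rewrite splice_lt//; exact: lt_t.
rewrite /=; under [X in Gheat _ _ X]eq_fun do rewrite key.
have bg := Eb_bl slo0 slohi x pt cF.
rewrite (GheatE slo0 slohi) ?subr_ge0 ?(ltW lt_last)//; last first.
  exact: (bl_shift (x (last 0 pre)) bg).
have hS := Ssg_step slo0 slohi (sub_ge0 lt_last).
by rewrite (step_shift hS _ bg) add0r.
Qed.

Lemma backward_EE m (ts : m.+1.-tuple R) (phi : 'rV[R]_m.+1 -> R) j x : path <%R 0 ts ->
  bounded_lipschitz phi -> (j <= m.+1)%N ->
  backward slo shi (phi \o row_of_seq m.+1) (drop j (steps ts)) (take j (incr 0 ts x)) =
  EE slo shi (nth 0 (0 :: tval ts) j) (Fphi ts phi) x.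
Proof.
move=> pt bp jm; have sz : size ts = m.+1 by rewrite size_tuple.
have cF := cyl_Fphi sz bp.
have E : take j ts ++ drop j ts = tval ts by exact: cat_take_drop.
have sj : size (take j ts) = j by rewrite size_takel ?sz.
have lj : last 0 (take j ts) = nth 0 (0 :: tval ts) j.
  rewrite (last_nth 0) sj; case: j jm E sj => [//|j] jm E sj /=.
  by rewrite nth_take.
have := @backward_Eb (phi \o row_of_seq m.+1) (take j ts) (drop j ts) x.
rewrite E => /(_ pt cF); rewrite -/(Fphi _ _).
have -> : drop j (steps ts) = pairmap (fun s t => t - s) (last 0 (take j ts)) (drop j ts).
  rewrite /steps -{1}E pairmap_cat drop_size_cat// size_pairmap//.
have -> : take j (incr 0 ts x) = incr 0 (take j ts) x.
  by rewrite /incr -{1}E pairmap_cat take_size_cat// size_pairmap.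
move=> ->; rewrite lj; symmetry; apply: (EEE slo0 slohi x cF).
- by move: pt; rewrite -{1}E cat_path lj => /andP[].
- move=> r; rewrite -[X in r \in 0 :: X]E -cat_cons mem_cat => /orP[rp|rd]; [left|by right].
  rewrite -lj; apply: path_le_last rp.
  by move: pt; rewrite -{1}E cat_path => /andP[].
Qed.

(** Functions of increments do not see [x 0]. Subtracting it makes [F] such a function and changes
    nothing on paths, which start at 0. *)
Definition base F x := F (fun r => x r - x 0).

Lemma base_pv F (w : Omega R) : base F (pv w) = F (pv w).
Proof.
by rewrite /base; congr F; apply/funext => r; rewrite (pv_le0 w (lexx 0)) subr0.
Qed.

Lemma cyl_base ts F : cyl ts F -> cyl (0 :: ts) (base F).
Proof.
move=> /cylP[C [L [C0 L0 hC hL]]]; exists C, (L * (1 + (size ts)%:R)); split=> [x|x y]; first exact: hC.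
apply: le_trans (hL _ _) _; rewrite -mulrA; apply: ler_wpM2l => //.
rewrite big_cons; set S := \sum_(t <- ts) `|x t - y t|.
apply: (@le_trans _ _ (\sum_(t <- ts) (`|x t - y t| + `|x 0 - y 0|))).
  apply: ler_sum => t _; rewrite (_ : _ - _ = (x t - y t) - (x 0 - y 0)); last by ring.
  exact: ler_normB.
rewrite big_split /= big_const_seq count_predT iter_addr_0 -[_ *+ size ts]mulr_natl.
have S0 : 0 <= S by exact: sumr_ge0.
have := mulr_ge0 (ler0n R (size ts)) S0; have := normr_ge0 (x 0 - y 0).
by rewrite mulrDl mul1r mulrDr -/S; lra.
Qed.

Lemma cylf_base F : cylf F -> cylf (base F).
Proof.
move=> [ts [h cF]]; exists (0 :: ts); split; last exact: cyl_base.
by move=> t; rewrite inE => /predU1P[->//|/h].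
Qed.

Lemma base_Fphi F t : cylf F -> 0 <= t -> exists m (g : m.+1.-tuple R) (phi : 'rV[R]_m.+1 -> R) j,
  [/\ path <%R 0 g, bounded_lipschitz phi, (j <= m.+1)%N, t = nth 0 (0 :: tval g) j &
      Fphi g phi = base F].
Proof.
(* The point 1 keeps the grid nonempty, as a tuple of size [m.+1] has to be, and [t] becomes 0 or a
   grid point, as [cond_lip] requires. *)
move=> [ts [ts0 cF]] t0; pose g := grid 0 (t :: 1 :: ts).
have pg : path <%R 0 g := grid_path _ _.
have sg : (0 < size g)%N.
  have : 1 \in g by rewrite mem_grid ltr01 !inE eqxx orbT.
  by case: g {pg}.
pose m := (size g).-1; have sz : size g = m.+1 by rewrite /m prednK.
have tg : t \in 0 :: g.
  move: t0; rewrite le_eqVlt inE => /predU1P[->|t0]; first by rewrite eqxx.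
  by rewrite mem_grid t0 inE eqxx orbT.
have rg r : r \in ts -> r \in 0 :: g.
  move=> rts; have := ts0 _ rts; rewrite le_eqVlt inE => /predU1P[->|r0]; first by rewrite eqxx.
  by rewrite mem_grid r0 !inE rts !orbT.
have /cylP[C [L [C0 L0 hC hL]]] := cF.
exists m, (Tuple (introT eqP sz)), (fun v => F (recon g v)), (index t (0 :: g)); split=> //.
- apply/bounded_lipschitzP; exists C, (L * ((size ts)%:R * m.+1%:R)); split=> [v|u v]; first exact: hC.
  apply: le_trans (hL _ _) _; rewrite -!mulrA; apply: ler_wpM2l => //.
  rewrite mulr_natl -iter_addr_0 -(count_predT ts) -big_const_seq; apply: ler_sum => r _.
  rewrite /recon -sumrB; apply: le_trans (ler_norm_sum _ _ _) _.
  rewrite mulr_natl -[X in _ *+ X]card_ord -sumr_const; apply: ler_sum => i _.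
  case: ifP => _; last by rewrite subrr normr0.
  by apply: le_trans (row_norm_ge (u - v) i); rewrite !mxE.
- by rewrite -ltnS -sz -[X in (_ < X)%N]/(size (0 :: g)) index_mem.
- by rewrite -[RHS]/(nth 0 (0 :: g) (index t (0 :: g))) nth_index.
- apply/funext => x; rewrite /Fphi /base /=; apply: (cyl_dep cF) => r /rg rr.
  rewrite -(sum_incr x pg rr) /recon sz; apply: eq_bigr => i _; rewrite mxE//.
Qed.

Lemma cond_lipP t (X Y : Omega R -> R) : cond_lip slo shi t X Y ->
  exists F, [/\ cylf F, 0 <= t, X = (fun w => F (pv w)) & Y = (fun w => EE slo shi t F (pv w))].
Proof.
move=> [m [ts [phi [j [pt bp [jm tj] -> ->]]]]].
have sz : size ts = m.+1 by rewrite size_tuple.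
have ge0 r : r \in 0 :: tval ts -> 0 <= r.
  by rewrite inE => /predU1P[->//|/(path_gt pt)/ltW].
exists (Fphi ts phi); split=> //.
- by exists (0 :: tval ts); split=> //; exact: cyl_Fphi.
- by rewrite tj; apply: ge0; apply: mem_nth; rewrite /= sz ltnS.
- by apply/funext => w; rewrite tj -(backward_EE _ pt bp jm).
Qed.

Lemma cond_lip_base F t : cylf F -> 0 <= t ->
  cond_lip slo shi t (fun w => F (pv w)) (fun w => EE slo shi t (base F) (pv w)).
Proof.
move=> cF t0; have [m [g [phi [j [pg bp jm tj E]]]]] := base_Fphi cF t0.
exists m, g, phi, j; split=> //.
- by apply/funext => w; rewrite -base_pv -E.
- by apply/funext => w; rewrite -E tj -(backward_EE _ pg bp jm).
Qed.

Lemma Eb_ext F G s g x : path <%R s g -> 0 <= s -> (forall y, y 0 = 0 -> F y = G y) -> x 0 = 0 ->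
  Eb slo shi s g F x = Eb slo shi s g G x.
Proof.
move=> + + FG; elim: g s x => [|t g IH] s x /=; first by move=> _ _; exact: FG.
move=> /andP[st pg] s0 x0; congr (Ssg _ _ _ _ _); apply/funext => z.
have t0 := le_lt_trans s0 st.
by apply: IH; rewrite ?(ltW t0)// splice_lt.
Qed.

Lemma E0_base F : cylf F -> E0 slo shi (base F) = E0 slo shi F.
Proof.
move=> [ts [ts0 cF]]; rewrite /E0.
have c0 : cyl (0 :: ts) F by apply: cyl_sub cF => r rts; rewrite inE rts orbT.
rewrite (EE_grid slo0 slohi 0 (cst 0) (cyl_base cF) (fun r h => h)).
rewrite (EE_grid slo0 slohi 0 (cst 0) c0 (fun r h => h)).
apply: Eb_ext => //; first exact: grid_path.
by move=> y y0; rewrite /base; congr F; apply/funext => r; rewrite y0 subr0.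
Qed.

Lemma calPP (P : probability (Omega R) R) : calP slo shi P <->
  forall F, cylf F -> (\int[P]_w (F (pv w))%:E <= (E0 slo shi F)%:E)%E.
Proof.
split=> [hP F cF|hP m ts phi pt bp].
  have [m [g [phi [j [pg bp jm tj E]]]]] := base_Fphi cF (lexx 0).
  rewrite -E0_base// -E; have := hP m g phi pg bp.
  have := @backward_EE m g phi 0 (cst 0) pg bp (leq0n _).
  rewrite drop0 take0 /= => ->; congr (_ <= _)%E; apply: eq_integral => w _.
  by rewrite -(base_pv F) -E.
have := @backward_EE m ts phi 0 (cst 0) pt bp (leq0n _).
rewrite drop0 take0 /= => ->; apply: hP.
have sz : size ts = m.+1 by rewrite size_tuple.
exists (0 :: tval ts); split; last exact: cyl_Fphi.
by move=> r; rewrite inE => /predU1P[->//|/(path_gt pt)/ltW].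
Qed.

Lemma Lip_cyl (T : \bar R) (X : Omega R -> R) : Lip T X ->
  exists ts F, [/\ forall t, t \in ts -> 0 <= t /\ (t%:E <= T)%E, cyl ts F & X = fun w => F (pv w)].
Proof.
move=> [m [ts [phi [hts /bounded_lipschitzP[C [L [hC hL]]] ->]]]].
exists (codom ts), (fun x => phi (\row_i x (ts i))); split=> //.
  by move=> t /codomP[i ->]; exact: hts.
exists C, `|L|; split=> [x|x y]; first exact: hC.
apply: le_trans (hL _ _) _; apply: le_trans (ler_wpM2r _ (ler_norm L)) _ => //.
apply: ler_wpM2l => //; apply: row_norm_le; first exact: sumr_ge0.
move=> i; rewrite !mxE; apply: (term_le_sum (f := fun t => `|x t - y t|)) => //.
exact: codom_f.
Qed.

Lemma cyl_Lip (T : \bar R) ts F : (0 <= T)%E -> (forall t, t \in ts -> 0 <= t /\ (t%:E <= T)%E) ->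
  cyl ts F -> Lip T (fun w => F (pv w)).
Proof.
move=> T0 hts cF; have /cylP[C [L [C0 L0 hC hL]]] := cF; pose m := size ts.
pose rc (v : 'rV[R]_m.+1) r := v 0 (inord (index r (0 :: ts))).
exists m, (fun i => nth 0 (0 :: ts) i), (fun v => F (rc v)); split.
- move=> i; have : nth 0 (0 :: ts) i \in 0 :: ts by exact: mem_nth.
  by rewrite inE => /predU1P[->//|/hts].
- apply/bounded_lipschitzP; exists C, (L * (size ts)%:R); split=> [v|u v]; first exact: hC.
  apply: le_trans (hL _ _) _; rewrite -mulrA; apply: ler_wpM2l => //.
  rewrite mulr_natl -iter_addr_0 -(count_predT ts) -big_const_seq; apply: ler_sum => r _.
  by apply: le_trans (row_norm_ge (u - v) (inord (index r (0 :: ts)))); rewrite !mxE.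
- apply/funext => w; apply: (cyl_dep cF) => r rts; rewrite /rc mxE inordK.
    by rewrite -[nth _ _ _]/(nth 0 (0 :: ts) (index r (0 :: ts))) nth_index// inE rts orbT.
  by rewrite -[X in (_ < X)%N]/(size (0 :: ts)) index_mem inE rts orbT.
Qed.

Lemma rep_calP Lam : dominated slo shi Lam -> exists P : probability (Omega R) R,
  calP slo shi P /\ forall F, cylf F -> (\int[P]_w (F (pv w))%:E = (Lam F)%:E)%E.
Proof.
move=> hL; have [P hP] := rep_probability slo0 slohi hL; exists P; split=> //.
by apply/calPP => F cF; rewrite hP// lee_fin; exact: (dom_le hL).
Qed.

Lemma sublin_E0 : sublin (E0 slo shi).
Proof.
split=> [F G cF cG|k F k0 [ts [_ cF]]].
  by have [ts [_ c1 c2]] := cylf2 cF cG; exact: (EE_sub slo0 slohi 0 c1 c2).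
exact: (EE_mulr slo0 slohi cF (cyl_cst ts k) (cst 0)).
Qed.

Lemma calP_nonempty : exists P : probability (Omega R) R, calP slo shi P.
Proof.
have [Lam [h1 h2 h3 _]] := hahn_banach sublin_E0 (cylf_cst 0).
by have [P [hP _]] := rep_calP (Dominated h1 h2 h3); exists P.
Qed.

End link.

(** * The past of the canonical process *)

Section real_integral.
Variables (d : measure_display) (T : measurableType d) (R : realType) (P : probability T R).
Implicit Types (x y g : T -> R) (A : set T).

Definition ig x := P.-integrable [set: T] (EFin \o x).
Definition Ex x : R := (\int[P]_w x w)%R.

Lemma ig_meas x : ig x -> measurable_fun setT x.
Proof. by move=> /integrableP[/measurable_EFinP]. Qed.

Lemma ig_dom x y : measurable_fun setT x -> (forall w, `|x w| <= y w) -> ig y -> ig x.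
Proof.
move=> mx xy; apply: le_integrable => //; first exact/measurable_EFinP.
by move=> w _ /=; rewrite lee_fin (le_trans (xy w))// ler_norm.
Qed.

Lemma ig_add x y : ig x -> ig y -> ig (fun w => x w + y w).
Proof. by move=> hx hy; have := integrableD measurableT hx hy. Qed.

Lemma ig_scale k x : ig x -> ig (fun w => k * x w).
Proof. by move=> hx; have := integrableZl measurableT k hx. Qed.

Lemma ig_sub x y : ig x -> ig y -> ig (fun w => x w - y w).
Proof. by move=> hx hy; have := integrableB measurableT hx hy. Qed.

Lemma ig_norm x : ig x -> ig (fun w => `|x w|).
Proof. by move=> hx; have := integrable_abse hx. Qed.

Lemma ig_bmf x : bmf x -> ig x.
Proof. exact: bmf_integrable. Qed.

Lemma ig_cst k : ig (fun=> k). Proof. exact/ig_bmf/bmf_cst. Qed.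

Lemma ig_indic A x : measurable A -> ig x -> ig (fun w => \1_A w * x w).
Proof.
move=> mA hx; apply: (ig_dom _ _ (ig_norm hx)).
  by apply: measurable_funM; [exact: measurable_indic|exact: ig_meas].
by move=> w; rewrite indicE; case: (w \in A); rewrite ?mul1r// mul0r normr0.
Qed.

Lemma ExE x : ig x -> (\int[P]_w (x w)%:E)%E = (Ex x)%:E.
Proof. by move=> hx; rewrite fineK//; exact: integrable_fin_num. Qed.

Lemma ExD x y : ig x -> ig y -> Ex (fun w => x w + y w) = Ex x + Ex y.
Proof. by move=> hx hy; exact: RintegralD. Qed.

Lemma ExB x y : ig x -> ig y -> Ex (fun w => x w - y w) = Ex x - Ex y.
Proof. by move=> hx hy; exact: RintegralB. Qed.

Lemma ExZ k x : ig x -> Ex (fun w => k * x w) = k * Ex x.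
Proof. by move=> hx; exact: RintegralZl. Qed.

Lemma Ex_cst k : Ex (fun=> k) = k.
Proof.
by rewrite /Ex Rintegral_cst// (_ : fine _ = 1) ?mulr1//; exact: (congr1 fine (probability_setT P)).
Qed.

Lemma Ex_le x y : ig x -> ig y -> (forall w, x w <= y w) -> Ex x <= Ex y.
Proof. by move=> hx hy xy; apply: le_Rintegral => // w _; exact: xy. Qed.

Lemma Ex_ge0 x : (forall w, 0 <= x w) -> 0 <= Ex x.
Proof. by move=> x0; apply: Rintegral_ge0 => w _. Qed.

Lemma Ex_abs x : ig x -> `|Ex x| <= Ex (fun w => `|x w|).
Proof. by move=> hx; exact: le_normr_Rintegral. Qed.

Lemma Ex_indic A : measurable A -> Ex (\1_A) = fine (P A).
Proof. by move=> mA; rewrite /Ex /Rintegral integral_indic// setIT. Qed.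

Lemma Ex_indic_dist A x y : measurable A -> ig x -> ig y ->
  `|Ex (fun w => \1_A w * x w) - Ex (fun w => \1_A w * y w)| <= Ex (fun w => `|x w - y w|).
Proof.
move=> mA hx hy; have hAx := ig_indic mA hx; have hAy := ig_indic mA hy.
rewrite -ExB//; apply: le_trans (Ex_abs (ig_sub hAx hAy)) _.
apply: Ex_le; [exact/ig_norm/ig_sub|exact/ig_norm/ig_sub|move=> w].
by rewrite -mulrBr normrM ler_piMl// indicE; case: (w \in A); rewrite ?normr1 ?normr0.
Qed.

Lemma Ex_indicC A x : measurable A -> ig x ->
  Ex x = Ex (fun w => \1_A w * x w) + Ex (fun w => \1_(~` A) w * x w).
Proof.
move=> mA hx; rewrite -ExD; [|exact: ig_indic|by apply: ig_indic => //; exact: measurableC].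
congr Ex; apply/funext => w; rewrite !indicE in_setC.
by case: (w \in A); rewrite /= ?mul1r ?mul0r ?addr0 ?add0r.
Qed.

Lemma Ex_ae x y : measurable_fun setT x -> measurable_fun setT y -> {ae P, forall w, x w = y w} ->
  Ex x = Ex y.
Proof.
move=> mx my xy; congr fine; apply: ae_eq_integral => //; try exact/measurable_EFinP.
by apply: filterS xy => w /= -> _.
Qed.

Lemma Ex_dct (xn : nat -> T -> R) x g : (forall n, measurable_fun setT (xn n)) ->
  measurable_fun setT x -> ig g -> {ae P, forall w n, `|xn n w| <= g w} ->
  {ae P, forall w, xn ^~ w @ \oo --> x w} -> (fun n => Ex (xn n)) @ \oo --> Ex x.
Proof.
move=> mxn mx hg hd hc.
have [] := @dominated_convergence _ T R P setT measurableT (fun n => EFin \o xn n) (EFin \o x) (EFin \o g).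
- by move=> n; apply/measurable_EFinP.
- exact/measurable_EFinP.
- by apply: filterS hc => w hw _; apply: cvg_EFin hw; exact: nearW.
- exact: hg.
- by apply: filterS hd => w hw n _; rewrite lee_fin; exact: hw.
move=> ix _; rewrite (_ : (\int[P]_(w in setT) (EFin \o x) w)%E = (Ex x)%:E); last exact: ExE.
by move=> /fine_cvg.
Qed.

End real_integral.

Lemma max_dist (R : realDomainType) (a b u v : R) :
  `|Num.max a b - Num.max u v| <= `|a - u| + `|b - v|.
Proof.
have key (a' b' u' v' : R) : Num.max a' b' - Num.max u' v' <= `|a' - u'| + `|b' - v'|.
  rewrite lerBlDl ge_max; have := ler_norm (a' - u'); have := ler_norm (b' - v').
  have := normr_ge0 (a' - u'); have := normr_ge0 (b' - v').
  have : u' <= Num.max u' v' by rewrite le_max lexx.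
  have : v' <= Num.max u' v' by rewrite le_max lexx orbT.
  by move=> *; apply/andP; split; lra.
by rewrite ler_norml key andbT lerNl opprB [`|a - u|]distrC [`|b - v|]distrC key.
Qed.

(** * Past events, their approximation, and change of measure after a given time *)

Section filtration.
Variables (R : realType) (slo shi : R).
Hypotheses (slo0 : 0 <= slo) (slohi : slo <= shi).
Implicit Types (F G : (R -> R) -> R) (s t r z : R) (A D : set (Omega R)).
Implicit Types (P Q : probability (Omega R) R) (w : Omega R).

Lemma pv_stop t w r : 0 <= t -> pv (stop t%:E w) r = pv w (Num.min r t).
Proof. by move=> t0; rewrite /pv /stop /= -EFin_min. Qed.

Lemma pv_inj w w' : pv w = pv w' -> w = w'.
Proof. by move=> h; apply: val_inj. Qed.

Lemma stop_stop s t w : 0 <= s <= t -> stop s%:E (stop t%:E w) = stop s%:E w.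
Proof.
move=> /andP[s0 st]; have t0 := le_trans s0 st; apply: pv_inj; apply/funext => r.
by rewrite !pv_stop// -minA (min_l st).
Qed.

Lemma stop_pinfty w : stop +oo%E w = w.
Proof. by apply: pv_inj; apply/funext => r; rewrite /pv /stop /= miney. Qed.

Lemma measurable_stop t : 0 <= t -> measurable_fun setT (stop t%:E : Omega R -> Omega R).
Proof.
move=> t0 _ D mD; rewrite setTI.
apply: (Borel_gen (S := [set D | measurable (stop t%:E @^-1` D)])) mD.
  split => [|E mE|E mE] /=.
  - by rewrite preimage_set0.
  - by rewrite setTD; exact: measurableC.
  - by rewrite preimage_bigcup; apply: bigcup_measurable => k _; exact: mE.
move=> q c r q0 /=.
rewrite (_ : _ @^-1` _ = [set w | `|B (Num.min q t) w - c| <= r]); last first.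
  by apply/seteqP; split => w /=; rewrite -[B q (stop _ w)]/(pv (stop t%:E w) q) pv_stop.
have : measurable_fun setT (fun w : Omega R => `|B (Num.min q t) w - c|).
  by apply: measurableT_comp => //; apply: measurable_funB => //; exact: measurable_B.
move=> /(_ measurableT _ (measurable_itv `]-oo, r])); rewrite setTI.
by congr measurable; apply/seteqP; split=> w /=; rewrite in_itv.
Qed.

Definition Ft t A := exists D, measurable D /\ A = stop t%:E @^-1` D.

Lemma Ft_measurable t A : 0 <= t -> Ft t A -> measurable A.
Proof. by move=> t0 [D [mD ->]]; have := measurable_stop t0 measurableT mD; rewrite setTI. Qed.

Lemma Ft_sub s t A : 0 <= s <= t -> Ft s A -> Ft t A.
Proof.
move=> st [D [mD ->]]; have s0 : 0 <= s by case/andP: st.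
exists (stop s%:E @^-1` D); split; first by apply: (Ft_measurable s0); exists D.
by apply/seteqP; split => w /=; rewrite stop_stop.
Qed.

Lemma FtP t A : Ft t A <-> measurable (A : set (g_sigma_algebra_preimageType (@stop R t%:E))).
Proof.
split=> [[D [mD ->]]|[D mD <-]]; first by exists D => //; rewrite setTI.
by exists D; rewrite setTI.
Qed.

Lemma FtT t : Ft t setT. Proof. by exists setT. Qed.

Lemma FtC t A : Ft t A -> Ft t (~` A).
Proof. by rewrite !FtP; exact: measurableC. Qed.

Lemma FtI t A D : Ft t A -> Ft t D -> Ft t (A `&` D).
Proof. by rewrite !FtP; exact: measurableI. Qed.

Definition adR t (x : Omega R -> R) := measurable_fun [set: g_sigma_algebra_preimageType (@stop R t%:E)] x.

Lemma adR_pre t x (D : set R) : adR t x -> measurable D -> Ft t (x @^-1` D).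
Proof. by move=> hx mD; apply/FtP; have := hx measurableT D mD; rewrite setTI. Qed.

(** The level set of [x] through [w] is a preimage under stopping, so it contains the stopped path
    along with [w]. *)
Lemma adR_stop t x w : 0 <= t -> adR t x -> x (stop t%:E w) = x w.
Proof.
move=> t0 hx; have [D [_ E]] := adR_pre hx (measurable_set1 (x w)).
have : (x @^-1` [set x w]) w by [].
rewrite E /= -{1}(@stop_stop t t w) ?t0//= => h.
by have : (stop t%:E @^-1` D) (stop t%:E w) by []; rewrite -E.
Qed.

Lemma adR_meas t x : 0 <= t -> adR t x -> measurable_fun setT x.
Proof.
move=> t0 hx _ D mD; rewrite setTI; apply: (Ft_measurable t0); exact: adR_pre.
Qed.

Lemma known_reindex t G : known t (fun x => G (fun r => x (Num.min r t))).
Proof. by move=> y y' yy; congr G; apply/funext => r; apply: yy; rewrite ge_min lexx orbT. Qed.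

Lemma cylf_reindex t G : 0 <= t -> cylf G -> cylf (fun x => G (fun r => x (Num.min r t))).
Proof.
move=> t0 [ts [h cG]]; exists (map (fun r => Num.min r t) ts); split.
  by move=> r /mapP[q /h q0 ->]; rewrite le_min q0.
exact: (cyl_reindex (fun r => Num.min r t) cG).
Qed.

(* Two measures are treated at once, so that measures agreeing on cylinder
   functionals of the past agree on the past. *)
Definition dist2 P Q (f : Omega R -> R) := Ex P (fun w => `|f w|) + Ex Q (fun w => `|f w|).

Lemma dist2_le P Q (f g h : Omega R -> R) : bmf f -> bmf g -> bmf h ->
  (forall w, `|f w| <= `|g w| + `|h w|) -> dist2 P Q f <= dist2 P Q g + dist2 P Q h.
Proof.
move=> bf bg bh fgh; rewrite /dist2 addrACA -!ExD; try exact/ig_norm/ig_bmf.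
by apply: lerD; apply: Ex_le => //; try exact/ig_norm/ig_bmf; apply: ig_add; exact/ig_norm/ig_bmf.
Qed.

Lemma dist2_cvg P Q (fn : nat -> Omega R -> R) : (forall n, measurable_fun setT (fn n)) ->
  (forall n w, `|fn n w| <= 1) -> (forall w, (fun n => fn n w) @ \oo --> (0 : R)) ->
  forall e, 0 < e -> exists n, dist2 P Q (fn n) <= e.
Proof.
move=> mf f1 f0 e e0.
have h (P' : probability (Omega R) R) : (fun n => Ex P' (fun w => `|fn n w|)) @ \oo --> Ex P' (fun=> 0).
  apply: (@Ex_dct _ _ R P' _ _ (fun=> 1)) => //.
  - by move=> n; exact: measurableT_comp.
  - exact: ig_cst.
  - by apply: nearW => w n; rewrite normr_id.
  - by apply: aeW => w; rewrite -(@normr0 _ R); exact: (cvg_norm (f0 w)).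
have : (fun n => dist2 P Q (fn n)) @ \oo --> (0 : R).
  by have := cvgD (h P) (h Q); rewrite !Ex_cst addr0; exact.
move=> /cvgrPdist_le /(_ e e0)[N _ hN].
exists N; have := hN N (leqnn N); rewrite /= sub0r normrN; apply: le_trans.
exact: ler_norm.
Qed.

(** The sets approximable in mean by cylinder functionals form a sigma-algebra containing the
    generators of [Borel_gen]: maxima treat finite unions, and dominated convergence the countable
    ones. *)
Lemma approx_stop P Q t D e : 0 <= t -> measurable D -> 0 < e ->
  exists G, [/\ cylf G, forall x, 0 <= G x <= 1 &
    dist2 P Q (fun w => \1_D (stop t%:E w) - G (pv (stop t%:E w))) <= e].
Proof.
move=> t0 mD; move: e; pose S := [set D | measurable D /\ forall e, 0 < e ->
  exists G, [/\ cylf G, forall x, 0 <= G x <= 1 &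
    dist2 P Q (fun w => \1_D (stop t%:E w) - G (pv (stop t%:E w))) <= e]].
suff : S D by move=> [].
have ms := measurable_stop t0.
have bi (E : set (Omega R)) : measurable E -> bmf (fun w => \1_E (stop t%:E w) : R).
  move=> mE; split; first by apply: measurableT_comp ms; exact: measurable_indic.
  by exists 1 => w; rewrite indicE; case: (_ \in E); rewrite ?normr1 ?normr0.
have bG G : cylf G -> bmf (fun w => G (pv (stop t%:E w))).
  move=> cG; have [mG [C hC]] := cylf_bmf cG; split; last by exists C => w.
  exact: (measurableT_comp mG ms).
have bN (f : Omega R -> R) : bmf f -> bmf (fun w => - f w).
  by move=> /(bmf_scale (-1)); congr bmf; apply/funext => w; rewrite mulN1r.
have bd E G : measurable E -> cylf G -> bmf (fun w => \1_E (stop t%:E w) - G (pv (stop t%:E w)) : R).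
  by move=> mE cG; apply: bmf_add; [exact: bi|exact/bN/bG].
have SC E : S E -> S (~` E).
  move=> [mE hE]; split; first exact: measurableC.
  move=> e e0; have [G [cG G01 hG]] := hE _ e0.
  exists (fun x => 1 - G x); split; first by apply: cylf_subr => //; exact: cylf_cst.
    by move=> x; have /andP[] := G01 x; lra.
  apply: le_trans hG; rewrite le_eqVlt; apply/orP; left; apply/eqP; congr (_ + _);
    congr Ex; apply/funext => w; rewrite !indicE in_setC; case: (_ \in E) => /=;
    rewrite ?mulr1n ?mulr0n -[LHS]normrN; congr `|_|; ring.
have SU E E' : S E -> S E' -> S (E `|` E').
  move=> [mE hE] [mE' hE']; split; first exact: measurableU.
  move=> e e0; have e2 : 0 < e / 2 by rewrite divr_gt0.
  have [G [cG G01 hG]] := hE _ e2; have [G' [cG' G01' hG']] := hE' _ e2.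
  have cM := cylf_max cG cG'.
  exists (fun x => Num.max (G x) (G' x)); split=> //.
    move=> x; have /andP[a b] := G01 x; have /andP[a' b'] := G01' x.
    by rewrite le_max a /= ge_max b b'.
  rewrite [e]splitr; apply: le_trans (lerD hG hG').
  apply: (dist2_le P Q (bd _ _ (measurableU _ _ mE mE') cM) (bd _ _ mE cG) (bd _ _ mE' cG')).
  move=> w; rewrite (_ : \1_(E `|` E') _ = Num.max (\1_E (stop t%:E w)) (\1_E' (stop t%:E w))).
    exact: max_dist.
  rewrite !indicE in_setU; case: (_ \in E); case: (_ \in E') => /=;
    by rewrite ?mulr1n ?mulr0n ?maxxx ?(max_l ler01) ?(max_r ler01).
apply: (Borel_gen (S := S)) => //.
  split=> [|E|E hE].
  - split=> // e e0; exists (fun=> 0); split; first exact: cylf_cst.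
      by move=> x; rewrite lexx ler01.
    rewrite /dist2 (_ : (fun w => _) = fun=> 0) ?Ex_cst ?addr0 ?ltW//.
    by apply/funext => w; rewrite indicE in_set0 subrr normr0.
  - by rewrite setTD; exact: SC.
  have mE n : measurable (E n) by case: (hE n).
  pose U n := \bigcup_(k in [set k | (k < n)%N]) E k.
  have SUn n : S (U n).
    elim: n => [|n IH].
      rewrite (_ : U 0%N = ~` setT); last first.
        by rewrite setCT; apply/seteqP; split => w // [].
      apply: SC; split=> // e e0; exists (fun=> 1); split; first exact: cylf_cst.
        by move=> x; rewrite lexx ler01.
      rewrite /dist2 (_ : (fun w => _) = fun=> 0) ?Ex_cst ?addr0 ?ltW//.
      by apply/funext => w; rewrite indicE in_setT mulr1n subrr normr0.
    rewrite (_ : U n.+1 = U n `|` E n); first exact: SU.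
    apply/seteqP; split => w /=.
      by move=> [k /=]; rewrite ltnS leq_eqVlt => /predU1P[->|kn] Ek; [right|left; exists k].
    by move=> [[k /= kn Ek]|En]; [exists k => //=; exact: ltnW|exists n => /=].
  have mUE : measurable (\bigcup_k E k) by exact: bigcup_measurable.
  split=> // e e0; have e2 : 0 < e / 2 by rewrite divr_gt0.
  pose fn n w : R := \1_(\bigcup_k E k) (stop t%:E w) - \1_(U n) (stop t%:E w).
  have mfn n : bmf (fn n).
    by apply: bmf_add; [exact: bi|apply: bN; apply: bi; case: (SUn n)].
  have [|||n hn] := @dist2_cvg P Q fn _ _ _ _ e2.
  - by move=> n; case: (mfn n).
  - move=> n w; rewrite /fn !indicE; case: (_ \in _); case: (_ \in _) => /=;
      by rewrite ?mulr1n ?mulr0n ?subrr ?subr0 ?sub0r ?normrN ?normr1 ?normr0.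
  - move=> w; apply: cvg_near_cst; rewrite /fn.
    have [[k _ Ek]|nE] := pselect ((\bigcup_k E k) (stop t%:E w)).
      exists k.+1 => // n /= kn; rewrite !indicE !mem_set ?subrr//; last by exists k.
      by exists k.
    apply: nearW => n; rewrite !indicE !memNset ?subrr// => -[k _ Ek]; apply: nE; exists k => //.
  have [_ /(_ _ e2)[G [cG G01 hG]]] := SUn n.
  exists G; split=> //; rewrite [e]splitr; apply: le_trans (lerD hn hG).
  apply: dist2_le => //; [exact: bd|by apply: bd => //; case: (SUn n)|move=> w].
  by rewrite /fn; apply: le_trans (ler_normD _ _); rewrite addrA subrK.
move=> q c r q0; set E := [set w | _].
have mE : measurable E.
  have : measurable_fun setT (fun w : Omega R => `|B q w - c|).
    by apply: measurableT_comp => //; apply: measurable_funB => //; exact: measurable_B.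
  move=> /(_ measurableT _ (measurable_itv `]-oo, r])); rewrite setTI.
  by congr measurable; apply/seteqP; split=> w /=; rewrite in_itv.
split=> // e e0; pose G (n : nat) (x : R -> R) := clamp (1 - n%:R * (`|x q - c| - r)).
have G01 n x : 0 <= G n x <= 1.
  by rewrite /G /clamp le_min ler01 le_max lexx !orbT ge_min lexx orbT.
have cG n : cylf (G n).
  apply: (cylf_val q0 (f := fun y => clamp (1 - n%:R * (`|y - c| - r)))).
  exists 1, n%:R; split=> [y|y z].
    have /andP[a b] := G01 n (fun=> y); rewrite /G in a b.
    by rewrite ger0_norm.
  have : `| `|y - c| - `|z - c| | <= `|y - z|.
    by apply: le_trans (ler_dist_dist _ _) _; rewrite opprB addrA subrK.
  move=> /(ler_wpM2l (ler0n R n)); rewrite -{1}(ger0_norm (ler0n R n)) -normrM mulrBr.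
  set p := n%:R * `|y - c|; set p' := n%:R * `|z - c|; move: (n%:R * `|y - z|) => a h.
  apply: le_trans h; rewrite !mulrBr -/p -/p'; move: (n%:R * r) => b; rewrite /clamp.
  have [|] := ler0P (p - p'); have [|] := leP (1 - (p - b)) 0; have [|] := leP (1 - (p' - b)) 0;
    rewrite ?(min_l ler01); have [|] := leP (1 - (p - b)) 1; have [|] := leP (1 - (p' - b)) 1;
    move=> *; rewrite ler_norml; apply/andP; split; lra.
have [|||n hn] := @dist2_cvg P Q (fun n w => \1_E (stop t%:E w) - G n (pv (stop t%:E w))) _ _ _ _ e0.
- by move=> n; case: (bd _ _ mE (cG n)).
- move=> n w; have /andP[a b] := G01 n (pv (stop t%:E w)).
  by rewrite indicE ler_norml; case: (_ \in E) => /=; rewrite ?mulr1n ?mulr0n; apply/andP; split; lra.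
- move=> w; set w' := stop _ _; apply: cvg_near_cst.
  have [Ew|Ew] := pselect (E w').
    apply: nearW => n; rewrite indicE mem_set// /G /clamp mulr1n.
    have : n%:R * (`|pv w' q - c| - r) <= 0 by rewrite mulr_ge0_le0// subr_le0.
    move: (n%:R * _) => a a0; rewrite max_l; last by lra.
    by rewrite min_r ?subrr//; lra.
  have d0 : 0 < `|pv w' q - c| - r by rewrite subr_gt0 ltNge; exact/negP.
  exists (Num.truncn (`|pv w' q - c| - r)^-1).+1 => // n /= hn.
  rewrite indicE memNset// /G /clamp max_r ?(min_l ler01) ?subr0//.
  rewrite subr_le0 -ler_pdivrMr// mul1r; apply: ltW; apply: lt_le_trans (truncnS_gt _) _.
  by rewrite ler_nat.
- by exists (G n).
Qed.

Lemma approx_Ft P Q t A e : 0 <= t -> Ft t A -> 0 < e ->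
  exists G, [/\ cylf G, known t G, forall x, 0 <= G x <= 1 &
    dist2 P Q (fun w => \1_A w - G (pv w)) <= e].
Proof.
move=> t0 [D [mD ->]] e0; have [G [cG G01 hG]] := approx_stop P Q t0 mD e0.
exists (fun x => G (fun r => x (Num.min r t))); split=> //.
- exact: cylf_reindex.
- exact: known_reindex.
apply: le_trans hG; rewrite le_eqVlt; apply/orP; left; apply/eqP; congr (_ + _);
  congr Ex; apply/funext => w; congr `|_ - G _|; apply/funext => r; by rewrite pv_stop.
Qed.

Lemma Ex_indic_approx P A (x g : Omega R -> R) C : measurable A -> bmf x -> bmf g ->
  (forall w, `|x w| <= C) ->
  `|Ex P (fun w => \1_A w * x w) - Ex P (fun w => g w * x w)| <= C * Ex P (fun w => `|\1_A w - g w|).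
Proof.
move=> mA bx bg hC; have bA := bmf_indic R mA.
have b1 := bmf_mul bA bx; have b2 := bmf_mul bg bx.
have bN : bmf (fun w => \1_A w - g w : R).
  by have := bmf_add bA (bmf_scale (-1) bg); congr bmf; apply/funext => w; rewrite mulN1r.
rewrite -ExB; [|exact: ig_bmf|exact: ig_bmf].
apply: le_trans (Ex_abs (ig_sub (ig_bmf _ b1) (ig_bmf _ b2))) _.
rewrite -ExZ; last exact/ig_norm/ig_bmf.
apply: Ex_le => [||w].
- by apply: ig_norm; apply: ig_sub; exact: ig_bmf.
- by apply: ig_scale; apply: ig_norm; exact: ig_bmf.
- by rewrite -mulrBl normrM mulrC ler_wpM2r.
Qed.

Lemma agree_Ft P Q t A : 0 <= t -> (forall G, cylf G -> known t G ->
    Ex P (fun w => G (pv w)) = Ex Q (fun w => G (pv w))) -> Ft t A -> P A = Q A.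
Proof.
move=> t0 hPQ hA; have mA := Ft_measurable t0 hA.
have fP : P A \is a fin_num by exact: fin_num_measure.
have fQ : Q A \is a fin_num by exact: fin_num_measure.
rewrite -(fineK fP) -(fineK fQ) -!Ex_indic//; congr EFin.
apply/eqP; rewrite -subr_eq0 -normr_le0; apply/ler_addgt0Pr => e e0; rewrite add0r.
have [G [cG kG G01 hG]] := approx_Ft P Q t0 hA e0.
have key P' : `|Ex P' (\1_A) - Ex P' (fun w => G (pv w))| <= Ex P' (fun w => `|\1_A w - G (pv w)|).
  have one : forall w : Omega R, `|(fun=> 1) w| <= 1 :> R by move=> w; rewrite normr1.
  have := @Ex_indic_approx P' A (fun=> 1) (fun w => G (pv w)) 1 mA (bmf_cst _ 1) (cylf_bmf cG) one.
  rewrite mul1r (_ : (fun w => \1_A w * 1) = \1_A); last by apply/funext => w; rewrite mulr1.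
  by rewrite (_ : (fun w => G (pv w) * 1) = fun w => G (pv w))//; apply/funext => w; rewrite mulr1.
have := key P; have := key Q; move: hG; rewrite /dist2 (hPQ G cG kG) => h k1 k2.
rewrite (_ : _ - _ = (Ex P (\1_A) - Ex Q (fun w => G (pv w))) - (Ex Q (\1_A) - Ex Q (fun w => G (pv w)))); last by ring.
by apply: le_trans (ler_normB _ _) _; apply: le_trans (lerD k2 k1) h.
Qed.

Lemma cylf_EE t F : 0 <= t -> cylf F -> cylf (EE slo shi t F).
Proof.
move=> t0 [ts [h cF]]; exists [seq Num.min r t | r <- t :: ts]; split; last exact: EE_cyl.
by move=> r /mapP[q + ->]; rewrite inE le_min t0 andbT => /predU1P[->//|/h].
Qed.

Lemma EE_centered t F G : 0 <= t -> cylf F -> cylf G -> known t G -> (forall x, 0 <= G x) ->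
  E0 slo shi (fun x => G x * (F x - EE slo shi t F x)) = 0.
Proof.
move=> t0 cF cG kG G0; have cE := cylf_EE t0 cF.
have [ts [ht c1 c2]] := cylf2 (cylf_subr cF cE) cG.
have [ts' [_ d1 d2]] := cylf2 cF cE.
rewrite /E0 -(EE_tower slo0 slohi (cst 0) t0 (cyl_mul c2 c1)).
rewrite (_ : EE slo shi t _ = fun=> 0) ?EE_cst//; apply/funext => x.
rewrite (EE_mulr slo0 slohi c1 c2)//.
rewrite (EE_addr slo0 slohi d1 (cyl_opp d2)) ?subrr ?mulr0//.
have [ts'' [_ cF']] := cF.
by move=> y y' yy; rewrite (EE_known slo0 slohi cF' yy).
Qed.

Lemma calP_Ex P F : calP slo shi P -> cylf F -> Ex P (fun w => F (pv w)) <= E0 slo shi F.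
Proof.
move=> /(calPP slo0 slohi) hP cF; have := hP _ cF.
by rewrite ExE ?lee_fin//; exact/ig_bmf/cylf_bmf.
Qed.

(** For a nonnegative [G] known at [t], [EE_centered] and domination give the inequality with [G] in
    place of the indicator; [approx_Ft] then replaces [G] by the event. *)
Lemma Up_cyl P F t A : calP slo shi P -> cylf F -> 0 <= t -> Ft t A ->
  Ex P (fun w => \1_A w * F (pv w)) <= Ex P (fun w => \1_A w * EE slo shi t F (pv w)).
Proof.
move=> hP cF t0 hA; have mA := Ft_measurable t0 hA.
have cE := cylf_EE t0 cF; have cZ := cylf_subr cF cE.
have [ts [_ [C [_ [hC _]]]]] := cZ.
have iF := ig_bmf P (cylf_bmf cF); have iE := ig_bmf P (cylf_bmf cE).
rewrite -subr_le0 -ExB; [|exact: ig_indic|exact: ig_indic].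
rewrite (_ : (fun w => _) = (fun w => \1_A w * (F (pv w) - EE slo shi t F (pv w)))); last first.
  by apply/funext => w; rewrite mulrBr.
have C0 : 0 <= C by exact: le_trans (hC (cst 0)).
apply/ler_addgt0Pr => e e0; rewrite add0r.
have eC : 0 < e / (C + 1) by rewrite divr_gt0// ltr_wpDl.
have [G [cG kG G01 hG]] := approx_Ft P P t0 hA eC.
have := Ex_indic_approx P mA (cylf_bmf cZ) (cylf_bmf cG) (fun w => hC (pv w)).
have G0 x : 0 <= G x by case/andP: (G01 x).
have := calP_Ex hP (cylf_mul cG cZ); rewrite EE_centered// => h1 h2.
have h3 : Ex P (fun w => `|\1_A w - G (pv w)|) <= e / (C + 1).
  by apply: le_trans hG; rewrite /dist2 lerDr; exact: Ex_ge0.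
have h4 : C * Ex P (fun w => `|\1_A w - G (pv w)|) <= e.
  apply: le_trans (ler_wpM2l C0 h3) _; rewrite mulrA ler_pdivrMr ?ltr_wpDl//.
  by rewrite mulrC ler_pM2l// lerDl.
by move: h2; rewrite ler_norml => /andP[_]; lra.
Qed.

(** The sublinear functional is [p], the expectation under [P] of the conditional expectation. On
    functionals known at [t] it equals the expectation under [P], so every linear functional below
    it agrees with [P] on the past; by the tower property [p] lies below [E0]. *)
Lemma Low_cyl P F t : calP slo shi P -> cylf F -> 0 <= t ->
  exists Q, [/\ calP slo shi Q, forall A, Ft t A -> Q A = P A &
    Ex Q (fun w => F (pv w)) = Ex P (fun w => EE slo shi t F (pv w))].
Proof.
move=> hP cF t0; pose p H := Ex P (fun w => EE slo shi t H (pv w)).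
have iE H : cylf H -> ig P (fun w => EE slo shi t H (pv w)).
  by move=> cH; exact/ig_bmf/cylf_bmf/cylf_EE.
have sp : sublin p.
  split=> [H K cH cK|k H k0 cH].
    have [ts [_ c1 c2]] := cylf2 cH cK.
    rewrite /p -ExD; [|exact: iE|exact: iE]; apply: Ex_le => [||w].
    - by apply: iE; exact: cylf_add.
    - by apply: ig_add; exact: iE.
    - exact: (EE_sub slo0 slohi t c1 c2).
  have [ts [_ c1]] := cH; rewrite /p -ExZ; last exact: iE.
  congr Ex; apply/funext => w.
  exact: (EE_mulr slo0 slohi c1 (cyl_cst ts k) (pv w)).
have [Lam [L1 L2 L3 L4]] := hahn_banach sp cF.
have hL : dominated slo shi Lam.
  split=> // H cH; apply: le_trans (L3 _ cH) _.
  apply: le_trans (calP_Ex hP (cylf_EE t0 cH)) _; have [ts [_ c1]] := cH.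
  by rewrite /E0 (EE_tower slo0 slohi (cst 0) t0 c1).
have [Q [hQ QL]] := rep_calP slo0 slohi hL.
have QE H : cylf H -> Ex Q (fun w => H (pv w)) = Lam H.
  by move=> cH; apply: EFin_inj; rewrite -QL// ExE//; exact/ig_bmf/cylf_bmf.
exists Q; split=> //; last by rewrite QE// L4.
move=> A hA; apply: (agree_Ft t0 _ hA) => G cG kG; rewrite QE//.
have pG H : cylf H -> known t H -> p H = Ex P (fun w => H (pv w)).
  move=> cH kH; congr Ex; apply/funext => w; have [ts [_ c1]] := cH.
  exact: (EE_id slo0 slohi (pv w) c1 kH).
apply/eqP; rewrite eq_le; apply/andP; split; first by rewrite -pG// L3.
have cN := cylf_scale (-1) cG.
have := L3 _ cN; rewrite pG//; last by move=> y y' yy; rewrite (kG _ _ yy).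
by rewrite L2// ExZ ?mulN1r ?lerN2//; exact/ig_bmf/cylf_bmf.
Qed.

End filtration.

(** * Conditional expectation up to quasi-sure equality *)

Lemma cvg_le_cvg (R : realType) (u v : nat -> R) a b : u @ \oo --> a -> v @ \oo --> b ->
  (forall n, u n <= v n) -> a <= b.
Proof.
move=> ua vb uv; rewrite -(ulim_cvg ua) -(ulim_cvg vb).
by apply: ulim_le => //; exact: (cvg_bounded_seq ua) || exact: (cvg_bounded_seq vb).
Qed.

Lemma Ex_le_ae d (T : measurableType d) (R : realType) (P : probability T R) (x y : T -> R) :
  ig P x -> ig P y -> {ae P, forall w, x w <= y w} -> Ex P x <= Ex P y.
Proof.
move=> hx hy xy; have mx := ig_meas hx; have my := ig_meas hy.
have mm : measurable_fun setT (fun w => Num.min (x w) (y w)) by exact: measurable_minr.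
rewrite (@Ex_ae _ _ _ P x (fun w => Num.min (x w) (y w)))//; last first.
  by apply: filterS xy => w h; rewrite min_l.
apply: Ex_le => // [|w]; last by rewrite ge_min lexx orbT.
apply: (ig_dom mm _ (ig_add (ig_norm hx) (ig_norm hy))) => w.
have := normr_ge0 (x w); have := normr_ge0 (y w).
by have [] := leP (x w) (y w); lra.
Qed.

Lemma Ex_eq0_ae d (T : measurableType d) (R : realType) (P : probability T R) (x : T -> R) :
  ig P x -> (forall w, 0 <= x w) -> Ex P x <= 0 -> {ae P, forall w, x w = 0}.
Proof.
move=> hx x0 h; have mx : measurable_fun setT (EFin \o x) by apply/measurable_EFinP; exact: (ig_meas hx).
have : (\int[P]_w `|(EFin \o x) w| = 0)%E.
  under eq_integral => w _ do rewrite /= ger0_norm//.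
  by rewrite ExE//; congr EFin; apply/eqP; rewrite eq_le h Ex_ge0.
move=> /(ae_eq_integral_abs P measurableT mx); apply: filterS => w /= /(_ Logic.I).
by case.
Qed.

Section quasi_sure.
Variables (R : realType) (slo shi : R).
Hypotheses (slo0 : 0 <= slo) (slohi : slo <= shi).
Implicit Types (x y : Omega R -> R) (A D : set (Omega R)) (P Q : probability (Omega R) R) (t e : R).
Local Notation cP := (calP slo shi).
Local Notation qs := (qs slo shi).

(** A member of [calP] is exhibited because the supremum over an empty set would be [-oo] instead of
    0. *)
Lemma qsP A : qs A <-> exists N, [/\ measurable N, forall P, cP P -> P N = 0%E & ~` A `<=` N].
Proof.
have [P0 hP0] := calP_nonempty slo0 slohi.
split=> [[N [mN cN AN]]|[N [mN cN AN]]]; exists N; split=> //.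
  move=> P hP; apply/eqP; rewrite eq_le measure_ge0 andbT -cN.
  by apply: ereal_sup_ubound; exists P.
rewrite /capacity; apply/eqP; rewrite eq_le; apply/andP; split.
  by apply: ge_ereal_sup => _ [P hP <-]; rewrite cN.
by rewrite -(cN _ hP0); apply: ereal_sup_ubound; exists P0.
Qed.

Lemma qs_ae A P : qs A -> cP P -> {ae P, forall w, A w}.
Proof. by move=> /qsP[N [mN cN AN]] hP; exists N; split=> //; exact: cN. Qed.

Lemma qsS A D : A `<=` D -> qs A -> qs D.
Proof. by move=> AD [N [mN cN AN]]; exists N; split=> // w nD; apply: AN => /AD. Qed.

Lemma qs_all (A : nat -> set (Omega R)) : (forall n, qs (A n)) -> qs [set w | forall n, A n w].
Proof.
move=> hA; have [N hN] := choice (fun n => (qsP (A n)).1 (hA n)); apply/qsP; exists (\bigcup_n N n); split.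
- by apply: bigcup_measurable => n _; case: (hN n).
- move=> P hP; apply/negligibleP; first by apply: bigcup_measurable => n _; case: (hN n).
  apply: negligible_bigcup => n; have [mN cN _] := hN n.
  by apply/negligibleP => //; exact: cN.
- by move=> w /existsNP[n nA]; exists n => //; have [_ _] := hN n; exact.
Qed.

Lemma qsI A D : qs A -> qs D -> qs (A `&` D).
Proof.
move=> hA hD; apply: (qsS (A := [set w | forall n, (if n is 0%N then A else D) w])).
  by move=> w h; split; [exact: (h 0%N)|exact: (h 1%N)].
by apply: qs_all => -[].
Qed.

Lemma qsW A : (forall w, A w) -> qs A.
Proof.
by move=> hA; apply/qsP; exists set0; split; [exact: measurable0|move=> P _; rewrite measure0|move=> w /(_ (hA w))].
Qed.

Lemma qs_null A : measurable A -> (forall P, cP P -> {ae P, forall w, ~ A w}) -> qs (~` A).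
Proof.
move=> mA h; apply/qsP; exists A; split=> //; last by rewrite setCK.
move=> P hP; have [N [mN PN sub]] := h P hP.
apply/eqP; rewrite eq_le measure_ge0 andbT -PN le_measure ?inE//.
by move=> w Aw; apply: sub => /(_ Aw).
Qed.

Definition rv x := measurable_fun [set: Omega R] x /\
  exists C : R, forall P, cP P -> (\int[P]_w `|x w|%:E <= C%:E)%E.

Lemma rv_ig x P : rv x -> cP P -> ig P x.
Proof.
move=> [mx [C hC]] hP; apply/integrableP; split; first exact/measurable_EFinP.
by apply: le_lt_trans (hC P hP) (ltry _).
Qed.

Lemma rv_bound x : rv x -> exists C : R, forall P, cP P -> Ex P (fun w => `|x w|) <= C.
Proof.
move=> hx; have [mx [C hC]] := hx; exists C => P hP; rewrite -lee_fin -ExE; first exact: hC.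
exact/ig_norm/rv_ig.
Qed.

Lemma rvI x C : (forall P, cP P -> ig P x) -> (forall P, cP P -> Ex P (fun w => `|x w|) <= C) -> rv x.
Proof.
move=> hx hC; split.
  by have [P hP] := calP_nonempty slo0 slohi; exact: ig_meas (hx P hP).
by exists C => P hP; rewrite ExE ?lee_fin ?hC//; exact/ig_norm/hx.
Qed.

Lemma rv_add x y : rv x -> rv y -> rv (fun w => x w + y w).
Proof.
move=> hx hy; have [C hC] := rv_bound hx; have [D hD] := rv_bound hy.
apply: (@rvI _ (C + D)) => P hP; have ix := rv_ig hx hP; have iy := rv_ig hy hP; first exact: ig_add.
apply: le_trans (lerD (hC P hP) (hD P hP)); rewrite -ExD; try exact: ig_norm.
by apply: Ex_le => [||w]; [exact/ig_norm/ig_add|apply: ig_add; exact: ig_norm|exact: ler_normD].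
Qed.

Lemma rv_scale k x : rv x -> rv (fun w => k * x w).
Proof.
move=> hx; have [C hC] := rv_bound hx.
apply: (@rvI _ (`|k| * C)) => P hP; have ix := rv_ig hx hP; first exact: ig_scale.
apply: le_trans (ler_wpM2l (normr_ge0 k) (hC P hP)); rewrite -ExZ; last exact: ig_norm.
apply: Ex_le => [||w]; [exact/ig_norm/ig_scale|exact/ig_scale/ig_norm|by rewrite normrM].
Qed.

Lemma rv_sub x y : rv x -> rv y -> rv (fun w => x w - y w).
Proof.
move=> hx hy; have := rv_add hx (rv_scale (-1) hy).
by congr rv; apply/funext => w; rewrite mulN1r.
Qed.

Lemma rv_bmf x : bmf x -> rv x.
Proof.
move=> bx; have [mx [C hC]] := bx; apply: (@rvI _ C) => P hP; first exact: ig_bmf.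
by rewrite -(Ex_cst P C); apply: Ex_le => //; [exact/ig_norm/ig_bmf|exact: ig_cst].
Qed.

Lemma rv_cyl F : cylf F -> rv (fun w => F (pv w)).
Proof. by move=> cF; exact/rv_bmf/cylf_bmf. Qed.

Lemma adR_intro t x : 0 <= t -> measurable_fun setT x -> (forall w, x (stop t%:E w) = x w) -> adR t x.
Proof.
move=> t0 mx hx _ D mD; rewrite setTI; apply/FtP; exists (x @^-1` D); split.
  by have := mx measurableT D mD; rewrite setTI.
by apply/seteqP; split => w /=; rewrite hx.
Qed.

Definition agree t P Q := forall A, Ft t A -> Q A = P A.

(** A function invariant under stopping sees only the image of the measure under stopping, and
    agreement on the past says that the two images coincide. *)
Lemma adR_Ex_ge0 t P Q (f : Omega R -> \bar R) : 0 <= t -> agree t P Q ->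
  measurable_fun setT f -> (forall w, 0 <= f w)%E -> (forall w, f (stop t%:E w) = f w) ->
  (\int[P]_w f w = \int[Q]_w f w)%E.
Proof.
move=> t0 PQ mf f0 fs; have ms := measurable_stop t0.
have key P' : (\int[P']_w f w = \int[pushforward P' (stop t%:E)]_w f w)%E.
  rewrite (ge0_integral_pushforward ms)// preimage_setT.
  by apply: eq_integral => w _; rewrite /= fs.
rewrite (key P) (key Q); apply: eq_measure_integral => A mA _.
have PQA : Q (stop t%:E @^-1` A) = P (stop t%:E @^-1` A) by apply: PQ; exists A.
exact: (esym PQA).
Qed.

Lemma adR_Ex t P Q x : 0 <= t -> agree t P Q -> adR t x -> Ex P x = Ex Q x.
Proof.
move=> t0 PQ hx; have mx := adR_meas t0 hx; have me : measurable_fun setT (EFin \o x) by exact/measurable_EFinP.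
rewrite /Ex /Rintegral integralE [in RHS]integralE; congr (fine (_ - _)).
  apply: (adR_Ex_ge0 t0 PQ) => //; first exact: measurable_funepos.
  by move=> w; rewrite !funeposE /= adR_stop.
apply: (adR_Ex_ge0 t0 PQ) => //; first exact: measurable_funeneg.
by move=> w; rewrite !funenegE /= adR_stop.
Qed.

Lemma adR_indic t A x : Ft t A -> adR t x -> adR t (fun w => \1_A w * x w).
Proof. by move=> /FtP mA hx; apply: measurable_funM => //; exact: measurable_indic. Qed.

Definition Up t x y := forall Q A, cP Q -> Ft t A ->
  Ex Q (fun w => \1_A w * x w) <= Ex Q (fun w => \1_A w * y w).

Definition Low t x y := forall P e, cP P -> 0 < e ->
  exists Q, [/\ cP Q, agree t P Q & Ex P y <= Ex Q x + e].

(* y is a version of the conditional expectation of x at time t *)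
Record Rel t x y : Prop := MkRel {
  rel_x : rv x ; rel_y : rv y ; rel_ad : adR t y ; rel_up : Up t x y ; rel_low : Low t x y }.

(** [Low] speaks of total expectations. Subtracting [Up] on the complement of [A] under the new
    measure localizes it to [A]; the expectations of the adapted functions are the same under both
    measures. *)
Lemma Rel_cmp t x y x' y' P A e : 0 <= t -> Rel t x y -> rv x' -> rv y' -> adR t y' -> Up t x' y' ->
  cP P -> Ft t A -> 0 < e ->
  exists2 Q, cP Q /\ agree t P Q & Ex P (fun w => \1_A w * (y w - y' w)) <= Ex Q (fun w => \1_A w * (x w - x' w)) + e.
Proof.
move=> t0 [hx hy ay up low] hx' hy' ay' up' hP hA e0.
have mA := Ft_measurable t0 hA; have hAC := FtC hA; have mAC := Ft_measurable t0 hAC.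
have [Q [hQ PQ h]] := low P e hP e0; exists Q => //.
have E P' (z z' : Omega R -> R) : cP P' -> rv z -> rv z' ->
    Ex P' (fun w => \1_A w * (z w - z' w)) = Ex P' (fun w => \1_A w * z w) - Ex P' (fun w => \1_A w * z' w).
  move=> hP' hz hz'; rewrite -ExB; try (apply: ig_indic => //; exact: rv_ig).
  by congr Ex; apply/funext => w; rewrite mulrBr.
rewrite E// E//; move: h.
rewrite (Ex_indicC mA (rv_ig hy hP)) (Ex_indicC mA (rv_ig hx hQ)).
have := up Q _ hQ hAC; have := up' Q _ hQ hA.
by rewrite -(adR_Ex t0 PQ (adR_indic hAC ay)) -(adR_Ex t0 PQ (adR_indic hA ay')); lra.
Qed.

Lemma Ft_pos t y : adR t y -> Ft t [set w | 0 < y w].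
Proof.
move=> hy; have := adR_pre hy (measurable_itv `]0, +oo[).
by congr Ft; apply/seteqP; split=> w /=; rewrite in_itv/= andbT.
Qed.

(** [Rel_cmp] on the past event where [y > y'] shows that this event is null. With [x = x'] it gives
    uniqueness of versions, and with only [Up] on the right it serves for supermartingales. *)
Lemma Rel_le t x y x' y' : 0 <= t -> Rel t x y -> rv x' -> rv y' -> adR t y' -> Up t x' y' ->
  qs [set w | x w <= x' w] -> qs [set w | y w <= y' w].
Proof.
move=> t0 hR hx' hy' ay' up' xx; have [hx hy ay up low] := hR.
have ad : adR t (fun w => y w - y' w) by exact: measurable_funB.
have hA := Ft_pos ad; set A := [set w | _] in hA; have mA := Ft_measurable t0 hA.
apply: (qsS (A := ~` A)); first by move=> w; rewrite /A /= subr_gt0 => /negP; rewrite -leNgt.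
apply: qs_null => // P hP.
have iA : ig P (fun w => \1_A w * (y w - y' w)).
  by apply: ig_indic => //; apply: (rv_ig _ hP); exact: rv_sub.
have A0 w : 0 <= \1_A w * (y w - y' w).
  rewrite indicE; have [Aw|Aw] := pselect (A w); last by rewrite memNset// mul0r.
  by rewrite mem_set// mul1r ltW.
have : Ex P (fun w => \1_A w * (y w - y' w)) <= 0.
  apply/ler_addgt0Pr => e e0; rewrite add0r.
  have [Q [hQ _] h] := Rel_cmp t0 hR hx' hy' ay' up' hP hA e0.
  apply: le_trans h _; rewrite -[leRHS]add0r lerD2r -(Ex_cst Q 0); apply: Ex_le_ae.
  - by apply: ig_indic => //; apply: (rv_ig _ hQ); exact: rv_sub.
  - exact: ig_cst.
  apply: filterS (qs_ae xx hQ) => w h; rewrite indicE.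
  by case: (w \in A); rewrite ?mul0r// mul1r subr_le0.
move=> /(Ex_eq0_ae iA A0); apply: filterS => w + Aw; rewrite indicE mem_set// mul1r.
by move=> h; move: Aw; rewrite /A /= h ltxx.
Qed.

(** The factor 2 appears because the event where [y > y'] and its complement are treated with two
    different measures. *)
Lemma Rel_norm t x y x' y' c : 0 <= t -> Rel t x y -> Rel t x' y' ->
  (forall P, cP P -> Ex P (fun w => `|x w - x' w|) <= c) ->
  forall P, cP P -> Ex P (fun w => `|y w - y' w|) <= 2 * c.
Proof.
move=> t0 hR hR' hc P hP; have [hx hy ay up low] := hR; have [hx' hy' ay' up' low'] := hR'.
have ad : adR t (fun w => y w - y' w) by exact: measurable_funB.
have hA := Ft_pos ad; set A := [set w | _] in hA; have mA := Ft_measurable t0 hA.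
have hAC := FtC hA; have mAC := Ft_measurable t0 hAC.
have iy : ig P (fun w => y w - y' w) by apply: (rv_ig _ hP); exact: rv_sub.
apply/ler_addgt0Pr => e e0; have e2 : 0 < e / 2 by rewrite divr_gt0.
rewrite (Ex_indicC mA (ig_norm iy)).
have bound z z' Q D : cP Q -> measurable D -> rv z -> rv z' ->
    (forall P, cP P -> Ex P (fun w => `|z w - z' w|) <= c) ->
    Ex Q (fun w => \1_D w * (z w - z' w)) <= c.
  move=> hQ mD hz hz' hcz; apply: le_trans (hcz Q hQ).
  have iz : ig Q (fun w => z w - z' w) by apply: (rv_ig _ hQ); exact: rv_sub.
  apply: Ex_le => [||w]; [exact: ig_indic|exact: ig_norm|rewrite indicE].
  by case: (w \in D); rewrite ?mul0r ?mul1r ?ler_norm.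
have [Q [hQ _] h] := Rel_cmp t0 hR hx' hy' ay' up' hP hA e2.
have [Q' [hQ' _] h'] := Rel_cmp t0 hR' hx hy ay up hP hAC e2.
have hc' P' : cP P' -> Ex P' (fun w => `|x' w - x w|) <= c.
  move=> /hc; congr (_ <= _); congr Ex; by apply/funext => w; rewrite distrC.
have b1 := bound _ _ _ _ hQ mA hx hx' hc; have b2 := bound _ _ _ _ hQ' mAC hx' hx hc'.
have -> : (fun w => \1_A w * `|y w - y' w|) = (fun w => \1_A w * (y w - y' w)).
  apply/funext => w; rewrite indicE; have [Aw|Aw] := pselect (A w).
    by rewrite mem_set// gtr0_norm.
  by rewrite memNset// !mul0r.
have -> : (fun w => \1_(~` A) w * `|y w - y' w|) = (fun w => \1_(~` A) w * (y' w - y w)).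
  apply/funext => w; rewrite indicE; have [Aw|Aw] := pselect ((~` A) w).
    by rewrite mem_set// distrC ger0_norm// subr_ge0 -subr_le0 leNgt; apply/negP.
  by rewrite memNset// !mul0r.
by move: h h' b1 b2; lra.
Qed.

Lemma Rel_cyl t F : 0 <= t -> cylf F -> Rel t (fun w => F (pv w)) (fun w => EE slo shi t F (pv w)).
Proof.
move=> t0 cF; have cE := cylf_EE slo0 slohi t0 cF; split.
- exact: rv_cyl.
- exact: rv_cyl.
- apply: adR_intro => // [|w]; first by case: (cylf_bmf cE).
  have [ts [_ c]] := cF; apply: (EE_known slo0 slohi c) => r rt.
  by rewrite pv_stop// min_l.
- by move=> Q A hQ hA; exact: Up_cyl.
- move=> P e hP e0; have [Q [hQ PQ E]] := Low_cyl slo0 slohi hP cF t0.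
  by exists Q; split=> //; rewrite E lerDl ltW.
Qed.

Definition ncvg (xn : nat -> Omega R -> R) x := forall e, 0 < e -> exists N : nat,
  forall n P, (N <= n)%N -> cP P -> Ex P (fun w => `|xn n w - x w|) <= e.

Lemma Rel_ncvg t xn yn x y : (forall n, Rel t (xn n) (yn n)) -> 0 <= t ->
  rv x -> rv y -> adR t y -> ncvg xn x -> ncvg yn y -> Rel t x y.
Proof.
move=> hR t0 hx hy ay cx cy; split=> //.
  move=> Q A hQ hA; have mA := Ft_measurable t0 hA.
  apply/ler_addgt0Pr => e e0; have e2 : 0 < e / 2 by rewrite divr_gt0.
  have [N hN] := cx _ e2; have [M hM] := cy _ e2; pose n := maxn N M.
  have [hxn hyn ayn up low] := hR n.
  have a := hN n Q (leq_maxl _ _) hQ; have b := hM n Q (leq_maxr _ _) hQ.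
  have := Ex_indic_dist mA (rv_ig hxn hQ) (rv_ig hx hQ).
  have := Ex_indic_dist mA (rv_ig hyn hQ) (rv_ig hy hQ).
  by have := up Q A hQ hA; rewrite !ler_norml => h /andP[_ h1] /andP[h2 _]; lra.
move=> P e hP e0; have e3 : 0 < e / 3 by rewrite divr_gt0.
have [N hN] := cx _ e3; have [M hM] := cy _ e3; pose n := maxn N M.
have [hxn hyn ayn up low] := hR n; have [Q [hQ PQ h]] := low P _ hP e3.
exists Q; split=> //.
have a := hN n Q (leq_maxl _ _) hQ; have b := hM n P (leq_maxr _ _) hP.
have := Ex_abs (ig_sub (rv_ig hxn hQ) (rv_ig hx hQ)); have := Ex_abs (ig_sub (rv_ig hyn hP) (rv_ig hy hP)).
rewrite !ExB; try exact: rv_ig.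
by rewrite !ler_norml => /andP[h1 _] /andP[_ h2]; lra.
Qed.

(** Both directions of monotonicity at once: in either case the sequence is dominated by
    [|xn 0| + |x|], which is what dominated convergence uses. *)
Definition mcvg (xn : nat -> Omega R -> R) x w :=
  ((forall n, xn n.+1 w <= xn n w) \/ (forall n, xn n w <= xn n.+1 w)) /\ xn ^~ w @ \oo --> x w.

Lemma mcvg_bound xn x w n : mcvg xn x w -> `|xn n w| <= `|xn 0%N w| + `|x w|.
Proof.
move=> [+ cx]; have bd u v z : u <= z -> z <= v -> `|z| <= `|u| + `|v| :> R.
  move=> uz zv; have := ler_norm v; have := normr_ge0 v; have := normr_ge0 u.
  by have := ler_norm (- u); rewrite normrN ler_norml => *; apply/andP; split; lra.
move=> [dec|inc].
  have h : {homo xn^~ w : m p / (m <= p)%N >-> m >= p} by apply/nonincreasing_seqP.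
  rewrite addrC; apply: bd; last exact: h.
  by rewrite -(cvg_lim _ cx)//; apply: nonincreasing_cvgn_ge => //; apply/cvg_ex; eexists; exact: cx.
have h : {homo xn^~ w : m p / (m <= p)%N >-> m <= p} by apply/nondecreasing_seqP.
apply: bd; first exact: h.
by rewrite -(cvg_lim _ cx)//; apply: nondecreasing_cvgn_le => //; apply/cvg_ex; eexists; exact: cx.
Qed.

Lemma Ex_mcvg xn x P A : (forall n, rv (xn n)) -> rv x -> qs (mcvg xn x) -> cP P -> measurable A ->
  (fun n => Ex P (fun w => \1_A w * xn n w)) @ \oo --> Ex P (fun w => \1_A w * x w).
Proof.
move=> hxn hx hm hP mA.
have mI : measurable_fun setT (\1_A : Omega R -> R) by exact: measurable_indic.
apply: (@Ex_dct _ _ R P _ _ (fun w => `|xn 0%N w| + `|x w|)).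
- by move=> n; apply: measurable_funM => //; case: (hxn n).
- by apply: measurable_funM => //; case: hx.
- by apply: ig_add; apply: ig_norm; exact: rv_ig.
- apply: filterS (qs_ae hm hP) => w hw n; apply: le_trans (mcvg_bound n hw).
  by rewrite indicE; case: (w \in A); rewrite ?mul1r// mul0r normr0.
- by apply: filterS (qs_ae hm hP) => w [_ hw]; apply: cvgMr.
Qed.

Lemma Ex_mcvgT xn x P : (forall n, rv (xn n)) -> rv x -> qs (mcvg xn x) -> cP P ->
  (fun n => Ex P (xn n)) @ \oo --> Ex P x.
Proof.
move=> hxn hx hm hP; have := Ex_mcvg hxn hx hm hP measurableT.
have E z : (fun w : Omega R => \1_setT w * z w) = z :> (_ -> R).
  by apply/funext => w; rewrite indicE in_setT mul1r.
by rewrite E; under eq_fun do rewrite E.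
Qed.

Lemma Up_mcvg t xn yn x y : 0 <= t -> (forall n, rv (xn n)) -> (forall n, rv (yn n)) -> rv x -> rv y ->
  qs (mcvg xn x) -> qs (mcvg yn y) -> (forall n, Up t (xn n) (yn n)) -> Up t x y.
Proof.
move=> t0 hxn hyn hx hy mx my up Q A hQ hA; have mA := Ft_measurable t0 hA.
by apply: cvg_le_cvg (Ex_mcvg hxn hx mx hQ mA) (Ex_mcvg hyn hy my hQ mA) _ => n; exact: up.
Qed.

(** For fixed [P] one index [N] brings the expectation of [yn N] close to that of [y]; the measure
    found for [xn N] also serves for the larger [x]. *)
Lemma Rel_incr t xn yn x y : (forall n, Rel t (xn n) (yn n)) -> 0 <= t ->
  rv x -> rv y -> adR t y -> qs (mcvg xn x) -> qs (mcvg yn y) ->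
  (forall n, qs [set w | xn n w <= x w]) -> Rel t x y.
Proof.
move=> hR t0 hx hy ay mx my xx.
have hxn n : rv (xn n) by case: (hR n).
have hyn n : rv (yn n) by case: (hR n).
split=> //; first by apply: (Up_mcvg t0 hxn hyn) => // n; case: (hR n).
move=> P e hP e0; have e2 : 0 < e / 2 by rewrite divr_gt0.
have /cvgrPdist_le/(_ _ e2)[N _ hN] := Ex_mcvgT hyn hy my hP.
have [_ _ _ _ /(_ P _ hP e2)[Q [hQ PQ h]]] := hR N.
exists Q; split=> //; have := hN N (leqnn N); rewrite /= ler_norml => /andP[_ h1].
have := Ex_le_ae (rv_ig (hxn N) hQ) (rv_ig hx hQ) (qs_ae (xx N) hQ); lra.
Qed.

Definition Lcyl x := rv x /\ forall e, 0 < e -> exists2 F, cylf F &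
  forall P, cP P -> Ex P (fun w => `|x w - F (pv w)|) <= e.

(** The ultralimit of the expectations is linear and dominated, hence represented by a member of
    [calP]. It extends from cylinder functionals to [Lcyl] because the approximation there is
    uniform over [calP]. *)
Lemma calP_compact (Qn : nat -> probability (Omega R) R) : (forall n, cP (Qn n)) ->
  exists2 Q, cP Q & forall x, Lcyl x -> Ex Q x = ulim (fun n => Ex (Qn n) x).
Proof.
move=> hQn; pose Lam F := ulim (fun n => Ex (Qn n) (fun w => F (pv w))).
have bs x : rv x -> bounded_seq (fun n => Ex (Qn n) x).
  move=> hx; have [C hC] := rv_bound hx; exists C => n.
  by apply: le_trans (Ex_abs (rv_ig hx (hQn n))) (hC _ (hQn n)).
have bsF F : cylf F -> bounded_seq (fun n => Ex (Qn n) (fun w => F (pv w))).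
  by move=> /rv_cyl/bs.
have hL : dominated slo shi Lam.
  split=> [F G cF cG|k F cF|F cF].
  - rewrite /Lam -ulimD; [|exact: bsF|exact: bsF]; congr ulim; apply/funext => n.
    by rewrite ExD//; exact/ig_bmf/cylf_bmf.
  - rewrite /Lam -ulimZ; last exact: bsF; congr ulim; apply/funext => n.
    by rewrite ExZ//; exact/ig_bmf/cylf_bmf.
  - by apply: ulim_le_cst; [exact: bsF|apply: filterE => n; exact: calP_Ex].
have [Q [hQ QL]] := rep_calP slo0 slohi hL; exists Q => // x [hx hF].
have QE F : cylf F -> Ex Q (fun w => F (pv w)) = Lam F.
  by move=> cF; apply: EFin_inj; rewrite -QL// ExE//; exact/ig_bmf/cylf_bmf.
apply/eqP; rewrite -subr_eq0 -normr_le0; apply/ler_addgt0Pr => e e0; rewrite add0r.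
have e2 : 0 < e / 2 by rewrite divr_gt0.
have [F cF hFe] := hF _ e2.
have d P : cP P -> `|Ex P x - Ex P (fun w => F (pv w))| <= e / 2.
  move=> hP; rewrite -ExB; [|exact: rv_ig|exact/(rv_ig _ hP)/rv_cyl].
  by apply: le_trans (hFe P hP); apply: Ex_abs; apply: ig_sub; [exact: rv_ig|exact/(rv_ig _ hP)/rv_cyl].
have d1 := d Q hQ; rewrite (QE _ cF) in d1.
have d2 : `|ulim (fun n => Ex (Qn n) x) - Lam F| <= e / 2.
  by apply: ulim_dist; [exact: bs|exact: bsF|apply: filterE => n; exact: d].
rewrite (_ : _ - _ = (Ex Q x - Lam F) - (ulim (fun n => Ex (Qn n) x) - Lam F)); last by ring.
by apply: le_trans (ler_normB _ _) _; lra.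
Qed.

Lemma Lcyl_cyl F : cylf F -> Lcyl (fun w => F (pv w)).
Proof.
move=> cF; split; first exact: rv_cyl.
move=> e e0; exists F => // P hP; rewrite (_ : (fun w => _) = fun=> 0) ?Ex_cst ?ltW//.
by apply/funext => w; rewrite subrr normr0.
Qed.

(** The nearly optimal measures [Qn] depend on [n]. For [n >= m] monotonicity bounds the expectation
    of [xn n] under [Qn n] by that of [xn m]; the limit in [n] is taken with [m] fixed, by
    compactness, and only then does [m] grow. *)
Lemma Rel_decr t xn yn x y : (forall n, Rel t (xn n) (yn n)) -> (forall n, Lcyl (xn n)) -> 0 <= t ->
  rv x -> rv y -> adR t y -> qs (mcvg xn x) -> qs (mcvg yn y) ->
  (forall n, qs [set w | xn n.+1 w <= xn n w]) -> Rel t x y.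
Proof.
move=> hR hLx t0 hx hy ay mx my dec.
have hxn n : rv (xn n) by case: (hR n).
have hyn n : rv (yn n) by case: (hR n).
split=> //; first by apply: (Up_mcvg t0 hxn hyn) => // n; case: (hR n).
move=> P e hP e0.
have /choice[Qn hQn] : forall n, exists Q, [/\ cP Q, agree t P Q & Ex P (yn n) <= Ex Q (xn n) + e].
  by move=> n; have [_ _ _ _] := hR n; exact.
have hQ n : cP (Qn n) by case: (hQn n).
have [Q cQ QE] := calP_compact hQ; exists Q; split=> //.
  move=> A hA; symmetry; apply: (agree_Ft t0 _ hA) => G cG kG.
  rewrite (QE _ (Lcyl_cyl cG)).
  have -> : (fun n => Ex (Qn n) (fun w => G (pv w))) = (fun=> Ex P (fun w => G (pv w))); last by rewrite ulim_cst.
  apply/funext => n; symmetry; apply: (adR_Ex t0); first by case: (hQn n).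
  apply: adR_intro => // [|w]; first by case: (cylf_bmf cG).
  by apply: kG => r rt; rewrite pv_stop// min_l.
have mono m n : (m <= n)%N -> Ex (Qn n) (xn n) <= Ex (Qn n) (xn m).
  move=> mn; apply: Ex_le_ae; [exact: rv_ig|exact: rv_ig|].
  apply: filterS (qs_ae (qs_all dec) (hQ n)) => w hw.
  have h : {homo xn^~ w : p q / (p <= q)%N >-> p >= q} by apply/nonincreasing_seqP.
  exact: h.
have cy := Ex_mcvgT hyn hy my hP; have cx := Ex_mcvgT hxn hx mx cQ.
have key m : Ex P y <= Ex Q (xn m) + e.
  rewrite (QE _ (hLx m)) -(ulim_cvg cy).
  have bx : bounded_seq (fun n => Ex (Qn n) (xn m)).
    have [C hC] := rv_bound (hxn m); exists C => n.
    by apply: le_trans (Ex_abs (rv_ig (hxn m) (hQ n))) (hC _ (hQ n)).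
  rewrite -[X in _ + X](ulim_cst e) -ulimD//; last exact: bounded_seq_cst.
  apply: ulim_le_near; [exact: cvg_bounded_seq cy|apply: bounded_seqD => //; exact: bounded_seq_cst|].
  have [_] := ultra_natP; apply; exists m => // n /= mn.
  have [_ _ h] := hQn n; apply: le_trans h _; rewrite lerD2r; exact: mono.
rewrite -lerBlDr; apply: (cvg_le_cvg (cvg_cst _) cx) => n; rewrite lerBlDr; exact: key.
Qed.

End quasi_sure.

Lemma measurable_fun_limn_einf d (T : measurableType d) (R : realType) (f : nat -> T -> \bar R) :
  (forall n, measurable_fun setT (f n)) -> measurable_fun setT (fun w => limn_einf (f ^~ w)).
Proof.
move=> mf; rewrite (_ : (fun w => _) = (fun w => - limn_esup (fun n => - f n w))%E).
  apply: measurableT_comp => //; apply: measurable_fun_limn_esup => n.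
  exact: measurableT_comp.
by apply/funext => w; rewrite -[X in (- X)%E]/(limn_esup (-%E \o (f ^~ w))) limn_esupN oppeK.
Qed.

Lemma fatou_cvg d (T : measurableType d) (R : realType) (P : probability T R)
  (f : nat -> T -> R) (g : T -> R) (C : R) N : (forall n, measurable_fun setT (f n)) ->
  measurable_fun setT g -> (forall n w, 0 <= f n w) -> {ae P, forall w, f ^~ w @ \oo --> g w} ->
  (forall n, (N <= n)%N -> (\int[P]_w (f n w)%:E <= C%:E)%E) -> (\int[P]_w (g w)%:E <= C%:E)%E.
Proof.
move=> mf mg f0 fg hC; pose F n w := (f (n + N)%N w)%:E.
have mF n : measurable_fun setT (F n) by apply/measurable_EFinP.
have F0 n w : setT w -> (0 <= F n w)%E by rewrite lee_fin.
rewrite (@ae_eq_integral _ _ _ P setT (fun w => limn_einf (F ^~ w)))//.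
- apply: le_trans (fatou P measurableT mF F0) _; rewrite limn_einf_lim.
  apply: lime_le; first exact: is_cvg_einfs.
  apply: nearW => n; apply: (@le_trans _ _ (\int[P]_w F n w)%E).
    by apply: ereal_inf_lbound; exists n => //=.
  by apply: hC; rewrite leq_addl.
- exact/measurable_EFinP.
- exact: measurable_fun_limn_einf.
apply: filterS fg => w hw _.
have h : F ^~ w @ \oo --> (g w)%:E.
  by apply: cvg_EFin; [exact: nearW|rewrite -(cvg_shiftn N) in hw].
by rewrite (cvg_limn_einf_sup h).
Qed.

(** * Extended real random variables and their finite versions *)

Section bridge.
Variables (R : realType) (slo shi : R).
Hypotheses (slo0 : 0 <= slo) (slohi : slo <= shi).
Implicit Types (x y : Omega R -> R) (X Y : Omega R -> \bar R) (A D : set (Omega R)).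
Implicit Types (P Q : probability (Omega R) R) (t e C : R) (T : \bar R).
Local Notation cP := (calP slo shi).
Local Notation qs := (qs slo shi).
Local Notation rv := (rv slo shi).
Local Notation ncvg := (ncvg slo shi).
Local Notation Rel := (Rel slo shi).
Local Notation Lcyl := (Lcyl slo shi).

Definition re X w : R := fine (X w).

Definition rvE X := measurable_fun [set: Omega R] X /\
  exists C : R, forall P, cP P -> (\int[P]_w `|X w| <= C%:E)%E.

Lemma qs_fin X : rvE X -> qs [set w | X w = (re X w)%:E].
Proof.
move=> [mX [C hC]]; pose N := setT `&` [set w | X w \is a fin_num].
have mN : measurable N by exact: emeasurable_fin_num.
apply: (qsS (A := ~` ~` N)).
  by rewrite setCK => w [_ /= h]; rewrite /re fineK.
apply: (qs_null slo0 slohi); first exact: measurableC.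
move=> P hP; have iX : P.-integrable setT X.
  by apply/integrableP; split=> //; apply: le_lt_trans (hC P hP) (ltry _).
by apply: filterS (integrable_ae measurableT iX) => w h nN; apply: nN; split=> //; exact: h.
Qed.

Lemma rv_re X : rvE X -> rv (re X).
Proof.
move=> [mX [C hC]]; have mr : measurable_fun setT (re X) by exact: (measurableT_comp (fine_measurable measurableT) mX).
split=> //; exists C => P hP; apply: le_trans (hC P hP); apply: ge0_le_integral => //.
- by apply/measurable_EFinP; exact: measurableT_comp.
- exact: measurableT_comp.
- by move=> w _; rewrite /re; case: (X w) => [r||] //=; rewrite ?normr0 ?leey.
Qed.

Lemma rvE_EFin x : rv x -> rvE (EFin \o x).
Proof. by move=> [mx hC]; split=> //; exact/measurable_EFinP. Qed.

Lemma int_dist X Y P : rvE X -> rvE Y -> cP P ->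
  (\int[P]_w `|X w - Y w| = (Ex P (fun w => `|re X w - re Y w|)%R)%:E)%E.
Proof.
move=> hX hY hP; have rX := rv_re hX; have rY := rv_re hY.
rewrite -ExE; last by apply/ig_norm/ig_sub; exact: (rv_ig _ hP).
apply: ae_eq_integral => //.
- apply: measurableT_comp => //; apply: emeasurable_funB; [by case: hX|by case: hY].
- apply/measurable_EFinP; apply: measurableT_comp => //; apply: measurable_funB; [by case: rX|by case: rY].
by apply: filterS (qs_ae slo0 slohi (qsI slo0 slohi (qs_fin hX) (qs_fin hY)) hP) => w [/= -> ->] _.
Qed.

Lemma cvg_EhatP (Xn : nat -> Omega R -> \bar R) X : cvg_Ehat slo shi Xn X <->
  forall e, 0 < e -> exists N : nat, forall n P, (N <= n)%N -> cP P ->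
    (\int[P]_w `|Xn n w - X w| <= e%:E)%E.
Proof.
have [P0 hP0] := calP_nonempty slo0 slohi.
have ge0 n : (0 <= Ehat slo shi (fun w => `|Xn n w - X w|))%E.
  apply: le_trans (_ : \int[P0]_w `|Xn n w - X w| <= _)%E; first exact: integral_ge0.
  by apply: ereal_sup_ubound; exists P0.
split=> [/fine_cvgP[[N _ hN] /cvgrPdist_le h] e e0|h].
  have [M _ hM] := h e e0; exists (maxn N M) => n P; rewrite geq_max => /andP[Nn Mn] hP.
  apply: (@le_trans _ _ (Ehat slo shi (fun w => `|Xn n w - X w|))%E).
    by apply: ereal_sup_ubound; exists P.
  rewrite -(fineK (hN n Nn)) lee_fin; have := hM n Mn.
  by rewrite /= sub0r normrN; apply: le_trans; exact: ler_norm.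
have le n e : (forall P, cP P -> (\int[P]_w `|Xn n w - X w| <= e%:E)%E) ->
    (Ehat slo shi (fun w => `|Xn n w - X w|) <= e%:E)%E.
  by move=> H; apply: ge_ereal_sup => _ [P hP <-]; exact: H.
apply/fine_cvgP; split.
  have [N hN] := h 1 ltr01; exists N => // n /= Nn; rewrite ge0_fin_numE//.
  by apply: le_lt_trans (le _ _ (fun P => hN n P Nn)) (ltry _).
apply/cvgrPdist_le => e e0; have [N hN] := h e e0; exists N => // n /= Nn.
have hle := le _ _ (fun P => hN n P Nn).
have fn : Ehat slo shi (fun w => `|Xn n w - X w|)%E \is a fin_num.
  by rewrite ge0_fin_numE// (le_lt_trans hle (ltry _)).
by rewrite sub0r normrN ger0_norm ?fine_ge0// -lee_fin fineK.
Qed.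

Lemma ncvgP (Xn : nat -> Omega R -> \bar R) X : (forall n, rvE (Xn n)) -> rvE X ->
  cvg_Ehat slo shi Xn X <-> ncvg (fun n => re (Xn n)) (re X).
Proof.
move=> hXn hX; rewrite cvg_EhatP; split=> h e e0; have [N hN] := h e e0; exists N => n P Nn hP;
  by have := hN n P Nn hP; rewrite (int_dist (hXn n) hX hP) lee_fin.
Qed.

Lemma cvg_rvE (Xn : nat -> Omega R -> \bar R) X : (forall n, rvE (Xn n)) -> measurable_fun setT X ->
  cvg_Ehat slo shi Xn X -> rvE X.
Proof.
move=> hXn mX /cvg_EhatP/(_ 1 ltr01)[N hN]; split=> //.
have [mN [C hC]] := hXn N; exists (1 + C) => P hP; rewrite EFinD.
apply: le_trans (leeD (hN N P (leqnn N) hP) (hC P hP)).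
have m1 : measurable_fun setT (fun w => `|Xn N w - X w|)%E.
  by apply: measurableT_comp => //; exact: emeasurable_funB.
have m2 : measurable_fun setT (fun w => `|Xn N w|)%E by exact: measurableT_comp.
rewrite -ge0_integralD//; apply: ge0_le_integral => //.
- exact: measurableT_comp.
- exact: emeasurable_funD.
move=> w _; case: (X w) => [r||]; case: (Xn N w) => [s||] //=; rewrite ?leey//.
have e : r = s - (s - r) by ring.
by rewrite -EFinD lee_fin {1}e [leRHS]addrC ler_normB.
Qed.

Lemma stop_preim T D A : (0 <= T)%E -> measurable D -> setT `&` stop T @^-1` D = A -> measurable A.
Proof.
case: T => [t| |] //; rewrite ?lee_fin => t0 mD <-; rewrite setTI.
  by apply: (Ft_measurable t0); exists D.
by rewrite (_ : stop +oo%E @^-1` D = D)//; apply/seteqP; split=> w /=; rewrite stop_pinfty.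
Qed.

Lemma adapted_meas T X : (0 <= T)%E -> adapted T X -> measurable_fun setT X.
Proof.
move=> T0 hX _ D mD; rewrite setTI; have := hX measurableT D mD; rewrite setTI => -[E mE].
exact: stop_preim.
Qed.

Lemma adapted_pinfty X : measurable_fun setT X -> adapted +oo%E X.
Proof.
move=> mX _ D mD; have := mX measurableT D mD; rewrite !setTI => mE.
by exists (X @^-1` D) => //; rewrite setTI; apply/seteqP; split=> w /=; rewrite stop_pinfty.
Qed.

Lemma adR_re t X : adapted t%:E X -> adR t (re X).
Proof. by move=> hX; exact: (measurableT_comp (fine_measurable measurableT) hX). Qed.

Lemma adapted_EFin t x : adR t x -> adapted t%:E (EFin \o x).
Proof. by move=> hx; apply/measurable_EFinP. Qed.

Lemma L1P T X : (0 <= T)%E -> L1 slo shi T X <-> adapted T X /\ rvE X.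
Proof.
move=> T0; split=> [[aX hX]|[aX [mX [C hC]]]]; split=> //.
  split; first exact: adapted_meas aX.
  have hb P : cP P -> (\int[P]_w `|X w| <= Ehat slo shi (fun w => `|X w|))%E.
    by move=> hP; apply: ereal_sup_ubound; exists P.
  have [P0 hP0] := calP_nonempty slo0 slohi.
  have fE : Ehat slo shi (fun w => `|X w|)%E \is a fin_num.
    by rewrite ge0_fin_numE//; apply: le_trans (hb _ hP0); exact: integral_ge0.
  by exists (fine (Ehat slo shi (fun w => `|X w|)%E)) => P hP; rewrite fineK//; exact: hb.
by apply: le_lt_trans (ltry C); apply: ge_ereal_sup => _ [P hP <-]; exact: hC.
Qed.

Definition LcylT T x := rv x /\ forall e, 0 < e -> exists ts F,
  [/\ forall t, t \in ts -> 0 <= t /\ (t%:E <= T)%E, cyl ts F &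
      forall P, cP P -> Ex P (fun w => `|x w - F (pv w)|) <= e].

Lemma LcylT_Lcyl T x : LcylT T x -> Lcyl x.
Proof.
move=> [hx h]; split=> // e e0; have [ts [F [hts cF hF]]] := h e e0.
by exists F => //; exists ts; split=> // t /hts[].
Qed.

Lemma rvE_Lip T Z : Lip T Z -> rvE (EFin \o Z).
Proof.
move=> /Lip_cyl[ts [F [hts cF ->]]]; apply/rvE_EFin/rv_cyl => //.
by exists ts; split=> // t /hts[].
Qed.

Lemma LG1_cvg T X : LG slo shi 1 T X ->
  exists Xn, (forall n, Lip T (Xn n)) /\ cvg_Ehat slo shi (fun n => EFin \o Xn n) X.
Proof.
move=> [aX [Xn [hL h]]]; exists Xn; split=> //; move: h; rewrite /cvg_Ehat.
rewrite (_ : (fun n => Ehat _ _ (fun w => _ `^ 1)%E) =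
  (fun n => Ehat slo shi (fun w => `|(EFin \o Xn n) w - X w|)%E))//.
by apply/funext => n; congr Ehat; apply/funext => w; rewrite poweRe1.
Qed.

(** This turns a sequence converging for the upper expectation into approximability up to any [e],
    uniformly over [calP], the form in which [Rel_norm] and compactness use it. *)
Lemma LG1P T X : (0 <= T)%E -> LG slo shi 1 T X <-> [/\ adapted T X, rvE X & LcylT T (re X)].
Proof.
move=> T0; split=> [hX|[aX rX [hx hF]]].
  have [Xn [hL hc]] := LG1_cvg hX; have [aX _] := hX.
  have rXn n : rvE (EFin \o Xn n) by exact: rvE_Lip (hL n).
  have rX := cvg_rvE rXn (adapted_meas T0 aX) hc.
  split=> //; split; first exact: rv_re.
  move=> e e0; have [N hN] := (ncvgP rXn rX).1 hc e e0.
  have [ts [F [hts cF E]]] := Lip_cyl (hL N); exists ts, F; split=> // P hP.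
  have := hN N P (leqnn N) hP; congr (_ <= _); congr Ex; apply/funext => w.
  by rewrite distrC /re /= E.
have /choice[Z hZ] : forall n : nat, exists Z : Omega R -> R, Lip T Z /\
    forall P, cP P -> Ex P (fun w => `|re X w - Z w|) <= n.+1%:R^-1.
  move=> n; have n0 : 0 < n.+1%:R^-1 :> R by rewrite invr_gt0.
  have [ts [F [hts cF hFe]]] := hF _ n0; exists (fun w => F (pv w)); split=> //.
  exact: cyl_Lip hts cF.
split=> //; exists Z; split=> [n|]; first by case: (hZ n).
rewrite (_ : (fun n => Ehat _ _ (fun w => _ `^ 1)%E) =
  (fun n => Ehat slo shi (fun w => `|(EFin \o Z n) w - X w|)%E)); last first.
  by apply/funext => n; congr Ehat; apply/funext => w; rewrite poweRe1.
have rZ n : rvE (EFin \o Z n) by case: (hZ n) => /rvE_Lip.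
apply/(ncvgP rZ rX) => e e0; exists (Num.truncn e^-1) => n P hn hP.
have [_ h] := hZ n; have := h P hP.
rewrite (_ : (fun w => `|re X w - Z n w|) = (fun w => `|re (EFin \o Z n) w - re X w|)); last first.
  by apply/funext => w; rewrite distrC.
move=> /le_trans; apply; rewrite invf_ple ?posrE//; apply: ltW (lt_le_trans (truncnS_gt _) _).
by rewrite ler_nat.
Qed.

Lemma LG1_rvE T X : (0 <= T)%E -> LG slo shi 1 T X -> rvE X.
Proof. by move=> T0 /(LG1P _ T0)[]. Qed.

Lemma LG1_L1 T X : (0 <= T)%E -> LG slo shi 1 T X -> L1 slo shi T X.
Proof. by move=> T0 /(LG1P _ T0)[aX rX _]; apply/L1P. Qed.

Lemma LG1_star T X : (0 <= T)%E -> LG slo shi 1 T X -> LG1star slo shi T X.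
Proof.
move=> T0 hX; split; first exact: LG1_L1.
exists (fun=> X); split=> //; apply: (qsW slo0 slohi) => w; split=> //; exact: cvg_cst.
Qed.

Lemma star_starstar T X : LG1star slo shi T X -> LG1starstar slo shi T X.
Proof.
move=> hX; split; first by case: hX.
exists (fun=> X); split=> //; apply: (qsW slo0 slohi) => w; split=> //; exact: cvg_cst.
Qed.

Lemma starstar_bar T X : (0 <= T)%E -> LG1starstar slo shi T X -> LG1bar slo shi T X.
Proof.
move=> T0 hX; have [hL _] := hX; split=> //; exists (fun=> X); split=> //.
have [_ rX] := (L1P X T0).1 hL.
apply/(ncvgP (fun=> rX) rX) => e e0; exists 0%N => n P _ _.
by rewrite (_ : (fun w => _) = fun=> 0) ?Ex_cst ?ltW//; apply/funext => w; rewrite subrr normr0.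
Qed.

Section horizon.
Variable t : R.
Hypothesis t0 : 0 <= t.

Lemma L1_pinfty X : L1 slo shi t%:E X -> L1 slo shi +oo%E X.
Proof. by move=> [aX hX]; split=> //; apply: adapted_pinfty; apply: adapted_meas aX; rewrite lee_fin. Qed.

Lemma LG1_pinfty X : LG slo shi 1 t%:E X -> LG slo shi 1 +oo%E X.
Proof.
move=> [aX [Xn [hL h]]]; split; first by apply: adapted_pinfty; apply: adapted_meas aX; rewrite lee_fin.
exists Xn; split=> // n; have [m [ts [phi [hts bp E]]]] := hL n; exists m, ts, phi; split=> // i.
by have [a _] := hts i; split=> //; exact: leey.
Qed.

Lemma star_pinfty X : LG1star slo shi t%:E X -> LG1star slo shi +oo%E X.
Proof.
by move=> [/L1_pinfty hX [Xn [h1 h2]]]; split=> //; exists Xn; split=> // n; exact: LG1_pinfty.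
Qed.

Lemma starstar_pinfty X : LG1starstar slo shi t%:E X -> LG1starstar slo shi +oo%E X.
Proof.
by move=> [/L1_pinfty hX [Xn [h1 h2]]]; split=> //; exists Xn; split=> // n; exact: star_pinfty.
Qed.

Lemma bar_pinfty X : LG1bar slo shi t%:E X -> LG1bar slo shi +oo%E X.
Proof.
by move=> [/L1_pinfty hX [Xn [h1 h2]]]; split=> //; exists Xn; split=> // n; exact: starstar_pinfty.
Qed.

End horizon.

Lemma monotone_mcvg (Xn : nat -> Omega R -> \bar R) X : (forall n, rvE (Xn n)) -> rvE X ->
  qs [set w | ((forall n, Xn n.+1 w <= Xn n w) \/ (forall n, Xn n w <= Xn n.+1 w))%E /\
              Xn ^~ w @ \oo --> X w] ->
  qs (mcvg (fun n => re (Xn n)) (re X)).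
Proof.
move=> hXn hX h.
have hf := qs_all slo0 slohi (fun n => qs_fin (hXn n)).
have := qsI slo0 slohi h (qsI slo0 slohi hf (qs_fin hX)); apply: qsS.
move=> w [[mono cx] [/= hn hw]]; split.
  case: mono => mono; [left|right] => n; have := mono n; by rewrite !hn lee_fin.
by rewrite hw in cx; exact: (fine_cvg cx).
Qed.

Lemma decr_mcvg Xn X : (forall n, rvE (Xn n)) -> rvE X -> decreases_qs slo shi Xn X ->
  qs (mcvg (fun n => re (Xn n)) (re X)).
Proof.
by move=> hXn hX h; apply: monotone_mcvg => //; apply: qsS h => w [a b]; split=> //; left.
Qed.

Lemma incr_mcvg Xn X : (forall n, rvE (Xn n)) -> rvE X -> increases_qs slo shi Xn X ->
  qs (mcvg (fun n => re (Xn n)) (re X)).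
Proof.
by move=> hXn hX h; apply: monotone_mcvg => //; apply: qsS h => w [a b]; split=> //; right.
Qed.

Lemma lim_rvE (Xn : nat -> Omega R -> \bar R) X C : (forall n, rvE (Xn n)) -> measurable_fun setT X ->
  (forall n P, cP P -> Ex P (fun w => `|re (Xn n) w|) <= C) ->
  qs [set w | Xn ^~ w @ \oo --> X w] -> rvE X.
Proof.
move=> hXn mX hC hc; split=> //; exists C => P hP.
pose F n w := `|Xn n w|%E.
have mF n : measurable_fun setT (F n) by apply: measurableT_comp => //; case: (hXn n).
have F0 n w : setT w -> (0 <= F n w)%E by move=> _; exact: abse_ge0.
rewrite (@ae_eq_integral _ _ _ P setT (fun w => limn_einf (F ^~ w)))//.
- apply: le_trans (fatou P measurableT mF F0) _; rewrite limn_einf_lim.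
  apply: lime_le; first exact: is_cvg_einfs.
  apply: nearW => n; apply: (@le_trans _ _ (\int[P]_w F n w)%E).
    by apply: ereal_inf_lbound; exists n => //=.
  rewrite (_ : (\int[P]_w F n w)%E = (Ex P (fun w => `|re (Xn n) w|))%:E) ?lee_fin ?hC//.
  rewrite -ExE; last exact/ig_norm/(rv_ig _ hP)/rv_re.
  apply: ae_eq_integral => //; last first.
    by apply: filterS (qs_ae slo0 slohi (qs_fin (hXn n)) hP) => w /= h _; rewrite /F h.
  apply/measurable_EFinP; apply: measurableT_comp => //; by case: (rv_re (hXn n)).
- exact: measurableT_comp.
- exact: measurable_fun_limn_einf.
apply: filterS (qs_ae slo0 slohi hc hP) => w hw _.
by rewrite (cvg_limn_einf_sup (cvg_abse hw)).
Qed.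

End bridge.

(** * Existence of conditional expectations *)

Section existence.
Variables (R : realType) (slo shi : R).
Hypotheses (slo0 : 0 <= slo) (slohi : slo <= shi).
Implicit Types (x y : Omega R -> R) (X Y : Omega R -> \bar R) (z : nat -> Omega R -> R).
Implicit Types (P Q : probability (Omega R) R) (t e C : R) (T : \bar R).
Local Notation cP := (calP slo shi).
Local Notation qs := (qs slo shi).
Local Notation rv := (rv slo shi).
Local Notation rvE := (rvE slo shi).
Local Notation ncvg := (ncvg slo shi).
Local Notation Rel := (Rel slo shi).

(** An upper limit, so that the candidate is defined and adapted on all of [Omega], also on the
    exceptional set where the sequence diverges. *)
Definition rlim z w : R := fine (limn_esup (fun n => (z n w)%:E)).

Lemma rlimE z w l : z ^~ w @ \oo --> l -> rlim z w = l.
Proof.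
move=> h; have h' : (fun n => (z n w)%:E) @ \oo --> l%:E by apply: cvg_EFin => //; exact: nearW.
by rewrite /rlim (cvg_limn_einf_sup h').
Qed.

Lemma adR_rlim t z : (forall n, adR t (z n)) -> adR t (rlim z).
Proof.
move=> hz; apply: (measurableT_comp (fine_measurable measurableT)).
by apply: measurable_fun_limn_esup => n; apply/measurable_EFinP; exact: hz.
Qed.

(** The sum of the absolute increments has expectations bounded uniformly over [calP], so it is
    finite q.s. and the sequence converges there. *)
Lemma series_cvg z C : (forall n, rv (z n)) ->
  (forall P n, cP P -> \sum_(0 <= k < n) Ex P (fun w => `|z k.+1 w - z k w|) <= C) ->
  qs [set w | z ^~ w @ \oo --> rlim z w].
Proof.
move=> hz hC; pose d k w := (`|z k.+1 w - z k w|)%:E.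
have rd k : rv (fun w => z k.+1 w - z k w) by exact: rv_sub.
have d0 k w : (0 <= d k w)%E by rewrite lee_fin.
have md k : measurable_fun setT (d k).
  by apply/measurable_EFinP; apply: measurableT_comp => //; case: (rd k).
pose S w := (\sum_(k <oo) d k w)%E.
have S0 w : (0 <= S w)%E by apply: nneseries_ge0.
have mS : measurable_fun setT S.
  by apply: (@ge0_emeasurable_sum _ _ _ setT d xpredT).
have rS : rvE S.
  split=> //; exists C => P hP.
  under eq_integral do rewrite gee0_abs//.
  rewrite integral_nneseries//; apply: lime_le; first by apply: is_cvg_nneseries => k _ _; exact: integral_ge0.
  apply: nearW => n; apply: le_trans (_ : (\sum_(0 <= k < n) Ex P (fun w => `|z k.+1 w - z k w|))%:E <= _)%E.
    rewrite -sumEFin; apply: lee_sum => k _; rewrite ExE//; exact/ig_norm/(rv_ig _ hP).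
  by rewrite lee_fin hC.
apply: qsS (qs_fin slo0 slohi rS) => w /= hS.
pose s n := \sum_(0 <= k < n) `|z k.+1 w - z k w|.
have sle n : s n <= re S w.
  rewrite -lee_fin -hS /s -sumEFin; exact: nneseries_lim_ge.
have sS n : s n.+1 = s n + `|z n.+1 w - z n w| by rewrite /s big_nat_recr.
have cs : cvgn s.
  apply: nondecreasing_is_cvgn; last by exists (re S w) => _ [n _ <-]; exact: sle.
  by apply/nondecreasing_seqP => n; rewrite sS lerDl.
have zs n : z n w <= z 0%N w + s n.
  elim: n => [|n IH]; first by rewrite /s big_geq// addr0.
  by rewrite sS; have := ler_norm (z n.+1 w - z n w); lra.
(* The sequence is the difference of two nondecreasing bounded ones, [z n w + s n] and [s n]. *)
have cu : cvgn (fun n => z n w + s n).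
  apply: nondecreasing_is_cvgn; last first.
    by exists (z 0%N w + re S w + re S w) => _ [n _ <-]; have := zs n; have := sle n; lra.
  apply/nondecreasing_seqP => n; rewrite sS.
  by have := ler_norm (- (z n.+1 w - z n w)); rewrite normrN; lra.
have cz : z ^~ w @ \oo --> limn (fun n => z n w + s n) - limn s.
  rewrite (_ : z ^~ w = (fun n => (z n w + s n) - s n)); first exact: (cvgB cu cs).
  by apply/funext => n; rewrite addrK.
by rewrite (rlimE cz).
Qed.

Lemma sum_half n : \sum_(0 <= k < n) (2^-1) ^+ k <= 2 :> R.
Proof.
have -> : \sum_(0 <= k < n) (2^-1) ^+ k = 2 - 2 * (2^-1) ^+ n :> R.
  elim: n => [|n IH]; first by rewrite big_geq// expr0; lra.
  by rewrite big_nat_recr//= IH exprS; lra.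
by rewrite gerBl mulr_ge0// exprn_ge0// invr_ge0.
Qed.

(** A subsequence whose increments are summable uniformly over [calP] converges q.s.; Fatou's lemma
    then turns the Cauchy bounds into bounds on the distance to the limit. *)
Lemma complete t z : 0 <= t -> (forall n, rv (z n)) -> (forall n, adR t (z n)) ->
  (forall e, 0 < e -> exists N : nat, forall n m P, (N <= n)%N -> (N <= m)%N -> cP P ->
     Ex P (fun w => `|z n w - z m w|) <= e) ->
  exists y, [/\ rv y, adR t y & ncvg z y].
Proof.
move=> t0 hz az hc.
have e0 k : 0 < (2^-1) ^+ k :> R by rewrite exprn_gt0// invr_gt0.
have [N hN] := choice (fun k => hc _ (e0 k)).
(* Partial sums give increasing indices with [phi k] at least [N k]. *)
pose phi k := \sum_(0 <= j < k.+1) (N j).+1.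
have phiS k : phi k.+1 = (phi k + (N k.+1).+1)%N by rewrite /phi big_nat_recr.
have phiN k : (N k <= phi k)%N.
  by case: k => [|k]; [rewrite /phi big_nat1|rewrite phiS ltnW// leq_addl].
have phik k : (k <= phi k)%N.
  by elim: k => // k IH; rewrite phiS -addn1 leq_add.
pose z' k := z (phi k).
have hz' : qs [set w | z' ^~ w @ \oo --> rlim z' w].
  apply: (@series_cvg _ 2) => [k|P n hP]; first exact: hz.
  apply: le_trans (sum_half n); apply: ler_sum => k _; apply: hN => //.
  by rewrite phiS (leq_trans (phiN k))// leq_addr.
pose y := rlim z'; have ay : adR t y by apply: adR_rlim => k; exact: az.
have my := adR_meas t0 ay.
have key e M n P : (forall n m P, (M <= n)%N -> (M <= m)%N -> cP P ->
     Ex P (fun w => `|z n w - z m w|) <= e) -> (M <= n)%N -> cP P ->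
   (\int[P]_w (`|z n w - y w|)%:E <= e%:E)%E.
  move=> hM Mn hP; apply: (@fatou_cvg _ _ R P (fun m w => `|z n w - z' m w|) _ _ M) => //.
  - move=> m; apply: measurableT_comp => //; apply: measurable_funB; first by case: (hz n).
    by case: (hz (phi m)).
  - by apply: measurableT_comp => //; apply: measurable_funB => //; case: (hz n).
  - by apply: filterS (qs_ae slo0 slohi hz' hP) => w /= h; apply: cvg_norm; apply: cvgB => //; exact: cvg_cst.
  - move=> m Mm; rewrite ExE; last exact: (ig_norm (ig_sub (rv_ig (hz n) hP) (rv_ig (hz (phi m)) hP))).
    by rewrite lee_fin hM// (leq_trans Mm).
have ry : rv y.
  have [M hM] := hc 1 ltr01.
  have rd : rv (fun w => z M w - y w).
    split; first by apply: measurable_funB => //; case: (hz M).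
    by exists 1 => P hP; exact: (key 1 M M P hM).
  have := rv_sub slo0 slohi (hz M) rd; congr rv; apply/funext => w; by rewrite subKr.
exists y; split=> // e e00; have [M hM] := hc e e00; exists M => n P Mn hP.
rewrite -lee_fin -ExE; first exact: (key e M n P hM).
by apply/ig_norm/ig_sub; exact: (rv_ig _ hP).
Qed.

(** For a monotone sequence the expected absolute increments telescope, so a uniform bound makes
    them summable. The sign [s] covers both directions. *)
Lemma mono_lim t z C s : 0 <= t -> (forall n, rv (z n)) -> (forall n, adR t (z n)) ->
  (forall n P, cP P -> Ex P (fun w => `|z n w|) <= C) -> s = 1 \/ s = -1 ->
  qs [set w | forall n, 0 <= s * (z n.+1 w - z n w)] ->
  exists y, [/\ rv y, adR t y & qs (mcvg z y)].
Proof.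
move=> t0 hz az hC hs mono; have s1 : `|s| = 1 by case: hs => ->; rewrite ?normrN normr1.
pose y := rlim z; have ay : adR t y by exact: adR_rlim.
have cy : qs [set w | z ^~ w @ \oo --> y w].
  apply: (@series_cvg _ (C + C)) => // P n hP.
  have E k : Ex P (fun w => `|z k.+1 w - z k w|) = s * Ex P (z k.+1) - s * Ex P (z k).
    have i1 := rv_ig (hz k.+1) hP; have i2 := rv_ig (hz k) hP.
    rewrite -mulrBr -ExB// -ExZ; last exact: ig_sub.
    have id := ig_sub i1 i2.
    apply: Ex_ae; [exact: ig_meas (ig_norm id)|exact: ig_meas (ig_scale s id)|].
    apply: filterS (qs_ae slo0 slohi mono hP) => w /= h.
    by rewrite -[RHS]ger0_norm// normrM s1 mul1r.
  rewrite (eq_bigr (fun k => s * Ex P (z k.+1) - s * Ex P (z k))); last by move=> k _; exact: E.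
  rewrite telescope_sumr//; apply: le_trans (ler_norm _) _; apply: le_trans (ler_normB _ _) _.
  rewrite !normrM s1 !mul1r; apply: lerD.
    by apply: le_trans (Ex_abs (rv_ig (hz n) hP)) (hC _ _ hP).
  by apply: le_trans (Ex_abs (rv_ig (hz 0%N) hP)) (hC _ _ hP).
exists y; split=> //.
  have rz n : rvE (EFin \o z n) by exact/rvE_EFin/hz.
  have my : measurable_fun setT (EFin \o y) by apply/measurable_EFinP; exact: adR_meas ay.
  have := @lim_rvE _ _ _ slo0 slohi (fun n => EFin \o z n) _ C rz my hC.
  move=> H; apply: (rv_re (X := EFin \o y)); apply: H; apply: qsS cy => w /= h.
  by apply: cvg_EFin => //; exact: nearW.
apply: qsS (qsI slo0 slohi mono cy) => w [h1 h2]; split=> //.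
case: hs => E; [right|left] => n; have := h1 n; rewrite /= E; lra.
Qed.

Lemma Rel0 t : 0 <= t -> Rel t (fun=> 0) (fun=> 0).
Proof.
move=> t0; have := Rel_cyl slo0 slohi t0 (cylf_cst 0).
by rewrite (_ : (fun w => EE slo shi t _ _) = fun=> 0)//; apply/funext => w; rewrite EE_cst.
Qed.

Lemma Rel_mcvg_bound t (xn yn : nat -> Omega R -> R) x : 0 <= t ->
  (forall n, Rel t (xn n) (yn n)) -> rv x -> qs (mcvg xn x) ->
  exists C, forall n P, cP P -> Ex P (fun w => `|yn n w|) <= C.
Proof.
move=> t0 hR hx hm; have rx n : rv (xn n) by case: (hR n).
have [C hC] := rv_bound (rx 0%N); have [D hD] := rv_bound hx.
exists (2 * (C + D)) => n P hP.
have E (z' : Omega R -> R) : (fun w => `|z' w - 0|) = (fun w => `|z' w|) by apply/funext => w; rewrite subr0.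
have := @Rel_norm _ _ _ slo0 slohi t (xn n) (yn n) (fun=> 0) (fun=> 0) (C + D) t0 (hR n) (Rel0 t0).
rewrite (E (xn n)) (E (yn n)) => /(_ _ P hP); apply => Q hQ.
apply: le_trans (lerD (hC Q hQ) (hD Q hQ)).
have i0 := rv_ig (rx 0%N) hQ; have ix := rv_ig hx hQ.
rewrite -ExD; [|exact: ig_norm|exact: ig_norm]; apply: Ex_le_ae.
- exact/ig_norm/(rv_ig _ hQ).
- by apply: ig_add; exact: ig_norm.
- by apply: filterS (qs_ae slo0 slohi hm hQ) => w /mcvg_bound.
Qed.

Lemma T0_pinfty : (0 <= +oo :> \bar R)%E. Proof. exact: leey. Qed.

Lemma adapted_measR t X : 0 <= t -> adapted t%:E X -> measurable_fun setT X.
Proof. by move=> t0; apply: adapted_meas; rewrite lee_fin. Qed.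

(** Whatever approximating sequences a version comes from, it satisfies [Rel]. One such lemma for
    each layer of the extension makes the choice in [condE] immaterial. *)
Lemma cond_LG1_rel t X Y : cond_LG1 slo shi t X Y ->
  [/\ 0 <= t, rvE X, rvE Y & Rel t (re X) (re Y)].
Proof.
move=> [hX aY [Xn [Yn [hc cX cY]]]].
have /choice[F hF] : forall n, exists F, [/\ cylf F, 0 <= t, Xn n = (fun w => F (pv w)) &
    Yn n = (fun w => EE slo shi t F (pv w))] by move=> n; exact: (cond_lipP slo0 slohi).
have t0 : 0 <= t by case: (hF 0%N).
have rX := LG1_rvE slo0 slohi T0_pinfty hX.
have rXn n : rvE (EFin \o Xn n) by have [cF _ -> _] := hF n; exact/rvE_EFin/rv_cyl.
have rYn n : rvE (EFin \o Yn n).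
  by have [cF _ _ ->] := hF n; apply/rvE_EFin/rv_cyl => //; exact: cylf_EE.
have rY := cvg_rvE slo0 slohi rYn (adapted_measR t0 aY) cY.
split=> //; apply: (Rel_ncvg (xn := Xn) (yn := Yn)) => //.
- by move=> n; have [cF _ -> ->] := hF n; exact: Rel_cyl.
- exact: rv_re.
- exact: rv_re.
- exact: adR_re.
- exact: (ncvgP slo0 slohi rXn rX).1.
- exact: (ncvgP slo0 slohi rYn rY).1.
Qed.

Lemma cond_star_rel t X Y : cond_LG1star slo shi t X Y ->
  [/\ 0 <= t, rvE X, rvE Y & Rel t (re X) (re Y)].
Proof.
move=> [[hX _] aY [Xn [Yn [hc cX cY]]]].
have h n := cond_LG1_rel (hc n); have t0 : 0 <= t by case: (h 0%N).
have [_ rX] := (L1P slo0 slohi X T0_pinfty).1 hX.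
have rXn n : rvE (Xn n) by case: (h n).
have rYn n : rvE (Yn n) by case: (h n).
have hR n : Rel t (re (Xn n)) (re (Yn n)) by case: (h n).
have mX := decr_mcvg slo0 slohi rXn rX cX.
have [C hC] := Rel_mcvg_bound t0 hR (rv_re rX) mX.
have rY : rvE Y.
  apply: (lim_rvE slo0 slohi rYn (adapted_measR t0 aY) hC).
  by apply: qsS cY => w [].
split=> //; apply: (Rel_decr slo0 slohi hR) => //.
- move=> n; have [hXn _ _] := hc n.
  by have [_ _ /LcylT_Lcyl] := (LG1P slo0 slohi (Xn n) T0_pinfty).1 hXn.
- exact: rv_re.
- exact: rv_re.
- exact: adR_re.
- exact: decr_mcvg.
- move=> n; have hf := qsI slo0 slohi (qs_fin slo0 slohi (rXn n)) (qs_fin slo0 slohi (rXn n.+1)).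
  apply: qsS (qsI slo0 slohi cX hf) => w [[/(_ n) d _] [/= e1 e2]].
  by move: d; rewrite e1 e2 lee_fin.
Qed.

Lemma cond_starstar_rel t X Y : cond_LG1starstar slo shi t X Y ->
  [/\ 0 <= t, rvE X, rvE Y & Rel t (re X) (re Y)].
Proof.
move=> [[hX _] aY [Xn [Yn [hc cX cY]]]].
have h n := cond_star_rel (hc n); have t0 : 0 <= t by case: (h 0%N).
have [_ rX] := (L1P slo0 slohi X T0_pinfty).1 hX.
have rXn n : rvE (Xn n) by case: (h n).
have rYn n : rvE (Yn n) by case: (h n).
have hR n : Rel t (re (Xn n)) (re (Yn n)) by case: (h n).
have mX := incr_mcvg slo0 slohi rXn rX cX.
have [C hC] := Rel_mcvg_bound t0 hR (rv_re rX) mX.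
have rY : rvE Y.
  apply: (lim_rvE slo0 slohi rYn (adapted_measR t0 aY) hC).
  by apply: qsS cY => w [].
split=> //; apply: (Rel_incr slo0 slohi hR) => //.
- exact: rv_re.
- exact: rv_re.
- exact: adR_re.
- exact: incr_mcvg.
- move=> n; have hf := qsI slo0 slohi (qs_fin slo0 slohi (rXn n)) (qs_fin slo0 slohi rX).
  apply: qsS (qsI slo0 slohi cX hf) => w [[d cw] [/= e1 e2]].
  have nd : nondecreasing_seq (Xn ^~ w) by apply/nondecreasing_seqP.
  rewrite -lee_fin -e1 -e2 -(cvg_lim _ cw)//.
  by rewrite (cvg_lim _ (ereal_nondecreasing_cvgn nd))//; apply: ereal_sup_ubound; exists n.
Qed.

Lemma cond_bar_rel t X Y : cond_LG1bar slo shi t X Y ->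
  [/\ 0 <= t, rvE X, rvE Y & Rel t (re X) (re Y)].
Proof.
move=> [[hX _] aY [Xn [Yn [hc cX cY]]]].
have h n := cond_starstar_rel (hc n); have t0 : 0 <= t by case: (h 0%N).
have [_ rX] := (L1P slo0 slohi X T0_pinfty).1 hX.
have rXn n : rvE (Xn n) by case: (h n).
have rYn n : rvE (Yn n) by case: (h n).
have hR n : Rel t (re (Xn n)) (re (Yn n)) by case: (h n).
have rY := cvg_rvE slo0 slohi rYn (adapted_measR t0 aY) cY.
split=> //; apply: (Rel_ncvg hR) => //.
- exact: rv_re.
- exact: rv_re.
- exact: adR_re.
- exact: (ncvgP slo0 slohi rXn rX).1.
- exact: (ncvgP slo0 slohi rYn rY).1.
Qed.

Lemma ncvg_cauchy (xn : nat -> Omega R -> R) x : (forall n, rv (xn n)) -> rv x -> ncvg xn x ->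
  forall e, 0 < e -> exists N : nat, forall n m P, (N <= n)%N -> (N <= m)%N -> cP P ->
     Ex P (fun w => `|xn n w - xn m w|) <= e.
Proof.
move=> hxn hx h e e0; have e2 : 0 < e / 2 by rewrite divr_gt0.
have [N hN] := h _ e2; exists N => n m P Nn Nm hP.
have d k : ig P (fun w => `|xn k w - x w|) by apply/ig_norm/ig_sub; exact: (rv_ig _ hP).
rewrite [e]splitr; apply: le_trans (lerD (hN n P Nn hP) (hN m P Nm hP)).
rewrite -ExD//; apply: Ex_le => [||w]; [by apply/ig_norm/ig_sub; exact: (rv_ig _ hP)|exact: ig_add|].
rewrite [X in _ <= _ + X]distrC; apply: le_trans (ler_normD _ _).
by rewrite addrA subrK.
Qed.

Lemma Rel_complete t (xn yn : nat -> Omega R -> R) x : 0 <= t -> (forall n, Rel t (xn n) (yn n)) ->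
  rv x -> ncvg xn x -> exists y, [/\ rv y, adR t y & ncvg yn y].
Proof.
move=> t0 hR hx hc; have rx n : rv (xn n) by case: (hR n).
apply: (complete t0); [by move=> n; case: (hR n)|by move=> n; case: (hR n)|].
move=> e e0; have e2 : 0 < e / 2 by rewrite divr_gt0.
have [N hN] := ncvg_cauchy rx hx hc e2; exists N => n m P Nn Nm hP.
have := Rel_norm slo0 slohi t0 (hR n) (hR m) (fun Q hQ => hN n m Q Nn Nm hQ) hP.
by rewrite mulrC divfK.
Qed.

Lemma ex_LG1 t X : 0 <= t -> LG slo shi 1 +oo%E X -> exists Y, cond_LG1 slo shi t X Y.
Proof.
move=> t0 hX; have rX := LG1_rvE slo0 slohi T0_pinfty hX.
have [Xn [hL cX]] := LG1_cvg hX.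
have /choice[F hF] : forall n, exists F, cylf F /\ Xn n = (fun w => F (pv w)).
  by move=> n; have [ts [F [hts cF E]]] := Lip_cyl (hL n); exists F; split=> //; exists ts; split=> // r /hts[].
pose Yn n w := EE slo shi t (base (F n)) (pv w).
have hc n : cond_lip slo shi t (Xn n) (Yn n).
  by have [cF ->] := hF n; exact: cond_lip_base.
have rXn n : rvE (EFin \o Xn n) by have [cF ->] := hF n; exact/rvE_EFin/rv_cyl.
have hR n : Rel t (Xn n) (Yn n).
  have [cF E] := hF n; have := Rel_cyl slo0 slohi t0 (cylf_base cF).
  by congr Rel; apply/funext => w; rewrite E base_pv.
have nX := (ncvgP slo0 slohi rXn rX).1 cX.
have [y [ry ay cy]] := Rel_complete t0 hR (rv_re rX) nX.
exists (EFin \o y); split=> //; first exact: adapted_EFin.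
exists Xn, Yn; split=> //.
have rYn n : rvE (EFin \o Yn n) by apply: rvE_EFin; case: (hR n).
exact: (ncvgP slo0 slohi rYn (rvE_EFin ry)).2.
Qed.

Lemma Rel_mono_lim t (xn yn : nat -> Omega R -> R) x s : 0 <= t -> (forall n, Rel t (xn n) (yn n)) ->
  rv x -> qs (mcvg xn x) -> s = 1 \/ s = -1 -> qs [set w | forall n, 0 <= s * (xn n.+1 w - xn n w)] ->
  exists y, [/\ rv y, adR t y & qs ([set w | forall n, 0 <= s * (yn n.+1 w - yn n w)] `&` mcvg yn y)].
Proof.
move=> t0 hR hx hm hs mono.
have [C hC] := Rel_mcvg_bound t0 hR hx hm.
have ry n : rv (yn n) by case: (hR n).
have ay n : adR t (yn n) by case: (hR n).
have my : qs [set w | forall n, 0 <= s * (yn n.+1 w - yn n w)].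
  apply: (qs_all slo0 slohi) => n; have [hx1 hy1 ay1 up1 low1] := hR n; have [hx2 hy2 ay2 up2 low2] := hR n.+1.
  case: hs mono => -> mono.
    apply: qsS (Rel_le slo0 slohi t0 (hR n) hx2 hy2 ay2 up2 _) => [w /=|]; first by lra.
    by apply: qsS mono => w /(_ n) /=; lra.
  apply: qsS (Rel_le slo0 slohi t0 (hR n.+1) hx1 hy1 ay1 up1 _) => [w /=|]; first by lra.
  by apply: qsS mono => w /(_ n) /=; lra.
have [y [r a m]] := mono_lim t0 ry ay hC hs my.
by exists y; split=> //; exact: qsI.
Qed.

Lemma ex_star t X : 0 <= t -> LG1star slo shi +oo%E X -> exists Y, cond_LG1star slo shi t X Y.
Proof.
move=> t0 hX; have [hL [Xn [hXn cX]]] := hX.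
have [_ rX] := (L1P slo0 slohi X T0_pinfty).1 hL.
have [Yn hc] := choice (fun n => ex_LG1 t0 (hXn n)).
have h n := cond_LG1_rel (hc n).
have rXn n : rvE (Xn n) by case: (h n).
have rYn n : rvE (Yn n) by case: (h n).
have hR n : Rel t (re (Xn n)) (re (Yn n)) by case: (h n).
have mX := decr_mcvg slo0 slohi rXn rX cX.
have mono : qs [set w | forall n, 0 <= -1 * (re (Xn n.+1) w - re (Xn n) w)].
  apply: qsS (qsI slo0 slohi cX (qs_all slo0 slohi (fun n => qs_fin slo0 slohi (rXn n)))).
  by move=> w [[d _] f] n; have := d n; rewrite !f lee_fin; lra.
have [y [ry ay my]] := Rel_mono_lim t0 hR (rv_re rX) mX (or_intror erefl) mono.
exists (EFin \o y); split=> //; first exact: adapted_EFin.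
exists Xn, Yn; split=> //.
apply: qsS (qsI slo0 slohi my (qs_all slo0 slohi (fun n => qs_fin slo0 slohi (rYn n)))).
move=> w [[d [_ c]] f]; split=> [n|]; first by have := d n; rewrite !f lee_fin; lra.
rewrite (_ : Yn ^~ w = fun n => (re (Yn n) w)%:E); last by apply/funext => n; exact: f.
by apply: cvg_EFin => //; exact: nearW.
Qed.

Lemma ex_starstar t X : 0 <= t -> LG1starstar slo shi +oo%E X ->
  exists Y, cond_LG1starstar slo shi t X Y.
Proof.
move=> t0 hX; have [hL [Xn [hXn cX]]] := hX.
have [_ rX] := (L1P slo0 slohi X T0_pinfty).1 hL.
have [Yn hc] := choice (fun n => ex_star t0 (hXn n)).
have h n := cond_star_rel (hc n).
have rXn n : rvE (Xn n) by case: (h n).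
have rYn n : rvE (Yn n) by case: (h n).
have hR n : Rel t (re (Xn n)) (re (Yn n)) by case: (h n).
have mX := incr_mcvg slo0 slohi rXn rX cX.
have mono : qs [set w | forall n, 0 <= 1 * (re (Xn n.+1) w - re (Xn n) w)].
  apply: qsS (qsI slo0 slohi cX (qs_all slo0 slohi (fun n => qs_fin slo0 slohi (rXn n)))).
  by move=> w [[d _] f] n; have := d n; rewrite !f lee_fin; lra.
have [y [ry ay my]] := Rel_mono_lim t0 hR (rv_re rX) mX (or_introl erefl) mono.
exists (EFin \o y); split=> //; first exact: adapted_EFin.
exists Xn, Yn; split=> //.
apply: qsS (qsI slo0 slohi my (qs_all slo0 slohi (fun n => qs_fin slo0 slohi (rYn n)))).
move=> w [[d [_ c]] f]; split=> [n|]; first by have := d n; rewrite !f lee_fin; lra.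
rewrite (_ : Yn ^~ w = fun n => (re (Yn n) w)%:E); last by apply/funext => n; exact: f.
by apply: cvg_EFin => //; exact: nearW.
Qed.

Lemma ex_bar t X : 0 <= t -> LG1bar slo shi +oo%E X -> exists Y, cond_LG1bar slo shi t X Y.
Proof.
move=> t0 hX; have [hL [Xn [hXn cX]]] := hX.
have [_ rX] := (L1P slo0 slohi X T0_pinfty).1 hL.
have [Yn hc] := choice (fun n => ex_starstar t0 (hXn n)).
have h n := cond_starstar_rel (hc n).
have rXn n : rvE (Xn n) by case: (h n).
have rYn n : rvE (Yn n) by case: (h n).
have hR n : Rel t (re (Xn n)) (re (Yn n)) by case: (h n).
have nX := (ncvgP slo0 slohi rXn rX).1 cX.
have [y [ry ay cy]] := Rel_complete t0 hR (rv_re rX) nX.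
exists (EFin \o y); split=> //; first exact: adapted_EFin.
exists Xn, Yn; split=> //.
exact: (ncvgP slo0 slohi rYn (rvE_EFin ry)).2.
Qed.

Lemma condE_spec t X : 0 <= t -> LG1bar slo shi +oo%E X ->
  [/\ adapted t%:E (condE slo shi t X), rvE X, rvE (condE slo shi t X) &
      Rel t (re X) (re (condE slo shi t X))].
Proof.
move=> t0 hX; have h : cond_LG1bar slo shi t X (condE slo shi t X).
  by rewrite /condE; case: xgetP => [Y _ //|H]; have [Y hY] := ex_bar t0 hX; case: (H Y).
have [_ aY _] := h; have [_ rX rY hR] := cond_bar_rel h; by split.
Qed.

Lemma LG1_bar T X : (0 <= T)%E -> LG slo shi 1 T X -> LG1bar slo shi T X.
Proof. by move=> T0 hX; apply: starstar_bar => //; apply: star_starstar => //; exact: LG1_star. Qed.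

(** This keeps the truncated recursion inside L^1_G: [Rel_norm] carries cylinder approximations of
    [X] to their conditional expectations, which are cylinder functionals with times up to [t]. *)
Lemma condE_LG1 t X : 0 <= t -> LG slo shi 1 +oo%E X -> LG slo shi 1 t%:E (condE slo shi t X).
Proof.
move=> t0 hX; have [aY rX rY hR] := condE_spec t0 (LG1_bar T0_pinfty hX).
have [_ _ hl] := (LG1P slo0 slohi X T0_pinfty).1 hX.
have T0 : (0 <= t%:E)%E by rewrite lee_fin.
apply/(LG1P slo0 slohi _ T0); split=> //; split; first exact: rv_re.
move=> e e0; have e2 : 0 < e / 2 by rewrite divr_gt0.
have [_ /(_ _ e2)[ts [F [hts cF hF]]]] := hl.
have cf : cylf F by exists ts; split=> // r /hts[].
exists [seq Num.min r t | r <- t :: ts], (EE slo shi t F); split.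
- move=> r /mapP[q + ->]; rewrite lee_fin ge_min lexx orbT le_min t0 andbT.
  by rewrite inE => /predU1P[->//|/hts[]].
- exact: EE_cyl.
- move=> P hP; have := Rel_norm slo0 slohi t0 hR (Rel_cyl slo0 slohi t0 cf) hF hP.
  by rewrite mulrC divfK.
Qed.

End existence.

(** * The Snell envelope *)

Section snell_envelope.
Variables (R : realType) (slo shi : R).
Hypotheses (slo0 : 0 <= slo) (slohi : slo <= shi).
Implicit Types (x y : Omega R -> R) (P Q : probability (Omega R) R) (t e C : R) (T : \bar R).
Local Notation cP := (calP slo shi).
Local Notation qs := (qs slo shi).
Local Notation rv := (rv slo shi).
Local Notation rvE := (rvE slo shi).
Local Notation Rel := (Rel slo shi).
Local Notation Up := (Up slo shi).
Local Notation condE := (condE slo shi).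

(** It plays the role of Hoelder's inequality: either [a <= d], or the power of exponent [b - 1] of
    [a] exceeds that of [d]. A small [d] compares norms of orders [b] and 1, and [d = 1] bounds the
    supremum of the payoffs. *)
Lemma le_powR (d a b : R) : 0 < d -> 1 < b -> 0 <= a -> a <= d + (d `^ (b - 1))^-1 * a `^ b.
Proof.
move=> d0 b1 a0; have b0 : 0 <= b - 1 by rewrite subr_ge0 ltW.
have K0 : 0 < d `^ (b - 1) by exact: powR_gt0.
have [ad|da] := leP a d; first by rewrite ler_wpDr// mulr_ge0 ?powR_ge0// invr_ge0 ltW.
rewrite ler_wpDl ?(ltW d0)//.
have a1 := lt_trans d0 da.
have -> : a `^ b = a `^ (b - 1) * a.
  rewrite -{3}[a]powRr1// -powRD; first by rewrite subrK.
  by rewrite (lt0r_neq0 a1) implybT.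
rewrite mulrA ler_peMl ?(ltW a1)// mulrC ler_pdivlMr// mul1r.
by apply: ge0_ler_powR; rewrite ?nnegrE// ltW.
Qed.

Lemma le_poweR (d b : R) (a : \bar R) : 0 < d -> 1 < b -> (0 <= a)%E ->
  (a <= d%:E + ((d `^ (b - 1))^-1)%:E * a `^ b)%E.
Proof.
move=> d0 b1; have b0 : b != 0 by apply: lt0r_neq0; exact: lt_trans b1.
case: a => [a| |] //; first by rewrite !lee_fin => a0; exact: le_powR.
move=> _; rewrite poweRyr// gt0_muley ?addey//.
by rewrite lte_fin invr_gt0 powR_gt0.
Qed.

Lemma LG_LG1 (b : R) T X : (0 <= T)%E -> 1 < b -> LG slo shi b T X -> LG slo shi 1 T X.
Proof.
move=> T0 b1 [aX [Xn [hL hc]]]; split=> //; exists Xn; split=> //.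
have mX := adapted_meas T0 aX.
have rXn n : rvE (EFin \o Xn n) by exact: rvE_Lip (hL n).
have md n : measurable_fun setT (fun w => `|(Xn n w)%:E - X w|)%E.
  by apply: measurableT_comp => //; apply: emeasurable_funB => //; case: (rXn n).
rewrite (_ : (fun n => Ehat _ _ (fun w => _ `^ 1)%E) =
  (fun n => Ehat slo shi (fun w => `|(EFin \o Xn n) w - X w|)%E)); last first.
  by apply/funext => n; congr Ehat; apply/funext => w; rewrite poweRe1.
have hc' : cvg_Ehat slo shi (fun n w => (`|(Xn n w)%:E - X w| `^ b)%E) (cst 0%E).
  rewrite /cvg_Ehat (_ : (fun n => _) = (fun n => Ehat slo shi (fun w => (`|(Xn n w)%:E - X w| `^ b)%E)))//.
  by apply/funext => n; congr Ehat; apply/funext => w; rewrite sube0 gee0_abs// poweR_ge0.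
apply/(cvg_EhatP slo0 slohi) => e e0; have e2 : 0 < e / 2 by rewrite divr_gt0.
pose K := ((e / 2) `^ (b - 1))^-1; have K0 : 0 < K by rewrite invr_gt0 powR_gt0.
have [N hN] := (cvg_EhatP slo0 slohi _ _).1 hc' _ (divr_gt0 e2 K0).
exists N => n P Nn hP; have := hN n P Nn hP.
under eq_integral do rewrite sube0 gee0_abs ?poweR_ge0//.
set F := fun w => (`|(Xn n w)%:E - X w| `^ b)%E => hF.
have mF : measurable_fun setT F by exact: (measurableT_comp (measurable_poweR b) (md n)).
have F0 w : (0 <= F w)%E by exact: poweR_ge0.
apply: (@le_trans _ _ (\int[P]_w ((e / 2)%:E + K%:E * F w))%E).
  apply: ge0_le_integral => //.
  - exact: md.
  - by apply: emeasurable_funD => //; exact: measurable_funeM.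
  - by move=> w _; exact: le_poweR.
rewrite ge0_integralD//.
- rewrite (ExE (ig_cst P (e / 2))) Ex_cst ge0_integralZl_EFin ?(ltW K0)//.
  have h := lee_wpmul2l (_ : 0 <= K%:E)%E hF.
  apply: le_trans (leeD (lexx _) (h _)) _; first by rewrite lee_fin ltW.
  rewrite -EFinM -EFinD lee_fin mulrCA divff ?lt0r_neq0// mulr1 -splitr//.
- by move=> w _; rewrite lee_fin ltW.
- by move=> w _; rewrite mule_ge0// lee_fin ltW.
- exact: measurable_funeM.
Qed.

Lemma LG1_max T X Y : (0 <= T)%E -> LG slo shi 1 T X -> LG slo shi 1 T Y ->
  LG slo shi 1 T (fun w => maxe (X w) (Y w)).
Proof.
move=> T0 /(LG1P slo0 slohi _ T0)[aX rX [hx lX]] /(LG1P slo0 slohi _ T0)[aY rY [hy lY]].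
have aM : adapted T (fun w => maxe (X w) (Y w)) by exact: measurable_maxe.
have mM := adapted_meas T0 aM.
have [mX [C hC]] := rX; have [mY [D hD]] := rY.
have rM : rvE (fun w => maxe (X w) (Y w)).
  split=> //; exists (C + D) => P hP; rewrite EFinD; apply: le_trans (leeD (hC P hP) (hD P hP)).
  have m1 : measurable_fun setT (fun w => `|X w|)%E by exact: measurableT_comp.
  have m2 : measurable_fun setT (fun w => `|Y w|)%E by exact: measurableT_comp.
  rewrite -ge0_integralD//; apply: ge0_le_integral => //.
  - exact: measurableT_comp.
  - exact: emeasurable_funD.
  - by move=> w _; have [_|_] := leP (X w) (Y w); [rewrite leeDr|rewrite leeDl].
apply/(LG1P slo0 slohi _ T0); split=> //; split; first exact: rv_re.
move=> e e0; have e2 : 0 < e / 2 by rewrite divr_gt0.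
have [ts [F [hts cF hF]]] := lX _ e2; have [ts' [G [hts' cG hG]]] := lY _ e2.
have c1 : cyl (ts ++ ts') F by apply: cyl_sub cF => r h; rewrite mem_cat h.
have c2 : cyl (ts ++ ts') G by apply: cyl_sub cG => r h; rewrite mem_cat h orbT.
exists (ts ++ ts'), (fun x : R -> R => Num.max (F x) (G x)); split.
- by move=> r; rewrite mem_cat => /orP[/hts|/hts'].
- exact: cyl_max.
have cfF : cylf F by exists ts; split=> // r /hts[].
have cfG : cylf G by exists ts'; split=> // r /hts'[].
have rF : rv (fun w => F (pv w)) by exact: rv_cyl.
have rG : rv (fun w => G (pv w)) by exact: rv_cyl.
have rFG : rv (fun w => Num.max (F (pv w)) (G (pv w))) by have := rv_cyl slo0 slohi (cylf_max cfF cfG).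
move=> P hP; rewrite [e]splitr; apply: le_trans (lerD (hF P hP) (hG P hP)).
have i1 : ig P (fun w => `|re X w - F (pv w)|) by apply/ig_norm/ig_sub; exact: (rv_ig _ hP).
have i2 : ig P (fun w => `|re Y w - G (pv w)|) by apply/ig_norm/ig_sub; exact: (rv_ig _ hP).
rewrite -ExD//; apply: Ex_le_ae.
- by apply/ig_norm/ig_sub; [exact/(rv_ig _ hP)/rv_re|exact: (rv_ig _ hP)].
- exact: ig_add.
apply: filterS (qs_ae slo0 slohi (qsI slo0 slohi (qs_fin slo0 slohi rX) (qs_fin slo0 slohi rY)) hP).
move=> w [/= eX eY]; rewrite {1}/re eX eY -EFin_max /=; exact: max_dist.
Qed.

Lemma condE_le t A B : 0 <= t -> LG1bar slo shi +oo%E A -> LG1bar slo shi +oo%E B ->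
  qs [set w | (A w <= B w)%E] -> qs [set w | (condE t A w <= condE t B w)%E].
Proof.
move=> t0 hA hB AB.
have [aA rA rcA RA] := condE_spec slo0 slohi t0 hA; have [aB rB rcB [hx hy ay up low]] := condE_spec slo0 slohi t0 hB.
have fin := fun X rX => qs_fin slo0 slohi (X := X) rX.
have h : qs [set w | re A w <= re B w].
  by apply: qsS (qsI slo0 slohi AB (qsI slo0 slohi (fin _ rA) (fin _ rB))) => w [/= le [/= eA eB]]; move: le; rewrite eA eB lee_fin.
have := Rel_le slo0 slohi t0 RA hx hy ay up h.
move=> /(qsI slo0 slohi (qsI slo0 slohi (fin _ rcA) (fin _ rcB))); apply: qsS.
by move=> w [[/= eA eB] ?]; rewrite eA eB lee_fin.
Qed.

Lemma limn_cvg (u : nat -> \bar R) : limn_esup u = limn_einf u -> u @ \oo --> limn_esup u.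
Proof.
move=> E; have h1 : einfs u @ \oo --> limn_esup u by rewrite E limn_einf_lim; exact: is_cvg_einfs.
have h2 : esups u @ \oo --> limn_esup u by rewrite limn_esup_lim; exact: is_cvg_esups.
apply: (squeeze_cvge _ h1 h2); apply: nearW => n; apply/andP; split.
  by apply: ereal_inf_lbound; exists n => //=.
by apply: ereal_sup_ubound; exists n => //=.
Qed.

(** [limn] returns the default [point] where the sequence diverges; it is therefore the upper limit
    on the adapted event where it equals the lower one, and a constant elsewhere. *)
Lemma adapted_limn T (F : nat -> Omega R -> \bar R) : (forall n, adapted T (F n)) ->
  adapted T (fun w => limn (F ^~ w)).
Proof.
move=> aF; pose s w := limn_esup (F ^~ w); pose i w := limn_einf (F ^~ w).
have E : (fun w => limn (F ^~ w)) = (fun w => if s w == i w then s w else point).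
  apply/funext => w; case: ifPn => [/eqP h|/eqP h].
    by apply/cvg_lim => //; exact: limn_cvg.
  apply: dvgP => /cvg_ex[l hl]; apply: h; rewrite /s /i.
  by rewrite !(cvg_limn_einf_sup hl).
rewrite /adapted E; have ms : adapted T s by exact: measurable_fun_limn_esup.
apply: measurable_fun_ifT => //.
by apply: measurable_fun_eqe => //; exact: measurable_fun_limn_einf.
Qed.

Variables (beta : R) (X : nat -> Omega R -> \bar R).
Hypotheses (hbeta : 1 < beta) (hX : forall n, LG slo shi beta n%:R%:E (X n)).
Hypothesis hXsup : (Ehat slo shi (fun w =>
  ereal_sup [set (`|X n w| `^ beta)%E | n in [set: nat]]) < +oo)%E.

Local Notation W := (snell_rec slo shi X).

Lemma nat0 n : 0 <= n%:R :> R. Proof. exact: ler0n. Qed.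

Lemma nat0E n : (0 <= n%:R%:E :> \bar R)%E. Proof. by rewrite lee_fin. Qed.

Lemma X_LG1 n : LG slo shi 1 n%:R%:E (X n).
Proof. exact: (LG_LG1 (nat0E n) hbeta (hX n)). Qed.

Lemma W_LG1 k n : LG slo shi 1 n%:R%:E (W k n).
Proof.
elim: k n => [|k IH] n /=; first exact: X_LG1.
apply: (LG1_max (nat0E n)); first exact: X_LG1.
by apply: condE_LG1 => //; apply: LG1_pinfty (IH n.+1).
Qed.

Lemma W_rvE k n : rvE (W k n).
Proof. exact: (LG1_rvE slo0 slohi (nat0E n) (W_LG1 k n)). Qed.

Lemma W_bar k n : LG1bar slo shi +oo%E (W k n).
Proof. by apply: (LG1_bar slo0 slohi (leey _)); exact: (LG1_pinfty (nat0 n) (W_LG1 k n)). Qed.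

Lemma W_ad k n : adapted n%:R%:E (W k n).
Proof. by case: (W_LG1 k n). Qed.

Lemma W_spec k n : [/\ adapted n%:R%:E (condE n%:R (W k n.+1)), rvE (W k n.+1),
  rvE (condE n%:R (W k n.+1)) & Rel n%:R (re (W k n.+1)) (re (condE n%:R (W k n.+1)))].
Proof. exact: (condE_spec slo0 slohi (nat0 n) (W_bar k n.+1)). Qed.

Lemma W_incr k n : qs [set w | (W k n w <= W k.+1 n w)%E].
Proof.
elim: k n => [|k IH] n; first by apply: (qsW slo0 slohi) => w /=; rewrite le_max lexx.
have := condE_le (nat0 n) (W_bar k n.+1) (W_bar k.+1 n.+1) (IH n.+1).
apply: qsS => w /= h; rewrite ge_max le_max lexx /=.
by rewrite le_max h orbT.
Qed.

Lemma W_all n : qs [set w | forall k, (W k n w <= W k.+1 n w)%E].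
Proof. by apply: (qs_all slo0 slohi) => k; exact: W_incr. Qed.

Lemma W_nondecr n w : (forall k, (W k n w <= W k.+1 n w)%E) -> nondecreasing_seq (fun k => W k n w).
Proof. by move=> h; apply/nondecreasing_seqP. Qed.

Lemma snellN_incr n N M : (n <= N)%N -> (N <= M)%N ->
  qs [set w | (snellN slo shi X N n w <= snellN slo shi X M n w)%E].
Proof.
move=> nN NM; apply: qsS (W_all n) => w /W_nondecr; apply; exact: leq_sub2r.
Qed.

Lemma snell_sup n w : (forall k, (W k n w <= W k.+1 n w)%E) ->
  snell slo shi X n w = ereal_sup (range (fun k => W k n w)).
Proof.
move=> /W_nondecr/ereal_nondecreasing_cvgn h; rewrite /snell; apply/cvg_lim => //.
(* The shift by [n] discards the horizons [N < n], for which the truncated subtraction [N - n] is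
   0. *)
rewrite -(cvg_shiftn n (fun N => snellN slo shi X N n w)).
rewrite [X in X @ _ --> _](_ : _ = (fun k => W k n w)) //.
by apply/funext => k; rewrite /snellN /= addnK.
Qed.

Lemma snell_cvg n w : (forall k, (W k n w <= W k.+1 n w)%E) ->
  (fun k => W k n w) @ \oo --> snell slo shi X n w.
Proof. by move=> h; rewrite (snell_sup h); exact/ereal_nondecreasing_cvgn/W_nondecr. Qed.

Lemma snell_ge n : qs [set w | forall k, (W k n w <= snell slo shi X n w)%E].
Proof.
apply: qsS (W_all n) => w h k; rewrite (snell_sup h); apply: ereal_sup_ubound; by exists k.
Qed.

Lemma snell_adapted n : adapted n%:R%:E (snell slo shi X n).
Proof. by apply: adapted_limn => N; exact: W_ad. Qed.

(** The summand 1 comes from a <= 1 + a^beta, which is [le_poweR] with [d = 1]. *)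
Definition Xsup w := 1 + re (fun w => ereal_sup [set (`|X n w| `^ beta)%E | n in [set: nat]]) w.

Lemma Xsup_spec : rv Xsup /\ qs [set w | forall n, `|re (X n) w| <= Xsup w].
Proof.
pose S w := ereal_sup [set (`|X n w| `^ beta)%E | n in [set: nat]].
have mX n : measurable_fun setT (X n).
  by apply: adapted_meas (nat0E n) _; case: (hX n).
have mS : measurable_fun setT S.
  have -> : S = (fun w => esups (fun n => (`|X n w| `^ beta)%E) 0%N).
    by apply/funext => w; congr ereal_sup; apply/seteqP; split=> _ [n _ <-]; exists n.
  apply: measurable_fun_esups => n.
  by apply: (measurableT_comp (measurable_poweR beta)); exact: measurableT_comp.
have le n w : (`|X n w| `^ beta <= S w)%E by apply: ereal_sup_ubound; exists n.
have S0 w : (0 <= S w)%E by apply: le_trans (le 0%N w); exact: poweR_ge0.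
have rS : rvE S.
  split=> //; exists (fine (Ehat slo shi S)) => P hP.
  under eq_integral do rewrite gee0_abs//.
  have hb : (\int[P]_w S w <= Ehat slo shi S)%E by apply: ereal_sup_ubound; exists P.
  by rewrite fineK// ge0_fin_numE//; apply: le_trans hb; exact: integral_ge0.
split.
  by apply: rv_add => //; [exact: (rv_cyl slo0 slohi (cylf_cst 1))|exact: rv_re].
have fX := qs_all slo0 slohi (fun n => qs_fin slo0 slohi (W_rvE 0 n)).
apply: qsS (qsI slo0 slohi fX (qs_fin slo0 slohi rS)) => w [/= eX eS] n.
have := le_poweR ltr01 hbeta (abse_ge0 (X n w)); rewrite powR1 invr1 mul1e => h.
have := le_trans h (leeD (lexx _) (le n w)).
by rewrite eS (eX n) /= -EFinD lee_fin.
Qed.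

Lemma agree_trans s t P Q Q' : 0 <= s <= t -> agree s P Q -> agree t Q Q' -> agree s P Q'.
Proof. by move=> st h1 h2 A hA; rewrite h2 ?h1//; exact: (Ft_sub st). Qed.

(** The event [A] is what makes the induction run. On [A1] stopping is at least as good as
    continuing, and [X n] has the same expectation there under any measure that agrees with [P] on
    the past; on [A2] the measure is changed after time [n], and the induction hypothesis is applied
    to [A2] under it. *)
Lemma snell_bound k n P A e : cP P -> Ft n%:R A -> 0 < e -> exists Q, [/\ cP Q, agree n%:R P Q &
  Ex P (fun w => \1_A w * re (W k n) w) <= Ex Q (fun w => \1_A w * Xsup w) + e].
Proof.
have [rM hM] := Xsup_spec.
have leM Q n' D : cP Q -> measurable D ->
    Ex Q (fun w => \1_D w * re (X n') w) <= Ex Q (fun w => \1_D w * Xsup w).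
  move=> hQ mD; apply: Ex_le_ae.
  - by apply: ig_indic => //; apply: (rv_ig _ hQ); exact: rv_re (W_rvE 0 n').
  - by apply: ig_indic => //; exact: (rv_ig _ hQ).
  apply: filterS (qs_ae slo0 slohi hM hQ) => w /(_ n'); rewrite indicE.
  by case: (w \in D); rewrite ?mul1r ?mul0r// => /(le_trans (ler_norm _)).
elim: k n P A e => [|k IH] n P A e hP hA e0.
  have mA := Ft_measurable (nat0 n) hA.
  exists P; split=> //; apply: le_trans (leM P n A hP mA) _; by rewrite lerDl ltW.
have mA := Ft_measurable (nat0 n) hA; have e2 : 0 < e / 2 by rewrite divr_gt0.
have [ac rW rc hR] := W_spec k n; set c := re (condE _ _) in hR.
have [_ rvc adc _ _] := hR.
have rX0 : rv (re (X n)) := rv_re (W_rvE 0 n).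
have adx : adR n%:R (re (X n)) := adR_re (@W_ad 0 n).
have hD := Ft_pos (measurable_funB adc adx); set D := [set w | _] in hD.
have hA2 := FtI hA hD; have hA1 := FtI hA (FtC hD).
set A1 := A `&` ~` D in hA1; set A2 := A `&` D in hA2.
have mA1 := Ft_measurable (nat0 n) hA1; have mA2 := Ft_measurable (nat0 n) hA2.
(* Comparison with the pair of zero functions is [Low] localized to [A2]. *)
have h0 := Rel0 slo0 slohi (nat0 n); have [rz rz' az upz _] := h0.
have [Q1 [hQ1 PQ1] b1] := Rel_cmp (nat0 n) hR rz rz' az upz hP hA2 e2.
have nn : 0 <= (n%:R : R) <= n.+1%:R by rewrite ler0n ler_nat leqnSn.
have [Q2 [hQ2 PQ2 b2]] := IH n.+1 Q1 A2 _ hQ1 (Ft_sub nn hA2) e2.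
have PQ := agree_trans nn PQ1 PQ2.
exists Q2; split=> //.
have E0 z : (fun w => \1_A2 w * (z w - 0)) = (fun w : Omega R => \1_A2 w * z w :> R).
  by apply/funext => w; rewrite subr0.
rewrite !E0 in b1.
have iI B Q (z : Omega R -> R) : cP Q -> measurable B -> rv z -> ig Q (fun w => \1_B w * z w).
  by move=> hQ mB hz; apply: ig_indic => //; exact: (rv_ig _ hQ).
have eA (z z' : R) w : \1_A1 w * z + \1_A2 w * z' = \1_A w * (if w \in D then z' else z).
  rewrite !indicE !in_setI in_setC; case: (w \in A); case: (w \in D) => /=;
    by rewrite ?mulr1n ?mulr0n ?mul1r ?mul0r ?addr0 ?add0r.
have e1 : Ex P (fun w => \1_A w * re (W k.+1 n) w) =
    Ex P (fun w => \1_A1 w * re (X n) w) + Ex P (fun w => \1_A2 w * c w).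
  rewrite -ExD; [|exact: iI|exact: iI].
  have r1 : rv (re (W k.+1 n)) := rv_re (W_rvE k.+1 n).
  have iL := iI A P _ hP mA r1.
  have iR := ig_add (iI A1 P _ hP mA1 rX0) (iI A2 P _ hP mA2 rvc).
  apply: Ex_ae; [exact: ig_meas iL|exact: ig_meas iR|].
  have fin := qsI slo0 slohi (qs_fin slo0 slohi (W_rvE 0 n)) (qs_fin slo0 slohi rc).
  apply: filterS (qs_ae slo0 slohi fin hP) => w [/= eX ec].
  rewrite eA; congr (_ * _); rewrite {1}/re /= eX ec -EFin_max /= -/c.
  have [Dw|Dw] := pselect (D w); first by rewrite mem_set// max_r// ltW// -subr_gt0.
  by rewrite memNset// max_l// -subr_le0 leNgt; apply/negP.
have e3 : Ex Q2 (fun w => \1_A w * Xsup w) = Ex Q2 (fun w => \1_A1 w * Xsup w) + Ex Q2 (fun w => \1_A2 w * Xsup w).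
  rewrite -ExD; [|exact: iI|exact: iI]; congr Ex; apply/funext => w; rewrite eA.
  by case: (w \in D).
have e4 : Ex P (fun w => \1_A1 w * re (X n) w) = Ex Q2 (fun w => \1_A1 w * re (X n) w).
  by apply: (adR_Ex (nat0 n) PQ); exact: adR_indic.
have := leM Q2 n A1 hQ2 mA1; rewrite e1 e3 e4.
by move: b1 b2; rewrite -/c; lra.
Qed.

(** An upper bound on expectations is enough, since [W k n] lies above [X n] and so
    [|W| <= W + 2 * |X n|]. *)
Lemma W_norm_bound n : exists C, forall k P, cP P -> Ex P (fun w => `|re (W k n) w|) <= C.
Proof.
have [rM _] := Xsup_spec; have [C hC] := rv_bound rM.
have rX0 : rv (re (X n)) := rv_re (W_rvE 0 n).
have [D hD] := rv_bound rX0.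
exists (C + 1 + 2 * D) => k P hP; have rW := rv_re (W_rvE k n).
have [Q [hQ _ h]] := snell_bound k hP (FtT n%:R) ltr01.
have E (z : Omega R -> R) : (fun w => \1_setT w * z w) = z.
  by apply/funext => w; rewrite indicE in_setT mul1r.
rewrite !E in h.
have h1 : Ex Q Xsup <= C by apply: le_trans (ler_norm _) _; apply: le_trans (Ex_abs (rv_ig rM hQ)) (hC Q hQ).
have iW := rv_ig rW hP; have iX := ig_norm (rv_ig rX0 hP).
apply: (@le_trans _ _ (Ex P (fun w => re (W k n) w + 2 * `|re (X n) w|))); last first.
  rewrite ExD//; last exact: ig_scale.
  by rewrite ExZ//; have := hD P hP; move: h h1; lra.
apply: Ex_le_ae; [exact: ig_norm|by apply: ig_add => //; exact: ig_scale|].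
have hf := qsI slo0 slohi (qs_fin slo0 slohi (W_rvE k n)) (qs_fin slo0 slohi (W_rvE 0 n)).
apply: filterS (qs_ae slo0 slohi (qsI slo0 slohi (W_all n) hf) hP) => w [/W_nondecr h2 [/= e1 e2]].
have := h2 0%N k (leq0n k); rewrite e1 /= e2 lee_fin => h3.
have := ler_norm (- re (X n) w); rewrite normrN; have := normr_ge0 (re (X n) w).
by have [_|_] := ler0P (re (W k n) w); move: h3; lra.
Qed.

Lemma snell_rvE n : rvE (snell slo shi X n).
Proof.
have [C hC] := W_norm_bound n.
apply: (lim_rvE slo0 slohi (fun k => W_rvE k n) (adapted_meas (nat0E n) (@snell_adapted n)) hC).
by apply: qsS (W_all n) => w /snell_cvg.
Qed.

Lemma snell_incr n : increases_qs slo shi (fun k => W k n) (snell slo shi X n).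
Proof. by apply: qsS (W_all n) => w h; split=> //; exact: snell_cvg. Qed.

Lemma snell_bar n : LG1bar slo shi n%:R%:E (snell slo shi X n).
Proof.
apply: (starstar_bar slo0 slohi (nat0E n)); split.
  by apply/(L1P slo0 slohi _ (nat0E n)); split; [exact: snell_adapted|exact: snell_rvE].
exists (fun k => W k n); split; last exact: snell_incr.
by move=> k; exact: (LG1_star slo0 slohi (nat0E n) (W_LG1 k n)).
Qed.

Lemma snell_mcvg n : qs (mcvg (fun k => re (W k n)) (re (snell slo shi X n))).
Proof. exact: (incr_mcvg slo0 slohi (fun k => W_rvE k n) (snell_rvE n) (snell_incr n)). Qed.

(** The limit is taken in the inequality tested against past events, where dominated convergence
    applies on both sides; the conditional expectation of the limit enters only afterwards, through
    [Rel_le]. The index on the right is shifted because [W k.+1 n] dominates the conditional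
    expectation of [W k n.+1]. *)
Lemma snell_up n : Up n%:R (re (snell slo shi X n.+1)) (re (snell slo shi X n)).
Proof.
have m1 : qs (mcvg (fun k => re (W k.+1 n)) (re (snell slo shi X n))).
  apply: qsS (snell_mcvg n) => w [mono c]; split; last first.
    by move: c; rewrite -(cvg_shiftS (fun k => re (W k n) w)).
  by case: mono => h; [left|right] => k; exact: h.
apply: (Up_mcvg slo0 slohi (nat0 n) (fun k => rv_re (W_rvE k n.+1)) (fun k => rv_re (W_rvE k.+1 n))
  (rv_re (snell_rvE n.+1)) (rv_re (snell_rvE n)) (snell_mcvg n.+1) m1) => k Q A hQ hA.
have mA := Ft_measurable (nat0 n) hA.
have [ac rW rc [_ rvc _ up _]] := W_spec k n; apply: le_trans (up Q A hQ hA) _.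
apply: Ex_le_ae; try (apply: ig_indic => //; apply: (rv_ig _ hQ) => //; exact: rv_re (W_rvE k.+1 n)).
have hf := qsI slo0 slohi (qs_fin slo0 slohi rc) (qs_fin slo0 slohi (W_rvE k.+1 n)).
apply: filterS (qs_ae slo0 slohi hf hQ) => w [/= e1 e2]; rewrite indicE.
case: (w \in A); rewrite ?mul0r// !mul1r -lee_fin -e1 -e2.
by rewrite le_max lexx orbT.
Qed.

Lemma snell_up_le m n : (m <= n)%N -> Up m%:R (re (snell slo shi X n)) (re (snell slo shi X m)).
Proof.
elim: n => [|n IH]; first by rewrite leqn0 => /eqP-> Q A.
rewrite leq_eqVlt => /predU1P[->//|]; rewrite ltnS => mn Q A hQ hA.
apply: le_trans (IH mn Q A hQ hA); apply: snell_up => //.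
by apply: Ft_sub hA; rewrite ler0n ler_nat.
Qed.

Lemma snell_supermartingale : Gsupermartingale slo shi (snell slo shi X).
Proof.
split=> [|m n mn]; first exact: snell_bar.
have [aC _ rC hR] := condE_spec slo0 slohi (nat0 m) (bar_pinfty (nat0 n) (snell_bar n)).
have h := Rel_le slo0 slohi (nat0 m) hR (rv_re (snell_rvE n)) (rv_re (snell_rvE m))
  (adR_re (@snell_adapted m)) (snell_up_le mn) (qsW slo0 slohi (fun w => lexx _)).
have hf := qsI slo0 slohi (qs_fin slo0 slohi rC) (qs_fin slo0 slohi (snell_rvE m)).
apply: qsS (qsI slo0 slohi hf h) => w [[/= e1 e2] h3]; by rewrite e1 e2 lee_fin.
Qed.

Lemma snell_dominates : dominates slo shi (snell slo shi X) X.
Proof. by move=> n; apply: qsS (snell_ge n) => w /(_ 0%N). Qed.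

Lemma snell_smallest (U : nat -> Omega R -> \bar R) : Gsupermartingale slo shi U ->
  dominates slo shi U X -> forall n, qs [set w | (snell slo shi X n w <= U n w)%E].
Proof.
move=> [bU sU] dU n.
have WU k : forall n, qs [set w | (W k n w <= U n w)%E].
  elim: k => [|k IH] {}n; first exact: dU.
  have h1 := condE_le (nat0 n) (W_bar k n.+1) (bar_pinfty (nat0 n.+1) (bU n.+1)) (IH n.+1).
  have h2 := sU n n.+1 (leqnSn n).
  apply: qsS (qsI slo0 slohi (dU n) (qsI slo0 slohi h1 h2)) => w [a [b c]] /=.
  by rewrite ge_max a (le_trans b c).
apply: qsS (qsI slo0 slohi (W_all n) (qs_all slo0 slohi (fun k => WU k n))) => w [h1 h2] /=.
by rewrite (snell_sup h1); apply: ge_ereal_sup => _ [k _ <-]; exact: h2.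
Qed.

End snell_envelope.

Theorem proposition3p5 (R : realType) (slo shi : R) (hlo : 0 <= slo)
    (hlohi : slo <= shi) (beta : R) (hbeta : 1 < beta)
    (X : nat -> Omega R -> \bar R)
    (hXbelow : forall n : nat, exists c : R,
       qs slo shi [set w | (c%:E <= X n w)%E])
    (hX : forall n : nat, LG slo shi beta n%:R%:E (X n))
    (hXsup : (Ehat slo shi (fun w =>
       ereal_sup [set (`|X n w| `^ beta)%E | n in [set: nat]]) < +oo)%E) :
  [/\ forall n N M : nat, (n <= N)%N -> (N <= M)%N ->
        qs slo shi [set w | (snellN slo shi X N n w <= snellN slo shi X M n w)%E],
      Gsupermartingale slo shi (snell slo shi X),
      dominates slo shi (snell slo shi X) X &
      forall U : nat -> Omega R -> \bar R,
        Gsupermartingale slo shi U -> dominates slo shi U X ->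
        forall n : nat,
          qs slo shi [set w | (snell slo shi X n w <= U n w)%E]].
Proof.
split.
- by move=> n N M nN NM; exact: (snellN_incr hlo hlohi hbeta hX nN NM).
- exact: (snell_supermartingale hlo hlohi hbeta hX hXsup).
- exact: (snell_dominates hlo hlohi hbeta hX).
- by move=> U hU hd n; exact: (snell_smallest hlo hlohi hbeta hX hU hd).
Qed.
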